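(* Let $X$ be a normal $G/\mu_n$-embedding with $G=\mathrm{SL}_2$ and $n\leq 2$, such that no $G$-stable prime divisor of $X$ dominates $\mathbb{P}^1$ under the rational quotient $\pi: X\dashrightarrow\mathbb{P}^1$ by $B$. Then the special fiber $\tilde X_0$ is a normal variety. Moreover, $\tilde Y_0=\tilde X_0/\!/U$ is an affine space.
   Context: $k$ is an algebraically closed field of characteristic zero; $G=\mathrm{SL}_2$; $B\subset G$ is the group of upper triangular matrices, $U$ its unipotent part, $T$ the diagonal torus, $\mu_n\subset T$ the cyclic subgroup of order $n$. A normal $G/\mu_n$-embedding is a normal $G$-variety $X$ with a $G$-equivariant open immersion $G/\mu_n\hookrightarrow X$. $\pi:X\dashrightarrow\mathbb{P}^1$ restricts on $G/\mu_n$ to the geometric quotient $G/\mu_n\to B\backslash G/\mu_n\simeq\mathbb{P}^1$. The Cox ring $\mathrm{Cox}(X)=\bigoplus_{[D]\in\mathrm{Cl}(X)}H^0(X,\mathcal{O}_X(D))$ (standard $\mathrm{Cl}(X)$-graded ring structure) is a finitely generated normal domain with a natural $G$-action (each divisorial sheaf on $X$ has a unique $G$-linearization); $\tilde X=\mathrm{Spec}\,\mathrm{Cox}(X)$. For each $G$-stable prime divisor $D$ of $X$, let $r_D\in\mathrm{Cox}(X)_{[D]}$ be its canonical section; the algebra of invariants $\mathrm{Cox}(X)^G$ is the polynomial algebra in the $r_D$, so $\tilde X/\!/G$ is an affine space $\mathbb{A}^M$ with $M$ the number of $G$-stable prime divisors. The special fiber $\tilde X_0$ is the schematic fiber at $0$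 of the quotient morphism $\tilde X\to\mathbb{A}^M$, i.e. $\tilde X_0=\mathrm{Spec}\big(\mathrm{Cox}(X)/(r_D)_D\big)$, and $\tilde Y_0:=\tilde X_0/\!/U=\mathrm{Spec}\big((\mathrm{Cox}(X)/(r_D)_D)^U\big)$. *)

(* Defs.v *)
From HB Require Import structures.
From mathcomp Require Import all_boot all_order all_algebra.
From mathcomp Require Import generic_quotient.
From mathcomp Require Import boolp classical_sets functions.
From mathcomp Require Import freeg mpoly.

Set Implicit Arguments.
Unset Strict Implicit.
Unset Printing Implicit Defensive.

Import GRing.Theory.
Local Open Scope classical_set_scope.
Local Open Scope ring_scope.

(** Algebraic varieties over an algebraically closed field are treated as
    spaces with functions (as in the textbooks of Humphreys, Kempf and
    Springer): a set of closed points, its open subsets, and for each open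
    subset [U] the regular functions on [U].  A function on [U] is represented
    by a total function, of which only the values on [U] matter. *)

Section Spaces.
Variable k : closedFieldType.

Record space := Space {
  points :> Type;
  opn : set (set points);
  reg : set points -> set (points -> k) }.

Record is_space_with_functions (X : space) : Prop := {
  opn_setT : opn (@setT X);
  opn_setI : forall U V : set X, opn U -> opn V -> opn (U `&` V);
  opn_bigcup : forall F : set (set X), F `<=` @opn X ->
    opn (\bigcup_(U in F) U);
  reg_opn : forall (U : set X) f, reg U f -> opn U;
  reg_ext : forall (U : set X) f g, (forall x, U x -> f x = g x) -> reg U f -> reg U g;
  reg_restrict : forall (U V : set X) f,
    opn V -> V `<=` U -> reg U f -> reg V f;
  reg_local : forall (U : set X) f, opn U ->
    (forall x, U x -> exists V, [/\ V x, V `<=` U & reg V f]) -> reg U f;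
  reg_cst : forall (U : set X) (c : k), opn U -> reg U (fun=> c);
  reg_add : forall (U : set X) f g,
    reg U f -> reg U g -> reg U (fun x => f x + g x);
  reg_mul : forall (U : set X) f g,
    reg U f -> reg U g -> reg U (fun x => f x * g x);
  reg_inv : forall (U : set X) f,
    reg U f -> reg (U `&` [set x | f x != 0]) (fun x => (f x)^-1) }.

Definition closed_set (X : space) (Z : set X) : Prop := opn (~` Z).

Definition irreducible_set (X : space) (Z : set X) : Prop :=
  Z !=set0 /\ forall U V : set X, opn U -> opn V ->
    Z `&` U !=set0 -> Z `&` V !=set0 -> Z `&` U `&` V !=set0.

(** The structure induced on a set [X] by an injection [e] into affine space:
    the Zariski topology and the functions that are locally quotients of
    polynomials. *)
Definition zariski_open (X : Type) n (e : X -> 'I_n -> k) : set (set X) :=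
  [set V | forall x, V x -> exists p : {mpoly k[n]},
    p.@[e x] != 0 /\ forall y, p.@[e y] != 0 -> V y].

Definition zariski_reg (X : Type) n (e : X -> 'I_n -> k) :
    set X -> set (X -> k) :=
  fun V => [set f | forall x, V x -> exists p q : {mpoly k[n]},
    q.@[e x] != 0 /\
    forall y, q.@[e y] != 0 -> V y /\ f y = p.@[e y] / q.@[e y]].

Definition algebraic_set n (Z : set ('I_n -> k)) : Prop :=
  exists S : set {mpoly k[n]}, Z = [set v | forall p, S p -> p.@[v] = 0].

Definition affine (X : space) : Prop :=
  exists n (e : X -> 'I_n -> k),
    [/\ injective e, algebraic_set (range e),
        @opn X = zariski_open e & @reg X = zariski_reg e].

(** Only meaningful for an open subset [U]. *)
Definition open_subspace (X : space) (U : set X) : space :=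
  @Space {x : X | U x}
    [set V | opn (sval @` V)]
    (fun V => [set f | exists2 F, reg (sval @` V) F &
                         forall x, V x -> f x = F (sval x)]).

(** The product of varieties: locally, a regular function is a quotient of sums
    [\sum_i a_i(x) b_i(y)], and the non-vanishing loci of such sums form a
    basis of the topology (which is finer than the product topology). *)
Definition tensor_function (X Y : space) (U : set X) (V : set Y) :
    set (X * Y -> k) :=
  [set h | exists m (a : 'I_m -> X -> k) (b : 'I_m -> Y -> k),
    [/\ forall i, reg U (a i), forall i, reg V (b i) &
        h = fun z => \sum_i a i z.1 * b i z.2]].

Definition prod_space (X Y : space) : space :=
  @Space (X * Y)%type
    [set W | forall z, W z -> exists U V h,
      [/\ opn U /\ opn V, U z.1 /\ V z.2, tensor_function U V h, h z != 0 &
          forall w, U w.1 -> V w.2 -> h w != 0 -> W w]]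
    (fun W => [set f | forall z, W z -> exists U V g h,
      [/\ opn U /\ opn V, U z.1 /\ V z.2,
          tensor_function U V g /\ tensor_function U V h, h z != 0 &
          forall w, U w.1 -> V w.2 -> h w != 0 -> W w /\ f w = g w / h w]]).

(** The quotient structure along a surjection [p]. *)
Definition quot_space (X : space) (Y : Type) (p : X -> Y) : space :=
  @Space Y [set V | opn (p @^-1` V)]
    (fun V => [set f : Y -> k | reg (p @^-1` V) (f \o p)]).

Definition morphism_on (X Y : space) (V : set X) (phi : X -> Y) : Prop :=
  forall W : set Y, opn W -> opn (V `&` phi @^-1` W) /\
    forall f, reg W f -> reg (V `&` phi @^-1` W) (f \o phi).

Definition morphism (X Y : space) (phi : X -> Y) : Prop :=
  morphism_on setT phi.

Definition open_immersion (Y X : space) (i : Y -> X) : Prop :=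
  [/\ injective i, opn (range i),
      forall V : set Y, opn V <-> opn (i @` V) &
      forall (V : set Y) (f : X -> k), reg V (f \o i) <-> reg (i @` V) f].

Record variety := Variety {
  variety_space :> space;
  variety_functions : is_space_with_functions variety_space;
  variety_irreducible : irreducible_set (@setT variety_space);
  variety_finite_type : exists m (U : 'I_m -> set variety_space),
    [/\ forall i, opn (U i), forall i, affine (open_subspace (U i)) &
        forall x, exists i, U i x];
  variety_separated :
    @closed_set (prod_space variety_space variety_space) [set z | z.1 = z.2] }.

End Spaces.

Section RationalFunctions.
Variables (k : closedFieldType) (X : variety k).
Local Notation XF := (variety_functions X).

Record partial_function := PartialFunction {
  dom : set X;
  fn : X -> k;
  fn_reg : reg dom fn;
  dom_neq0 : dom !=set0 }.

HB.instance Definition _ := gen_eqMixin partial_function.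
HB.instance Definition _ := gen_choiceMixin partial_function.

Definition pf_eq (f g : partial_function) : bool :=
  `[< exists W, [/\ opn W, W !=set0, W `<=` dom f `&` dom g &
                    forall x, W x -> fn f x = fn g x] >].

Lemma meet_neq0 (U V : set X) :
  opn U -> opn V -> U !=set0 -> V !=set0 -> U `&` V !=set0.
Proof.
move=> oU oV U0 V0; have [_] := variety_irreducible X.
by move=> /(_ U V oU oV); rewrite !setTI; apply.
Qed.

Lemma dom_opn f : opn (dom f).
Proof. exact: (reg_opn XF (fn_reg f)). Qed.

Lemma pf_eq_equiv : equiv_class_of pf_eq.
Proof.
split.
- move=> f; apply/asboolP; exists (dom f); split=> //.
  + exact: dom_opn.
  + exact: dom_neq0.
- have sym f g : pf_eq f g -> pf_eq g f.
    move=> /asboolP[W [oW W0 Wd e]]; apply/asboolP; exists W; split=> //.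
    + by rewrite setIC.
    + by move=> x /e.
  by move=> f g; apply/idP/idP; exact: sym.
- move=> g f h /asboolP[W [oW W0 Wd e]] /asboolP[V [oV V0 Vd e']].
  apply/asboolP; exists (W `&` V); split.
  + exact: (opn_setI XF).
  + exact: meet_neq0.
  + by move=> x [/Wd [? _] /Vd [_ ?]].
  + by move=> x [Wx Vx]; rewrite e ?e'.
Qed.

Canonical pf_equiv := EquivRelPack pf_eq_equiv.

(** The function field k(X). *)
Definition ratfun := {eq_quot pf_equiv}%qT.

HB.instance Definition _ := Choice.on ratfun.
HB.instance Definition _ := EqQuotient.on ratfun.

Local Notation cls := (\pi_ratfun)%qT.

Lemma pf_eqP f g : reflect (cls f = cls g) (pf_eq f g).
Proof. by apply: (iffP idP) => [/(eqmodP pf_equiv)|/(eqmodP pf_equiv)]. Qed.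

Lemma pf_eqI f g : (forall x, dom f x -> dom g x -> fn f x = fn g x) ->
  cls f = cls g.
Proof.
move=> e; apply/pf_eqP/asboolP; exists (dom f `&` dom g); split=> //.
- by apply: (opn_setI XF); exact: dom_opn.
- by apply: meet_neq0; [exact: dom_opn|exact: dom_opn|exact: dom_neq0|exact: dom_neq0].
- by move=> x [? ?]; exact: e.
Qed.

Definition pf_cst (c : k) : partial_function :=
  PartialFunction (reg_cst XF c (opn_setT XF)) (variety_irreducible X).1.

Section Op.
Variable op : k -> k -> k.
Hypothesis reg_op : forall (U : set X) f g,
  reg U f -> reg U g -> reg U (fun x => op (f x) (g x)).

Lemma pf_op_reg f g : reg (dom f `&` dom g) (fun x => op (fn f x) (fn g x)).
Proof.
have oI : opn (dom f `&` dom g) by apply: (opn_setI XF); exact: dom_opn.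
by apply: reg_op; apply: (reg_restrict XF oI) (fn_reg _) => x [].
Qed.

Lemma pf_op_neq0 f g : dom f `&` dom g !=set0.
Proof.
by apply: meet_neq0; [exact: dom_opn|exact: dom_opn|exact: dom_neq0|exact: dom_neq0].
Qed.

Definition pf_op f g := PartialFunction (@pf_op_reg f g) (@pf_op_neq0 f g).

Definition rat_op (a b : ratfun) : ratfun := cls (pf_op (repr a) (repr b)).

Lemma rat_opE f g : rat_op (cls f) (cls g) = cls (pf_op f g).
Proof.
rewrite /rat_op.
have /pf_eqP/asboolP[W [oW W0 Wd e]] := reprK (cls f).
have /pf_eqP/asboolP[V [oV V0 Vd e']] := reprK (cls g).
apply/pf_eqP/asboolP; exists (W `&` V); split.
- exact: (opn_setI XF).
- exact: meet_neq0.
- by move=> x [/Wd [? ?] /Vd [? ?]].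
- by move=> x [Wx Vx] /=; rewrite e ?e'.
Qed.
End Op.

Lemma pf_inv_reg f :
  reg (dom f `&` [set x | fn f x != 0]) (fun x => (fn f x)^-1).
Proof. exact: (reg_inv XF (fn_reg f)). Qed.

Definition pf_inv f : partial_function :=
  match pselect (dom f `&` [set x | fn f x != 0] !=set0) with
  | left ne => PartialFunction (@pf_inv_reg f) ne
  | right _ => pf_cst 0
  end.

Definition rat_add := rat_op (reg_add XF).
Definition rat_mul := rat_op (reg_mul XF).
Definition ratC (c : k) : ratfun := cls (pf_cst c).
Definition rat_opp (a : ratfun) := rat_mul (ratC (-1)) a.
Definition rat_inv (a : ratfun) : ratfun := cls (pf_inv (repr a)).

Lemma rat_ind (P : ratfun -> Prop) : (forall f, P (cls f)) -> forall a, P a.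
Proof. by move=> H a; rewrite -[a]reprK. Qed.

Lemma rat_addA : associative rat_add.
Proof.
elim/rat_ind=> f; elim/rat_ind=> g; elim/rat_ind=> h.
by rewrite /rat_add !rat_opE; apply: pf_eqI => x _ _ /=; rewrite addrA.
Qed.
Lemma rat_addC : commutative rat_add.
Proof.
elim/rat_ind=> f; elim/rat_ind=> g.
by rewrite /rat_add !rat_opE; apply: pf_eqI => x _ _ /=; rewrite addrC.
Qed.
Lemma rat_add0 : left_id (ratC 0) rat_add.
Proof.
elim/rat_ind=> f.
by rewrite /rat_add /ratC !rat_opE; apply: pf_eqI => x _ _ /=; rewrite add0r.
Qed.
Lemma rat_addN : left_inverse (ratC 0) rat_opp rat_add.
Proof.
elim/rat_ind=> f; rewrite /rat_opp /rat_mul /rat_add /ratC !rat_opE.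
by apply: pf_eqI => x _ _ /=; rewrite mulN1r addNr.
Qed.
HB.instance Definition _ :=
  GRing.isZmodule.Build ratfun rat_addA rat_addC rat_add0 rat_addN.

Lemma rat_mulA : associative rat_mul.
Proof.
elim/rat_ind=> f; elim/rat_ind=> g; elim/rat_ind=> h.
by rewrite /rat_mul !rat_opE; apply: pf_eqI => x _ _ /=; rewrite mulrA.
Qed.
Lemma rat_mulC : commutative rat_mul.
Proof.
elim/rat_ind=> f; elim/rat_ind=> g.
by rewrite /rat_mul !rat_opE; apply: pf_eqI => x _ _ /=; rewrite mulrC.
Qed.
Lemma rat_mul1 : left_id (ratC 1) rat_mul.
Proof.
elim/rat_ind=> f.
by rewrite /rat_mul /ratC !rat_opE; apply: pf_eqI => x _ _ /=; rewrite mul1r.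
Qed.
Lemma rat_mulD : left_distributive rat_mul rat_add.
Proof.
elim/rat_ind=> f; elim/rat_ind=> g; elim/rat_ind=> h.
by rewrite /rat_mul /rat_add !rat_opE; apply: pf_eqI => x _ _ /=; rewrite mulrDl.
Qed.
Lemma rat_1neq0 : ratC 1 != ratC 0.
Proof.
apply/negP => /eqP /pf_eqP/asboolP[W [_ [x Wx] _ /(_ x Wx)]] /= /eqP.
by rewrite oner_eq0.
Qed.
HB.instance Definition _ :=
  GRing.Zmodule_isComNzRing.Build ratfun rat_mulA rat_mulC rat_mul1 rat_mulD
    rat_1neq0.

Lemma rat_mulV (a : ratfun) : a != 0 -> rat_inv a * a = 1.
Proof.
move=> a0; rewrite /rat_inv /pf_inv; case: pselect => [ne|nne].
  rewrite -[X in _ * X]reprK [LHS]rat_opE; apply: pf_eqI => x /= [[_ fx0] _] _.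
  by rewrite mulVf.
case/eqP: a0; rewrite -[a]reprK; apply: pf_eqI => x /= dx _.
by apply/eqP/negPn/negP => fx; apply: nne; exists x.
Qed.
Lemma rat_inv0 : rat_inv 0 = 0.
Proof.
rewrite /rat_inv /pf_inv; case: pselect => // ne; apply: pf_eqI => x /= [_ fx0] _.
have /pf_eqP/asboolP[W [oW W0 Wd e]] : cls (repr (0 : ratfun)) = cls (pf_cst 0).
  by rewrite reprK.
have [y [[dy fy0] Wy]] := meet_neq0 (reg_opn XF (pf_inv_reg _)) oW ne W0.
by move: fy0; rewrite /= e //= eqxx.
Qed.
HB.instance Definition _ :=
  GRing.ComNzRing_isField.Build ratfun rat_mulV rat_inv0.

(** [a] is the class of the regular function [f] on the nonempty open [U]. *)
Definition germ (a : ratfun) (U : set X) (f : X -> k) : Prop :=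
  exists F : partial_function, [/\ cls F = a, dom F = U & fn F = f].

Definition has_value (a : ratfun) (x : X) (c : k) : Prop :=
  exists U f, [/\ germ a U f, U x & f x = c].

(** The local ring of [X] along an irreducible closed subset [Z] (or at the
    point [x], for [Z = [set x]]), and its maximal ideal. *)
Definition local_ring (Z : set X) : set ratfun :=
  [set a | exists U f, germ a U f /\ Z `&` U !=set0].

Definition local_max (Z : set X) : set ratfun :=
  [set a | exists U f, [/\ germ a U f, Z `&` U !=set0 &
                           forall x, Z x -> U x -> f x = 0]].

Definition normal_variety : Prop :=
  forall (x : X) (a : ratfun),
    (exists p : {poly ratfun},
       [/\ p \is monic, root p a & forall i, local_ring [set x] p`_i]) ->
    local_ring [set x] a.

Record prime_divisor := PrimeDivisor {
  pd_set :> set X;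
  pd_closed : closed_set pd_set;
  pd_irreducible : irreducible_set pd_set;
  pd_proper : pd_set <> setT;
  pd_codim1 : forall Z : set X, closed_set Z -> irreducible_set Z ->
    pd_set `<=` Z -> Z = pd_set \/ Z = setT }.

HB.instance Definition _ := gen_eqMixin prime_divisor.
HB.instance Definition _ := gen_choiceMixin prime_divisor.

Definition weil_divisor := {freeg prime_divisor / int}.

Definition uniformizer (P : prime_divisor) (t : ratfun) : Prop :=
  local_max P t /\
  forall a, local_max P a -> exists2 b, local_ring P b & a = b * t.

(** The order along [P] of a nonzero rational function on a normal variety, for
    which the local ring along [P] is a discrete valuation ring: [a = u t^m]
    with [u] a unit and [t] a uniformizer.  It has a junk value at [a = 0]. *)
Definition ord (P : prime_divisor) (a : ratfun) : int :=
  xget 0 [set m | exists t u, [/\ uniformizer P t, local_ring P u,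
                                  ~ local_max P u & a = u * t ^ m]].

(** The sections over [V] of the sheaf O_X(D), as rational functions. *)
Definition sections (D : weil_divisor) (V : set X) : set ratfun :=
  [set a | a = 0 \/
    forall P : prime_divisor, P `&` V !=set0 -> 0 <= ord P a + coeff P D].

Definition global_sections (D : weil_divisor) : set ratfun := sections D setT.

Definition lin_equiv (D E : weil_divisor) : Prop :=
  exists2 a : ratfun, a != 0 & forall P, ord P a = coeff P D - coeff P E.

(** The Cox ring of [X], up to isomorphism: an algebra graded by Cl(X), with an
    identification [cox_sec D] of H^0(X, O_X(D)) with the piece of degree [D]
    for every Weil divisor [D], such that the product of homogeneous elements
    is the product of sections O_X(D) (x) O_X(E) -> O_X(D + E).  If all
    invertible functions on [X] are constant, this determines the graded
    algebra: the identifications of H^0(X, O_X(D)) with H^0(X, O_X(E)) for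
    linearly equivalent [D] and [E] are then multiplications by rational
    functions which depend multiplicatively on [D - E]. *)
Record cox_ring := CoxRing {
  cox_alg :> comAlgType k;
  cox_sec : weil_divisor -> ratfun -> cox_alg;
  cox_sec_linear : forall D (c : k) a b,
    global_sections D a -> global_sections D b ->
    cox_sec D (ratC c * a + b) = c *: cox_sec D a + cox_sec D b;
  cox_sec_inj : forall D a, global_sections D a -> cox_sec D a = 0 -> a = 0;
  cox_sec1 : cox_sec 0 1 = 1;
  cox_secM : forall D E a b, global_sections D a -> global_sections E b ->
    cox_sec D a * cox_sec E b = cox_sec (D + E) (a * b);
  cox_sec_equiv : forall D E a, lin_equiv D E -> global_sections D a ->
    exists2 b, global_sections E b & cox_sec E b = cox_sec D a;
  cox_sec_span : forall r : cox_alg,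
    exists m (D : 'I_m -> weil_divisor) (a : 'I_m -> ratfun),
      (forall i, global_sections (D i) (a i)) /\
      r = \sum_i cox_sec (D i) (a i);
  cox_sec_direct : forall m (D : 'I_m -> weil_divisor) (a : 'I_m -> ratfun),
    (forall i, global_sections (D i) (a i)) ->
    (forall i j, i != j -> ~ lin_equiv (D i) (D j)) ->
    \sum_i cox_sec (D i) (a i) = 0 -> forall i, cox_sec (D i) (a i) = 0 }.

(** The section 1 of O_X(P), whose divisor of zeros is [P]. *)
Definition canonical_section (R : cox_ring) (P : prime_divisor) : R :=
  cox_sec R << P >> 1.

End RationalFunctions.

Section SL2.
Variable k : closedFieldType.

Definition sl2 := {A : 'M[k]_2 | \det A == 1}.
HB.instance Definition _ := Choice.on sl2.

Definition sl2_mx (g : sl2) : 'M[k]_2 := val g.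
Coercion sl2_mx : sl2 >-> matrix.

Lemma sl2_det (g : sl2) : \det g = 1.
Proof. exact/eqP/(valP g). Qed.
Lemma sl2_unit (g : sl2) : sl2_mx g \in unitmx.
Proof. by rewrite unitmxE sl2_det unitr1. Qed.

Definition sl2_of (A : 'M[k]_2) (dA : \det A = 1) : sl2 :=
  exist (fun A : 'M[k]_2 => is_true (\det A == 1)) A (introT eqP dA).

Lemma sl2_mul_subproof (g h : sl2) : \det (g *m h) = 1.
Proof. by rewrite det_mulmx !sl2_det mulr1. Qed.
Lemma sl2_inv_subproof (g : sl2) : \det (invmx g) = 1.
Proof. by rewrite det_inv sl2_det invr1. Qed.

Definition sl2_one : sl2 := sl2_of (det1 k 2).
Definition sl2_mul (g h : sl2) : sl2 := sl2_of (sl2_mul_subproof g h).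
Definition sl2_inv (g : sl2) : sl2 := sl2_of (sl2_inv_subproof g).

Lemma sl2_mulA : associative sl2_mul.
Proof. by move=> g h l; apply: val_inj; rewrite /= mulmxA. Qed.
Lemma sl2_mul1g : left_id sl2_one sl2_mul.
Proof. by move=> g; apply: val_inj; rewrite /= mul1mx. Qed.
Lemma sl2_mulg1 : right_id sl2_one sl2_mul.
Proof. by move=> g; apply: val_inj; rewrite /= mulmx1. Qed.
Lemma sl2_mulVg : left_inverse sl2_one sl2_inv sl2_mul.
Proof. by move=> g; apply: val_inj; rewrite /= mulVmx ?sl2_unit. Qed.
Lemma sl2_mulgV : right_inverse sl2_one sl2_inv sl2_mul.
Proof. by move=> g; apply: val_inj; rewrite /= mulmxV ?sl2_unit. Qed.
HB.instance Definition _ := isGroup.Build sl2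
  sl2_mulA sl2_mul1g sl2_mulg1 sl2_mulVg sl2_mulgV.

Definition sl2_coord (g : sl2) (i : 'I_(2 * 2)) : k := mxvec g ord0 i.

Definition sl2_space : space k :=
  Space (zariski_open sl2_coord) (zariski_reg sl2_coord).

Definition borel : set sl2 := [set g : sl2 | g 1 0 = 0].

Definition unipotent : set sl2 :=
  [set g : sl2 | [/\ g 1 0 = 0, g 0 0 = 1 & g 1 1 = 1]].

Definition mu (n : nat) : set sl2 :=
  [set g : sl2 | [/\ g 1 0 = 0, g 0 1 = 0 & g 0 0 ^+ n = 1]].

(** The quotient variety L\G/H of [G = SL_2] by two subgroups; in particular
    G/mu_n is [double_quot [set 1%g] (mu n)], and B\G/mu_n is
    [double_quot borel (mu n)]. *)
Definition double_coset (L H : set sl2) (g : sl2) : set sl2 :=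
  [set x | exists l h, [/\ L l, H h & x = (l * g * h)%g]].

Definition double_cosets (L H : set sl2) : Type :=
  {C : set sl2 | exists g, C = double_coset L H g}.

Definition coset_map (L H : set sl2) (g : sl2) : double_cosets L H :=
  exist _ (double_coset L H g) (ex_intro _ g erefl).

Definition double_quot (L H : set sl2) : space k :=
  @quot_space k sl2_space (double_cosets L H) (coset_map L H).

Definition homogeneous_space (n : nat) : space k := double_quot [set 1%g] (mu n).

(** B\G/mu_n, isomorphic to the projective line. *)
Definition borel_quotient (n : nat) : space k := double_quot borel (mu n).

Record G_variety := GVariety {
  G_variety_variety :> variety k;
  act : sl2 -> G_variety_variety -> G_variety_variety;
  act1 : forall x, act 1%g x = x;
  actM : forall g h x, act (g * h)%g x = act g (act h x);
  act_morphism :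
    @morphism k (prod_space sl2_space G_variety_variety) G_variety_variety
      (fun z => act z.1 z.2) }.

Record embedding (n : nat) := Embedding {
  embedding_variety :> G_variety;
  embedding_map : homogeneous_space n -> embedding_variety;
  embedding_open : open_immersion embedding_map;
  embedding_equivariant : forall g h : sl2,
    embedding_map (coset_map [set 1%g] (mu n) (g * h)%g) =
    act g (embedding_map (coset_map [set 1%g] (mu n) h)) }.

Definition G_stable (X : G_variety) (Z : set X) : Prop :=
  forall g : sl2, act g @` Z = Z.

(** The rational map pi : X --> B\G/mu_n is given on the open orbit by the
    quotient map G/mu_n -> B\G/mu_n.  The prime divisor [P] dominates
    B\G/mu_n if pi, extended to an open subset [V] which meets [P], maps
    [P `&` V] onto a dense subset. *)
Definition dominates (n : nat) (X : embedding n) (P : prime_divisor X) : Prop :=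
  exists (V : set X) (phi : X -> borel_quotient n),
    [/\ opn V /\ P `&` V !=set0,
        morphism_on V phi,
        forall g : sl2,
          let x := embedding_map X (coset_map [set 1%g] (mu n) g) in
          V x -> phi x = coset_map borel (mu n) g &
        forall W : set (borel_quotient n), opn W -> W !=set0 ->
          exists x, [/\ pd_set P x, V x & W (phi x)]].

End SL2.

Section CoxAction.
Variables (k : closedFieldType) (X : G_variety k).
Local Open Scope ring_scope.

(** The rational function [x |-> a (g^-1 x)]. *)
Definition translate (g : sl2 k) (a : ratfun X) : ratfun X :=
  xget 0 [set b | forall x c, has_value a x c -> has_value b (act g x) c].

(** A G-linearization of the sheaf O_X(D), described by the action [phi] of
    [G] on its rational sections: [phi g] maps sections over [V] to sections
    over [g V], is semilinear with respect to the action on functions, and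
    depends algebraically on [g]. *)
Record linearization (D : weil_divisor X) (phi : sl2 k -> ratfun X -> ratfun X) :
    Prop := {
  lin_add : forall g a b, phi g (a + b) = phi g a + phi g b;
  lin_semi : forall g a b, phi g (a * b) = translate g a * phi g b;
  lin1 : forall a, phi 1%g a = a;
  linM : forall g h a, phi (g * h)%g a = phi g (phi h a);
  lin_sections : forall g (V : set X) a, opn V -> sections D V a ->
    sections D (act g @` V) (phi g a);
  lin_algebraic : forall a, exists (W : set (prod_space (sl2_space k) X)) F,
    [/\ W !=set0, reg W F &
        forall z, W z -> has_value (phi z.1 a) z.2 (F z)] }.

(** The action of [G] on the Cox ring: on the piece of degree [D], it is given
    by the (unique) G-linearization of O_X(D). *)
Definition cox_action (R : cox_ring X) (alpha : sl2 k -> R -> R) : Prop :=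
  (forall g, {morph alpha g : r s / r + s}) /\
  exists phi : weil_divisor X -> sl2 k -> ratfun X -> ratfun X,
    (forall D, linearization D (phi D)) /\
    forall D g a, global_sections D a ->
      alpha g (cox_sec R D a) = cox_sec R D (phi D g a).

End CoxAction.

Section SpecialFiber.
Variable k : closedFieldType.
Local Open Scope ring_scope.

Definition ideal_generated (A : comAlgType k) (S : set A) : set A :=
  [set a | exists m (r s : 'I_m -> A),
     (forall i, S (s i)) /\ a = \sum_i r i * s i].

(** The ideal [J] with \tilde X_0 = Spec(Cox(X)/J). *)
Definition special_ideal (X : G_variety k) (R : cox_ring X) : set R :=
  ideal_generated
    [set r | exists2 P : prime_divisor X, G_stable P & r = canonical_section R P].

(** Spec(A/J) is a normal variety: A/J is a finitely generated k-algebra, an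
    integral domain, and integrally closed (the fraction a/b lies in A/J if it
    satisfies a monic equation, here multiplied by b^d). *)
Definition normal_affine_variety (A : comAlgType k) (J : set A) : Prop :=
  [/\ exists m (s : 'I_m -> A), forall a, exists p : {mpoly k[m]},
        J (a - mmap (in_alg A) s p),
      ~ J 1,
      forall a b, J (a * b) -> J a \/ J b &
      forall a b, ~ J b ->
        (exists d (c : 'I_d -> A),
           J (a ^+ d + \sum_(i < d) c i * a ^+ i * b ^+ (d - i))) ->
        exists h, J (a - h * b)].

(** (A/J)^U, as a set of representatives in [A], for a subset [U] of SL_2 and
    an action [alpha] on [A] which leaves [J] stable. *)
Definition invariants_mod (A : comAlgType k) (alpha : sl2 k -> A -> A)
    (J : set A) (U : set (sl2 k)) : set A :=
  [set a | forall u, U u -> J (alpha u a - a)].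

(** The subalgebra [B/J] of [A/J] is a polynomial algebra over [k] in finitely
    many variables, i.e. Spec(B/J) is an affine space. *)
Definition affine_space_mod (A : comAlgType k) (J B : set A) : Prop :=
  exists m (s : 'I_m -> A),
    [/\ forall i, B (s i),
        forall b, B b -> exists p : {mpoly k[m]}, J (b - mmap (in_alg A) s p) &
        forall p : {mpoly k[m]}, J (mmap (in_alg A) s p) -> p = 0].

End SpecialFiber.

Arguments special_ideal {k X} R _.

(* Main.v *)
From HB Require Import structures.
From mathcomp Require Import all_boot all_order all_algebra.
From mathcomp Require Import generic_quotient.
From mathcomp Require Import boolp classical_sets functions.
From mathcomp Require Import freeg mpoly.
From mathcomp Require Import ring zify.
Require Import Defs.

Set Implicit Arguments.
Unset Strict Implicit.
Unset Printing Implicit Defensive.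

Import Order.TTheory GRing.Theory Num.Theory.
Local Open Scope classical_set_scope.
Local Open Scope ring_scope.


(** Pulled back along the orbit map [G -> G/mu_n], a homogeneous section of the Cox ring becomes a
    polynomial function on [G]. If the section is fixed by [U] and has [T]-weight [d], this function
    is a binary form of degree [d] in the second row of the matrix, so it splits into linear forms
    ([binary_form_factor]). Invertible functions on the orbit are constant and linearizations are
    unique. Hence the section is, up to a scalar, a product of the sections [s_l] attached to the
    divisors of linear forms [l] and of the canonical sections [r_P] of the stable prime divisors
    ([sec_of_forms], [highest_weight_sections]).

    Along a stable prime divisor [P], the order of [l] is either the same for all [l], or the same
    except at one line where it is larger. In the first case the quotient of the two coordinates of
    the second row is transcendental on [P], so [P] dominates the projective line
    ([dominates_of_const]). Under the hypothesis, therefore, every [P] has one exceptional line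
    ([exceptional_form]), the point onto which [P] is contracted. Choose a finite list of at least
    two lines that contains the exceptional ones, and let [s_i] be their sections. Modulo the [r_P],
    every other [s_l] is a combination of two of the [s_i] ([form_section_mod]), so the [s_i]
    generate the highest weight vectors. Comparing orders along the stable divisors, within one
    divisor class, shows that they are algebraically independent modulo the [r_P]
    ([special_independence]). Complete reducibility in characteristic zero, obtained from a
    truncated extremal projector ([highest_weight_lift]), turns this into the fact that the
    [U]-invariants of the quotient ring form the polynomial ring in the [s_i].

    The quotient ring is a domain because its highest weight vectors multiply without zero divisors
    ([prime_highest_weight]). It is generated by the [s_i] and partners [s'_i], each pair spanning a
    standard representation. The determinants [s_i s'_j - s_j s'_i] are invariant, hence scalars
    [c_ij]. Inverting one [s_i] gives a localized polynomial ring. If some [c_ij] is nonzero, [s_i]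
    and [s_j] generate the unit ideal, and normality follows by gluing ([twisted_normal]). If all
    [c_ij] vanish, the ring is that of matrices with two rows and rank at most one. It is the ring
    of torus invariants [x_a z_j] in a polynomial ring, so it is normal ([untwisted_normal]).

    The geometry rests on the fact that a function not regular at a point of a normal variety has a
    polar prime divisor through that point, whose local ring is a discrete valuation ring
    ([pole_divisor]). *)

(** * Noetherian rings and Hilbert's basis theorem *)

Section Noetherian.
Variable A : comNzRingType.
Implicit Types (I : set A) (l : seq A).

Record is_ideal I : Prop := IsIdeal {
  ideal0 : I 0;
  idealD : forall a b, I a -> I b -> I (a + b);
  idealMl : forall r a, I a -> I (r * a) }.

Definition in_gen l a := exists r : nat -> A, a = \sum_(i < size l) r i * l`_i.

Definition noetherian := forall I, is_ideal I ->
  exists l, (forall x, x \in l -> I x) /\ forall a, I a -> in_gen l a.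

Record is_prime I : Prop := IsPrime {
  prime_ideal : is_ideal I;
  prime1 : ~ I 1;
  primeM : forall a b, I (a * b) -> I a \/ I b }.

Lemma idealN I a : is_ideal I -> I a -> I (- a).
Proof. by move=> iI Ia; rewrite -mulN1r; apply: idealMl. Qed.

Lemma idealB I a b : is_ideal I -> I a -> I b -> I (a - b).
Proof. by move=> iI Ia Ib; apply: idealD => //; apply: idealN. Qed.

Lemma idealMr I a r : is_ideal I -> I a -> I (a * r).
Proof. by move=> iI Ia; rewrite mulrC; apply: idealMl. Qed.

Lemma ideal_sum I (T : Type) (s : seq T) (P : pred T) (F : T -> A) :
  is_ideal I -> (forall i, P i -> I (F i)) -> I (\sum_(i <- s | P i) F i).
Proof.
by move=> iI H; apply: big_ind => //; [apply: ideal0 | move=> x y; apply: idealD].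
Qed.

Lemma in_gen_ideal l : is_ideal (in_gen l).
Proof.
split.
- by exists (fun=> 0); rewrite big1 // => i _; rewrite mul0r.
- move=> a b [r ->] [r' ->]; exists (fun i => r i + r' i).
  by rewrite -big_split; apply: eq_bigr => i _ /=; rewrite mulrDl.
- move=> c a [r ->]; exists (fun i => c * r i).
  by rewrite mulr_sumr; apply: eq_bigr => i _; rewrite mulrA.
Qed.

Lemma in_gen_mem l x : x \in l -> in_gen l x.
Proof.
move=> /(nthP 0) [i il <-]; exists (fun j => (j == i)%:R).
rewrite (bigD1 (Ordinal il)) //= eqxx mul1r big1 ?addr0 // => j nj.
by rewrite -val_eqE in nj; rewrite (negPf nj) mul0r.
Qed.

Lemma in_gen_sub l I a : is_ideal I -> (forall x, x \in l -> I x) ->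
  in_gen l a -> I a.
Proof.
move=> iI H [r ->]; apply: ideal_sum => // i _; apply: idealMl => //.
by apply: H; rewrite mem_nth.
Qed.

Lemma in_gen_subset l l' a : {subset l <= l'} -> in_gen l a -> in_gen l' a.
Proof.
move=> s; apply: in_gen_sub; first exact: in_gen_ideal.
by move=> x /s; apply: in_gen_mem.
Qed.

(** The ideals generated by initial segments of the sequence form a chain. Their union is an ideal,
    and its finitely many generators already lie in one member. This is the form in which the
    ascending chain condition is used below. *)
Lemma noetherian_sequence (f : nat -> A) : noetherian ->
  exists n, in_gen (mkseq f n) (f n).
Proof.
move=> nA; pose I : set A := fun a => exists n, in_gen (mkseq f n) a.
have mono m n a : (m <= n)%N -> in_gen (mkseq f m) a -> in_gen (mkseq f n) a.
  move=> mn; apply: in_gen_subset => x /mapP [i]; rewrite mem_iota => /= im ->.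
  by apply: map_f; rewrite mem_iota /= (leq_trans im).
have iI : is_ideal I.
  split.
  - by exists 0%N; apply: ideal0; apply: in_gen_ideal.
  - move=> a b [m Ha] [n Hb]; exists (maxn m n); apply: (idealD (in_gen_ideal _)).
      by apply: mono Ha; rewrite leq_maxl.
    by apply: mono Hb; rewrite leq_maxr.
  - by move=> r a [m Ha]; exists m; apply: (idealMl (in_gen_ideal _)).
have [l [lI lg]] := nA I iI.
have [n Hn] : exists n, forall x, x \in l -> in_gen (mkseq f n) x.
  elim: l lI {lg} => [_|x l IH H]; first by exists 0%N.
  have [n Hn] := IH (fun y yl => H y (mem_behead (s := x :: l) yl)).
  have [m Hm] := H x (mem_head _ _).
  exists (maxn m n) => y; rewrite inE => /orP[/eqP->|/Hn].
    by apply: mono Hm; rewrite leq_maxl.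
  by apply: mono; rewrite leq_maxr.
exists n; apply: (in_gen_sub (l := l)) => //; first exact: in_gen_ideal.
apply: lg; exists n.+1; apply: in_gen_mem; apply: map_f.
by rewrite mem_iota /= ltnS.
Qed.

(** Without a maximal member, choice builds a strictly increasing chain in [F]. The new elements
    picked along it contradict [noetherian_sequence]. *)
Lemma noetherian_maximal (F : set (set A)) : noetherian ->
  (forall I, F I -> is_ideal I) -> (exists I, F I) ->
  exists I, F I /\ forall I', F I' -> (forall a, I a -> I' a) -> forall a, I' a -> I a.
Proof.
move=> nA FI [I0 FI0]; apply: contrapT => nex.
have step (I : {I | F I}) : exists J : {I' | F I'} * A,
    (forall a, sval I a -> sval J.1 a) /\ sval J.1 J.2 /\ ~ sval I J.2.
  case: I => I HI; apply: contrapT => nJ; apply: nex; exists I; split => //.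
  move=> I' HI' sub a I'a; apply: contrapT => nIa; apply: nJ.
  by exists (exist _ I' HI', a).
have [next Hn] := choice step.
pose ch n := iter n (fun J => (next J).1) (exist _ I0 FI0).
have mono m n a : (m <= n)%N -> sval (ch m) a -> sval (ch n) a.
  move=> /subnK <-; elim: (n - m)%N => // d IH H.
  by rewrite addSn /=; apply: (Hn _).1; apply: IH.
have [n gn] := noetherian_sequence (fun n => (next (ch n)).2) nA.
apply: (Hn (ch n)).2.2.
apply: in_gen_sub gn; first by apply: FI; apply: (svalP (ch n)).
move=> x /mapP [i]; rewrite mem_iota /= => il ->.
by apply: (mono i.+1) => //=; apply: (Hn (ch i)).2.1.
Qed.

End Noetherian.

Lemma noetherian_surj (A B : comNzRingType) (f : {rmorphism A -> B}) :
  (forall b, exists a, f a = b) -> noetherian A -> noetherian B.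
Proof.
move=> sf nA I iI.
have [|l [lI lg]] := nA (fun a => I (f a)).
  split; first by rewrite rmorph0; apply: ideal0.
    by move=> a b Ha Hb; rewrite rmorphD; apply: idealD.
  by move=> r a Ha; rewrite rmorphM; apply: idealMl.
exists (map f l); split => [x /mapP [y yl ->]|b Ib]; first exact: lI.
have [a fa] := sf b; have [r ar] : in_gen l a by apply: lg; rewrite fa.
exists (fun i => f (r i)); rewrite -fa ar rmorph_sum size_map; apply: eq_bigr => i _.
by rewrite rmorphM (nth_map 0).
Qed.

Lemma noetherian_field (k : fieldType) : noetherian k.
Proof.
move=> I iI; case: (pselect (exists2 a, I a & a != 0)) => [[a Ia a0]|H].
  exists [:: a]; split => [x|b Ib]; first by rewrite inE => /eqP->.
  by exists (fun=> b / a); rewrite /= big_ord_recl big_ord0 addr0 /= divfK.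
exists [::]; split => // a Ia; exists (fun=> 0); rewrite big_ord0.
by apply/eqP/negPn/negP => a0; apply: H; exists a.
Qed.

Section HilbertBasis.
Variable A : comNzRingType.

(** If [I] is not finitely generated, repeatedly pick in [I] a polynomial of least size outside the
    ideal generated by the previous ones. Some leading coefficient is a combination of earlier ones,
    and cancelling leading terms contradicts minimality. *)
Theorem noetherian_poly : noetherian A -> noetherian {poly A}.
Proof.
move=> nA I iI; apply: contrapT => nI.
have pickP (l : seq {poly A}) : exists p : {poly A}, (forall x, x \in l -> I x) ->
    I p /\ ~ in_gen l p /\ forall q : {poly A}, I q -> ~ in_gen l q -> (size p <= size q)%N.
  case: (pselect (forall x, x \in l -> I x)) => [lI|?]; last by exists 0.
  have [p0 [Ip0 np0]] : exists p, I p /\ ~ in_gen l p.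
    apply: contrapT => H; apply: nI; exists l; split => // a Ia.
    by apply: contrapT => na; apply: H; exists a.
  pose S n := `[< exists p : {poly A}, [/\ I p, ~ in_gen l p & size p = n] >].
  have exS : exists n, S n by exists (size p0); apply/asboolP; exists p0.
  case: (ex_minnP exS) => m /asboolP[p [Ip np sp]] Hm.
  exists p => _; split => //; split => // q Iq nq; rewrite sp; apply: Hm.
  by apply/asboolP; exists q.
have [pick Hp] := choice pickP.
pose L := fix L n := if n is m.+1 then rcons (L m) (pick (L m)) else [::].
have LI n : forall x, x \in L n -> I x.
  elim: n => //= n IH x; rewrite mem_rcons inE => /orP [/eqP ->|/IH //].
  by have [] := Hp _ IH.
pose g n := pick (L n).
have LE n : L n = mkseq g n.
  elim: n => //= n IH; rewrite -[RHS]/(mkseq g n.+1) /mkseq -addn1 iotaD map_cat /= add0n.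
  by rewrite -/(mkseq g n) -IH cats1.
have [gI] := all_and2 (fun n => Hp _ (LI n)); move=> /all_and2 [gN gmin].
have gmono i n : (i <= n)%N -> (size (g i) <= size (g n))%N.
  move=> le; apply: gmin; first exact: gI.
  move=> H; apply: (gN n); move: H; apply: in_gen_subset => x; rewrite !LE.
  move=> /mapP [j]; rewrite mem_iota /= => jl ->; apply: map_f.
  by rewrite mem_iota /= (leq_trans jl).
have [n [r Hr]] := noetherian_sequence (fun n => lead_coef (g n)) nA.
rewrite size_mkseq in Hr.
(* The powers of ['X] bring every earlier [g i] to the degree of [g n], so [h] has the same leading
   term as [g n]. *)
pose h := \sum_(i < n) (r i)%:P * 'X^(size (g n) - size (g i)) * g i.
have Lh : in_gen (L n) h.
  exists (fun i => (r i)%:P * 'X^(size (g n) - size (g i))).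
  by rewrite LE size_mkseq; apply: eq_bigr => i _; rewrite nth_mkseq.
have gn0 : g n != 0.
  by apply/eqP => g0; apply: (gN n); rewrite -/(g n) g0; apply: ideal0; apply: in_gen_ideal.
have sz : (size (g n - h)%R < size (g n))%N.
  have sg : (0 < size (g n))%N by rewrite size_poly_gt0.
  rewrite -(prednK sg) ltnS; apply/leq_sizeP => j; rewrite leq_eqVlt => /orP[/eqP <-|jl].
    rewrite coefB -/(lead_coef (g n)) Hr /h coef_sum -sumrB big1 // => i _.
    rewrite nth_mkseq // -mulrA coefCM coefXnM.
    have le := gmono _ _ (ltnW (ltn_ord i)).
    have [s0|s0] := posnP (size (g i)).
      have -> : g i = 0 by apply/eqP; rewrite -size_poly_eq0 s0.
      by rewrite lead_coef0 coef0 if_same subrr.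
    rewrite ltnNge (_ : (size (g n) - size (g i) <= (size (g n)).-1)%N) /=; last first.
      by rewrite -subn1 leq_sub2l.
    rewrite (_ : ((size (g n)).-1 - (size (g n) - size (g i)))%N = (size (g i)).-1) ?subrr //.
    by rewrite -!subn1 -subnDA addnC subnDA subKn.
  rewrite prednK // in jl.
  rewrite coefB [(g n)`_j]nth_default // sub0r /h coef_sum big1 ?oppr0 // => i _.
  rewrite -mulrA coefCM coefXnM; case: ifP => _; first by rewrite mulr0.
  rewrite nth_default ?mulr0 // leq_subRL; last by rewrite (leq_trans _ jl) // leq_subr.
  by rewrite subnK // gmono // ltnW.
have := gmin n (g n - h); rewrite leqNgt sz => H; suff: false by [].
apply: H; first exact: (idealB iI (gI n) (in_gen_sub iI (LI n) Lh)).
move=> H; apply: (gN n); rewrite -/(g n) -(subrK h (g n)).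
by apply: idealD => //; apply: in_gen_ideal.
Qed.
End HilbertBasis.

(** * Complete integral closedness of polynomial rings *)

Section AlmostIntegral.

(* Complete integral closedness: almost integral fractions [a / b] lie in [A]. *)
Definition cic (A : idomainType) := forall a b c : A, b != 0 -> c != 0 ->
  (forall n, exists d, c * a ^+ n = d * b ^+ n) -> exists h, a = h * b.

Lemma cic_field (k : fieldType) : cic k.
Proof. by move=> a b c b0 _ _; exists (a / b); rewrite divfK. Qed.

(** A monic equation of degree [d] rewrites high powers of [a / b] through lower ones, so [b ^+ d]
    is a common denominator for all powers. *)
Lemma cic_integral (A : idomainType) (a b : A) d (c : 'I_d -> A) : cic A -> b != 0 ->
  a ^+ d + \sum_(i < d) c i * a ^+ i * b ^+ (d - i) = 0 -> exists h, a = h * b.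
Proof.
move=> cA b0 H; apply: (cA a b (b ^+ d)) => //; first by rewrite expf_neq0.
elim/ltn_ind => n IH; have [nd|dn] := ltnP n d.
  exists (b ^+ (d - n) * a ^+ n).
  by rewrite mulrAC -exprD subnK // ltnW.
have -> : a ^+ n = - \sum_(i < d) c i * a ^+ (n - (d - i)) * b ^+ (d - i).
  move: H => /eqP; rewrite addr_eq0 => /eqP H.
  rewrite -{1}(subnKC dn) exprD H mulNr mulr_suml; congr (- _); apply: eq_bigr => i _.
  rewrite mulrAC; congr (_ * _); rewrite -(mulrA (c i)) -exprD; congr (_ * _ ^+ _).
  by have := ltn_ord i; lia.
have IH' (i : 'I_d) : exists e, b ^+ d * a ^+ (n - (d - i)) = e * b ^+ (n - (d - i)).
  apply: IH; have := ltn_ord i; lia.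
have [e He] := choice IH'.
exists (- \sum_(i < d) c i * e i); rewrite mulrN mulNr; congr (- _).
rewrite mulr_sumr mulr_suml; apply: eq_bigr => i _.
rewrite -mulrA mulrCA [b ^+ d * _]mulrA He -!mulrA -exprD subnK //.
by have := ltn_ord i; lia.
Qed.

(** After removing the gcd from [f / g], every power of the reduced denominator divides [c]. The
    denominator is then a constant up to scaling. For a constant denominator the leading coefficient
    of the numerator is almost integral over [A], so its leading term can be split off, and
    induction on the size finishes. *)
Lemma cic_poly (A : idomainType) : cic A -> cic {poly A}.
Proof.
move=> cA f g c g0 c0 H.
have [a a0 [h Hh]] : exists2 a : A, a != 0 & exists h, a *: f = h * g.
  pose d := gcdp f g; have d0 : d != 0 by rewrite gcdp_eq0 negb_and g0 orbT.
  have Hf : f %/ d * d = _ *: f := Pdiv.WeakIdomain.divpK (dvdp_gcdl f g).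
  have Hg : g %/ d * d = _ *: g := Pdiv.WeakIdomain.divpK (dvdp_gcdr f g).
  have : coprimep (f %/ d) (g %/ d) by apply: coprimep_div_gcd; rewrite g0 orbT.
  move: Hf Hg; set u := _ ^+ _; set v := _ ^+ _; move: (f %/ d) (g %/ d).
  have u0 : u != 0 by rewrite expf_neq0 // lead_coef_eq0.
  have v0 : v != 0 by rewrite expf_neq0 // lead_coef_eq0.
  move=> f1 g1 Hf Hg cop.
  have g10 : g1 != 0.
    apply: contraNneq g0 => g10; move: Hg; rewrite g10 mul0r => /esym/eqP.
    by rewrite scale_poly_eq0 (negPf v0).
  have dv n : g1 ^+ n %| c.
    have [e He] := H n.
    have E : v ^+ n *: (c * f1 ^+ n) = (u ^+ n *: e) * g1 ^+ n.
      apply: (mulIf (expf_neq0 n d0)).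
      rewrite -scalerAl -!mulrA -!exprMn Hf Hg !exprZn -!scalerAr He.
      by rewrite -scalerAl !scalerA mulrC.
    rewrite -(@Gauss_dvdpl _ _ (f1 ^+ n)); last first.
      by rewrite coprimep_sym coprimep_expl // coprimep_expr.
    by rewrite -(dvdpZr _ _ (expf_neq0 n v0)) E dvdp_mull.
  have /eqP : size g1 = 1%N.
    have := dvdp_leq c0 (dv (size c)); have := size_exp g1 (size c).
    have : (0 < size g1)%N by rewrite size_poly_gt0.
    have : (0 < size c)%N by rewrite size_poly_gt0.
    case: (size g1) => // -[|m] //= c0' _; rewrite mulSn => E le.
    by move: E le c0'; case: (size _) => [|x] /= E le c0'; lia.
  move=> /size_poly1P [w w0 wE].
  exists (w * u); first by rewrite mulf_neq0.
  exists (v *: f1); rewrite -scalerAl -scalerA -Hf -mul_polyC -wE.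
  by rewrite mulrCA Hg -scalerAr.
have {}H n : exists e, c * h ^+ n = e * a%:P ^+ n.
  have [e He] := H n; exists e; apply: (mulIf (expf_neq0 n g0)).
  by rewrite -mulrA -exprMn -Hh -mul_polyC exprMn mulrCA He mulrCA mulrA.
suff [h' Hh'] : exists h', h = h' * a%:P.
  exists h'; have a0' : a%:P != 0 by rewrite polyC_eq0.
  by apply: (mulfI a0'); rewrite mul_polyC Hh Hh' mulrAC mulrC.
have [N] := ubnP (size h); elim: N h H {Hh} => // N IH h H; rewrite ltnS => sN.
have [->|h0] := eqVneq h 0; first by exists 0; rewrite mul0r.
have [l Hl] : exists l, lead_coef h = l * a.
  apply: (cA _ _ (lead_coef c)); rewrite ?lead_coef_eq0 // => n.
  have [e He] := H n; exists (lead_coef e).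
  by rewrite -lead_coef_exp -lead_coefM He lead_coefM lead_coef_exp lead_coefC.
pose w := - (l *: 'X^((size h).-1)).
have [|| h' Hh'] := IH (h + w * a%:P).
(* Subtracting an element of the ring from an almost integral fraction keeps the same common
   denominator [c], by the binomial formula. *)
- move=> n; have [e He] := choice H.
  exists (\sum_(i < n.+1) (e (n - i)%N * w ^+ i) *+ 'C(n, i)).
  rewrite exprDn mulr_sumr mulr_suml; apply: eq_bigr => i _.
  rewrite mulrnAr mulrnAl; congr (_ *+ _).
  rewrite exprMn (mulrA c) He -!mulrA; congr (_ * _); rewrite mulrCA; congr (_ * _).
  by rewrite -exprD subnK // -ltnS.
- apply: leq_trans sN; have sh : (0 < size h)%N by rewrite size_poly_gt0.
  rewrite -(prednK sh) ltnS; apply/leq_sizeP => j; rewrite leq_eqVlt => /orP[/eqP <-|jl].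
    rewrite coefD mulrC mul_polyC coefZ coefN coefZ coefXn eqxx mulr1 -/(lead_coef h).
    by rewrite Hl mulrN mulrC subrr.
  rewrite prednK // in jl; rewrite coefD mulrC mul_polyC coefZ coefN coefZ coefXn.
  rewrite nth_default // add0r; case: eqP => [E|_]; last by rewrite mulr0 oppr0 mulr0.
  by move: jl sh; rewrite E; lia.
by exists (h' - w); rewrite mulrBl -Hh' addrK.
Qed.

Lemma cic_retract (A B : idomainType) (t : {rmorphism B -> A}) (f : {rmorphism A -> B}) :
  cancel t f -> cic A -> cic B.
Proof.
move=> tf cA a b c b0 c0 H.
have t0 x : x != 0 -> t x != 0.
  by apply: contraNneq => tx; rewrite -(tf x) tx rmorph0.
have [|h Hh] := cA (t a) (t b) (t c) (t0 _ b0) (t0 _ c0).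
  by move=> n; have [d Hd] := H n; exists (t d); rewrite -!rmorphXn -!rmorphM Hd.
by exists (f h); rewrite -[a]tf Hh rmorphM tf.
Qed.

End AlmostIntegral.

(** * The Nullstellensatz, by adjoining one variable at a time *)

Section Nullstellensatz.
Variable k : closedFieldType.

Lemma exists_nonroot (p : {poly k}) : p != 0 -> exists x, p.[x] != 0.
Proof.
move=> p0; have [s1|s1] := eqVneq (size p) 1%N.
  have /size_poly1P [c c0 ->] : size p == 1%N by rewrite s1.
  by exists 0; rewrite hornerC.
have : size (p - 1) != 1%N.
  rewrite size_polyDl // size_polyN size_poly1 ltn_neqAle eq_sym s1 /=.
  by rewrite size_poly_gt0.
move=> /closed_rootP [x /rootP]; rewrite hornerD hornerN hornerC => /eqP.
by rewrite subr_eq0 => /eqP E; exists x; rewrite E oner_eq0.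
Qed.

(** The Nullstellensatz for a [k]-algebra [P], in a form that passes from [P] to [{poly P}]:
    [k]-points of a prime ideal can be chosen off any prescribed [q] outside it. *)
Definition has_points (P : idomainType) (iota : {rmorphism k -> P}) :=
  forall (I : set P) q, is_prime I -> ~ I q -> exists phi : {rmorphism P -> k},
    [/\ forall c, phi (iota c) = c, forall p, I p -> phi p = 0 & phi q != 0].

Section Step.
Variables (P : idomainType) (iota : {rmorphism k -> P}).
Hypothesis HP : has_points iota.
Variables (I : set {poly P}) (q : {poly P}).
Hypotheses (pI : is_prime I) (nq : ~ I q).
Let iI := prime_ideal pI.
Let J : set P := fun c => I c%:P.

Let pJ : is_prime J.
Proof.
split; first split.
- by rewrite /J polyC0; apply: ideal0.
- by move=> a b; rewrite /J polyCD; apply: idealD.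
- by move=> a b; rewrite /J polyCM; apply: idealMl.
- exact: (prime1 pI).
- by move=> a b; rewrite /J polyCM; apply: primeM.
Qed.

Let coefJ (p : {poly P}) : (forall i, J p`_i) -> I p.
Proof.
move=> H; rewrite -[p]coefK poly_def; apply: ideal_sum => // i _.
by rewrite -mul_polyC; apply: idealMr => //; apply: H.
Qed.

(** A leading term with coefficient in [J] belongs to [I], so it can be removed without leaving
    [S]. *)
Let chop (S : set {poly P}) (p : {poly P}) :
  (forall f g, S f -> I g -> S (f - g)) -> S p -> ~ (forall i, J p`_i) ->
  exists p', [/\ S p', (size p' <= size p)%N & ~ J (lead_coef p')].
Proof.
move=> HS; have [N] := ubnP (size p); elim: N p => // N IH p; rewrite ltnS => sp Sp np.
case: (pselect (J (lead_coef p))) => [Jl|]; last by exists p.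
have p0 : p != 0.
  by apply/eqP => p0; apply: np => i; rewrite p0 coef0; apply: (ideal0 (prime_ideal pJ)).
have sp0 : (0 < size p)%N by rewrite size_poly_gt0.
pose w := lead_coef p *: 'X^((size p).-1).
have sw : (size (p - w)%R <= (size p).-1)%N.
  apply/leq_sizeP => j; rewrite leq_eqVlt => /orP[/eqP <-|jl].
    by rewrite coefB coefZ coefXn eqxx mulr1 subrr.
  rewrite prednK // in jl; rewrite coefB coefZ coefXn nth_default //.
  by case: eqP => [E|_]; [move: jl sp0; rewrite E; lia | rewrite mulr0 subrr].
have [|||p' [Sp' sp' np']] := IH (p - w).
- by apply: leq_ltn_trans sw _; move: sp sp0; lia.
- by apply: HS => //; rewrite /w -mul_polyC; apply: idealMr.
- move=> H; apply: np => i; have := H i; rewrite coefB coefZ coefXn.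
  case: eqP => [-> _|_]; first exact: Jl.
  by rewrite mulr0 subr0.
exists p'; split => //; apply: leq_trans sp' _; apply: leq_trans sw _.
exact: leq_pred.
Qed.

Let min_exists (S : set {poly P}) : (exists p, S p /\ ~ J (lead_coef p)) ->
  exists p, [/\ S p, ~ J (lead_coef p) &
    forall p', S p' -> ~ J (lead_coef p') -> (size p <= size p')%N].
Proof.
move=> [p0 [Sp0 np0]].
pose T n := `[< exists p : {poly P}, [/\ S p, ~ J (lead_coef p) & size p = n] >].
have exT : exists n, T n by exists (size p0); apply/asboolP; exists p0.
case: (ex_minnP exT) => m /asboolP[p [Sp np sp]] Hm; exists p; split => // p' Sp' np'.
by rewrite sp; apply: Hm; apply/asboolP; exists p'.
Qed.

(** If [I] is extended from [J], specialize a coefficient of [q] to a nonzero value and then choose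
    the variable off the roots. Otherwise [I] contains some [m] of least size with leading
    coefficient outside [J], and [I + (q)] contains a constant [c] outside [J]. A point of [J] where
    [c] and the leading coefficient of [m] survive extends by a root of the specialized [m].
    Pseudo-division by [m] shows that it kills [I], and [c] keeps [q] nonzero. *)
Lemma has_points_step : exists phi : {rmorphism {poly P} -> k},
  [/\ forall c, phi (iota c)%:P = c, forall p, I p -> phi p = 0 & phi q != 0].
Proof.
case: (pselect (forall p, I p -> forall i, J p`_i)) => [HA|].
  have [i nqi] : exists i, ~ J q`_i.
    by apply: contrapT => H; apply: nq; apply: coefJ => i; apply: contrapT => ?; apply: H; exists i.
  have [phi [phik phiJ phiq]] := HP pJ nqi.
  have [w Hw] : exists w, (map_poly phi q).[w] != 0.
    by apply: exists_nonroot; apply: contraNneq phiq => E; rewrite -coef_map E coef0.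
  exists (horner_eval w \o map_poly phi); split.
  - by move=> c; rewrite /= /horner_eval map_polyC hornerC /= phik.
  - move=> p Ip; rewrite /= /horner_eval (_ : map_poly phi p = 0) ?horner0 //.
    by apply/polyP => j; rewrite coef_map coef0; apply: phiJ; apply: HA.
  - by [].
move=> HB.
have IB f g : I f -> I g -> I (f - g) by apply: idealB.
have lc_exp (a : P) N : ~ J a -> ~ J (a ^+ N).
  move=> na; elim: N => [|N IH]; first by rewrite expr0; apply: (prime1 pJ).
  by rewrite exprS => /(primeM pJ) [].
have Iscale (c : P) N (p : {poly P}) : ~ J c -> I (c ^+ N *: p) -> I p.
  by move=> nc; rewrite -mul_polyC => /(primeM pI) [/(lc_exp _ N nc)|].
have [m [Im nm mmin]] : exists p, [/\ I p, ~ J (lead_coef p) &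
    forall p', I p' -> ~ J (lead_coef p') -> (size p <= size p')%N].
  apply: min_exists; apply: contrapT => H; apply: HB => p Ip; apply: contrapT => np.
  by have [p' [Ip' _ np']] := chop IB Ip np; apply: H; exists p'.
have Jred p : I p -> (size p < size m)%N -> forall i, J p`_i.
  move=> Ip sp; apply: contrapT => np.
  have [p' [Ip' sp' np']] := chop IB Ip np.
  by have := mmin _ Ip' np'; rewrite leqNgt (leq_ltn_trans sp' sp).
have sm : (1 < size m)%N.
  rewrite ltnNge; apply/negP => /size1_polyC E; apply: nm.
  by rewrite E lead_coefC /J -E.
pose S : set {poly P} := fun f => exists b p, I p /\ f = b * q + p.
have SB f g : S f -> I g -> S (f - g).
  by move=> [b [p [Ip ->]]] Ig; exists b, (p - g); split; [apply: idealB|rewrite addrA].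
have SI p : I p -> S p by move=> Ip; exists 0, p; rewrite mul0r add0r.
have Sq : S q by exists 1, 0; rewrite mul1r addr0; split => //; apply: ideal0.
have SM r f : S f -> S (r * f).
  move=> [b [p [Ip ->]]]; exists (r * b), (r * p); split; first exact: idealMl.
  by rewrite mulrDr mulrA.
have SBB f g : S f -> S g -> S (f - g).
  move=> [b [p [Ip ->]]] [b' [p' [Ip' ->]]]; exists (b - b'), (p - p').
  by split; [apply: idealB|rewrite mulrBl opprD addrACA].
have [g [Sg ng gmin]] : exists p, [/\ S p, ~ J (lead_coef p) &
    forall p', S p' -> ~ J (lead_coef p') -> (size p <= size p')%N].
  apply: min_exists.
  have [p' [Sp' _ np']] := chop SB Sq (fun H => nq (coefJ H)).
  by exists p'.
have g0 : g != 0.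
  by apply/eqP => E; apply: ng; rewrite E lead_coef0; apply: (ideal0 (prime_ideal pJ)).
have Sred p : S p -> (size p < size g)%N -> forall i, J p`_i.
  move=> Sp sp; apply: contrapT => np; have [p' [Sp' sp' np']] := chop SB Sp np.
  by have := gmin _ Sp' np'; rewrite leqNgt (leq_ltn_trans sp' sp).
have div p : S p -> exists Q rho N, [/\ lead_coef g ^+ N *: p = Q * g + rho, I rho,
     forall i, J rho`_i & (size rho < size g)%N].
  move=> Sp; exists (p %/ g), (p %% g), (scalp p g).
  have E := Pdiv.WeakIdomain.divp_eq p g.
  have sr : (size (p %% g)%R < size g)%N by rewrite Pdiv.CommonIdomain.ltn_modpN0.
  suff H : forall i, J (p %% g)`_i by split => //; apply: coefJ.
  apply: Sred => //.
  rewrite (_ : p %% g = lead_coef g ^+ scalp p g *: p - p %/ g * g); last first.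
    by rewrite E addrC addKr.
  by rewrite -mul_polyC; apply: SBB; apply: SM.
have nIg : ~ I g.
  move=> Ig; have [Q [rho [N [E Ir _ _]]]] := div q Sq.
  apply: nq; apply: (Iscale _ N _ ng); rewrite E; apply: (idealD iI) => //.
  exact: (idealMl iI).
(* Were [g] not constant, pseudo-dividing [m] by [g] would leave a remainder in [I] and hence put
   the quotient into [I]. That quotient is shorter than [m] but not zero modulo [J], against the
   choice of [m]. *)
have sg1 : size g = 1%N.
  apply/eqP; rewrite eqn_leq size_poly_gt0 g0 andbT leqNgt; apply/negP => sg.
  have [Q [rho [N [E Ir Jr sr]]]] := div m (SI _ Im).
  have IQ : I Q.
    case: (primeM pI (a := Q) (b := g)) => //.
    have -> : Q * g = lead_coef g ^+ N *: m - rho by rewrite E addrK.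
    by apply: idealB => //; rewrite -mul_polyC; apply: idealMl.
  have sgm : (size g <= size m)%N by apply: gmin => //; apply: SI.
  have Q0 : ~ forall i, J Q`_i.
    move=> JQ; apply: (lc_exp _ N ng).
    suff H : J (lead_coef g ^+ N * lead_coef m) by case: (primeM pJ H).
    rewrite -[lead_coef m]/(m`_(size m).-1) -coefZ E coefD.
    apply: (idealD (prime_ideal pJ)) => //; rewrite coefM.
    apply: (@ideal_sum _ J _ _ xpredT _ (prime_ideal pJ)) => i _.
    exact: (@idealMr _ J _ _ (prime_ideal pJ) (JQ i)).
  have [p' [Ip' sp' np']] := chop IB IQ Q0.
  have := mmin _ Ip' np'; rewrite leqNgt => /negP; apply; apply: leq_ltn_trans sp' _.
  have Qn0 : Q != 0.
    by apply/eqP => E0; apply: Q0 => i; rewrite E0 coef0; apply: (ideal0 (prime_ideal pJ)).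
  have : (size (Q * g)%R <= size m)%N.
    rewrite (_ : Q * g = lead_coef g ^+ N *: m - rho); last by rewrite E addrK.
    apply: leq_trans (size_polyD _ _) _; rewrite geq_max size_scale_leq size_polyN.
    by apply: leq_trans sgm; apply: ltnW.
  by rewrite size_mul //; move: sg; lia.
have [c cE] : exists c, g = c%:P by exists g`_0; apply: size1_polyC; rewrite sg1.
have nc : ~ J c by rewrite cE lead_coefC in ng.
have ncm : ~ J (c * lead_coef m) by move=> /(primeM pJ) [].
have [phi [phik phiJ]] := HP pJ ncm; rewrite rmorphM mulf_eq0 negb_or => /andP [phic phim].
have [w Hw] : exists w, root (map_poly phi m) w.
  by apply/closed_rootP; rewrite size_map_poly_id0 //; move: sm; case: (size m) => [|[]].
pose psi : {rmorphism {poly P} -> k} := horner_eval w \o map_poly phi.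
have psiC a : psi a%:P = phi a by rewrite /psi /= /horner_eval map_polyC hornerC.
have psiI p : I p -> psi p = 0.
  move=> Ip; have m0 : m != 0 by rewrite -size_poly_gt0 (ltn_trans _ sm).
  have E := Pdiv.WeakIdomain.divp_eq p m.
  have Er : p %% m = lead_coef m ^+ scalp p m *: p - p %/ m * m by rewrite E addrC addKr.
  have J0 : forall i, J (p %% m)`_i.
    apply: Jred; last by rewrite Pdiv.CommonIdomain.ltn_modpN0.
    rewrite Er -mul_polyC; apply: (idealB iI); exact: idealMl.
  have : psi (p %% m) = 0.
    rewrite /psi /= /horner_eval (_ : map_poly phi _ = 0) ?horner0 //.
    by apply/polyP => j; rewrite coef_map coef0; apply: phiJ.
  have psim : psi m = 0 by apply/rootP.
  rewrite Er rmorphB rmorphM psim mulr0 subr0 -mul_polyC rmorphM psiC rmorphXn.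
  by move=> /eqP; rewrite mulf_eq0 (negPf (expf_neq0 _ phim)) /= => /eqP.
exists psi; split => //; first by move=> a; rewrite psiC phik.
have [b [p [Ip gE]]] := Sg.
apply: contraNneq phic => q0; rewrite -psiC -cE gE rmorphD rmorphM q0 mulr0 add0r.
by rewrite psiI.
Qed.
End Step.

(** [P] is the iterated univariate polynomial ring in the first [j] variables. At [j = n], the map
    [mmap iota y] is a section of [psi], which carries the three properties proved one variable at a
    time over to [{mpoly k[n]}]. *)
Lemma mpoly_tower n j : (j <= n)%N ->
  exists (P : idomainType) (iota : {rmorphism k -> P}) (y : 'I_n -> P)
    (psi : {rmorphism P -> {mpoly k[n]}}),
  [/\ noetherian P /\ cic P, has_points iota, forall c, psi (iota c) = c%:MP &
      forall i : 'I_n, (i < j)%N -> psi (y i) = 'X_i].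
Proof.
elim: j => [_|j IH jn].
  exists k, idfun, (fun=> 0), (@mpolyC n k); split => //.
  - by split; [apply: noetherian_field | apply: cic_field].
  - move=> I q pI nq; exists idfun; split => //.
      move=> p Ip; apply/eqP/negPn/negP => p0; apply: (prime1 pI).
      by rewrite -(mulVf p0); apply: idealMl => //; apply: (prime_ideal pI).
    by apply/eqP => /= q0; apply: nq; rewrite q0; apply: (ideal0 (prime_ideal pI)).
have [P [iota [y [psi [[nP cP] hP psiC psiX]]]]] := IH (ltnW jn).
have cfu : commr_rmorph psi ('X_(Ordinal jn) : {mpoly k[n]}) by move=> x; apply: mulrC.
exists {poly P}, (polyC \o iota), (fun i => if i == Ordinal jn then 'X else (y i)%:P),
  (horner_morph cfu).
split.
- by split; [apply: noetherian_poly | apply: cic_poly].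
- by move=> I q pI nq; have := has_points_step hP pI nq.
- by move=> c; rewrite /= horner_morphC psiC.
- move=> i; rewrite ltnS leq_eqVlt => /orP[/eqP E|il].
    have -> : i = Ordinal jn by apply: val_inj.
    by rewrite eqxx /= horner_morphX.
  by rewrite -val_eqE /= (ltn_eqF il) /= horner_morphC psiX.
Qed.

Section Mpoly.
Variable n : nat.

Lemma rmorph_mmap (A B : comNzRingType) (f : {rmorphism k -> A}) (h : 'I_n -> A)
  (g : {rmorphism A -> B}) p : g (mmap f h p) = mmap (g \o f) (g \o h) p.
Proof.
rewrite /mmap rmorph_sum; apply: eq_bigr => m _; rewrite rmorphM; congr (_ * _).
by rewrite /mmap1 rmorph_prod; apply: eq_bigr => i _; rewrite rmorphXn.
Qed.

Lemma eq_mmap (A : comNzRingType) (f f' : k -> A) (h h' : 'I_n -> A) p :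
  f =1 f' -> h =1 h' -> mmap f h p = mmap f' h' p.
Proof.
move=> ff hh; rewrite /mmap; apply: eq_bigr => m _; rewrite ff; congr (_ * _).
by rewrite /mmap1; apply: eq_bigr => i _; rewrite hh.
Qed.

Lemma mmap_id (p : {mpoly k[n]}) : mmap (@mpolyC n k) (fun i => 'X_i) p = p.
Proof.
rewrite [RHS]mpolyE /mmap; apply: eq_bigr => m _; rewrite -mul_mpolyC; congr (_ * _).
by rewrite mpolyXE_id.
Qed.

Theorem noetherian_mpoly : noetherian {mpoly k[n]}.
Proof.
have [P [iota [y [psi [[nP _] _ psiC psiX]]]]] := mpoly_tower (leqnn n).
apply: (noetherian_surj (f := psi)) nP => p; exists (mmap iota y p).
by rewrite rmorph_mmap -[RHS]mmap_id; apply: eq_mmap => // i /=; apply: psiX.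
Qed.

Theorem cic_mpoly : cic {mpoly k[n]}.
Proof.
have [P [iota [y [psi [[_ cP] _ psiC psiX]]]]] := mpoly_tower (leqnn n).
apply: (cic_retract (t := mmap iota y) (f := psi)) cP => p.
by rewrite rmorph_mmap -[RHS]mmap_id; apply: eq_mmap => // i /=; apply: psiX.
Qed.

Theorem nullstellensatz (I : set {mpoly k[n]}) q : is_prime I -> ~ I q ->
  exists v : 'I_n -> k, (forall p, I p -> p.@[v] = 0) /\ q.@[v] != 0.
Proof.
have [P [iota [y [psi [_ hP psiC psiX]]]]] := mpoly_tower (leqnn n).
have psiK p : psi (mmap iota y p) = p.
  by rewrite rmorph_mmap -[RHS]mmap_id; apply: eq_mmap => // i /=; apply: psiX.
move=> pI nq; have iI := prime_ideal pI.
have pJ : is_prime (fun p => I (psi p)).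
  split; first split.
  - by rewrite rmorph0; apply: ideal0.
  - by move=> a b; rewrite rmorphD; apply: idealD.
  - by move=> a b; rewrite rmorphM; apply: idealMl.
  - by rewrite rmorph1; apply: (prime1 pI).
  - by move=> a b; rewrite rmorphM; apply: primeM.
have [|phi [phik phiI phiq]] := hP _ (mmap iota y q) pJ; first by rewrite psiK.
have ev p : phi (mmap iota y p) = p.@[phi \o y].
  by rewrite rmorph_mmap /meval; apply: eq_mmap => // c; apply: phik.
exists (phi \o y); split; last by rewrite -ev.
by move=> p Ip; rewrite -ev; apply: phiI; rewrite psiK.
Qed.

End Mpoly.
End Nullstellensatz.


(** * Values of rational functions, irreducible closed sets, local rings *)

Section RationalValues.
Variables (k : closedFieldType) (X : variety k).
Local Notation XF := (variety_functions X).
Local Notation K := (ratfun X).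
Local Notation cls := (\pi_K)%qT.
Implicit Types (U V Z : set X) (x y : X) (a b : K) (c d : k).

Lemma reg_agree U V W f g : reg U f -> reg V g -> opn W -> W !=set0 ->
  W `<=` U `&` V -> (forall x, W x -> f x = g x) ->
  forall x, U x -> V x -> f x = g x.
Proof.
move=> rf rg oW W0 WUV e x Ux Vx; apply: contrapT => nfg.
have oUV : opn (U `&` V) by apply: (opn_setI XF); apply: (reg_opn XF); eassumption.
have rd : reg (U `&` V) (fun x => f x + -1 * g x).
  apply: (reg_add XF); first by apply: (reg_restrict XF oUV _ rf) => z [].
  by apply: (reg_mul XF); [apply: (reg_cst XF) | apply: (reg_restrict XF oUV _ rg) => z []].
have oN := reg_opn XF (reg_inv XF rd).
have [|z [[_ /= nz] Wz]] := meet_neq0 oN oW _ W0.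
  by exists x; split => //=; rewrite mulN1r subr_eq0; apply/eqP.
by move: nz; rewrite e // mulN1r subrr eqxx.
Qed.

Lemma germ_ex a : exists U f, germ a U f.
Proof. by exists (dom (repr a)), (fn (repr a)), (repr a); split => //; rewrite reprK. Qed.

Lemma germ_reg a U f : germ a U f -> reg U f.
Proof. by move=> [F [_ <- <-]]; apply: fn_reg. Qed.

Lemma germ_neq0 a U f : germ a U f -> U !=set0.
Proof. by move=> [F [_ <- _]]; apply: dom_neq0. Qed.

Lemma reg_germ U f : reg U f -> U !=set0 -> exists a, germ a U f.
Proof. by move=> rf U0; exists (cls (PartialFunction rf U0)), (PartialFunction rf U0). Qed.

Lemma germ_agree a U V f g : germ a U f -> germ a V g ->
  forall x, U x -> V x -> f x = g x.
Proof.
move=> [F [<- <- <-]] [G [/esym/pf_eqP/asboolP[W [oW W0 Wd e]] <- <-]].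
exact: (reg_agree (fn_reg F) (fn_reg G) oW W0 Wd e).
Qed.

Lemma has_value_uniq a x c d : has_value a x c -> has_value a x d -> c = d.
Proof. by move=> [U [f [gf Ux <-]]] [V [g [gg Vx <-]]]; apply: (germ_agree gf gg). Qed.

Lemma reg_atP a x : local_ring [set x] a <-> exists c, has_value a x c.
Proof.
split=> [[U [f [g [y [/= -> Ux]]]]]|[c [U [f [g Ux _]]]]]; first by exists (f x), U, f.
by exists U, f; split => //; exists x.
Qed.

Lemma local_ringP Z a : local_ring Z a <-> exists x c, Z x /\ has_value a x c.
Proof.
split=> [[U [f [g [y [Zy Uy]]]]]|[x [c [Zx [U [f [g Ux _]]]]]]].
  by exists y, (f y); split => //; exists U, f.
by exists U, f; split => //; exists x.
Qed.

Lemma has_value_opn a x c : has_value a x c ->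
  exists U, [/\ opn U, U x & forall y, U y -> exists d, has_value a y d].
Proof.
move=> [U [f [g Ux _]]]; exists U; split => //; first exact: (reg_opn XF (germ_reg g)).
by move=> y Uy; exists (f y), U, f.
Qed.

Lemma has_value_nz a x c : has_value a x c -> c != 0 ->
  exists U, [/\ opn U, U x & forall y, U y -> exists2 d, d != 0 & has_value a y d].
Proof.
move=> [U [f [g Ux <-]]] fx.
exists (U `&` [set y | f y != 0]); split => //.
  exact: (reg_opn XF (reg_inv XF (germ_reg g))).
by move=> y [Uy fy]; exists (f y) => //; exists U, f.
Qed.

Section Op.
Variable op : k -> k -> k.
Hypothesis reg_op : forall U f g,
  reg U f -> reg U g -> reg U (fun x => op (f x) (g x)).
Lemma has_value_op a b x c d : has_value a x c -> has_value b x d ->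
  has_value (rat_op reg_op a b) x (op c d).
Proof.
move=> [U [f [[F [Fa FU Ff]] Ux <-]]] [V [g [[G [Gb GV Gg]] Vx <-]]].
exists (U `&` V), (fun x => op (f x) (g x)); split => //.
by exists (pf_op reg_op F G); rewrite -rat_opE Fa Gb /= FU Ff GV Gg.
Qed.
End Op.

Lemma has_valueD a b x c d : has_value a x c -> has_value b x d -> has_value (a + b) x (c + d).
Proof. exact: has_value_op. Qed.
Lemma has_valueM a b x c d : has_value a x c -> has_value b x d -> has_value (a * b) x (c * d).
Proof. exact: has_value_op. Qed.
Lemma has_valueC c x : has_value (ratC X c) x c.
Proof. by exists setT, (fun=> c); split => //; exists (pf_cst X c). Qed.
Lemma has_value0 x : has_value (0 : K) x 0. Proof. exact: has_valueC. Qed.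
Lemma has_value1 x : has_value (1 : K) x 1. Proof. exact: has_valueC. Qed.
Lemma has_valueN a x c : has_value a x c -> has_value (- a) x (- c).
Proof. by move=> h; rewrite -[- c]mulN1r; apply: has_valueM => //; apply: has_valueC. Qed.
Lemma has_valueB a b x c d : has_value a x c -> has_value b x d -> has_value (a - b) x (c - d).
Proof. by move=> ha hb; apply: has_valueD => //; apply: has_valueN. Qed.
Lemma has_valueX a x c n : has_value a x c -> has_value (a ^+ n) x (c ^+ n).
Proof.
move=> h; elim: n => [|n IH]; first by rewrite !expr0; apply: has_value1.
by rewrite !exprS; apply: has_valueM.
Qed.

Lemma rat_eqI a b U : opn U -> U !=set0 ->
  (forall x, U x -> forall c, has_value a x c -> has_value b x c) -> a = b.
Proof.
move=> oU U0 H.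
have [V [f gf]] := germ_ex a; have [W [g gg]] := germ_ex b.
have [F [Fa FV Ff]] := gf; have [G [Gb GW Gg]] := gg.
have oV := reg_opn XF (germ_reg gf); have oW := reg_opn XF (germ_reg gg).
rewrite -Fa -Gb; apply/pf_eqP/asboolP; exists (V `&` W `&` U); split.
- by apply: (opn_setI XF) => //; apply: (opn_setI XF).
- apply: (meet_neq0 _ oU _ U0); first exact: (opn_setI XF).
  exact: (meet_neq0 oV oW (germ_neq0 gf) (germ_neq0 gg)).
- by rewrite FV GW => x [].
- move=> x [[Vx Wx] Ux]; rewrite Ff Gg.
  have ha : has_value a x (f x) by exists V, f.
  by apply: (has_value_uniq (H x Ux _ ha)); exists W, g.
Qed.

Lemma has_value_neq0 a x c : has_value a x c -> c != 0 -> a != 0.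
Proof.
by move=> h; apply: contraNneq => a0; apply/eqP; apply: (has_value_uniq h); rewrite a0; apply: has_value0.
Qed.

Lemma has_valueV a x c : has_value a x c -> c != 0 -> has_value a^-1 x c^-1.
Proof.
move=> [U [f [gf Ux <-]]] fx0; have rf := germ_reg gf.
have [|b gb] := reg_germ (reg_inv XF rf); first by exists x.
have -> : a^-1 = b.
  apply/esym/(mulfI (x := a)); first by apply: (@has_value_neq0 a x (f x)) => //; exists U, f.
  rewrite divff; last by apply: (@has_value_neq0 a x (f x)) => //; exists U, f.
  apply: (rat_eqI (U := U `&` [set y | f y != 0])).
  - exact: (reg_opn XF (germ_reg gb)).
  - by exists x.
  - move=> y [Uy /= fy] e he.
    have h : has_value (a * b) y (f y * (f y)^-1).
      by apply: has_valueM; [exists U, f | exists (U `&` [set y | f y != 0]), (fun y => (f y)^-1)].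
    by rewrite (has_value_uniq he h) divff //; apply: has_value1.
by exists (U `&` [set y | f y != 0]), (fun y => (f y)^-1).
Qed.

Lemma has_value_meet a U : opn U -> U !=set0 -> exists x c, U x /\ has_value a x c.
Proof.
move=> oU U0; have [V [f gf]] := germ_ex a.
have [x [Ux Vx]] := meet_neq0 oU (reg_opn XF (germ_reg gf)) U0 (germ_neq0 gf).
by exists x, (f x); split => //; exists V, f.
Qed.

Lemma has_value_meet2 a b U : opn U -> U !=set0 ->
  exists x c d, [/\ U x, has_value a x c & has_value b x d].
Proof.
move=> oU U0; have [V [f gf]] := germ_ex a; have oV := reg_opn XF (germ_reg gf).
have [||x [d [[Ux Vx] hb]]] := @has_value_meet b (U `&` V).
- exact: (opn_setI XF).
- exact: (meet_neq0 oU oV U0 (germ_neq0 gf)).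
by exists x, (f x), d; split => //; exists V, f.
Qed.

Lemma ratC_is_additive : {morph ratC X : c d / c - d}.
Proof.
move=> c d; apply: (@rat_eqI _ _ setT); first exact: (opn_setT XF).
  exact: (variety_irreducible X).1.
move=> x _ e he; rewrite (has_value_uniq he (has_valueC _ x)).
by apply: has_valueB; apply: has_valueC.
Qed.
Lemma ratC_is_multiplicative : multiplicative (ratC X).
Proof.
split=> // c d; apply: (@rat_eqI _ _ setT); first exact: (opn_setT XF).
  exact: (variety_irreducible X).1.
move=> x _ e he; rewrite (has_value_uniq he (has_valueC _ x)).
by apply: has_valueM; apply: has_valueC.
Qed.
HB.instance Definition _ := GRing.isAdditive.Build k K (ratC X) ratC_is_additive.
HB.instance Definition _ := GRing.isMultiplicative.Build k K (ratC X) ratC_is_multiplicative.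

(** * Irreducible closed subsets *)

Definition cl Z : set X := [set y | forall V, opn V -> V y -> Z `&` V !=set0].

Lemma cl_sub Z : Z `<=` cl Z. Proof. by move=> x Zx V _ Vx; exists x. Qed.

Lemma cl_closed Z : closed_set (cl Z).
Proof.
rewrite /closed_set; pose F : set (set X) := [set V | opn V /\ Z `&` V = set0].
rewrite (_ : ~` cl Z = \bigcup_(V in F) V); first by apply: (opn_bigcup XF) => V [].
apply/seteqP; split => [x nx|x [V [oV ZV] Vx] cx].
  apply: contrapT => H; apply: nx => V oV Vx; apply/set0P/eqP => ZV.
  by apply: H; exists V.
by have := cx V oV Vx; rewrite ZV => -[].
Qed.

Lemma cl_min Z W : closed_set W -> Z `<=` W -> cl Z `<=` W.
Proof.
move=> cW ZW x cx; apply: contrapT => nW; have [y [Zy]] := cx _ cW nW.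
by apply; apply: ZW.
Qed.

Lemma cl_meet Z V : opn V -> cl Z `&` V !=set0 -> Z `&` V !=set0.
Proof. by move=> oV [x [cx Vx]]; apply: cx. Qed.

Lemma cl_irreducible Z : irreducible_set Z -> irreducible_set (cl Z).
Proof.
move=> [[x Zx] H]; split; first by exists x; apply: cl_sub.
move=> U V oU oV /(cl_meet oU) ZU /(cl_meet oV) ZV.
have [y [[Zy Uy] Vy]] := H U V oU oV ZU ZV.
by exists y; split => //; split => //; apply: cl_sub.
Qed.

Lemma cl_irreducible_meet Z U : closed_set Z -> irreducible_set Z -> opn U ->
  Z `&` U !=set0 -> cl (Z `&` U) = Z.
Proof.
move=> cZ [_ iZ] oU ZU; apply/seteqP; split; first by apply: cl_min => // x [].
move=> x Zx V oV Vx; have [|y [[Zy Uy] Vy]] := iZ U V oU oV ZU; first by exists x.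
by exists y.
Qed.

Lemma irreducible_meet Z U : irreducible_set Z -> opn U -> Z `&` U !=set0 ->
  irreducible_set (Z `&` U).
Proof.
move=> [_ iZ] oU ZU; split => // V W oV oW [x [[Zx Ux] Vx]] [y [[Zy Uy] Wy]].
have [||||z [[Zz [Uz Vz]] [_ Wz]]] := iZ (U `&` V) (U `&` W).
- exact: (opn_setI XF).
- exact: (opn_setI XF).
- by exists x.
- by exists y.
by exists z.
Qed.

Lemma setDclosed Z U : closed_set Z -> opn U -> closed_set (Z `\` U).
Proof.
move=> cZ oU; rewrite /closed_set.
rewrite (_ : ~` (Z `\` U) = \bigcup_(V in [set ~` Z; U]) V).
  by apply: (opn_bigcup XF) => V [->|->].
apply/seteqP; split => [x nx|x [V [->|->] Vx] [] //].
by case: (pselect (Z x)) => Zx; [exists U; [right|apply: contrapT => nU; apply: nx] |exists (~` Z); [left|]].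
Qed.

Lemma opn_compl Z : closed_set Z -> opn (~` Z). Proof. by []. Qed.

Lemma irreducible_cover (Z : set X) (L : seq (set X)) : irreducible_set Z ->
  (forall W, List.In W L -> closed_set W) ->
  (forall x, Z x -> exists W, List.In W L /\ W x) -> exists W, List.In W L /\ Z `<=` W.
Proof.
move=> [[x0 Zx0] iZ] cL H; apply: contrapT => nW.
suff : exists V, [/\ opn V, Z `&` V !=set0 & forall x, V x -> ~ exists W, List.In W L /\ W x].
  by move=> [V [_ [x [Zx Vx]] nV]]; apply: (nV x Vx); apply: H.
have {}nW : forall W, List.In W L -> ~ Z `<=` W by move=> W WL ZW; apply: nW; exists W.
elim: L cL nW {H} => [|W L IH] cL nW.
  exists setT; split; [exact: (opn_setT XF) | by exists x0 | by move=> x _ [W []]].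
have [V [oV ZV nV]] := IH (fun W WL => cL W (or_intror WL)) (fun W WL => nW W (or_intror WL)).
exists (V `&` ~` W); have oW : opn (~` W) by apply: cL; left.
split; first exact: (opn_setI XF).
  rewrite setIA; apply: iZ => //; apply: contrapT => H; apply: (nW W); first by left.
  by move=> x Zx; apply: contrapT => nx; apply: H; exists x.
by move=> x [Vx Wx] [W' [[<-//|W'L] W'x]]; apply: (nV x Vx); exists W'.
Qed.

(** * The local ring along an irreducible closed subset *)
Section LocalRing.
Variables (P : set X) (irrP : irreducible_set P).

Lemma local_maxP a : local_max P a <->
  local_ring P a /\ forall x c, P x -> has_value a x c -> c = 0.
Proof.
split=> [[U [f [gf PU H]]]|[[U [f [gf PU]]] H]]; last first.
  by exists U, f; split => // x Px Ux; apply: (H x) => //; exists U, f.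
split; first by exists U, f.
move=> x c Px hx; apply/eqP/negPn/negP => c0.
have [V [oV Vx HV]] := has_value_nz hx c0.
have [|z [[Pz Uz] Vz]] := irrP.2 U V (reg_opn XF (germ_reg gf)) oV PU.
  by exists x.
have [d d0 hd] := HV z Vz; have hf : has_value a z (f z) by exists U, f.
by move: d0; rewrite (has_value_uniq hd hf) H // eqxx.
Qed.

Lemma local_max_ring a : local_max P a -> local_ring P a.
Proof. by move=> /local_maxP []. Qed.

Lemma local_ring2 a b : local_ring P a -> local_ring P b ->
  exists x c d, [/\ P x, has_value a x c & has_value b x d].
Proof.
move=> /local_ringP [x [c [Px ha]]] /local_ringP [y [d [Py hb]]].
have [U [oU Ux HU]] := has_value_opn ha; have [V [oV Vy HV]] := has_value_opn hb.
have [||z [[Pz Uz] Vz]] := irrP.2 U V oU oV; [by exists x | by exists y|].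
by have [e he] := HU z Uz; have [e' he'] := HV z Vz; exists z, e, e'.
Qed.

Lemma local_ringD a b : local_ring P a -> local_ring P b -> local_ring P (a + b).
Proof.
move=> ha hb; have [x [c [d [Px hc hd]]]] := local_ring2 ha hb.
by apply/local_ringP; exists x, (c + d); split => //; apply: has_valueD.
Qed.

Lemma local_ringM a b : local_ring P a -> local_ring P b -> local_ring P (a * b).
Proof.
move=> ha hb; have [x [c [d [Px hc hd]]]] := local_ring2 ha hb.
by apply/local_ringP; exists x, (c * d); split => //; apply: has_valueM.
Qed.

Lemma local_ringC c : local_ring P (ratC X c).
Proof. by have [x Px] := irrP.1; apply/local_ringP; exists x, c; split => //; apply: has_valueC. Qed.

Lemma local_ring1 : local_ring P 1. Proof. exact: (local_ringC 1). Qed.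

Lemma local_ringN a : local_ring P a -> local_ring P (- a).
Proof. by move=> h; apply: local_ringM => //; apply: local_ringC. Qed.

Lemma local_ringX a n : local_ring P a -> local_ring P (a ^+ n).
Proof.
move=> h; elim: n => [|n IH]; first by rewrite expr0; apply: local_ring1.
by rewrite exprS; apply: local_ringM.
Qed.

Lemma local_ring_sum (I : Type) (r : seq I) (Q : pred I) (F : I -> K) :
  (forall i, Q i -> local_ring P (F i)) -> local_ring P (\sum_(i <- r | Q i) F i).
Proof.
by move=> H; apply: big_ind => //; [apply: (local_ringC 0) | move=> *; apply: local_ringD].
Qed.

Lemma local_maxPn a : local_ring P a -> ~ local_max P a ->
  exists x c, [/\ P x, has_value a x c & c != 0].
Proof.
move=> ha nm; apply: contrapT => H; apply: nm; apply/local_maxP; split => // x c Px hx.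
by apply/eqP/negPn/negP => c0; apply: H; exists x, c.
Qed.

Lemma local_max_value a x c : local_max P a -> P x -> has_value a x c -> c = 0.
Proof. by move=> /local_maxP [_ H]; apply: H. Qed.

Lemma local_unit a : local_ring P a -> ~ local_max P a ->
  [/\ a != 0, local_ring P a^-1 & ~ local_max P a^-1].
Proof.
move=> ha nm; have [x [c [Px hx c0]]] := local_maxPn ha nm.
have hV := has_valueV hx c0; split; first exact: has_value_neq0 hx c0.
  by apply/local_ringP; exists x, c^-1.
by move=> mV; have := local_max_value mV Px hV => /eqP; rewrite invr_eq0 (negPf c0).
Qed.

Lemma local_unitI a x c : P x -> has_value a x c -> c != 0 -> local_ring P a /\ ~ local_max P a.
Proof.
move=> Px hx c0; split; first by apply/local_ringP; exists x, c.
by move=> m; have := local_max_value m Px hx => /eqP; rewrite (negPf c0).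
Qed.

Lemma local_maxMr a b : local_max P a -> local_ring P b -> local_max P (a * b).
Proof.
move=> ma hb; have ha := local_max_ring ma.
apply/local_maxP; split; first exact: local_ringM.
move=> x c Px hx; apply/eqP/negPn/negP => c0.
have [U [oU Ux HU]] := has_value_nz hx c0.
have [y [d [e [Py hd he]]]] := local_ring2 ha hb.
have [V [oV Vy HV]] := has_value_opn hd; have [W [oW Wy HW]] := has_value_opn he.
have [|||z [[Pz Uz] [Vz Wz]]] := irrP.2 U (V `&` W) oU.
- exact: (opn_setI XF).
- by exists x.
- by exists y.
have [d' hd'] := HV z Vz; have [e' he'] := HW z Wz; have [f f0 hf] := HU z Uz.
move: f0; rewrite (has_value_uniq hf (has_valueM hd' he')).
by rewrite (local_max_value ma Pz hd') mul0r eqxx.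
Qed.

Lemma local_unitM a b : local_ring P a -> ~ local_max P a -> local_ring P b ->
  ~ local_max P b -> local_ring P (a * b) /\ ~ local_max P (a * b).
Proof.
move=> ha na hb nb; split; first exact: local_ringM.
have [a0 hV _] := local_unit ha na.
by move=> m; apply: nb; rewrite -[b](mulKf a0) mulrC; apply: local_maxMr.
Qed.

Lemma local_max_prime a b : local_ring P a -> local_ring P b ->
  local_max P (a * b) -> local_max P a \/ local_max P b.
Proof.
move=> ha hb m; case: (pselect (local_max P a)) => [|na]; [by left | right].
by apply: contrapT => nb; have [_] := local_unitM ha na hb nb.
Qed.

End LocalRing.
End RationalValues.


(** * Affine charts in coordinates *)

Section Charts.
Variables (k : closedFieldType) (X : variety k).
Local Notation XF := (variety_functions X).
Local Notation K := (ratfun X).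

(** An affine open subset expressed by functions on [X] itself, which avoids the subspace type.
    [chart_null] says that the image of the coordinate map is Zariski closed, so points found by the
    Nullstellensatz lie on [X]. *)
Record chart := Chart {
  chart_set :> X -> Prop;
  chart_dim : nat;
  chart_coord : X -> 'I_chart_dim -> k;
  chart_opn : opn chart_set;
  chart_basis : forall V x, opn V -> V x -> chart_set x ->
    exists q : {mpoly k[chart_dim]}, q.@[chart_coord x] != 0 /\
      forall y, chart_set y -> q.@[chart_coord y] != 0 -> V y;
  chart_poly : forall p : {mpoly k[chart_dim]},
    reg chart_set (fun y => p.@[chart_coord y]);
  chart_frac : forall V f x, reg V f -> V x -> chart_set x ->
    exists p q : {mpoly k[chart_dim]}, q.@[chart_coord x] != 0 /\
      forall y, chart_set y -> q.@[chart_coord y] != 0 ->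
        V y /\ f y = p.@[chart_coord y] / q.@[chart_coord y];
  chart_null : forall v, (forall p : {mpoly k[chart_dim]},
      (forall y, chart_set y -> p.@[chart_coord y] = 0) -> p.@[v] = 0) ->
    exists2 y, chart_set y & chart_coord y = v }.

Arguments chart_poly : clear implicits.
Arguments chart_coord : clear implicits.

Lemma affine_chart (U : set X) : opn U -> affine (open_subspace U) ->
  exists C : chart, chart_set C = U.
Proof.
move=> oU [n [e [_ [S HS] eo er]]].
(* The coordinates are extended by 0 outside [U], where their values do not matter. *)
pose e' x i := if pselect (U x) is left h then e (exist _ x h) i else 0.
have eE x (h : U x) : e' x = e (exist _ x h).
  by apply: funext => i; rewrite /e'; case: pselect => // h'; rewrite (Prop_irrelevance h h').
have imE (V : set X) : V `<=` U -> (@sval X U @` (@sval X U @^-1` V)) = V.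
  move=> VU; apply/seteqP; split => [x [[y Uy] Vy <-]//|x Vx].
  by exists (exist _ x (VU x Vx)).
unshelve eexists; [refine (@Chart U n e' oU _ _ _ _) | by []].
- move=> V x oV Vx Ux.
  have : @opn _ (open_subspace U) (@sval X U @^-1` V).
    rewrite /= (_ : _ @` _ = V `&` U); first exact: (opn_setI XF).
    apply/seteqP; split => [y [[z Uz] Vz <-]//|y [Vy Uy]].
    by exists (exist _ y Uy).
  rewrite eo => /(_ (exist _ x Ux) Vx) [p [px Hp]]; exists p; rewrite eE; split => // y Uy.
  by rewrite (eE y Uy) => /Hp.
- move=> p; have : @reg _ (open_subspace U) setT (fun y => p.@[e y]).
    rewrite er => x _; exists p, 1; rewrite meval1 oner_neq0; split => // y _.
    by rewrite meval1 divr1.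
  move=> [F rF FE].
  have : reg U F.
    by rewrite -(imE U) //; congr (reg _ F) : rF; congr image; apply/seteqP; split => // -[].
  by apply: (reg_ext XF) => x Ux; rewrite (eE x Ux) FE.
- move=> V f x rf Vx Ux.
  have : @reg _ (open_subspace U) (@sval X U @^-1` V) (fun y => f (sval y)).
    exists f => //; apply: (reg_restrict XF _ _ rf) => [|y [[z Uz] Vz <-]//].
    rewrite (_ : _ @` _ = V `&` U); first by apply: (opn_setI XF) => //; apply: (reg_opn XF rf).
    apply/seteqP; split => [y [[z Uz] Vz <-]//|y [Vy Uy]].
    by exists (exist _ y Uy).
  rewrite er => /(_ (exist _ x Ux) Vx) [p [q [qx Hq]]]; exists p, q; rewrite eE; split => // y Uy.
  by rewrite (eE y Uy) => /Hq.
- move=> v Hv; have : range e v.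
    rewrite HS => p Sp; apply: Hv => y Uy; rewrite (eE y Uy).
    have : range e (e (exist _ y Uy)) by exists (exist _ y Uy).
    by rewrite HS; apply.
  by move=> [[y Uy] _ <-]; exists y => //; rewrite eE.
Qed.

Lemma chart_cover : exists m (C : 'I_m -> chart), forall x, exists i, C i x.
Proof.
have [m [U [oU aU cU]]] := variety_finite_type X.
have [C HC] := choice (fun i => affine_chart (oU i) (aU i)).
by exists m, C => x; have [i Ui] := cU x; exists i; rewrite HC.
Qed.

Lemma chart_at x : exists C : chart, C x.
Proof. by have [m [C H]] := chart_cover; have [i Ci] := H x; exists (C i). Qed.

Section InChart.
Variables (C : chart) (x0 : X) (Cx0 : C x0).
Local Notation R := {mpoly k[chart_dim C]}.
Local Notation ev p y := (meval (chart_coord C y) p).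

(* [x0] witnesses that the chart is nonempty, so that polynomials have germs. *)
Definition kap (p : R) : K :=
  \pi_K%qT (PartialFunction (chart_poly C p) (ex_intro _ x0 Cx0)).
Local Notation kp := kap.

Lemma kap_value p y : C y -> has_value (kp p) y (ev p y).
Proof.
move=> Cy; exists (chart_set C), (fun y => ev p y); split => //.
by exists (PartialFunction (chart_poly C p) (ex_intro _ x0 Cx0)).
Qed.

Lemma chart_eqI a b : (forall y c, C y -> has_value a y c -> has_value b y c) -> a = b.
Proof.
move=> H; apply: (rat_eqI (U := chart_set C)); first exact: chart_opn.
  by exists x0.
by move=> y Cy c; apply: H.
Qed.

Lemma kap_is_additive : {morph kp : p q / p - q}.
Proof.
move=> p q; apply: chart_eqI => y c Cy h; rewrite (has_value_uniq h (kap_value _ Cy)).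
by rewrite mevalB; apply: has_valueB; apply: kap_value.
Qed.
Lemma kap_is_multiplicative : multiplicative kp.
Proof.
split=> [p q|]; apply: chart_eqI => y c Cy h; rewrite (has_value_uniq h (kap_value _ Cy)).
  by rewrite mevalM; apply: has_valueM; apply: kap_value.
by rewrite meval1; apply: has_value1.
Qed.
HB.instance Definition _ := GRing.isAdditive.Build R K kap kap_is_additive.
HB.instance Definition _ := GRing.isMultiplicative.Build R K kap kap_is_multiplicative.

Lemma kap_neq0 p y : C y -> ev p y != 0 -> kp p != 0.
Proof. by move=> Cy; apply: has_value_neq0; apply: kap_value. Qed.

Lemma kap_eq0P p : kp p = 0 <-> forall y, C y -> ev p y = 0.
Proof.
split=> [p0 y Cy|H]; last first.
  apply: chart_eqI => y c Cy h; rewrite (has_value_uniq h (kap_value _ Cy)) H //.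
  exact: has_value0.
by apply/eqP/negPn/negP => n0; have := kap_neq0 Cy n0; rewrite p0 eqxx.
Qed.

Lemma value_frac a y c : C y -> has_value a y c ->
  exists p q, [/\ ev q y != 0, kp q != 0 & a * kp q = kp p].
Proof.
move=> Cy [V [f [gf Vy _]]]; have [p [q [qy H]]] := chart_frac (germ_reg gf) Vy Cy.
exists p, q; split => //; first exact: kap_neq0 qy.
apply: (rat_eqI (U := chart_set C `&` [set y | ev q y != 0])).
- exact: (reg_opn XF (reg_inv XF (chart_poly C q))).
- by exists y.
- move=> z [Cz /= qz] d hd; have [Vz fz] := H z Cz qz.
  have hf : has_value a z (f z) by exists V, f.
  rewrite (has_value_uniq hd (has_valueM hf (kap_value q Cz))) fz divfK //.
  exact: kap_value.
Qed.

Lemma frac_value a y p q : C y -> ev q y != 0 -> a * kp q = kp p ->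
  has_value a y (ev p y / ev q y).
Proof.
move=> Cy qy E; rewrite -[a](mulfK (kap_neq0 Cy qy)) E.
by apply: has_valueM; [apply: kap_value | apply: has_valueV => //; apply: kap_value].
Qed.

Lemma rat_frac a : exists p q, kp q != 0 /\ a * kp q = kp p.
Proof.
have [||y [c [Cy h]]] := @has_value_meet _ _ a (chart_set C); first exact: chart_opn.
  by exists x0.
by have [p [q [_ q0 E]]] := value_frac Cy h; exists p, q.
Qed.

(** The prime ideal of an irreducible closed subset which meets the chart. *)
Section IdealOf.
Variables (P : set X) (irrP : irreducible_set P) (PC : P `&` chart_set C !=set0).

Definition ideal_of : set R :=
  [set p : R | forall y, P y -> C y -> ev p y = 0].
Local Notation I := (ideal_of).

Lemma chart_prime : is_prime I.
Proof.
split; first split.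
- by move=> y _ _; rewrite meval0.
- by move=> p q Ip Iq y Py Cy; rewrite mevalD Ip // Iq // addr0.
- by move=> r p Ip y Py Cy; rewrite mevalM Ip // mulr0.
- move=> I1; have [y [Py Cy]] := PC; have := I1 y Py Cy.
  by rewrite meval1 => /eqP; rewrite oner_eq0.
move=> p q Ipq; case: (pselect (I p)) => [|np]; [by left | right => y Py Cy].
apply/eqP/negPn/negP => qy; apply: np => z Pz Cz; apply/eqP/negPn/negP => pz.
have op (r : R) : opn (chart_set C `&` [set y | ev r y != 0]).
  exact: (reg_opn XF (reg_inv XF (chart_poly C r))).
have [||w [[Pw [Cw pw]] [_ qw]]] := irrP.2 _ _ (op p) (op q); first by exists z.
  by exists y.
by have := Ipq w Pw Cw; rewrite mevalM => /eqP; rewrite mulf_eq0 (negPf pw) (negPf qw).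
Qed.

Lemma not_ideal_of q : ~ I q -> exists y, [/\ P y, C y & ev q y != 0].
Proof.
move=> nq; apply: contrapT => H; apply: nq => y Py Cy.
by apply/eqP/negPn/negP => qy; apply: H; exists y.
Qed.

Lemma ideal_of_kap0 p : kp p = 0 -> I p.
Proof. by move=> /kap_eq0P H y _ Cy; apply: H. Qed.

Lemma local_ring_frac a : local_ring P a <-> exists p q, ~ I q /\ a * kp q = kp p.
Proof.
split=> [/local_ringP [x [c [Px h]]]|[p [q [/not_ideal_of [y [Py Cy qy]] E]]]].
  have [U [oU Ux HU]] := has_value_opn h.
  have [||y [[Py Uy] Cy]] := irrP.2 U (chart_set C) oU (chart_opn C) => //; first by exists x.
  have [d hd] := HU y Uy; have [p [q [qy _ E]]] := value_frac Cy hd.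
  by exists p, q; split => // /(_ y Py Cy) q0; rewrite q0 eqxx in qy.
by apply/local_ringP; exists y, (ev p y / ev q y); split => //; apply: frac_value.
Qed.

Lemma kap_local_ring p : local_ring P (kp p).
Proof.
by apply/local_ring_frac; exists p, 1; rewrite rmorph1 mulr1; split => //; apply: prime1 chart_prime.
Qed.

Lemma kap_local_max p : local_max P (kp p) <-> I p.
Proof.
split=> [m y Py Cy|Ip]; first exact: (local_max_value irrP m Py (kap_value p Cy)).
exists (chart_set C), (fun y => ev p y); split; [|done|by move=> x Px Cx; apply: Ip].
by exists (PartialFunction (chart_poly C p) (ex_intro _ x0 Cx0)).
Qed.

Lemma local_max_frac a : local_max P a <-> exists p q, [/\ ~ I q, I p & a * kp q = kp p].
Proof.
split=> [m|[p [q [nq Ip E]]]].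
  have /local_ring_frac [p [q [nq E]]] := local_max_ring irrP m.
  exists p, q; split => //; apply/kap_local_max; rewrite -E.
  by apply: local_maxMr => //; apply: kap_local_ring.
have [q0 qr _] : [/\ kp q != 0, local_ring P (kp q)^-1 & ~ local_max P (kp q)^-1].
  by apply: local_unit => //; [apply: kap_local_ring | move/kap_local_max].
by rewrite -[a](mulfK q0) E; apply: local_maxMr => //; apply/kap_local_max.
Qed.

End IdealOf.
End InChart.
End Charts.

Arguments chart_poly {k X} c p.
Arguments chart_coord {k X} c x i.


(** * Prime divisors on a normal variety: valuations, finiteness, Hartogs *)

Lemma exprz_unit_eq (F : fieldType) (u w t : F) (m m' : int) : t != 0 -> w != 0 ->
  u * t ^ m = w * t ^ m' -> u * w^-1 = t ^ (m' - m).
Proof.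
move=> t0 w0 E; apply: (mulIf w0); rewrite divfK //; apply: (mulIf (expfz_neq0 m t0)).
by rewrite E mulrAC -expfzDr // subrK mulrC.
Qed.

Lemma exprz_mulA (F : fieldType) (x y z : F) (m : int) : x * (y * z) ^ m = x * y ^ m * z ^ m.
Proof. by rewrite expfzMl mulrA. Qed.

Section Divisors.
Variables (k : closedFieldType) (X : variety k).
Hypothesis nX : normal_variety X.
Local Notation XF := (variety_functions X).
Local Notation K := (ratfun X).

Section Uniformizers.
Variables (P : set X) (irrP : irreducible_set P) (t : K).
Hypotheses (tm : local_max P t)
  (tgen : forall a, local_max P a -> exists2 b, local_ring P b & a = b * t).

Lemma uniformizer_neq0 a : local_max P a -> a != 0 -> t != 0.
Proof. by move=> /tgen [b _ ->]; apply: contraNneq => ->; rewrite mulr0. Qed.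

(* Krull's intersection theorem: an element divisible by all powers of [t] would give
   an infinite strictly increasing chain of ideals. *)
Lemma dvr_factor_nat a : local_ring P a -> a != 0 ->
  exists u m, [/\ local_ring P u, ~ local_max P u & a = u * t ^+ m].
Proof.
move=> ha a0; apply: contrapT => nf.
have [x Px] := irrP.1; have [C Cx] := chart_at x.
have PC : P `&` chart_set C !=set0 by exists x.
have step (b : {b | local_max P b}) : exists c, (exists m, a = sval b * t ^+ m) ->
    local_max P c /\ sval b = c * t.
  case: b => b mb; case: (pselect (exists m, a = b * t ^+ m)) => [[m E]|]; last by exists 0.
  have [c hc E'] := tgen mb; exists c => _; split => //.
  apply: contrapT => nc; apply: nf; exists c, m.+1; split => //.
  by rewrite E E' exprS mulrA.
have [next Hn] := choice step.
have ma : local_max P a.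
  by apply: contrapT => na; apply: nf; exists a, 0%N; rewrite mulr1.
pose nx (b : {b | local_max P b}) : {b | local_max P b} :=
  if pselect (local_max P (next b)) is left h then exist _ (next b) h else b.
pose y n := iter n nx (exist _ a ma).
have yE n : a = sval (y n) * t ^+ n.
  elim: n => [|n IH]; first by rewrite mulr1.
  have [mc E] := Hn (y n) (ex_intro _ n IH).
  rewrite /= /nx; case: pselect => //= _.
  by rewrite {1}IH -/(y n) {1}E exprS mulrA.
have yS n : sval (y n) = sval (y n.+1) * t.
  have [mc E] := Hn (y n) (ex_intro _ n (yE n)).
  by rewrite /= [in RHS]/nx -/(y n); case: pselect.
clearbody y.
have yD n d : sval (y n) = sval (y (n + d)%N) * t ^+ d.
  elim: d => [|d IH]; first by rewrite addn0 mulr1.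
  by rewrite IH yS exprS mulrA addnS.
have y0 n : sval (y n) != 0 by apply: contraNneq a0 => E; rewrite (yE n) E mul0r.
have fr n : exists pq, ~ ideal_of (C := C) P pq.2 /\ sval (y n) * kap Cx pq.2 = kap Cx pq.1.
  have /(local_ring_frac Cx irrP PC) [p [q H]] := local_max_ring irrP (svalP (y n)).
  by exists (p, q).
have [pq Hpq] := choice fr.
have [n [r]] := noetherian_sequence (fun n => (pq n).1) (@noetherian_mpoly k _).
rewrite size_mkseq => E.
have [nq En] := Hpq n.
apply: nq; apply/(kap_local_max Cx irrP PC).
(* Write [y n] as the fraction [p_n / q_n]. The relation expresses [p_n] through the earlier
   [p_i = y i * q_i], and [y i] is [y n] times [t ^+ (n - i)]. Dividing by [y n] makes [q_n]
   divisible by [t], although [q_n] does not vanish on [P]. *)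
have -> : kap Cx (pq n).2 =
    t * \sum_(i < n) kap Cx (r i * (pq i).2) * t ^+ (n - i.+1).
  apply: (mulfI (y0 n)); rewrite En E rmorph_sum !mulr_sumr; apply: eq_bigr => i _.
  rewrite nth_mkseq // !rmorphM /= -(Hpq i).2.
  rewrite (yD i (n - i)%N).
  have -> : (i + (n - i))%N = n by rewrite subnKC // ltnW.
  rewrite (_ : (n - i = (n - i.+1).+1)%N); last by have := ltn_ord i; lia.
  by rewrite exprS; ring.
apply: local_maxMr => //; apply: local_ring_sum => // i _.
apply: local_ringM => //; first exact: (kap_local_ring Cx irrP PC).
by apply: local_ringX => //; apply: local_max_ring.
Qed.

Lemma dvr_factor a : a != 0 ->
  exists u (m : int), [/\ local_ring P u, ~ local_max P u & a = u * t ^ m].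
Proof.
move=> a0; have [x Px] := irrP.1; have [C Cx] := chart_at x.
have PC : P `&` chart_set C !=set0 by exists x.
have [p [q [q0 E]]] := rat_frac Cx a.
have p0 : kap Cx p != 0 by rewrite -E mulf_neq0.
have [u [m [hu nu Eu]]] := dvr_factor_nat (kap_local_ring Cx irrP PC p) p0.
have [v [n [hv nv Ev]]] := dvr_factor_nat (kap_local_ring Cx irrP PC q) q0.
have [v0 vV nvV] := local_unit irrP hv nv.
have [uvr uvm] := local_unitM irrP hu nu vV nvV.
(* If [t] is zero, so is the maximal ideal, and only the exponent 0 can occur. *)
have [t0|t0] := eqVneq t 0.
  case: m n Eu Ev => [|m] [|n] Eu Ev.
  - exists (u / v), 0; split => //; rewrite expr0z mulr1 -(mulfK q0 a) E Eu Ev.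
    by rewrite !mulr1.
  - by move: q0; rewrite Ev t0 exprS mul0r mulr0 eqxx.
  - by move: p0; rewrite Eu t0 exprS mul0r mulr0 eqxx.
  - by move: p0; rewrite Eu t0 exprS mul0r mulr0 eqxx.
exists (u / v), (m%:Z - n%:Z); split => //.
rewrite -(mulfK q0 a) E Eu Ev invfM expfzDr // exprnN -!exprnP; ring.
Qed.

Lemma local_max_exprz (m : int) : t != 0 -> 0 < m -> local_max P (t ^ m).
Proof.
case: m => // -[|m] // t0 _; rewrite -exprnP exprS; apply: local_maxMr => //.
by apply: local_ringX => //; apply: local_max_ring.
Qed.

End Uniformizers.

Local Notation ev y p := (meval (chart_coord _ y) p).

(** Among the denominator ideals of the multiples [a c] that vanish at [x], a maximal one [I] is
    prime; put [b = a c]. If [b I] stayed in the ideal of [P], [b] would be integral and hence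
    regular at [x] by normality. So [b] times some element of [I] is a unit along the closure [P] of
    the zero set of [I], and [b^-1] is a uniformizer there. *)
Lemma pole_divisor x (a : K) : ~ local_ring [set x] a ->
  exists (P : prime_divisor X) t, [/\ pd_set P x, uniformizer P t & ~ local_ring P a].
Proof.
move=> na; have [C Cx] := chart_at x.
pose den (b : K) : set {mpoly k[chart_dim C]} := fun q => exists p, b * (kap Cx) q = (kap Cx) p.
have denI b : is_ideal (den b).
  split.
  - by exists 0; rewrite !rmorph0 mulr0.
  - by move=> p q [p' Hp] [q' Hq]; exists (p' + q'); rewrite !rmorphD mulrDr Hp Hq.
  - by move=> r p [p' Hp]; exists (r * p'); rewrite !rmorphM mulrCA Hp.
pose F : set (set {mpoly k[chart_dim C]}) :=
  fun I => exists c, I = den (a * (kap Cx) c) /\ forall q, I q -> ev x q = 0.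
have [||I [[c [IE Ix]] Imax]] := @noetherian_maximal _ F (@noetherian_mpoly k _).
- by move=> I [c [-> _]].
- exists (den (a * (kap Cx) 1)), 1; split => // q [p E]; apply/eqP/negPn/negP => qx; apply: na.
  apply/reg_atP; exists (ev x p / ev x q); apply: (frac_value (Cx0 := Cx) Cx qx).
  by rewrite -E rmorph1 mulr1.
pose b := a * (kap Cx) c; have Idef q : I q <-> den b q by rewrite IE.
have iI : is_ideal I by rewrite IE.
have I1 : ~ I 1 by move=> /Ix; rewrite meval1 => /eqP; rewrite oner_eq0.
have pI : is_prime I.
  split => // s t Ist; case: (pselect (I s)) => [|ns]; [by left | right].
  have sub (u : {mpoly k[chart_dim C]}) q : I q -> den (a * (kap Cx) (c * u)) q.
    by move=> /Idef [p E]; exists (p * u); rewrite !rmorphM mulrA mulrAC E.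
  have dM u q : den (a * (kap Cx) (c * u)) q -> I (u * q).
    by move=> [p E]; apply/Idef; exists p; rewrite rmorphM !mulrA -E rmorphM mulrA.
  have Md u q : I (u * q) -> den (a * (kap Cx) (c * u)) q.
    by move=> /Idef [p E]; exists p; rewrite -E !rmorphM /b !mulrA.
  case: (pselect (forall q, den (a * (kap Cx) (c * s)) q -> ev x q = 0)) => [H|H].
    apply: (Imax (den (a * (kap Cx) (c * s)))); [by exists (c * s) | exact: sub | exact: Md].
  have [q [dq qx]] : exists q, den (a * (kap Cx) (c * s)) q /\ ev x q <> 0.
    by apply: contrapT => H'; apply: H => q dq; apply: contrapT => qx; apply: H'; exists q.
  case: ns; apply: (Imax (den (a * (kap Cx) (c * q)))).
  - exists (c * q); split => // q' /dM /Ix /eqP; rewrite mevalM mulf_eq0.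
    by case/orP => /eqP // H0; case: qx.
  - exact: sub.
  - by apply: Md; rewrite mulrC; apply: dM.
have kI p : (kap Cx) p = 0 -> I p.
  by move=> p0; apply/Idef; exists 0; rewrite p0 mulr0 rmorph0.
pose Z : set X := fun y => C y /\ forall p, I p -> ev y p = 0.
have Zx : Z x by split.
(* The Nullstellensatz together with [chart_null]: [I] is the full vanishing ideal of [Z]. *)
have nulZ q : (forall y, Z y -> ev y q = 0) -> I q.
  move=> H; apply: contrapT => nq; have [v [Hv qv]] := nullstellensatz pI nq.
  have [y Cy yv] : exists2 y, C y & chart_coord C y = v.
    by apply: chart_null => p Hp; apply: Hv; apply: kI; apply/kap_eq0P.
  move: qv; rewrite -yv; apply/negP; rewrite negbK; apply/eqP; apply: H.
  by split => // p Ip; rewrite yv Hv.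
have ZnI q : ~ I q -> exists y, Z y /\ ev y q != 0.
  move=> nq; apply: contrapT => H; apply: nq; apply: nulZ => y Zy.
  by apply/eqP/negPn/negP => qy; apply: H; exists y.
have irrZ : irreducible_set Z.
  split; first by exists x.
  move=> V W oV oW [v [Zv Vv]] [w [Zw Ww]].
  have [q [qv Hq]] := chart_basis oV Vv Zv.1; have [r [rw Hr]] := chart_basis oW Ww Zw.1.
  have [|y [Zy]] := ZnI (q * r).
    by move=> /(primeM pI) [/(Zv.2 _)|/(Zw.2 _)] /eqP; [rewrite (negPf qv)|rewrite (negPf rw)].
  rewrite mevalM mulf_eq0 negb_or => /andP [qy ry]; exists y; split; first split => //.
    by apply: Hq => //; apply: Zy.1.
  by apply: Hr => //; apply: Zy.1.
have irrP := cl_irreducible irrZ; have cP := @cl_closed _ _ Z.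
pose P := cl Z; have Px : P x by apply: cl_sub.
have PC : P `&` chart_set C !=set0 by exists x.
have IP p : ideal_of (C := C) P p <-> I p.
  split=> [Hp|Ip y Py Cy]; first by apply: nulZ => y Zy; apply: Hp Zy.1; apply: cl_sub.
  apply/eqP/negPn/negP => py.
  have [|z [Zz [Cz pz]]] := Py _ (reg_opn XF (reg_inv XF (chart_poly C p))); first by split.
  by move: pz; rewrite /= (Zz.2 _ Ip) eqxx.
have [q0 [Iq0 kq0]] : exists q, I q /\ (kap Cx) q != 0.
  by have [p [q [q0 E]]] := rat_frac Cx b; exists q; split => //; apply/Idef; exists p.
have Pproper : P <> setT.
  move=> PT; have [y Cy /eqP qy] : exists2 y, C y & ev y q0 <> 0.
    apply: contrapT => H; move/eqP: kq0; apply; apply/kap_eq0P => y Cy.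
    by apply: contrapT => n; apply: H; exists y.
  have Py : P y by rewrite PT.
  have [|z [Zz [Cz pz]]] := Py _ (reg_opn XF (reg_inv XF (chart_poly C q0))); first by split.
  by move: pz; rewrite /= (Zz.2 _ Iq0) eqxx.
have lrP a' := local_ring_frac Cx irrP PC a'; have lmP a' := local_max_frac Cx irrP PC a'.
have nb : ~ local_ring P b.
  by move=> /lrP [p [q [nq E]]]; apply: nq; apply/IP/Idef; exists p.
(* Otherwise multiplication by [b] maps the finitely generated ideal [I] to itself. Then [b] is an
   eigenvalue of a matrix [M] over the coordinate ring, and its characteristic polynomial is a monic
   equation for [b]. *)
have [pi [Ipi nm]] : exists p, I p /\ ~ local_max P (b * (kap Cx) p).
  apply: contrapT => H.
  have {}H p : I p -> exists2 r, I r & b * (kap Cx) p = (kap Cx) r.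
    move=> Ip; have [r E] := (Idef p).1 Ip; exists r => //.
    apply/IP/(kap_local_max Cx irrP PC); rewrite -E.
    by apply: contrapT => n; apply: H; exists p.
  have [l [lI lg]] := @noetherian_mpoly k _ I iI.
  pose m := size l.
  have Hm (i : 'I_m) : exists r : nat -> _, b * (kap Cx) l`_i = (kap Cx) (\sum_(j < m) r j * l`_j).
    by have [|r Ir ->] := H l`_i; [apply: lI; rewrite mem_nth | have [c' ->] := lg r Ir; exists c'].
  have [cf Hcf] := choice Hm.
  pose M : 'M[{mpoly k[chart_dim C]}]_m := \matrix_(j, i) cf i j.
  have ev_b : eigenvalue (map_mx (kap Cx) M) b.
    apply/eigenvalueP; exists (\row_i (kap Cx) l`_i).
      apply/rowP => i; rewrite !mxE Hcf rmorph_sum; apply: eq_bigr => j _.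
      by rewrite !mxE rmorphM mulrC.
    apply/eqP => /rowP E; move/eqP: kq0; apply.
    have [r ->] := lg _ Iq0; rewrite rmorph_sum big1 // => i _.
    by have := E i; rewrite !mxE => Ei; rewrite rmorphM /= Ei mulr0.
  have /reg_atP [d hd] : local_ring [set x] b.
    apply: nX; exists (char_poly (map_mx (kap Cx) M)); split.
    - exact: char_poly_monic.
    - by rewrite -eigenvalue_root_char.
    - move=> i; apply/reg_atP; rewrite -map_char_poly coef_map /=.
      by exists (ev x (char_poly M)`_i); apply: kap_value.
  have [p [q [qx _ E]]] := value_frac Cx Cx hd.
  have /Ix qx0 : I q by apply/Idef; exists p.
  by move: qx; rewrite qx0 eqxx.
have [r E] := (Idef pi).1 Ipi.
have hu : local_ring P (b * (kap Cx) pi) by rewrite E; apply: (kap_local_ring Cx irrP PC).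
have [u0 uV _] := local_unit irrP hu nm.
have b0 : b != 0 by apply: contraNneq u0 => ->; rewrite mul0r.
have tE : b^-1 = (kap Cx) pi * (b * (kap Cx) pi)^-1.
  by apply: (mulfI b0); rewrite mulrA !divff.
have tm : local_max P b^-1.
  rewrite tE; apply: local_maxMr => //.
  by apply/(kap_local_max Cx irrP PC)/IP.
have Imul p : I p -> local_ring P (b * (kap Cx) p).
  by move=> /Idef [r' ->]; apply: (kap_local_ring Cx irrP PC).
have unif a' : local_max P a' -> local_ring P (a' * b).
  move=> /lmP [p [q [nq /IP Ip E']]].
  have [q00 qr _] : [/\ (kap Cx) q != 0, local_ring P ((kap Cx) q)^-1 & ~ local_max P ((kap Cx) q)^-1].
    apply: local_unit => //; first exact: (kap_local_ring Cx irrP PC).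
    by move=> /(kap_local_max Cx irrP PC).
  rewrite -[a'](mulfK q00) E' mulrAC [(kap Cx) p * b]mulrC.
  by apply: local_ringM => //; apply: Imul.
(* If some nonzero [y] vanishes on [W], write it as a unit along [P] times a power of [b^-1]. The
   ideal [J] of [W] is prime and lies in [I], so it contains the numerator [t1] of [b^-1]. Since
   [b^-1] generates the maximal ideal along [P], [J] contains all of [I]. *)
have codim1 (W : set X) : closed_set W -> irreducible_set W -> P `<=` W -> W = P \/ W = setT.
  move=> cW irrW PW; apply: contrapT => H.
  have WC : W `&` chart_set C !=set0 by exists x; split => //; apply: PW.
  have pW := chart_prime irrW WC; set J := ideal_of (C := C) W in pW.
  have JI p : J p -> I p by move=> Jp; apply/IP => y Py; apply: Jp; apply: PW.
  have [y [Jy ky]] : exists y, J y /\ (kap Cx) y != 0.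
    apply: contrapT => HJ; apply: H; right; apply/seteqP; split => // z _.
    rewrite -(cl_irreducible_meet cW irrW (chart_opn C) WC) => V oV Vz.
    have [|w [Vw Cw]] := meet_neq0 oV (chart_opn C) (ex_intro _ z Vz); first by exists x.
    apply: contrapT => nV.
    have [q [qw Hq]] := chart_basis oV Vw Cw.
    apply: HJ; exists q; split; last exact: (kap_neq0 _ Cw qw).
    move=> v Wv Cv; apply/eqP/negPn/negP => qv; apply: nV; exists v; split => //.
    exact: Hq.
  have unif' a' : local_max P a' -> exists2 c', local_ring P c' & a' = c' * b^-1.
    by move=> /unif h; exists (a' * b) => //; rewrite mulfK.
  have [u [m [hu' nu' E']]] := dvr_factor_nat irrP tm unif' (kap_local_ring Cx irrP PC y) ky.
  have /lrP [u1 [u2 [nu2 Eu]]] := hu'; have /lmP [t1 [t2 [nt2 It1 Et]]] := tm.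
  have kJ p : kap Cx p = 0 -> J p by move=> /kap_eq0P h z _ Cz; apply: h.
  have nJ p : ~ ideal_of (C := C) P p -> ~ J p by move=> np /JI /IP.
  have iJ := prime_ideal pW.
  have Ju : J (u1 * t1 ^+ m).
    have : J (y * u2 * t2 ^+ m - u1 * t1 ^+ m).
      apply: kJ; rewrite rmorphB !rmorphM !rmorphXn /= -Eu -Et E' exprMn.
      by apply/eqP; rewrite subr_eq0; apply/eqP; ring.
    move=> H'; rewrite -[_ * _](subKr (y * u2 * t2 ^+ m)); apply: (idealB iJ) => //.
    by apply: (idealMr _ iJ); apply: (idealMr _ iJ).
  have nu1 : ~ J u1.
    move=> /JI /IP Iu1; apply: nu'; apply/lmP; exists u1, u2; split => //.
  have Jt1 : J t1.
    case/(primeM pW): Ju => //; elim: m {E'} => [|m IH]; first by move/(prime1 pW).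
    by rewrite exprS => /(primeM pW) [].
  apply: H; left; apply/seteqP; split => //.
  rewrite -{1}(cl_irreducible_meet cW irrW (chart_opn C) WC); apply: cl_min => // z [Wz Cz].
  apply: cl_sub; split => // p Ip.
  have [v hv Ev] : exists2 v, local_ring P v & (kap Cx) p = v * b^-1.
    by apply: unif'; apply/(kap_local_max Cx irrP PC)/IP.
  have /lrP [v1 [v2 [nv2 Evv]]] := hv.
  have : J (p * (v2 * t2)).
    have : J (p * (v2 * t2) - v1 * t1).
      apply: kJ; rewrite rmorphB !rmorphM /= -Evv -Et Ev.
      by apply/eqP; rewrite subr_eq0; apply/eqP; ring.
    move=> H'; rewrite -[p * _](subrK (v1 * t1)); apply: (idealD iJ) => //.
    exact: (idealMl iJ).
  by move=> /(primeM pW) [|/(primeM pW) []]; [apply | move/(nJ _ nv2) | move/(nJ _ nt2)].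
exists (PrimeDivisor cP irrP Pproper codim1), b^-1; split => //.
- by split => // a' /unif h; exists (a' * b) => //; rewrite mulfK.
- move=> ha; apply: nb; apply: local_ringM => //; exact: (kap_local_ring Cx irrP PC).
Qed.

Lemma prime_divisor_eq (P Q : prime_divisor X) : pd_set P = pd_set Q -> P = Q.
Proof.
case: P Q => [P c i p m] [Q c' i' p' m'] /= E; move: c i p m c' i' p' m'; rewrite E.
by move=> *; congr PrimeDivisor; apply: Prop_irrelevance.
Qed.

Lemma prime_divisor_sub (P Q : prime_divisor X) : pd_set P `<=` pd_set Q -> P = Q.
Proof.
move=> /(pd_codim1 (pd_closed Q) (pd_irreducible Q)) [E|/pd_proper //].
exact/esym/prime_divisor_eq.
Qed.

(** Noetherian induction. In a counterexample with maximal vanishing ideal on the chart, removing an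
    open set that meets it leaves a decomposable set. If the trace on the chart is reducible, two
    such removals cover it. *)
Lemma irreducible_decomp (C : chart X) (Z : set X) : closed_set Z ->
  exists L : seq (set X), (forall W, List.In W L ->
      [/\ closed_set W, irreducible_set W & W `<=` Z]) /\
    forall x, Z x -> C x -> exists W, List.In W L /\ W x.
Proof.
pose good (Z : set X) := exists L : seq (set X), (forall W, List.In W L ->
      [/\ closed_set W, irreducible_set W & W `<=` Z]) /\
    forall x, Z x -> C x -> exists W, List.In W L /\ W x.
pose IZ (Z : set X) : set {mpoly k[chart_dim C]} :=
  [set p | forall y, Z y -> C y -> meval (chart_coord C y) p = 0].
rewrite -/(good Z) => cZ0; apply: contrapT => bad0; move: Z cZ0 bad0.
suff: forall Z, closed_set Z -> good Z by move=> H Z /H.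
apply: contrapT => H.
have [||I [[Z [IE cZ bZ]] Imax]] := @noetherian_maximal _
  [set I | exists Z, [/\ I = IZ Z, closed_set Z & ~ good Z]] (@noetherian_mpoly k _).
- move=> I [Z [-> _ _]]; split.
  + by move=> y _ _; rewrite meval0.
  + by move=> p q Ip Iq y Py Cy; rewrite mevalD Ip // Iq // addr0.
  + by move=> r p Ip y Py Cy; rewrite mevalM Ip // mulr0.
- apply: contrapT => H'; apply: H => Z cZ; apply: contrapT => bZ.
  by apply: H'; exists (IZ Z), Z.
have smaller V : opn V -> (Z `&` chart_set C) `&` V !=set0 -> good (Z `\` V).
  move=> oV [v [[Zv Cv] Vv]]; apply: contrapT => bV.
  have [q [qv Hq]] := chart_basis oV Vv Cv.
  have : IZ Z q.
    rewrite -IE; apply: (Imax (IZ (Z `\` V))).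
    - by exists (Z `\` V); split => //; apply: setDclosed.
    - by move=> p; rewrite IE => Ip y [Zy _] Cy; apply: Ip.
    - move=> y [Zy nVy] Cy; apply/eqP/negPn/negP => qy; apply: nVy; exact: Hq.
  by move=> /(_ v Zv Cv) /eqP; rewrite (negPf qv).
case: (pselect (irreducible_set (Z `&` chart_set C))) => [irr|nirr].
  apply: bZ; exists [:: cl (Z `&` chart_set C)]; split => [W [<-|//]|x Zx Cx].
    split; [exact: cl_closed | exact: cl_irreducible | by apply: cl_min => // x []].
  by exists (cl (Z `&` chart_set C)); split; [left | apply: cl_sub].
case: (pselect ((Z `&` chart_set C) !=set0)) => [ne|em]; last first.
  by apply: bZ; exists [::]; split => // x Zx Cx; case: em; exists x.
apply: nirr; split => // U V oU oV ZU ZV; apply: contrapT => nUV.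
have [L1 [H1 c1]] := smaller U oU ZU; have [L2 [H2 c2]] := smaller V oV ZV.
apply: bZ; exists (L1 ++ L2); split => [W /List.in_app_iff [/H1|/H2] [? ? s]|x Zx Cx].
- by split => // y /s [].
- by split => // y /s [].
case: (pselect (U x)) => Ux; last first.
  have [|W [WL Wx]] := c1 x _ Cx; first by split.
  by exists W; split => //; apply/List.in_app_iff; left.
have [|W [WL Wx]] := c2 x _ Cx.
  by split => // Vx; apply: nUV; exists x.
by exists W; split => //; apply/List.in_app_iff; right.
Qed.

(** A prime divisor inside [Z] lies, on a chart that it meets, in one of the finitely many
    irreducible pieces of [Z]. It equals that piece, since it has codimension one. *)
Lemma finite_divisors (Z : set X) : closed_set Z -> Z <> setT ->
  exists L : seq (prime_divisor X), forall P : prime_divisor X, pd_set P `<=` Z -> P \in L.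
Proof.
move=> cZ ZT; have [m [C HC]] := chart_cover X.
have [D HD] := choice (fun i => irreducible_decomp (C i) cZ).
have pick (W : set X) : exists L : seq (prime_divisor X),
    forall P, pd_set P = W -> P \in L.
  case: (pselect (exists P : prime_divisor X, pd_set P = W)) => [[P E]|n].
    by exists [:: P] => Q; rewrite -E => /prime_divisor_eq ->; rewrite inE.
  by exists [::] => P E; case: n; exists P.
have [pk Hpk] := choice pick.
exists (flatten [seq flatten [seq pk W | W <- D i] | i <- enum 'I_m]) => P PZ.
have [x Px] := (pd_irreducible P).1; have [i Cx] := HC x.
apply/flattenP; exists (flatten [seq pk W | W <- D i]).
  by apply: map_f; rewrite mem_enum.
have [DW Dc] := HD i.
have irr : irreducible_set (pd_set P `&` chart_set (C i)).
  by apply: irreducible_meet (chart_opn _) _; [apply: pd_irreducible | exists x].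
have [W [WL PW]] : exists W, List.In W (D i) /\ pd_set P `&` chart_set (C i) `<=` W.
  apply: irreducible_cover irr _ _; first by move=> W /DW [].
  by move=> y [Py Cy]; apply: Dc => //; apply: PZ.
have [cW iW WZ] := DW W WL.
have sub : pd_set P `<=` W.
  rewrite -(cl_irreducible_meet (pd_closed P) (pd_irreducible P) (chart_opn (C i))).
    exact: cl_min.
  by exists x.
have [E|WT] := pd_codim1 cW iW sub; last first.
  by case: ZT; apply/seteqP; split => // y _; apply: WZ; rewrite WT.
have := Hpk W P (esym E); elim: (D i) WL => [//|W' L IH] /= [->|WL] h; rewrite mem_cat.
  by rewrite h.
by rewrite IH // orbT.
Qed.

Lemma opn_avoid (L : seq (prime_divisor X)) :
  opn [set y | forall Q, Q \in L -> ~ pd_set Q y] /\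
  [set y | forall Q, Q \in L -> ~ pd_set Q y] !=set0.
Proof.
elim: L => [|Q L [oV V0]].
  rewrite (_ : [set y | _] = setT); last by apply/seteqP; split.
  by split; [exact: (opn_setT XF) | exact: (variety_irreducible X).1].
rewrite (_ : [set y | _] = (~` pd_set Q) `&` [set y | forall Q, Q \in L -> ~ pd_set Q y]).
  have oQ : opn (~` pd_set Q) := pd_closed Q.
  split; first exact: (opn_setI XF).
  apply: meet_neq0 => //; apply: contrapT => H; apply: (pd_proper (p := Q)).
  by apply/seteqP; split => // y _; apply: contrapT => nQ; apply: H; exists y.
apply/seteqP; split => [y H|y [nQ H] Q'].
  by split => [|Q' Q'L]; apply: H; rewrite inE ?eqxx // Q'L orbT.
by rewrite inE => /orP [/eqP -> //|]; apply: H.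
Qed.

Lemma divisor_open (P : prime_divisor X) (L : seq (prime_divisor X)) :
  exists V, [/\ opn V, pd_set P `&` V !=set0 &
    forall Q, Q \in L -> Q != P -> forall y, V y -> ~ pd_set Q y].
Proof.
elim: L => [|Q L [V [oV PV H]]].
  have [y Py] := (pd_irreducible P).1.
  by exists setT; split => //; [exact: (opn_setT XF) | exists y].
have [->|QP] := eqVneq Q P.
  by exists V; split => // Q'; rewrite inE => /orP [/eqP -> /eqP //|]; apply: H.
exists (V `&` ~` pd_set Q); split.
- by apply: (opn_setI XF) => //; apply: pd_closed.
- rewrite setIA; apply: (pd_irreducible P).2 => //; first exact: pd_closed.
  apply: contrapT => n; move/eqP: QP; apply; apply/esym/prime_divisor_sub => y Py.
  by apply: contrapT => nQ; apply: n; exists y.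
- move=> Q'; rewrite inE => /orP [/eqP -> _ y [_ nQ] //|Q'L Q'P y [Vy _]].
  exact: H Q'L Q'P y Vy.
Qed.

Lemma local_max_nonzero (P : prime_divisor X) : exists2 a : K, local_max P a & a != 0.
Proof.
have [x Px] := (pd_irreducible P).1; have [C Cx] := chart_at x.
have PC : pd_set P `&` chart_set C !=set0 by exists x.
have [y nPy] : exists y, ~ pd_set P y.
  by apply: contrapT => H; apply: (pd_proper (p := P)); apply/seteqP; split => // y _;
    apply: contrapT => n; apply: H; exists y.
have oP : opn (~` pd_set P) := pd_closed P.
have [||z [nPz Cz]] := meet_neq0 oP (chart_opn C); [by exists y | by exists x|].
have [q [qz Hq]] := chart_basis oP nPz Cz.
exists (kap Cx q); last exact: (kap_neq0 Cx Cz qz).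
apply/(kap_local_max Cx (pd_irreducible P) PC) => v Pv Cv.
by apply/eqP/negPn/negP => qv; apply: (Hq v Cv qv).
Qed.

Lemma local_ring_1V (P : set X) (a : K) : irreducible_set P -> a != 0 ->
  local_max P a -> ~ local_ring P a^-1.
Proof.
move=> irrP a0 m h; have := local_maxMr irrP m h; rewrite divff // => m1.
have [x Px] := irrP.1; have := local_max_value irrP m1 Px (has_value1 x).
by move/eqP; rewrite oner_eq0.
Qed.

(** Take a nonzero [a] vanishing on [P], and a point [y] of [P] off the finitely many other prime
    divisors in the zero locus of [a]. Then [a^-1] is not regular at [y]. Its polar divisor from
    [pole_divisor] passes through [y] and lies in that zero locus, so it is [P]. *)
Lemma uniformizer_ex (P : prime_divisor X) : exists2 t, uniformizer P t & t != 0.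
Proof.
have irrP := pd_irreducible P.
have [a ma a0] := local_max_nonzero P.
suff [t ut] : exists t, uniformizer P t.
  by exists t => //; apply: (uniformizer_neq0 ut.2 ma a0).
have [x [c [Px ha]]] := (local_ringP _ _).1 (local_max_ring irrP ma).
have [U [f [gf Ux _]]] := ha.
pose N := U `&` [set y | f y != 0]; have oN := reg_opn XF (reg_inv XF (germ_reg gf)).
have cZ : closed_set (cl (U `&` [set y | f y = 0])) by apply: cl_closed.
have [|L HL] := finite_divisors cZ.
  move=> ZT; have [w [d [Uw hd]]] := has_value_meet a (reg_opn XF (germ_reg gf)) (germ_neq0 gf).
  have N0 : N !=set0.
    apply: contrapT => H; move/eqP: a0; apply.
    apply: (rat_eqI (reg_opn XF (germ_reg gf)) (germ_neq0 gf)) => y Uy e he.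
    have hf : has_value a y (f y) by exists U, f.
    rewrite (has_value_uniq he hf) (_ : f y = 0); first exact: has_value0.
    by apply/eqP/negPn/negP => fy; apply: H; exists y.
  have [v Nv] := N0; have cv : cl (U `&` [set y | f y = 0]) v by rewrite ZT.
  have [u [[_ /= fu] [_ /= fnu]]] := cv _ oN Nv.
  by rewrite fu eqxx in fnu.
have irrPU := irreducible_meet irrP (reg_opn XF (germ_reg gf)).
have [y [[Py Uy] Hy]] : exists y, (pd_set P `&` U) y /\
    forall Q, Q \in L -> Q != P -> ~ pd_set Q y.
  have [V [oV [y0 [Py0 Vy0]] HV]] := divisor_open P L.
  have [||y [[Py Uy] Vy]] := irrP.2 U V (reg_opn XF (germ_reg gf)) oV; [by exists x|by exists y0|].
  by exists y; split => // Q QL QP; apply: HV.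
have [|Q [t [Qy ut nQ]]] := @pole_divisor y a^-1.
  move=> /reg_atP [d hd]; have hf : has_value a y (f y) by exists U, f.
  have := has_value_uniq (has_value1 y); have := has_valueM hf hd.
  rewrite divff // => h1 /(_ _ h1) /eqP; rewrite (local_max_value irrP ma Py hf) mul0r.
  by rewrite oner_eq0.
have irrQ := pd_irreducible Q.
have hQ : local_ring Q a by apply/local_ringP; exists y, (f y); split => //; exists U, f.
have mQ : local_max Q a.
  by apply: contrapT => nm; have [_ h _] := local_unit irrQ hQ nm.
suff QL : Q \in L.
  have [E|QP] := eqVneq Q P; first by exists t; rewrite -E.
  by case: (Hy Q QL QP).
apply: HL => z Qz; rewrite -(cl_irreducible_meet (pd_closed Q) irrQ (reg_opn XF (germ_reg gf))) in Qz; last by exists y.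
move=> V oV Vz; have [w [[Qw Uw] Vw]] := Qz V oV Vz; exists w; split => //; split => //=.
by apply: (local_max_value irrQ mQ Qw); exists U, f.
Qed.

(** * The order along a prime divisor *)
Section Ord.
Variable P : prime_divisor X.
Let irrP := pd_irreducible P.

(** Two uniformizers differ by a unit, and a unit cannot be a positive power of a uniformizer, so
    the [xget] in [ord] selects a unique value. *)
Lemma ord_unit t u (m : int) : uniformizer P t -> t != 0 -> local_ring P u -> ~ local_max P u ->
  ord P (u * t ^ m) = m.
Proof.
move=> ut t0 hu nu; rewrite /ord; case: xgetP => [m' _ [t' [u' [ut' hu' nu' E]]]|H].
  have [b hb Eb] := ut.2 _ ut'.1; have [b' hb' Eb'] := ut'.2 _ ut.1.
  have bb : b * b' = 1.
    by apply: (mulIf t0); rewrite mul1r -mulrA [b' * t]mulrC mulrA -Eb mulrC -Eb'.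
  have t0' : t' != 0 by apply: contraNneq t0 => E0; rewrite Eb' E0 mulr0.
  have b0 : b != 0 by apply: contraNneq t0' => E0; rewrite Eb E0 mul0r.
  have b'E : b' = b^-1 by apply: (mulfI b0); rewrite bb divff.
  have nb : ~ local_max P b.
    by move=> mb; apply: (local_ring_1V irrP b0 mb); rewrite -b'E.
  have nb' : ~ local_max P b'.
    by rewrite b'E; have [_ _] := local_unit irrP hb nb.
  have unz (z : int) : local_ring P (b ^ z) /\ ~ local_max P (b ^ z).
    have unX c n : local_ring P c -> ~ local_max P c -> local_ring P (c ^+ n) /\ ~ local_max P (c ^+ n).
      move=> hc nc; elim: n => [|n [IH1 IH2]]; last by rewrite exprS; apply: local_unitM.
      rewrite expr0; have [x Px] := irrP.1.
      by apply: (local_unitI irrP Px (has_value1 x)); rewrite oner_eq0.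
    case: z => n; first by rewrite -exprnP; apply: unX.
    by rewrite NegzE -exprnN -exprVn -b'E; apply: unX.
  have [hz nz] := unz m'.
  have [hw nw] := local_unitM irrP hu' nu' hz nz.
  have [w0 wV nwV] := local_unit irrP hw nw.
  have [u0 uV nuV] := local_unit irrP hu nu.
  have E2 : u * t ^ m = (u' * b ^ m') * t ^ m' by rewrite -exprz_mulA -Eb.
  have [lt|lt|//] := ltgtP m m'; exfalso.
    have [_] := local_unitM irrP hu nu wV nwV.
    rewrite (exprz_unit_eq t0 w0 E2); apply.
    by apply: (local_max_exprz irrP ut.1) => //; rewrite subr_gt0.
  have [_] := local_unitM irrP hw nw uV nuV.
  rewrite (exprz_unit_eq t0 u0 (esym E2)); apply.
  by apply: (local_max_exprz irrP ut.1) => //; rewrite subr_gt0.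
by case: (H m); exists t, u.
Qed.

Lemma ord_spec a : a != 0 -> exists t u, [/\ uniformizer P t, t != 0, local_ring P u,
  ~ local_max P u & a = u * t ^ ord P a].
Proof.
move=> a0; have [t ut t0] := uniformizer_ex P.
have [u [m [hu nu E]]] := dvr_factor irrP ut.1 ut.2 a0.
by exists t, u; split => //; rewrite {2}E ord_unit.
Qed.

Lemma ord_factor t a : uniformizer P t -> t != 0 -> a != 0 ->
  exists u, [/\ local_ring P u, ~ local_max P u & a = u * t ^ ord P a].
Proof.
move=> ut t0 a0.
have [u [m [hu nu E]]] := dvr_factor irrP ut.1 ut.2 a0.
by exists u; split => //; rewrite {2}E ord_unit.
Qed.

Lemma ordM a b : a != 0 -> b != 0 -> ord P (a * b) = ord P a + ord P b.
Proof.
move=> a0 b0; have [t [u [ut t0 hu nu Ea]]] := ord_spec a0.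
have [v [hv nv Eb]] := ord_factor ut t0 b0; have [hw nw] := local_unitM irrP hu nu hv nv.
by rewrite {1}Ea {1}Eb mulrACA -expfzDr // ord_unit.
Qed.

Lemma ord_unit0 a : local_ring P a -> ~ local_max P a -> ord P a = 0.
Proof.
move=> ha na; have [t ut t0] := uniformizer_ex P.
by rewrite -[a]mulr1 -(expr0z t) ord_unit.
Qed.

Lemma ord_value x a c : pd_set P x -> has_value a x c -> c != 0 -> ord P a = 0.
Proof. by move=> Px h c0; have [? ?] := local_unitI irrP Px h c0; apply: ord_unit0. Qed.

Lemma ord1 : ord P 1 = 0.
Proof. by have [x Px] := irrP.1; apply: (ord_value Px (has_value1 x)); rewrite oner_eq0. Qed.

Lemma ordC c : c != 0 -> ord P (ratC X c) = 0.
Proof. by have [x Px] := irrP.1; apply: (ord_value Px (has_valueC c x)). Qed.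

Lemma ordV a : a != 0 -> ord P a^-1 = - ord P a.
Proof.
move=> a0; apply/eqP; rewrite -addr_eq0 addrC -ordM ?invr_eq0 //.
by rewrite divff //; apply/eqP; exact: ord1.
Qed.

Lemma ordX a n : a != 0 -> ord P (a ^+ n) = ord P a *+ n.
Proof.
by move=> a0; elim: n => [|n IH]; [rewrite expr0 ord1 | rewrite exprS ordM ?expf_neq0 // IH mulrS].
Qed.

Lemma ord_ge0 a : a != 0 -> (0 <= ord P a) <-> local_ring P a.
Proof.
move=> a0; have [t [u [ut t0 hu nu E]]] := ord_spec a0.
split=> [|ha].
  rewrite {2}E; case: (ord P a) => // m _; rewrite -exprnP.
  apply: local_ringM => //; apply: local_ringX => //.
  by have := ut.1; apply: local_max_ring.
rewrite leNgt; apply/negP => lt; apply: nu.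
have -> : u = t ^ (- ord P a) * a by rewrite {2}E mulrCA -expfzDr // addNr expr0z mulr1.
apply: local_maxMr => //; apply: (local_max_exprz irrP ut.1) => //.
by rewrite oppr_gt0.
Qed.

Lemma ord_gt0 a : a != 0 -> (0 < ord P a) <-> local_max P a.
Proof.
move=> a0; have [t [u [ut t0 hu nu E]]] := ord_spec a0.
split=> [lt|ma].
  rewrite E mulrC; apply: local_maxMr => //; exact: (local_max_exprz irrP ut.1).
rewrite lt_def; apply/andP; split; last by apply/(ord_ge0 a0); apply: local_max_ring.
by apply/eqP => o0; apply: nu; move: ma; rewrite E o0 expr0z mulr1.
Qed.

Lemma ordD a b (m : int) : a + b != 0 -> (a = 0 \/ m <= ord P a) -> (b = 0 \/ m <= ord P b) ->
  m <= ord P (a + b).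
Proof.
move=> ab0 ha hb; have [t ut t0] := uniformizer_ex P.
have tz (z : int) : t ^ z != 0 by rewrite expfz_neq0.
have H c : (c = 0 \/ m <= ord P c) -> local_ring P (c * t ^ (- m)).
  move=> [->|mc]; first by rewrite mul0r; apply: (local_ringC irrP 0).
  have [->|c0] := eqVneq c 0; first by rewrite mul0r; apply: (local_ringC irrP 0).
  have [u [hu nu E]] := ord_factor ut t0 c0.
  rewrite E -mulrA -expfzDr //; move: mc; rewrite -subr_ge0; case: (_ - _) => // n _.
  apply: local_ringM => //; rewrite -exprnP; apply: local_ringX => //.
  by have := ut.1; apply: local_max_ring.
have : local_ring P ((a + b) * t ^ (- m)).
  by rewrite mulrDl; apply: local_ringD => //; apply: H.
move=> /(ord_ge0 (mulf_neq0 ab0 (tz _))); rewrite ordM //.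
rewrite (_ : ord P (t ^ (- m)) = - m) ?subr_ge0 //.
have [x Px] := irrP.1.
have [h1 h1'] := local_unitI irrP Px (has_value1 x) (oner_neq0 k).
by rewrite -[t ^ _]mul1r; apply: ord_unit.
Qed.

End Ord.

Lemma hartogs a x : a != 0 -> (forall P : prime_divisor X, pd_set P x -> 0 <= ord P a) ->
  local_ring [set x] a.
Proof.
move=> a0 H; apply: contrapT => na; have [P [t [Px ut nP]]] := pole_divisor na.
by apply: nP; apply/(ord_ge0 P a0); apply: H.
Qed.

Lemma ord_finite a : a != 0 ->
  exists L : seq (prime_divisor X), forall P, ord P a != 0 -> P \in L.
Proof.
move=> a0; have [U [f gf]] := germ_ex a; have oN := reg_opn XF (reg_inv XF (germ_reg gf)).
set N := (_ `&` _) in oN.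
have [||L HL] := @finite_divisors (~` N).
- by rewrite /closed_set setCK.
- move=> NT; move/eqP: a0; apply.
  apply: (rat_eqI (reg_opn XF (germ_reg gf)) (germ_neq0 gf)) => y Uy e he.
  have hf : has_value a y (f y) by exists U, f.
  rewrite (has_value_uniq he hf) (_ : f y = 0); first exact: has_value0.
  apply/eqP/negPn/negP => fy; have : (~` N) y by rewrite NT.
  by apply; split.
exists L => P; apply: contraNT => PL; apply/eqP.
have [x [Px Nx]] : exists x, pd_set P x /\ N x.
  apply: contrapT => H; move/negP: PL; apply; apply: HL => x Px Nx.
  by apply: H; exists x.
by apply: (ord_value Px (c := f x)); [exists U, f => //; split => //; case: Nx | case: Nx].
Qed.

End Divisors.


(** * Weak Nullstellensatz, Zariski structures, morphisms of spaces *)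

Section WeakNull.
Variables (k : closedFieldType) (n : nat).

(** A proper ideal containing [I] and maximal among these is prime, so [nullstellensatz] applies to
    it with [q = 1]. *)
Lemma weak_nullstellensatz (I : set {mpoly k[n]}) : is_ideal I -> ~ I 1 ->
  exists v : 'I_n -> k, forall p, I p -> p.@[v] = 0.
Proof.
move=> iI I1.
have [||J [[iJ J1 IJ] Jmax]] := @noetherian_maximal _
  [set J | [/\ is_ideal J, ~ J 1 & forall p, I p -> J p]] (@noetherian_mpoly k n).
- by move=> J [].
- by exists I.
suff pJ : is_prime J.
  by have [v [Hv _]] := nullstellensatz pJ J1; exists v => p /IJ /Hv.
split => // a b Jab; case: (pselect (J a)) => [|na]; [by left | right].
pose J' : set {mpoly k[n]} := fun x => exists r, J (x - r * a).
have iJ' : is_ideal J'.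
  split.
  - by exists 0; rewrite mul0r subr0; apply: ideal0.
  - move=> x y [r Hr] [s Hs]; exists (r + s).
    by rewrite mulrDl opprD addrACA; apply: idealD.
  - by move=> c x [r Hr]; exists (c * r); rewrite -mulrA -mulrBr; apply: idealMl.
have JJ' x : J x -> J' x by exists 0; rewrite mul0r subr0.
case: (pselect (J' 1)) => [[r Hr]|nJ'].
  rewrite -[b]mul1r -[1](subrK (r * a)) mulrDl; apply: idealD => //.
    exact: idealMr.
  by rewrite -mulrA; apply: idealMl.
case: na; apply: (Jmax J') => //; first by split => // x /IJ /JJ'.
by exists 1; rewrite mul1r subrr; apply: ideal0.
Qed.

End WeakNull.

Section ZariskiSpace.
Variables (k : closedFieldType) (T : Type) (n : nat) (e : T -> 'I_n -> k).
Local Notation X := (Space (zariski_open e) (zariski_reg e)).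

Lemma zariski_space : is_space_with_functions X.
Proof.
have op (U : set T) f : zariski_reg e U f -> zariski_open e U.
  by move=> H x Ux; have [p [q [qx Hq]]] := H x Ux; exists q; split => // y /Hq [].
have opI (U V : set T) : zariski_open e U -> zariski_open e V -> zariski_open e (U `&` V).
  move=> oU oV x [Ux Vx]; have [p [px Hp]] := oU x Ux; have [q [qx Hq]] := oV x Vx.
  exists (p * q); rewrite mevalM mulf_neq0 //; split => // y.
  by rewrite mevalM mulf_eq0 negb_or => /andP [/Hp ? /Hq ?].
split => //=.
- by move=> x _; exists 1; rewrite meval1 oner_neq0.
- move=> F HF x [U FU Ux]; have [p [px Hp]] := HF U FU x Ux.
  by exists p; split => // y /Hp Uy; exists U.
- move=> U f g E rf x Ux; have [p [q [qx Hq]]] := rf x Ux; exists p, q; split => // y /Hq [Uy <-].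
  by rewrite E.
- move=> U V f oV VU rf x Vx; have [p [q [qx Hq]]] := rf x (VU x Vx).
  have [r [rx Hr]] := oV x Vx; exists (p * r), (q * r).
  rewrite mevalM mulf_neq0 //; split => // y.
  rewrite mevalM mulf_eq0 negb_or => /andP [qy ry]; split; first exact: Hr.
  by rewrite (Hq y qy).2 !mevalM -mulf_div divff // mulr1.
- move=> U f oU H x Ux; have [V [Vx VU rf]] := H x Ux.
  have [p [q [qx Hq]]] := rf x Vx; exists p, q; split => // y /Hq [Vy ->]; split => //.
  exact: VU.
- move=> U c oU x Ux; have [p [px Hp]] := oU x Ux; exists (c *: p), p; split => // y py.
  by split; [apply: Hp | rewrite mevalZ mulfK].
- move=> U f g rf rg x Ux; have [p [q [qx Hq]]] := rf x Ux; have [r [s [sx Hs]]] := rg x Ux.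
  exists (p * s + r * q), (q * s); rewrite mevalM mulf_neq0 //; split => // y.
  rewrite mevalM mulf_eq0 negb_or => /andP [qy sy]; split; first exact: (Hq y qy).1.
  by rewrite (Hq y qy).2 (Hs y sy).2 addf_div // mevalD !mevalM.
- move=> U f g rf rg x Ux; have [p [q [qx Hq]]] := rf x Ux; have [r [s [sx Hs]]] := rg x Ux.
  exists (p * r), (q * s); rewrite mevalM mulf_neq0 //; split => // y.
  rewrite mevalM mulf_eq0 negb_or => /andP [qy sy]; split; first exact: (Hq y qy).1.
  by rewrite (Hq y qy).2 (Hs y sy).2 mulf_div !mevalM.
- move=> U f rf x [Ux /= fx]; have [p [q [qx Hq]]] := rf x Ux.
  exists (q * q), (p * q); rewrite mevalM mulf_neq0 //; last first.
    by move: fx; rewrite (Hq x qx).2 mulf_eq0 negb_or => /andP [].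
  split => // y; rewrite mevalM mulf_eq0 negb_or => /andP [py qy].
  have [Uy fy] := Hq y qy; rewrite /= fy; split; first by rewrite mulf_neq0 ?invr_eq0.
  by rewrite mevalM invf_div -mulf_div divff // mulr1.
Qed.

Lemma zariski_reg_poly (p : {mpoly k[n]}) : zariski_reg e setT (fun x => p.@[e x]).
Proof. by move=> x _; exists p, 1; rewrite meval1 oner_neq0; split => // y _; split => //; rewrite meval1 divr1. Qed.

Lemma zariski_eq_opn (p : {mpoly k[n]}) : zariski_open e [set x | p.@[e x] != 0].
Proof. by move=> x px; exists p. Qed.

End ZariskiSpace.

Section Morphisms.
Variable k : closedFieldType.
Implicit Types X Y A B : space k.

Lemma morphism_opn X Y (f : X -> Y) V : morphism f -> opn V -> opn (f @^-1` V).
Proof. by move=> mf oV; have := (mf V oV).1; rewrite setTI. Qed.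

Lemma morphism_reg X Y (f : X -> Y) V F : is_space_with_functions Y -> morphism f -> reg V F -> reg (f @^-1` V) (F \o f).
Proof. by move=> sY mf rF; have := (mf V (reg_opn sY rF)).2 F rF; rewrite setTI. Qed.

Lemma morphism_id X : is_space_with_functions X -> @morphism k X X id.
Proof. by move=> sX V oV; rewrite setTI; split. Qed.

Lemma morphism_cst X Y (y : Y) : is_space_with_functions X -> @morphism k X Y (fun=> y).
Proof.
move=> sX V oV; rewrite setTI.
have o : opn ((fun _ : X => y) @^-1` V).
  case: (pselect (V y)) => Vy.
    by rewrite (_ : _ @^-1` _ = setT); [exact: opn_setT | apply/seteqP; split].
  rewrite (_ : _ @^-1` _ = \bigcup_(U in set0) U); first exact: (opn_bigcup sX).
  by apply/seteqP; split => // x [].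
by split => // f _; apply: (reg_cst sX).
Qed.

Lemma morphism_comp X Y A (f : X -> Y) (g : Y -> A) :
  morphism f -> morphism g -> @morphism k X A (g \o f).
Proof.
move=> mf mg V oV; rewrite setTI.
have [] := mg V oV; rewrite setTI => oW rW; have [] := mf _ oW; rewrite setTI => oW' rW'.
by split => // F /rW /rW'.
Qed.

Lemma tensor_reg X A B (U : set A) (V : set B) h (f : X -> A) (g : X -> B) :
  is_space_with_functions X -> is_space_with_functions A -> is_space_with_functions B ->
  morphism f -> morphism g -> opn U -> opn V -> tensor_function U V h ->
  reg ((f @^-1` U) `&` (g @^-1` V)) (fun x => h (f x, g x)).
Proof.
move=> sX sA sB mf mg oU oV [m [a [b [ra rb ->]]]].
have o : opn ((f @^-1` U) `&` (g @^-1` V)) by apply: (opn_setI sX); apply: morphism_opn.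
suff H (s : seq 'I_m) : reg ((f @^-1` U) `&` (g @^-1` V)) (fun x => \sum_(i <- s) a i (f x) * b i (g x)).
  exact: H.
elim: s => [|i s IH].
  by apply: (reg_ext sX) (reg_cst sX 0 o) => x _; rewrite big_nil.
apply: (reg_ext sX) (reg_add sX _ IH) => [x _|]; first by rewrite big_cons.
apply: (reg_mul sX).
  by apply: (reg_restrict sX o _ (morphism_reg sA mf (ra i))) => x [].
by apply: (reg_restrict sX o _ (morphism_reg sB mg (rb i))) => x [].
Qed.

Lemma prod_pullback X A B (f : X -> A) (g : X -> B) :
  is_space_with_functions X -> is_space_with_functions A -> is_space_with_functions B ->
  morphism f -> morphism g -> @morphism k X (prod_space A B) (fun x => (f x, g x)).
Proof.
move=> sX sA sB mf mg W oW; rewrite setTI.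
have o : opn ((fun x => (f x, g x)) @^-1` W).
  rewrite (_ : _ @^-1` _ = \bigcup_(N in [set N | opn N /\ N `<=` (fun x => (f x, g x)) @^-1` W]) N).
    by apply: (opn_bigcup sX) => N [].
  apply/seteqP; split => [x Wx|x [N [_ NW] Nx]]; last exact: NW.
  have [U [V [h [[oU oV] [/= Ux Vx] th hx H]]]] := oW _ Wx.
  exists (((f @^-1` U) `&` (g @^-1` V)) `&` [set x | h (f x, g x) != 0]) => //.
  split; last by move=> y [[Uy Vy] hy]; apply: H.
  exact: (reg_opn sX (reg_inv sX (tensor_reg sX sA sB mf mg oU oV th))).
split => // F rF; apply: (reg_local sX) => // x Wx.
have [U [V [a [h [[oU oV] [/= Ux Vx] [ta th] hx H]]]]] := rF _ Wx.
have rh := tensor_reg sX sA sB mf mg oU oV th.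
exists (((f @^-1` U) `&` (g @^-1` V)) `&` [set x | h (f x, g x) != 0]); split => //.
  by move=> y [[Uy Vy] hy]; apply: (H (f y, g y) Uy Vy hy).1.
apply: (reg_ext sX) (reg_mul sX (reg_restrict sX _ _ (tensor_reg sX sA sB mf mg oU oV ta)) (reg_inv sX rh)).
- by move=> y [[Uy Vy] hy]; rewrite /= (H (f y, g y) Uy Vy hy).2.
- exact: (reg_opn sX (reg_inv sX rh)).
- by move=> y [].
Qed.

End Morphisms.

(** * [SL_2] as a variety: polynomial functions and polynomial curves *)

Section Matrices.
Variable k : closedFieldType.
Local Notation G := (sl2 k).
Implicit Types g h : G.

Lemma ord2P (i : 'I_2) : i = 0 \/ i = 1.
Proof. by case: i => [[|[|]] // H]; [left | right]; apply: val_inj. Qed.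

Lemma det22 (A : 'M[k]_2) : \det A = A 0 0 * A 1 1 - A 0 1 * A 1 0.
Proof.
have e1 : fintype.lift (0 : 'I_2) (0 : 'I_1) = 1 by apply: val_inj.
have e2 : fintype.lift (1 : 'I_2) (0 : 'I_1) = 0 by apply: val_inj.
rewrite (expand_det_row _ 0) !big_ord_recl big_ord0 addr0 /cofactor !det_mx11 !mxE e1 e2.
by rewrite expr0 expr1 mul1r mulN1r mulrN.
Qed.

Lemma mulmx22 (A B : 'M[k]_2) i j : (A *m B) i j = A i 0 * B 0 j + A i 1 * B 1 j.
Proof.
have e1 : fintype.lift (0 : 'I_2) (0 : 'I_1) = 1 by apply: val_inj.
by rewrite !mxE !big_ord_recl big_ord0 addr0 e1.
Qed.

Definition mx22 (a b c d : k) : 'M[k]_2 :=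
  \matrix_(i, j) if i == 0 then if j == 0 then a else b else if j == 0 then c else d.

Lemma mx22_det a b c d : \det (mx22 a b c d) = a * d - b * c.
Proof. by rewrite det22 !mxE. Qed.

Lemma sl2_eq g h : g 0 0 = h 0 0 -> g 0 1 = h 0 1 -> g 1 0 = h 1 0 -> g 1 1 = h 1 1 -> g = h.
Proof.
move=> e00 e01 e10 e11; apply/val_inj/matrixP => i j.
by case: (ord2P i) => ->; case: (ord2P j) => ->.
Qed.

Lemma sl2_ad g : g 0 0 * g 1 1 - g 0 1 * g 1 0 = 1.
Proof. by rewrite -det22 sl2_det. Qed.

Definition sl2_mk a b c d (H : a * d - b * c = 1) : G := sl2_of (etrans (mx22_det a b c d) H).

Lemma sl2_mkE a b c d (H : a * d - b * c = 1) :
  [/\ sl2_mk H 0 0 = a, sl2_mk H 0 1 = b, sl2_mk H 1 0 = c & sl2_mk H 1 1 = d].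
Proof. by rewrite /sl2_mk /sl2_of /= /sl2_mx /= !mxE. Qed.

Lemma sl2M g h i j : sl2_mx (g * h)%g i j = g i 0 * h 0 j + g i 1 * h 1 j.
Proof. exact: mulmx22. Qed.

Lemma sl2_1E : [/\ @sl2_mx k 1%g 0 0 = 1, @sl2_mx k 1%g 0 1 = 0, @sl2_mx k 1%g 1 0 = 0 & @sl2_mx k 1%g 1 1 = 1].
Proof. by rewrite /sl2_mx /= !mxE. Qed.

Fact sl2_adj_subproof g : g 1 1 * g 0 0 - (- g 0 1) * (- g 1 0) = 1.
Proof. by rewrite mulrNN mulrC sl2_ad. Qed.

Lemma sl2_VE g : [/\ sl2_mx (g^-1)%g 0 0 = g 1 1, sl2_mx (g^-1)%g 0 1 = - g 0 1, sl2_mx (g^-1)%g 1 0 = - g 1 0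
  & sl2_mx (g^-1)%g 1 1 = g 0 0].
Proof.
suff -> : (g^-1)%g = sl2_mk (sl2_adj_subproof g) by exact: sl2_mkE.
have [a b c d] := sl2_mkE (sl2_adj_subproof g).
have [o1 o2 o3 o4] := sl2_1E; have E := sl2_ad g.
apply: (@mulgI _ g); rewrite mulgV; apply: sl2_eq; rewrite sl2M ?a ?b ?c ?d ?o1 ?o2 ?o3 ?o4.
- by rewrite mulrN -E.
- by rewrite mulrN mulrC addNr.
- by rewrite mulrN [g 1 1 * _]mulrC subrr.
- by rewrite mulrN addrC mulrC [g 1 0 * _]mulrC -E.
Qed.

Fact upper_subproof (t : k) : 1 * 1 - t * 0 = 1. Proof. by rewrite mulr0 subr0 mulr1. Qed.
Fact lower_subproof (t : k) : 1 * 1 - 0 * t = 1. Proof. by rewrite mul0r subr0 mulr1. Qed.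
Fact diag_subproof (t : k) : t != 0 -> t * t^-1 - 0 * 0 = 1.
Proof. by move=> t0; rewrite mul0r subr0 divff. Qed.

Definition upper t : G := sl2_mk (upper_subproof t).
Definition lower t : G := sl2_mk (lower_subproof t).
Definition tdiag t (t0 : t != 0) : G := sl2_mk (diag_subproof t0).

Lemma upperE t : [/\ upper t 0 0 = 1, upper t 0 1 = t, upper t 1 0 = 0 & upper t 1 1 = 1].
Proof. exact: sl2_mkE. Qed.
Lemma lowerE t : [/\ lower t 0 0 = 1, lower t 0 1 = 0, lower t 1 0 = t & lower t 1 1 = 1].
Proof. exact: sl2_mkE. Qed.
Lemma tdiagE t (t0 : t != 0) :
  [/\ tdiag t0 0 0 = t, tdiag t0 0 1 = 0, tdiag t0 1 0 = 0 & tdiag t0 1 1 = t^-1].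
Proof. exact: sl2_mkE. Qed.

(** If the lower left entry is nonzero, three factors suffice; otherwise a preliminary row operation
    makes it nonzero. The fixed shape of the word is what gives the curves of [polycurve_join]. *)
Lemma elementary_factor g : exists s a c b : k,
  g = (lower s * upper a * lower c * upper b)%g.
Proof.
have H g' : g' 1 0 != 0 -> exists a c b, g' = (upper a * lower c * upper b)%g.
  move=> c0; exists ((g' 0 0 - 1) / g' 1 0), (g' 1 0), ((g' 1 1 - 1) / g' 1 0).
  have [a1 a2 a3 a4] := upperE ((g' 0 0 - 1) / g' 1 0).
  have [b1 b2 b3 b4] := upperE ((g' 1 1 - 1) / g' 1 0).
  have [l1 l2 l3 l4] := lowerE (g' 1 0).
  have E := sl2_ad g'; have E' : g' 0 1 = (g' 0 0 * g' 1 1 - 1) / g' 1 0.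
    by apply: (mulIf c0); rewrite divfK // -E opprB addrCA subrr addr0.
  apply: sl2_eq; rewrite !sl2M ?a1 ?a2 ?a3 ?a4 ?b1 ?b2 ?b3 ?b4 ?l1 ?l2 ?l3 ?l4 ?E';
    by field.
have [c0|c0] := eqVneq (g 1 0) 0; last first.
  have [a [c [b ->]]] := H g c0; exists 0, a, c, b; congr (_ * _ * _)%g.
  by rewrite (_ : lower 0 = 1%g) ?mul1g //; have [? ? ? ?] := lowerE 0;
    have [? ? ? ?] := sl2_1E; apply: sl2_eq; congruence.
have [l1 l2 l3 l4] := lowerE 1.
have [|a [c [b E]]] := H (lower 1 * g)%g.
  rewrite sl2M l3 l4 c0 mulr0 addr0 mul1r; apply/eqP => a0.
  by have := sl2_ad g; rewrite a0 c0 mul0r mulr0 subrr => /eqP; rewrite eq_sym oner_eq0.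
exists (-1), a, c, b; rewrite -!mulgA in E *; rewrite -E mulgA (_ : (lower (-1) * lower 1)%g = 1%g) ?mul1g //.
have [m1 m2 m3 m4] := lowerE (-1); have [o1 o2 o3 o4] := sl2_1E.
apply: sl2_eq; rewrite sl2M ?m1 ?m2 ?m3 ?m4 ?l1 ?l2 ?l3 ?l4 ?o1 ?o2 ?o3 ?o4;
  by rewrite ?mulr0 ?mul0r ?mulr1 ?addr0 ?add0r ?addNr.
Qed.

(** * Polynomial functions *)

Definition polyfun (f : G -> k) := exists p, forall g, f g = meval (sl2_coord g) p.

Lemma polyfun_cst c : polyfun (fun=> c). Proof. by exists c%:MP => g; rewrite mevalC. Qed.
Lemma polyfunD f1 f2 : polyfun f1 -> polyfun f2 -> polyfun (fun g => f1 g + f2 g).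
Proof. by move=> [p Hp] [q Hq]; exists (p + q) => g; rewrite mevalD Hp Hq. Qed.
Lemma polyfunM f1 f2 : polyfun f1 -> polyfun f2 -> polyfun (fun g => f1 g * f2 g).
Proof. by move=> [p Hp] [q Hq]; exists (p * q) => g; rewrite mevalM Hp Hq. Qed.
Lemma polyfun_ext f1 f2 : f1 =1 f2 -> polyfun f1 -> polyfun f2.
Proof. by move=> E [p Hp]; exists p => g; rewrite -E Hp. Qed.
Lemma polyfun_entry i j : polyfun (fun g => g i j).
Proof. by exists ('X_(mxvec_index i j)) => g; rewrite mevalXU /sl2_coord mxvecE. Qed.

Lemma sl2_coord_entry (c : 'I_(2 * 2)) : exists i j, forall g, sl2_coord g c = g i j.
Proof.
by case/mxvec_indexP: c => i j; exists i, j => g; rewrite /sl2_coord mxvecE.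
Qed.

(* An induction principle: polynomial functions are generated by the entries. *)
Lemma polyfun_ind (Q : (G -> k) -> Prop) :
  (forall f1 f2, f1 =1 f2 -> Q f1 -> Q f2) -> (forall c, Q (fun=> c)) ->
  (forall i j, Q (fun g => g i j)) ->
  (forall f1 f2, Q f1 -> Q f2 -> Q (fun g => f1 g + f2 g)) ->
  (forall f1 f2, Q f1 -> Q f2 -> Q (fun g => f1 g * f2 g)) ->
  forall f, polyfun f -> Q f.
Proof.
move=> Qe Qc Qx QD QM f [p Hp]; apply: (Qe (fun g => meval (sl2_coord g) p)) => [g|]; first by rewrite Hp.
apply: (Qe (fun g => \sum_(m <- msupp p) p@_m * \prod_i sl2_coord g i ^+ m i)) => [g|].
  by rewrite mevalE.
have QX (f1 : G -> k) n : Q f1 -> Q (fun g => f1 g ^+ n).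
  move=> Qh; elim: n => [|n IH]; first by apply: (Qe) (Qc 1) => g; rewrite expr0.
  by apply: (Qe) (QM _ _ Qh IH) => g; rewrite exprS.
elim: (msupp p) => [|m s IH]; first by apply: (Qe) (Qc 0) => g; rewrite big_nil.
apply: (Qe) (QD _ _ (QM _ _ (Qc p@_m) _) IH) => [g|]; first by rewrite big_cons.
elim: (index_enum _) => [|i r IHr]; first by apply: (Qe) (Qc 1) => g; rewrite big_nil.
apply: (Qe) (QM _ _ (QX _ (m i) _) IHr) => [g|]; first by rewrite big_cons.
have [a [b E]] := sl2_coord_entry i; exact: (Qe _ _) (fun g => esym (E g)) (Qx a b).
Qed.

Lemma polyfun_comp (phi : G -> G) f : (forall i j, polyfun (fun g => phi g i j)) ->
  polyfun f -> polyfun (fun g => f (phi g)).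
Proof.
move=> Hphi; move: f; apply: polyfun_ind => //.
- by move=> f1 f2 E; apply: polyfun_ext => g; apply: E.
- by move=> c; apply: polyfun_cst.
- by move=> f1 f2; apply: polyfunD.
- by move=> f1 f2; apply: polyfunM.
Qed.

Definition polycurve (gam : k -> G) := forall i j, exists P : {poly k}, forall z, gam z i j = P.[z].

Lemma polyfun_curve gam f : polycurve gam -> polyfun f -> exists P : {poly k}, forall z, f (gam z) = P.[z].
Proof.
move=> Hg; move: f; apply: polyfun_ind => //.
- by move=> f1 f2 E [P HP]; exists P => z; rewrite -E HP.
- by move=> c; exists c%:P => z; rewrite hornerC.
- by move=> f1 f2 [P HP] [Q HQ]; exists (P + Q) => z; rewrite hornerD HP HQ.
- by move=> f1 f2 [P HP] [Q HQ]; exists (P * Q) => z; rewrite hornerM HP HQ.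
Qed.

Lemma polycurveM gam1 gam2 : polycurve gam1 -> polycurve gam2 ->
  polycurve (fun z => gam1 z * gam2 z)%g.
Proof.
move=> H1 H2 i j; have [P1 E1] := H1 i 0; have [P2 E2] := H1 i 1.
have [Q1 F1] := H2 0 j; have [Q2 F2] := H2 1 j; exists (P1 * Q1 + P2 * Q2) => z.
by rewrite sl2M hornerD !hornerM E1 E2 F1 F2.
Qed.

Lemma polycurve_cst g : polycurve (fun=> g).
Proof. by move=> i j; exists (g i j)%:P => z; rewrite hornerC. Qed.

Lemma polycurve_upper t : polycurve (fun z => upper (z * t)).
Proof.
move=> i j; exists (if (i == 0) && (j == 1) then t *: 'X else (i == j)%:R) => z.
have [a b c d] := upperE (z * t).
case: (ord2P i) => ->; case: (ord2P j) => -> /=; rewrite ?a ?b ?c ?d ?hornerC //.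
by rewrite hornerZ hornerX mulrC.
Qed.

Lemma polycurve_lower t : polycurve (fun z => lower (z * t)).
Proof.
move=> i j; exists (if (i == 1) && (j == 0) then t *: 'X else (i == j)%:R) => z.
have [a b c d] := lowerE (z * t).
case: (ord2P i) => ->; case: (ord2P j) => -> /=; rewrite ?a ?b ?c ?d ?hornerC //.
by rewrite hornerZ hornerX mulrC.
Qed.

Lemma upper0 : upper 0 = 1%g.
Proof. by have [? ? ? ?] := upperE 0; have [? ? ? ?] := sl2_1E; apply: sl2_eq; congruence. Qed.
Lemma lower0 : lower 0 = 1%g.
Proof. by have [? ? ? ?] := lowerE 0; have [? ? ? ?] := sl2_1E; apply: sl2_eq; congruence. Qed.

(** Scale the parameters of the elementary factors of [g^-1 h] by [z]. Restriction to such curves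
    reduces irreducibility of [G] and constancy of its units to polynomials in one variable. *)
Lemma polycurve_join g h : exists gam, [/\ polycurve gam, gam 0 = g & gam 1 = h].
Proof.
have [s [a [c [b E]]]] := elementary_factor (g^-1 * h)%g.
exists (fun z => g * (lower (z * s) * upper (z * a) * lower (z * c) * upper (z * b)))%g; split.
- apply: polycurveM; first exact: polycurve_cst.
  by repeat (apply: polycurveM || apply: polycurve_upper || apply: polycurve_lower).
- by rewrite !mul0r !upper0 !lower0 !mulg1.
- by rewrite !mul1r -E mulVKg.
Qed.

Lemma polyfun_neq0 f1 f2 g h : polyfun f1 -> polyfun f2 -> f1 g != 0 -> f2 h != 0 ->
  exists x, f1 x != 0 /\ f2 x != 0.
Proof.
move=> p1 p2 n1 n2; have [gam [pg g0 g1]] := polycurve_join g h.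
have [P1 E1] := polyfun_curve pg p1; have [P2 E2] := polyfun_curve pg p2.
have : P1 * P2 != 0.
  rewrite mulf_neq0 //.
    by apply: contraNneq n1 => E; rewrite -g0 E1 E horner0.
  by apply: contraNneq n2 => E; rewrite -g1 E2 E horner0.
move=> /exists_nonroot [z]; rewrite hornerM mulf_eq0 negb_or => /andP [z1 z2].
by exists (gam z); rewrite E1 E2.
Qed.

Lemma polyfun_unit f : polyfun f -> (forall g, f g != 0) -> forall g h, f g = f h.
Proof.
move=> pf nf g h; have [gam [pg g0 g1]] := polycurve_join g h.
have [P E] := polyfun_curve pg pf.
have : size P = 1%N.
  apply/eqP/negPn/negP => /closed_rootP [z /rootP Pz].
  by move: (nf (gam z)); rewrite E Pz eqxx.
by move=> /eqP/size_poly1P [c _ Pc]; rewrite -g0 -g1 !E Pc !hornerC.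
Qed.

Lemma sl2_space_functions : is_space_with_functions (sl2_space k).
Proof. exact: zariski_space. Qed.

Lemma sl2_opnP (V : set G) g : opn (s := sl2_space k) V -> V g ->
  exists f, [/\ polyfun f, f g != 0 & forall h, f h != 0 -> V h].
Proof.
move=> oV Vg; have [p [pg Hp]] := oV g Vg.
by exists (fun h => meval (sl2_coord h) p); split => //; exists p.
Qed.

Lemma sl2_meet (U V : set G) : opn (s := sl2_space k) U -> opn (s := sl2_space k) V ->
  U !=set0 -> V !=set0 -> U `&` V !=set0.
Proof.
move=> oU oV [g Ug] [h Vh]; have [f1 [p1 n1 H1]] := sl2_opnP oU Ug.
have [f2 [p2 n2 H2]] := sl2_opnP oV Vh; have [x [x1 x2]] := polyfun_neq0 p1 p2 n1 n2.
by exists x; split; [apply: H1 | apply: H2].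
Qed.

Lemma polyfun_reg f : polyfun f -> reg (s := sl2_space k) setT f.
Proof.
move=> [p Hp]; apply: (reg_ext sl2_space_functions) (zariski_reg_poly _ p) => g _.
by rewrite Hp.
Qed.

(* The denominators of a global regular function generate the unit ideal. *)
Lemma reg_polyfun f : reg (s := sl2_space k) setT f -> polyfun f.
Proof.
move=> rf; pose I : set {mpoly k[2 * 2]} := fun q =>
  exists p, forall g, meval (sl2_coord g) q * f g = meval (sl2_coord g) p.
have iI : is_ideal I.
  split.
  - by exists 0 => g; rewrite !meval0 mul0r.
  - by move=> a b [p Hp] [q Hq]; exists (p + q) => g; rewrite !mevalD mulrDl Hp Hq.
  - by move=> r a [p Hp]; exists (r * p) => g; rewrite !mevalM -mulrA Hp.
case: (pselect (I 1)) => [[p Hp]|I1].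
  by exists p => g; rewrite -Hp meval1 mul1r.
have [v Hv] := weak_nullstellensatz iI I1.
pose x i j : {mpoly k[2 * 2]} := 'X_(mxvec_index i j).
have vdet : v (mxvec_index 0 0) * v (mxvec_index 1 1) - v (mxvec_index 0 1) * v (mxvec_index 1 0) = 1.
  have : I (x 0 0 * x 1 1 - x 0 1 * x 1 0 - 1).
    exists 0 => g; rewrite meval0 !mevalB !mevalM meval1 !mevalXU /sl2_coord !mxvecE sl2_ad.
    by rewrite subrr mul0r.
  by move=> /Hv /eqP; rewrite !mevalB !mevalM meval1 !mevalXU subr_eq0 => /eqP.
have [a b c d] := sl2_mkE vdet; set g := sl2_mk vdet in a b c d.
have vE : sl2_coord g = v.
  apply: funext => i; case/mxvec_indexP: i => i j; rewrite /sl2_coord mxvecE.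
  by case: (ord2P i) => ->; case: (ord2P j) => ->.
have [p [q [qg Hq]]] := rf g Logic.I.
(* Squaring the local denominator makes the identity hold on all of [G]: where [q] vanishes, both
   sides are zero. *)
have /Hv : I (q * q).
  exists (q * p) => h; rewrite !mevalM; have [->|qh] := eqVneq (meval (sl2_coord h) q) 0.
    by rewrite !mul0r.
  by rewrite (Hq h qh).2 -mulrA [_ * (_ / _)]mulrC divfK.
by rewrite mevalM -vE => /eqP; rewrite mulf_eq0 orbb (negPf qg).
Qed.

Lemma sl2_morphism (phi : G -> G) : (forall i j, polyfun (fun g => phi g i j)) ->
  @morphism k (sl2_space k) (sl2_space k) phi.
Proof.
move=> H V oV; rewrite setTI.
have pc p : polyfun (fun g => meval (sl2_coord (phi g)) p).
  by apply: (polyfun_comp (f := fun g => meval (sl2_coord g) p)) => //; exists p.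
split=> [g Vg|f rf g Vg].
  have [p [pg Hp]] := oV (phi g) Vg; have [p' E] := pc p; exists p'; rewrite -E; split => // h.
  by rewrite -E; apply: Hp.
have [p [q [qg Hq]]] := rf (phi g) Vg; have [p' E] := pc p; have [q' E'] := pc q.
by exists p', q'; rewrite -E'; split => // h; rewrite -E' -E; apply: Hq.
Qed.

Lemma polyfun_mull h i j : polyfun (fun g => sl2_mx (h * g)%g i j).
Proof.
apply: (polyfun_ext (f1 := fun g => h i 0 * g 0 j + h i 1 * g 1 j)) => [g|].
  by rewrite sl2M.
by apply: polyfunD; apply: polyfunM; (apply: polyfun_cst || apply: polyfun_entry).
Qed.

Lemma polyfun_mulr h i j : polyfun (fun g => sl2_mx (g * h)%g i j).
Proof.
apply: (polyfun_ext (f1 := fun g => g i 0 * h 0 j + g i 1 * h 1 j)) => [g|].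
  by rewrite sl2M.
by apply: polyfunD; apply: polyfunM; (apply: polyfun_cst || apply: polyfun_entry).
Qed.

End Matrices.


(** * The action of [G] on rational functions and prime divisors *)

Section Translate.
Variables (k : closedFieldType) (X : G_variety k).
Local Notation XF := (variety_functions X).
Local Notation K := (ratfun X).
Local Notation G := (sl2 k).
Implicit Types (g h : G) (a b : K) (x y : X).

Lemma act_morph g : @morphism k X X (act g).
Proof.
have := morphism_comp (prod_pullback XF (sl2_space_functions k) XF
  (morphism_cst (g : sl2_space k) XF) (morphism_id XF)) (@act_morphism k X).
exact.
Qed.

Lemma orbit_morph x : @morphism k (sl2_space k) X (fun g => act g x).
Proof.
have := morphism_comp (prod_pullback (sl2_space_functions k) (sl2_space_functions k) XF
  (morphism_id (sl2_space_functions k)) (morphism_cst x (sl2_space_functions k))) (@act_morphism k X).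
exact.
Qed.

Lemma actK g : cancel (@act k X g) (act g^-1%g).
Proof. by move=> x; rewrite -actM mulVg act1. Qed.
Lemma actVK g : cancel (@act k X g^-1%g) (act g).
Proof. by move=> x; rewrite -actM mulgV act1. Qed.

Lemma act_image g (V : set X) : act g @` V = act g^-1%g @^-1` V.
Proof.
apply/seteqP; split => [y [x Vx <-]|y Vy]; first by rewrite /preimage /= actK.
by exists (act g^-1%g y) => //; rewrite actVK.
Qed.

Lemma act_opn g (V : set X) : opn V -> opn (act g @` V).
Proof. by move=> oV; rewrite act_image; apply: morphism_opn => //; apply: act_morph. Qed.

Lemma act_setT g : act g @` (@setT X) = setT.
Proof. by rewrite act_image. Qed.

Lemma germ_translate g a : exists b, forall x c, has_value a x c -> has_value b (act g x) c.
Proof.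
have [U [f gf]] := germ_ex a; have rf := germ_reg gf.
have [b0 gb] : exists b, germ b (act g^-1%g @^-1` U) (f \o act g^-1%g).
  apply: reg_germ; first exact: (morphism_reg XF (act_morph _) rf).
  by have [x Ux] := germ_neq0 gf; exists (act g x); rewrite /preimage /= actK.
exists b0 => x c [V [f' [gf' Vx <-]]]; have rf' := germ_reg gf'.
have [b1 gb'] : exists b, germ b (act g^-1%g @^-1` V) (f' \o act g^-1%g).
  apply: reg_germ; first exact: (morphism_reg XF (act_morph _) rf').
  by exists (act g x); rewrite /preimage /= actK.
have -> : b0 = b1.
  have oU := reg_opn XF (germ_reg gb); have oV := reg_opn XF (germ_reg gb').
  apply: (rat_eqI (opn_setI XF oU oV)).
    exact: (meet_neq0 oU oV (germ_neq0 gb) (germ_neq0 gb')).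
  move=> y [Uy Vy] d hd; have h0 : has_value b0 y (f (act g^-1%g y)).
    by exists (act g^-1%g @^-1` U), (f \o act g^-1%g).
  rewrite (has_value_uniq hd h0) (germ_agree gf gf' Uy Vy).
  by exists (act g^-1%g @^-1` V), (f' \o act g^-1%g).
exists (act g^-1%g @^-1` V), (f' \o act g^-1%g); split => //=; rewrite ?actK //.
Qed.

Lemma translate_value g a x c : has_value a x c -> has_value (translate g a) (act g x) c.
Proof.
move: x c; rewrite /translate; case: xgetP => [b _ //|H].
by have [b Hb] := germ_translate g a; case: (H b).
Qed.

Lemma translate_eqI g a b (W : set X) : opn W -> W !=set0 ->
  (forall x, W x -> forall c, has_value a x c -> has_value b (act g x) c) ->
  translate g a = b.
Proof.
move=> oW W0 H; have [U [f gf]] := germ_ex a; have oU := reg_opn XF (germ_reg gf).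
apply: (rat_eqI (U := act g @` (W `&` U))).
- by apply: act_opn; apply: (opn_setI XF).
- by have [x Hx] := meet_neq0 oW oU W0 (germ_neq0 gf); exists (act g x), x.
- move=> _ [x [Wx Ux] <-] c hc; have hf : has_value a x (f x) by exists U, f.
  by rewrite (has_value_uniq hc (translate_value g hf)); apply: H.
Qed.

Lemma translate1 a : translate 1%g a = a.
Proof.
apply: (@translate_eqI _ _ _ setT); first exact: (opn_setT XF).
  exact: (variety_irreducible X).1.
by move=> x _ c; rewrite act1.
Qed.

Lemma translateA g h a : translate (g * h)%g a = translate g (translate h a).
Proof.
apply: (@translate_eqI _ _ _ setT); first exact: (opn_setT XF).
  exact: (variety_irreducible X).1.
by move=> x _ c hc; rewrite actM; apply: translate_value; apply: translate_value.
Qed.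

Lemma translateK g : cancel (@translate k X g) (translate g^-1%g).
Proof. by move=> a; rewrite -translateA mulVg translate1. Qed.
Lemma translateVK g : cancel (@translate k X g^-1%g) (translate g).
Proof. by move=> a; rewrite -translateA mulgV translate1. Qed.

Lemma translate_valueE g a x c : has_value (translate g a) (act g x) c <-> has_value a x c.
Proof.
split; last exact: translate_value.
by move=> /(translate_value g^-1%g); rewrite translateK actK.
Qed.

Lemma common_domain a b : exists W : set X, [/\ opn W, W !=set0 &
  forall x, W x -> exists c d, has_value a x c /\ has_value b x d].
Proof.
have [U [f gf]] := germ_ex a; have [V [h gh]] := germ_ex b.
have oU := reg_opn XF (germ_reg gf); have oV := reg_opn XF (germ_reg gh).
exists (U `&` V); split; first exact: (opn_setI XF).
  exact: (meet_neq0 oU oV (germ_neq0 gf) (germ_neq0 gh)).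
by move=> x [Ux Vx]; exists (f x), (h x); split; [exists U, f | exists V, h].
Qed.

Lemma translateD g : {morph translate (X := X) g : a b / a + b}.
Proof.
move=> a b; have [W [oW W0 H]] := common_domain a b.
apply: (translate_eqI oW W0) => x Wx e he; have [c [d [hc hd]]] := H x Wx.
rewrite (has_value_uniq he (has_valueD hc hd)).
by apply: has_valueD; apply: translate_value.
Qed.

Lemma translateM g : {morph translate (X := X) g : a b / a * b}.
Proof.
move=> a b; have [W [oW W0 H]] := common_domain a b.
apply: (translate_eqI oW W0) => x Wx e he; have [c [d [hc hd]]] := H x Wx.
rewrite (has_value_uniq he (has_valueM hc hd)).
by apply: has_valueM; apply: translate_value.
Qed.

Lemma translateC g c : translate g (ratC X c) = ratC X c.
Proof.
apply: (@translate_eqI _ _ _ setT); first exact: (opn_setT XF).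
  exact: (variety_irreducible X).1.
by move=> x _ d hd; rewrite (has_value_uniq hd (has_valueC c x)); apply: has_valueC.
Qed.

Lemma translate_0 g : translate g 0 = 0 :> K. Proof. exact: (translateC g 0). Qed.
Lemma translate_1 g : translate g 1 = 1 :> K. Proof. exact: (translateC g 1). Qed.

Lemma translate_neq0 g a : a != 0 -> translate g a != 0.
Proof. by apply: contraNneq => E; rewrite -(translateK g a) E translate_0. Qed.

Lemma translateV g a : translate g a^-1 = (translate g a)^-1.
Proof.
have [->|a0] := eqVneq a 0; first by rewrite invr0 translate_0 invr0.
apply: (mulfI (translate_neq0 g a0)); rewrite -translateM divff // translate_1.
by rewrite divff // translate_neq0.
Qed.

(** * Translates of prime divisors *)
Lemma act_cover_eq g (Z W : set X) : act g @` Z `<=` W <-> Z `<=` act g^-1%g @` W.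
Proof.
split=> [H x Zx|H _ [x Zx <-]]; first by exists (act g x); rewrite ?actK //; apply: H; exists x.
by have [y Wy <-] := H x Zx; rewrite actVK.
Qed.

Lemma act_imageK g (Z : set X) : act g^-1%g @` (act g @` Z) = Z.
Proof. by rewrite !act_image; apply/seteqP; split => x; rewrite /preimage /= actVK. Qed.

Lemma act_closed g (Z : set X) : closed_set Z -> closed_set (act g @` Z).
Proof.
rewrite /closed_set act_image => oZ.
rewrite (_ : ~` _ = act g^-1%g @^-1` (~` Z)) //.
by apply: morphism_opn => //; apply: act_morph.
Qed.

Lemma act_irreducible g (Z : set X) : irreducible_set Z -> irreducible_set (act g @` Z).
Proof.
move=> [[x Zx] iZ]; split; first by exists (act g x), x.
move=> U V oU oV [_ [[u Zu <-] Uu]] [_ [[v Zv <-] Vv]].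
have [||w [[Zw Uw] Vw]] := iZ (act g @^-1` U) (act g @^-1` V) (morphism_opn (act_morph g) oU)
  (morphism_opn (act_morph g) oV); [by exists u | by exists v |].
by exists (act g w); split => //; split => //; exists w.
Qed.

Section Pd.
Variables (g : G) (P : prime_divisor X).

Fact pd_act_proper : act g @` pd_set P <> setT.
Proof.
move=> E; apply: (pd_proper (p := P)); rewrite -[pd_set P](act_imageK g) E.
exact: act_setT.
Qed.

Fact pd_act_codim1 (Z : set X) : closed_set Z -> irreducible_set Z ->
  act g @` pd_set P `<=` Z -> Z = act g @` pd_set P \/ Z = setT.
Proof.
move=> cZ iZ /act_cover_eq PZ.
case: (pd_codim1 (act_closed g^-1%g cZ) (act_irreducible g^-1%g iZ) PZ) => E.
  by left; rewrite -E -{2}[g]invgK act_imageK.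
by right; rewrite -[Z](act_imageK g^-1%g) E act_setT.
Qed.

Definition pd_act : prime_divisor X :=
  PrimeDivisor (act_closed g (pd_closed P)) (act_irreducible g (pd_irreducible P))
    pd_act_proper pd_act_codim1.

Lemma pd_actE x : pd_set pd_act (act g x) <-> pd_set P x.
Proof. by rewrite -[pd_set pd_act]/(act g @` pd_set P) act_image /preimage /= actK. Qed.

Lemma local_ring_act a : local_ring pd_act (translate g a) <-> local_ring P a.
Proof.
split=> /local_ringP [x [c [Px hx]]]; apply/local_ringP.
  by case: Px => y Py yx; exists y, c; split => //; apply/(translate_valueE g); rewrite yx.
by exists (act g x), c; split; [apply/pd_actE | apply: translate_value].
Qed.

Lemma local_max_act a : local_max pd_act (translate g a) <-> local_max P a.
Proof.
split=> [/(local_maxP (pd_irreducible pd_act))|/(local_maxP (pd_irreducible P))] [h1 h2].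
  apply/(local_maxP (pd_irreducible P)); split; first exact/local_ring_act.
  by move=> x c Px hx; apply: (h2 (act g x)); [apply/pd_actE | apply: translate_value].
apply/(local_maxP (pd_irreducible pd_act)); split; first exact/local_ring_act.
by move=> _ c [x Px <-] /translate_valueE hx; apply: (h2 x).
Qed.

End Pd.

Lemma pd_actM g h P : pd_act (g * h)%g P = pd_act g (pd_act h P).
Proof.
apply: prime_divisor_eq => /=; apply/seteqP; split => [_ [x Px <-]|_ [_ [x Px <-] <-]].
  by rewrite actM; exists (act h x) => //; exists x.
by exists x => //; rewrite actM.
Qed.

Lemma pd_actK g P : pd_act g^-1%g (pd_act g P) = P.
Proof. by apply: prime_divisor_eq; apply: act_imageK. Qed.

Lemma pd_actVK g P : pd_act g (pd_act g^-1%g P) = P.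
Proof. by rewrite -{1}[g]invgK pd_actK. Qed.

Lemma pd_act_stable (P : prime_divisor X) : G_stable P -> forall g, pd_act g P = P.
Proof. by move=> sP g; apply: prime_divisor_eq; apply: sP. Qed.

Lemma uniformizer_act g P t : uniformizer P t -> uniformizer (pd_act g P) (translate g t).
Proof.
move=> [tm H]; split; first exact/local_max_act.
move=> a ma; have [b hb E] : exists2 b, local_ring P b & translate g^-1%g a = b * t.
  by apply: H; apply/(local_max_act g); rewrite translateVK.
by exists (translate g b); [apply/local_ring_act | rewrite -translateM -E translateVK].
Qed.

Lemma translateX g a (m : int) : translate g (a ^ m) = translate g a ^ m.
Proof.
have H n : translate g (a ^+ n) = translate g a ^+ n.
  by elim: n => [|n IH]; rewrite ?expr0 ?translate_1 // !exprS translateM IH.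
case: m => n; first by rewrite -!exprnP H.
by rewrite NegzE -!exprnN translateV H.
Qed.

Hypothesis nX : normal_variety X.

Lemma ord_act g P a : a != 0 -> ord (pd_act g P) (translate g a) = ord P a.
Proof.
move=> a0; have [t [u [ut t0 hu nu E]]] := ord_spec nX P a0.
rewrite {1}E translateM translateX ord_unit //.
- exact: uniformizer_act.
- exact: translate_neq0.
- exact/local_ring_act.
- by move=> /local_max_act.
Qed.

End Translate.


(** * [SL_2] has no nontrivial characters *)

Lemma divf_cancel (F : fieldType) (x y z t : F) : t != 0 -> x * (t * z) / (y * t) = x / y * z.
Proof. by move=> t0; rewrite [t * z]mulrC mulrA -mulf_div divff // mulr1 mulrAC. Qed.

Section Perfect.
Variable k : closedFieldType.
Local Notation G := (sl2 k).

Lemma upperM s t : (upper s * upper t)%g = upper (s + t) :> G.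
Proof.
have [a1 a2 a3 a4] := upperE s; have [b1 b2 b3 b4] := upperE t.
have [c1 c2 c3 c4] := upperE (s + t).
apply: sl2_eq; rewrite sl2M ?a1 ?a2 ?a3 ?a4 ?b1 ?b2 ?b3 ?b4 ?c1 ?c2 ?c3 ?c4; ring.
Qed.

Lemma lowerM s t : (lower s * lower t)%g = lower (s + t) :> G.
Proof.
have [a1 a2 a3 a4] := lowerE s; have [b1 b2 b3 b4] := lowerE t.
have [c1 c2 c3 c4] := lowerE (s + t).
apply: sl2_eq; rewrite sl2M ?a1 ?a2 ?a3 ?a4 ?b1 ?b2 ?b3 ?b4 ?c1 ?c2 ?c3 ?c4; ring.
Qed.

Lemma tdiag_upper l (l0 : l != 0) t : (tdiag l0 * upper t)%g = (upper (l ^+ 2 * t) * tdiag l0)%g :> G.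
Proof.
have [a1 a2 a3 a4] := upperE t; have [b1 b2 b3 b4] := tdiagE l0.
have [c1 c2 c3 c4] := upperE (l ^+ 2 * t).
by apply: sl2_eq; rewrite !sl2M ?a1 ?a2 ?a3 ?a4 ?b1 ?b2 ?b3 ?b4 ?c1 ?c2 ?c3 ?c4; field.
Qed.

Lemma lower_tdiag l (l0 : l != 0) t : (lower t * tdiag l0)%g = (tdiag l0 * lower (l ^+ 2 * t))%g :> G.
Proof.
have [a1 a2 a3 a4] := lowerE t; have [b1 b2 b3 b4] := tdiagE l0.
have [c1 c2 c3 c4] := lowerE (l ^+ 2 * t).
by apply: sl2_eq; rewrite !sl2M ?a1 ?a2 ?a3 ?a4 ?b1 ?b2 ?b3 ?b4 ?c1 ?c2 ?c3 ?c4; field.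
Qed.

(* SL_2(k) is perfect, so that it has no nontrivial characters. *)
Lemma sl2_character (chi : G -> k) : (forall g, chi g != 0) ->
  (forall g h, chi (g * h)%g = chi g * chi h) -> forall g, chi g = 1.
Proof.
move=> chi0 chiM.
have [l] : exists l : k, ('X * ('X ^+ 2 - 1)).[l] != 0.
  by apply: exists_nonroot; rewrite mulf_neq0 ?polyX_eq0 // -size_poly_eq0 size_XnsubC.
rewrite !hornerE mulf_eq0 negb_or => /andP [l0 l1].
have chi1 : chi 1%g = 1 by apply: (mulIf (chi0 1%g)); rewrite mul1r -chiM mulg1.
have U t : chi (upper t) = 1.
  pose s := t / (l ^+ 2 - 1); have -> : t = l ^+ 2 * s - s by rewrite /s; field.
  have e : chi (upper (l ^+ 2 * s)) = chi (upper s).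
    by apply: (mulIf (chi0 (tdiag l0))); rewrite -!chiM -tdiag_upper !chiM mulrC.
  by rewrite -upperM chiM e -chiM upperM subrr upper0.
have L t : chi (lower t) = 1.
  pose s := t / (l ^+ 2 - 1); have -> : t = l ^+ 2 * s - s by rewrite /s; field.
  have e : chi (lower (l ^+ 2 * s)) = chi (lower s).
    by apply: (mulfI (chi0 (tdiag l0))); rewrite -!chiM -lower_tdiag !chiM mulrC.
  by rewrite -lowerM chiM e -chiM lowerM subrr lower0.
by move=> g; have [s [a [c [b ->]]]] := elementary_factor g; rewrite !chiM !U !L !mulr1.
Qed.

End Perfect.

(** * The open orbit and the uniqueness of linearizations *)

Section Orbit.
Variables (k : closedFieldType) (n : nat) (X : embedding k n).
Hypothesis nX : normal_variety X.
Local Notation XF := (variety_functions X).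
Local Notation K := (ratfun X).
Local Notation G := (sl2 k).
Implicit Types (g h : G) (a b : K).

Definition orb (g : G) : X := embedding_map X (coset_map [set 1%g] (@mu k n) g).

Lemma orbM g h : orb (g * h)%g = act g (orb h).
Proof. exact: embedding_equivariant. Qed.

Definition open_orbit : set X := range (embedding_map X).

Lemma open_orbitP x : open_orbit x <-> exists g, x = orb g.
Proof.
split=> [[C _ <-]|[g ->]]; last by exists (coset_map [set 1%g] (@mu k n) g).
have [g Cg] := svalP C; exists g; rewrite /orb; congr (embedding_map X).
by case: C Cg => C HC Cg; apply: eq_exist.
Qed.

Lemma open_orbit_opn : opn open_orbit.
Proof. by have [] := embedding_open X. Qed.

Lemma orb_open g : open_orbit (orb g). Proof. by apply/open_orbitP; exists g. Qed.

Lemma orb_transitive g h : orb g = act (g * h^-1)%g (orb h).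
Proof. by rewrite -orbM -mulgA mulVg mulg1. Qed.

Lemma orb_morph : @morphism k (sl2_space k) X orb.
Proof.
have [_ oO oi ri] := embedding_open X; move=> V oV; rewrite setTI.
have E : embedding_map X @` (embedding_map X @^-1` V) = V `&` open_orbit.
  by apply/seteqP; split => [y [C VC <-]|y [VC [C _ EC]]]; [split => //; exists C | exists C; rewrite /preimage /= ?EC].
have oVO : opn (V `&` open_orbit) := opn_setI XF oV oO.
have := (oi (embedding_map X @^-1` V)).2; rewrite E => /(_ oVO) oVi; split => // f rf.
have := (ri (embedding_map X @^-1` V) f).2; rewrite E; apply.
by apply: (reg_restrict XF oVO _ rf) => x [].
Qed.

Lemma orb_pull_reg (W : set G) a f : opn (s := sl2_space k) W ->
  (forall g, W g -> has_value a (orb g) (f g)) -> reg (s := sl2_space k) W f.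
Proof.
move=> oW H; apply: (reg_local (sl2_space_functions k)) => // g Wg.
have [U [F [gF Ug E]]] := H g Wg.
have rF := morphism_reg XF orb_morph (germ_reg gF).
have oWU : opn (s := sl2_space k) (W `&` (orb @^-1` U)).
  by apply: (opn_setI (sl2_space_functions k)) => //; apply: (morphism_opn orb_morph); apply: (reg_opn XF (germ_reg gF)).
exists (W `&` (orb @^-1` U)); split; [by split | by move=> h [] | ].
apply: (reg_ext (sl2_space_functions k)) (reg_restrict (sl2_space_functions k) oWU _ rF).
  by move=> h [Wh Uh] /=; apply: (@has_value_uniq _ _ a (orb h)); [exists U, F | exact: H].
by move=> h [].
Qed.

Lemma sl2_rat_value (W : set G) a : opn (s := sl2_space k) W -> W !=set0 ->
  exists g c, W g /\ has_value a (orb g) c.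
Proof.
move=> oW W0; have [U [f gf]] := germ_ex a; have oU := reg_opn XF (germ_reg gf).
have [|y0 [Ux [C _ EC]]] := meet_neq0 oU open_orbit_opn (germ_neq0 gf).
  by exists (orb 1%g); apply: orb_open.
have [g Eg] : exists g, embedding_map X C = orb g by apply/open_orbitP; exists C.
have [|h [Wh Uh]] := sl2_meet oW (morphism_opn orb_morph oU) W0.
  by exists g; rewrite /preimage /= -Eg EC.
by exists h, (f (orb h)); split => //; exists U, f.
Qed.

Lemma sl2_rat_neq0 (W : set G) a : opn (s := sl2_space k) W -> W !=set0 -> a != 0 ->
  exists g c, [/\ W g, has_value a (orb g) c & c != 0].
Proof.
move=> oW W0 a0; have [U [f gf]] := germ_ex a; have oU := reg_opn XF (germ_reg gf).
have [h [c [[Wh Uh] hc]]] : exists h c, (W `&` (orb @^-1` U)) h /\ has_value a^-1 (orb h) c.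
  apply: sl2_rat_value.
    by apply: (opn_setI (sl2_space_functions k)) => //; apply: (morphism_opn orb_morph).
  have [|w Hw] := sl2_meet oW (morphism_opn orb_morph oU) W0; last by exists w.
  have [g [d [_ [V [f' [gf' Vg _]]]]]] := sl2_rat_value a (opn_setT (sl2_space_functions k)) (ex_intro _ 1%g I).
  have [|y0 [[Ux Vx] [C _ EC]]] := meet_neq0 (opn_setI XF oU (reg_opn XF (germ_reg gf'))) open_orbit_opn
      (meet_neq0 oU (reg_opn XF (germ_reg gf')) (germ_neq0 gf) (germ_neq0 gf')).
    by exists (orb 1%g); apply: orb_open.
  have [g' Eg] : exists g, embedding_map X C = orb g by apply/open_orbitP; exists C.
  by exists g'; rewrite /preimage /= -Eg EC.
have hf : has_value a (orb h) (f (orb h)) by exists U, f.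
exists h, (f (orb h)); split => //; apply/eqP => f0.
have := has_value_uniq (has_value1 (orb h)); have := has_valueM hf hc.
by rewrite divff // f0 mul0r => h1 /(_ _ h1) /eqP; rewrite oner_eq0.
Qed.

Lemma sl2_rat_eqI (W : set G) a b : opn (s := sl2_space k) W -> W !=set0 ->
  (forall g c, W g -> has_value a (orb g) c -> has_value b (orb g) c) -> a = b.
Proof.
move=> oW W0 H; apply/eqP; rewrite -subr_eq0; apply: contrapT => /negP ab.
have [U [f gf]] := germ_ex a; have oU := reg_opn XF (germ_reg gf).
have [g0 [c0 [Wg0 [V [f' [gf' Vg _]]]]]] := sl2_rat_value a oW W0.
have oV := reg_opn XF (germ_reg gf').
have [|||g [c [[Wg Ug] hc c1]]] := @sl2_rat_neq0 (W `&` (orb @^-1` V)) (a - b).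
- by apply: (opn_setI (sl2_space_functions k)) => //; apply: (morphism_opn orb_morph).
- by exists g0.
- by [].
have ha : has_value a (orb g) (f' (orb g)) by exists V, f'.
have hb := H g _ Wg ha.
by move: c1; rewrite (has_value_uniq hc (has_valueB ha hb)) subrr eqxx.
Qed.

(** By [hartogs], [a] and [a^-1] are regular on the orbit. Pulled back to [G], they are mutually
    inverse polynomial functions, and [polyfun_unit] applies. *)
Lemma orbit_unit_const a : a != 0 -> (forall g (P : prime_divisor X), pd_set P (orb g) -> ord P a = 0) ->
  exists2 c, c != 0 & a = ratC X c.
Proof.
move=> a0 H.
have ra b : b != 0 -> (forall g (P : prime_divisor X), pd_set P (orb g) -> ord P b = 0) ->
    exists2 f, polyfun f & forall g, has_value b (orb g) (f g).
  move=> b0 Hb; have Hr g : exists c, has_value b (orb g) c.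
    by apply/reg_atP; apply: (hartogs nX b0) => P Pg; rewrite (Hb g).
  have [f Hf] := choice Hr; exists f => //; apply: reg_polyfun.
  by apply: orb_pull_reg => //; apply: (opn_setT (sl2_space_functions k)).
have [f pf Hf] := ra a a0 H.
have [|g P Pg|f' _ Hf'] := ra a^-1; first by rewrite invr_eq0.
  by rewrite ordV // (H g) // oppr0.
have ff g : f g * f' g = 1.
  have := has_valueM (Hf g) (Hf' g); rewrite divff // => h.
  exact: (has_value_uniq h (has_value1 _)).
have f0 g : f g != 0.
  by apply: contraTneq isT => E; have := ff g; rewrite E mul0r => /eqP; rewrite eq_sym oner_eq0.
exists (f 1%g) => //; apply: (@sl2_rat_eqI setT).
- exact: (opn_setT (sl2_space_functions k)).
- by exists 1%g.
- move=> g c _ hc; rewrite (has_value_uniq hc (Hf g)) (polyfun_unit pf f0 g 1%g).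
  exact: has_valueC.
Qed.

Lemma unit_const a : a != 0 -> (forall P : prime_divisor X, ord P a = 0) ->
  exists2 c, c != 0 & a = ratC X c.
Proof. by move=> a0 H; apply: orbit_unit_const. Qed.

(** * Linearizations *)
Section Linearization.
Variables (D : weil_divisor X) (phi : G -> K -> K).
Hypothesis Hphi : linearization D phi.

(** A linearization is thus determined by the cocycle [phi g 1], whose cocycle identity is
    [lin_M]. *)
Lemma lin_E g a : phi g a = translate g a * phi g 1.
Proof. by rewrite -{1}[a]mulr1 (lin_semi Hphi). Qed.

Lemma lin_M g h : phi (g * h)%g 1 = phi g 1 * translate g (phi h 1).
Proof. by rewrite (linM Hphi) lin_E mulrC. Qed.

Lemma lin_inv g : translate g (phi g^-1%g 1) * phi g 1 = 1.
Proof. by rewrite mulrC -lin_M mulgV (lin1 Hphi). Qed.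

Lemma lin_neq0 g : phi g 1 != 0.
Proof. by apply/eqP => E; have := lin_inv g; rewrite E mulr0 => /eqP; rewrite eq_sym oner_eq0. Qed.

Lemma lin_0 g : phi g 0 = 0.
Proof. by rewrite lin_E translate_0 mul0r. Qed.

Lemma lin_eq0 g a : a != 0 -> phi g a != 0.
Proof. by move=> a0; rewrite lin_E mulf_neq0 ?lin_neq0 ?translate_neq0. Qed.

Lemma lin_global g a : global_sections D a -> global_sections D (phi g a).
Proof.
move=> ga; rewrite /global_sections -(act_setT X g).
by apply: (lin_sections Hphi) => //; exact: (opn_setT XF).
Qed.

(** Apply [lin_sections] to the local generator [t ^ (- coeff P D)] of O_X(D) on an open set that
    meets [P] but avoids the other divisors in the supports of [D] and [t]. The reverse inequality
    comes from [g^-1] in [lin_ord]. *)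
Lemma lin_ord_ge g P : coeff P D - coeff (pd_act g P) D <= ord (pd_act g P) (phi g 1).
Proof.
have [t ut t0] := uniformizer_ex nX P; pose m := coeff P D.
have tz : t ^ (- m) != 0 by rewrite expfz_neq0.
have [x Px] := (pd_irreducible P).1.
have [h1 h1'] := local_unitI (pd_irreducible P) Px (has_value1 x) (oner_neq0 k).
have ot : ord P (t ^ (- m)) = - m by rewrite -[t ^ _]mul1r; apply: ord_unit.
have [L HL] := ord_finite nX tz.
have [V [oV PV HV]] := divisor_open P (L ++ freeg.dom D).
have sa : sections D V (t ^ (- m)).
  right=> Q [y [Qy Vy]]; have [->|QP] := eqVneq Q P; first by rewrite ot addNr.
  have QL : Q \notin L ++ freeg.dom D.
    by apply/negP => QL; apply: (HV Q QL QP y Vy).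
  move: QL; rewrite mem_cat negb_or => /andP [QL QD].
  have -> : ord Q (t ^ (- m)) = 0 by apply/eqP/negPn/negP => /HL; rewrite (negPf QL).
  by rewrite coeff_outdom.
have [y [Py Vy]] := PV.
have := lin_sections Hphi g oV sa; case=> [E|/(_ (pd_act g P))].
  by have := lin_eq0 g tz; rewrite E eqxx.
have -> : ord (pd_act g P) (phi g (t ^ (- m))) = - m + ord (pd_act g P) (phi g 1).
  by rewrite lin_E ordM ?lin_neq0 ?translate_neq0 // ord_act // ot.
have ne : pd_set (pd_act g P) `&` act g @` V !=set0.
  by exists (act g y); split; exists y.
move=> /(_ ne); rewrite -/m; lia.
Qed.

(* [c(g) = phi g 1] is a rational section of O(gD - D) without zeros and poles. *)
Lemma lin_ord g P : ord (pd_act g P) (phi g 1) = coeff P D - coeff (pd_act g P) D.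
Proof.
apply/eqP; rewrite eq_le lin_ord_ge andbT.
have := lin_ord_ge g^-1%g (pd_act g P); rewrite pd_actK => le.
have := congr1 (ord (pd_act g P)) (lin_inv g).
rewrite ordM ?lin_neq0 ?translate_neq0 ?lin_neq0 // ord_act ?lin_neq0 // ord1 //; lia.
Qed.

End Linearization.

(** For each [g] the quotient of the cocycles has no zeros or poles, so it is a scalar by
    [unit_const]. These scalars form a character of [SL_2], which is trivial. *)
Lemma cocycle_uniq (c c' : G -> K) :
  (forall g h, c (g * h)%g = c g * translate g (c h)) ->
  (forall g h, c' (g * h)%g = c' g * translate g (c' h)) ->
  (forall g, c g != 0) -> (forall g, c' g != 0) ->
  (forall g P, ord P (c g) = ord P (c' g)) -> c =1 c'.
Proof.
move=> cM c'M c0 c'0 E g.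
have H g' : exists2 z, z != 0 & c g' / c' g' = ratC X z.
  apply: unit_const; first by rewrite mulf_neq0 ?invr_eq0.
  by move=> P; rewrite ordM ?invr_eq0 // ordV // E subrr.
have [chi chi0 Hchi] : exists2 chi : G -> k, forall g, chi g != 0 & forall g, c g / c' g = ratC X (chi g).
  have H' g' : exists z, z != 0 /\ c g' / c' g' = ratC X z by have [z z0 E'] := H g'; exists z.
  by have [chi Hchi] := choice H'; exists chi => g'; have [] := Hchi g'.
have chiM g1 g2 : chi (g1 * g2)%g = chi g1 * chi g2.
  apply: (fmorph_inj (ratC X)); rewrite rmorphM /= -(Hchi (g1 * g2)%g) cM c'M.
  have T : translate g1 (c g2) = translate g1 (c' g2) * ratC X (chi g2).
    by rewrite -[ratC X (chi g2)](translateC X g1) -Hchi -translateM mulrC divfK.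
  by rewrite T -(Hchi g1); apply: divf_cancel; apply: translate_neq0.
by rewrite -[c g](divfK (c'0 g)) Hchi (sl2_character chi0 chiM) rmorph1 mul1r.
Qed.

Lemma lin_uniq D (phi : G -> K -> K) (c : G -> K) : linearization D phi ->
  (forall g h, c (g * h)%g = c g * translate g (c h)) -> (forall g, c g != 0) ->
  (forall g P, ord (pd_act g P) (c g) = coeff P D - coeff (pd_act g P) D) ->
  forall g, phi g 1 = c g.
Proof.
move=> Hphi cM c0 Hc; apply: cocycle_uniq => //.
- exact: (lin_M Hphi).
- exact: (lin_neq0 Hphi).
- by move=> g P; rewrite -(pd_actVK g P) (lin_ord Hphi) Hc.
Qed.

(** The product of the cocycles of [D] and [E] has the orders that the cocycle of [D + E] must have,
    so uniqueness identifies them. *)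
Lemma lin_mul D E phiD phiE phiDE : linearization D phiD -> linearization E phiE ->
  linearization (D + E) phiDE -> forall g a b, phiDE g (a * b) = phiD g a * phiE g b.
Proof.
move=> HD HE HDE g a b.
have H : forall g, phiDE g 1 = phiD g 1 * phiE g 1.
  apply: (lin_uniq HDE) => [g1 g2|g'|g' P].
  - by rewrite (lin_M HD) (lin_M HE) translateM mulrACA.
  - by rewrite mulf_neq0 ?(lin_neq0 HD) ?(lin_neq0 HE).
  - rewrite ordM ?(lin_neq0 HD) ?(lin_neq0 HE) // (lin_ord HD) (lin_ord HE) !coeffD.
    by rewrite opprD addrACA.
by rewrite (lin_E HDE) (lin_E HD) (lin_E HE) translateM H mulrACA.
Qed.

Lemma lin_invariant D phi : linearization D phi ->
  (forall g (P : prime_divisor X), coeff (pd_act g P) D = coeff P D) -> forall g, phi g 1 = 1.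
Proof.
move=> HD H; apply: (lin_uniq HD) => [g1 g2|g'|g' P].
- by rewrite translate_1 mulr1.
- exact: oner_neq0.
- by rewrite ord1 // H subrr.
Qed.

End Orbit.


(** * Functions on [G x G] as finite sums of products *)

Section PolyfunMore.
Variable k : closedFieldType.
Local Notation G := (sl2 k).
Local Notation GF := (sl2_space_functions k).

Lemma polyfun_opn (f : G -> k) : polyfun f -> opn (s := sl2_space k) [set g | f g != 0].
Proof.
move=> pf; have := reg_opn GF (reg_inv GF (polyfun_reg pf)).
by rewrite (_ : _ `&` _ = [set g | f g != 0]) //; apply/seteqP; split => // x [].
Qed.

Lemma polyfun_sum (I : Type) (r : seq I) (f : I -> G -> k) : (forall i, polyfun (f i)) ->
  polyfun (fun g => \sum_(i <- r) f i g).
Proof.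
move=> H; elim: r => [|i r IH].
  by apply: (polyfun_ext _ (polyfun_cst 0)) => g; rewrite big_nil.
by apply: (polyfun_ext _ (polyfunD (H i) IH)) => g; rewrite big_cons.
Qed.

Lemma polyfun_entryV i j : polyfun (fun g : G => sl2_mx g^-1%g i j).
Proof.
case: (ord2P i) => ->; case: (ord2P j) => ->.
- by apply: (polyfun_ext _ (polyfun_entry k 1 1)) => g; case: (sl2_VE g).
- by apply: (polyfun_ext _ (polyfunM (polyfun_cst (-1)) (polyfun_entry k 0 1))) => g; rewrite mulN1r; case: (sl2_VE g).
- by apply: (polyfun_ext _ (polyfunM (polyfun_cst (-1)) (polyfun_entry k 1 0))) => g; rewrite mulN1r; case: (sl2_VE g).
- by apply: (polyfun_ext _ (polyfun_entry k 0 0)) => g; case: (sl2_VE g).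
Qed.

(* Functions on G x G which are finite sums of products. *)
Definition separable_fun (h : G -> G -> k) := exists N (p q : 'I_N -> G -> k),
  (forall i, polyfun (p i)) /\ forall g x, h g x = \sum_i p i g * q i x.

Lemma separable_fun1 (p q : G -> k) : polyfun p -> separable_fun (fun g x => p g * q x).
Proof. by move=> Hp; exists 1%N, (fun=> p), (fun=> q); split => // g x; rewrite big_ord1. Qed.

Lemma separable_funD h1 h2 : separable_fun h1 -> separable_fun h2 ->
  separable_fun (fun g x => h1 g x + h2 g x).
Proof.
move=> [N [p [q [Hp E]]]] [N' [p' [q' [Hp' E']]]].
pose sp T (u : 'I_N -> T) (v : 'I_N' -> T) (i : 'I_(N + N')) :=
  match fintype.split i with inl j => u j | inr j => v j end.
exists (N + N')%N, (sp _ p p'), (sp _ q q'); split.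
  by move=> i; rewrite /sp; case: fintype.split.
move=> g x; rewrite E E' big_split_ord; congr (_ + _); apply: eq_bigr => i _ /=; rewrite /sp.
  by rewrite (unsplitK (inl i)).
by rewrite (unsplitK (inr i)).
Qed.

Lemma separable_funM h1 h2 : separable_fun h1 -> separable_fun h2 ->
  separable_fun (fun g x => h1 g x * h2 g x).
Proof.
move=> [N [p [q [Hp E]]]] [N' [p' [q' [Hp' E']]]].
exists #|{: 'I_N * 'I_N'}|, (fun i g => p (enum_val i).1 g * p' (enum_val i).2 g),
  (fun i x => q (enum_val i).1 x * q' (enum_val i).2 x); split.
  by move=> i; apply: polyfunM.
move=> g x; rewrite E E' big_distrlr /= pair_big /=.
rewrite (reindex (@enum_val _ {: 'I_N * 'I_N'})) /=; last by apply: onW_bij; apply: enum_val_bij.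
by apply: eq_bigr => i _; rewrite mulrACA.
Qed.

Lemma separable_fun_ext h1 h2 : (forall g x, h1 g x = h2 g x) -> separable_fun h1 -> separable_fun h2.
Proof. by move=> E [N [p [q [Hp H]]]]; exists N, p, q; split => // g x; rewrite -E. Qed.

Lemma separable_translate (f : G -> k) : polyfun f -> separable_fun (fun g x => f (g^-1 * x)%g).
Proof.
move: f; apply: polyfun_ind => [f1 f2 E|c|i j|f1 f2|f1 f2].
- by apply: separable_fun_ext => g x.
- by apply: (separable_fun_ext _ (separable_fun1 (fun=> 1) (polyfun_cst c))) => g x; rewrite mulr1.
- apply: (separable_fun_ext _ (separable_funD (separable_fun1 (fun x => x 0 j) (polyfun_entryV i 0))
    (separable_fun1 (fun x => x 1 j) (polyfun_entryV i 1)))) => g x.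
  by rewrite sl2M.
- exact: separable_funD.
- exact: separable_funM.
Qed.

(** Choose points [gs] for which the vectors of values of the [p i] have the largest possible rank.
    Every other such vector is then a combination of these, with coefficients polynomial in [g]
    through a pseudo-inverse. Applied to translates of [f], this puts the orbit of [f] in the span
    of finitely many of its members. *)
Lemma separable_points h : separable_fun h -> exists t (gs : 'I_t -> G) (m : 'I_t -> G -> k),
  (forall j, polyfun (m j)) /\ forall g x, h g x = \sum_j m j g * h (gs j) x.
Proof.
move=> [N [p [q [Hp E]]]].
pose P g : 'rV[k]_N := \row_i p i g.
pose M t (gs : 'I_t -> G) : 'M[k]_(t, N) := \matrix_(j, i) p i (gs j).
pose S r := `[< exists t (gs : 'I_t -> G), \rank (M t gs) = r >].
have exS : exists r, S r.
  by exists (\rank (M 0%N (fun=> 1%g))); apply/asboolP; exists 0%N, (fun=> 1%g).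
have [r] : exists r, S r /\ forall r', S r' -> (r' <= r)%N.
  have [|r Sr Hr] := ex_maxnP exS (m := N); last by exists r.
  by move=> r /asboolP [t [gs <-]]; apply: rank_leq_col.
move=> [/asboolP [t [gs rE]] Hmax].
have sub g : (P g <= M t gs)%MS.
  pose gs' (j : 'I_(t + 1)) := match fintype.split j with inl i => gs i | inr _ => g end.
  have ME : M (t + 1)%N gs' = col_mx (M t gs) (P g).
    apply/matrixP => i j; rewrite !mxE /gs'.
    by case: fintype.split => i'; rewrite !mxE.
  have sM : (M t gs <= M (t + 1)%N gs')%MS by rewrite ME -addsmxE addsmxSl.
  have sP : (P g <= M (t + 1)%N gs')%MS by rewrite ME -addsmxE addsmxSr.
  apply: submx_trans sP _; have [_ <-] := mxrank_leqif_sup sM.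
  rewrite eqn_leq mxrankS //= rE; apply: Hmax; apply/asboolP.
  by exists (t + 1)%N, gs'.
exists t, gs, (fun j g => (P g *m pinvmx (M t gs)) 0 j); split.
  move=> j; apply: (polyfun_ext (f1 := fun g => \sum_i p i g * pinvmx (M t gs) i j)) => [g|].
    by rewrite [RHS]mxE; apply: eq_bigr => i _; rewrite [P g 0 i]mxE.
  by apply: polyfun_sum => i; apply: polyfunM => //; apply: polyfun_cst.
move=> g x; rewrite E; have PE i : p i g = \sum_j (P g *m pinvmx (M t gs)) 0 j * p i (gs j).
  have := congr1 (fun A : 'rV_N => A 0 i) (mulmxKpV (sub g)).
  by rewrite [P g 0 i]mxE => <-; rewrite mxE; apply: eq_bigr => j _; rewrite [M t gs j i]mxE.
under eq_bigr => i _ do rewrite PE mulr_suml.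
rewrite exchange_big; apply: eq_bigr => j _; rewrite E mulr_sumr.
by apply: eq_bigr => i _; rewrite mulrA.
Qed.

(** Nonempty open subsets of [G] meet, so finitely many proper closed subsets cannot cover it. *)
Lemma sl2_cover (T : eqType) (L : seq T) (S : T -> set G) :
  (forall Q, opn (s := sl2_space k) (~` S Q)) ->
  (forall h, exists Q, Q \in L /\ S Q h) -> exists Q, Q \in L /\ forall h, S Q h.
Proof.
move=> oS cov; apply: contrapT => H.
have {}H Q : Q \in L -> exists h, ~ S Q h.
  move=> QL; apply: contrapT => H'; apply: H; exists Q; split => // h.
  by apply: contrapT => nS; apply: H'; exists h.
suff [V [oV [h Vh] HV]] : exists V, [/\ opn (s := sl2_space k) V, V !=set0 &
    forall h, V h -> forall Q, Q \in L -> ~ S Q h].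
  by have [Q [QL SQ]] := cov h; apply: (HV h Vh Q QL SQ).
elim: L H {cov} => [|Q L IH] H.
  by exists setT; split => //; [exact: (opn_setT GF) | exists 1%g].
have [|V [oV V0 HV]] := IH; first by move=> Q' Q'L; apply: H; rewrite inE Q'L orbT.
exists (V `&` ~` S Q); split; first exact: (opn_setI GF).
  by apply: sl2_meet => //; apply: H; apply: mem_head.
by move=> h [Vh nS] Q'; rewrite inE => /orP [/eqP -> //|]; apply: HV.
Qed.

End PolyfunMore.

(** * Sections of divisorial sheaves as polynomial functions on [G] *)

Section Frames.
Variables (k : closedFieldType) (n : nat) (X : embedding k n).
Hypothesis nX : normal_variety X.
Local Notation XF := (variety_functions X).
Local Notation GF := (sl2_space_functions k).
Local Notation K := (ratfun X).
Local Notation G := (sl2 k).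
Implicit Types (g h : G) (a b : K) (D E : weil_divisor X) (W : set G) (F f : G -> k).

(* The orbit map is [orb : G -> X]; [F] trivializes, on [W], the pullback of O_X(D) to [G]
   compatibly with the linearization. *)
Record frame D (phi : G -> K -> K) W F : Prop := Frame {
  frame_lin : linearization D phi;
  frame_opn : opn (s := sl2_space k) W;
  frame_neq0 : W !=set0;
  frame_nz : forall x, W x -> F x != 0;
  frame_reg : reg (s := sl2_space k) W F;
  frame_supp : forall x P, W x -> pd_set P (orb X x) -> coeff P D = 0;
  frame_val : forall g x, W x -> W (g * x)%g ->
    has_value (phi g 1) (orb X (g * x)%g) (F (g * x)%g / F x) }.

Lemma mull_morph h : @morphism k (sl2_space k) (sl2_space k) (fun g => (h * g)%g).
Proof. by apply: sl2_morphism => i j; apply: polyfun_mull. Qed.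

Lemma mulr_morph h : @morphism k (sl2_space k) (sl2_space k) (fun g => (g * h)%g).
Proof. by apply: sl2_morphism => i j; apply: polyfun_mulr. Qed.

(** The linearization carries the fiber over a base point [orb X y0] to the fiber over [orb X x] by
    the element [x * y0^-1]. So [F x] is the value of [phi (x * y0^-1) 1] at [orb X x]. The
    algebraicity clause makes it regular, and the cocycle identity gives [frame_val]. *)
Lemma frame_ex D phi : linearization D phi -> exists W F, frame D phi W F.
Proof.
move=> Hphi; have [W0 [F0 [W00 rF0 HF0]]] := lin_algebraic Hphi 1.
have [[g0 x1] /= W01] := W00.
have s1 : @morphism k X (prod_space (sl2_space k) X) (fun x => (g0, x)).
  exact: (prod_pullback XF GF XF (morphism_cst (g0 : sl2_space k) XF) (morphism_id XF)).
have oW0 : opn W0.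
  move=> z Wz; have [U [V [p [q [oUV UVz [_ tq] qz H]]]]] := rF0 z Wz.
  by exists U, V, q; split => // w Uw Vw qw; have [] := H w Uw Vw qw.
have oW1 : opn (s := X) ((fun x => (g0, x)) @^-1` W0) := morphism_opn s1 oW0.
have W1ne : ((fun x => (g0, x)) @^-1` W0) !=set0 by exists x1.
have [oV V0] := opn_avoid (freeg.dom D).
set V := [set y | _] in oV V0.
have oS : opn (s := sl2_space k) [set z | W0 (g0, orb X z)] := morphism_opn (@orb_morph k n X) oW1.
have [z [c [Wz hc c0]]] : exists z c, [/\ [set z | W0 (g0, orb X z)] z,
    has_value (phi g0 1) (orb X z) c & c != 0].
  apply: sl2_rat_neq0 => //; last exact: (lin_neq0 Hphi).
  have [|x [W1x [C _ EC]]] := meet_neq0 oW1 (open_orbit_opn X) W1ne.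
    by exists (orb X 1%g); apply: orb_open.
  have [g Eg] : exists g, embedding_map X C = orb X g by apply/open_orbitP; exists C.
  by exists g; rewrite /= -Eg EC.
pose y0 := (g0^-1 * z)%g.
(* The choice of [y0] gives [rho z = (g0, orb X z)], a point of [W0] where [F0] is nonzero. *)
pose rho (x : sl2_space k) := ((x * y0^-1)%g, orb X x) : prod_space (sl2_space k) X.
have mrho : @morphism k (sl2_space k) (prod_space (sl2_space k) X) rho.
  exact: (prod_pullback GF GF XF (mulr_morph _) (@orb_morph k n X)).
have rhoz : rho z = (g0, orb X z).
  by rewrite /rho /y0 invgM invgK mulVKg.
have mW := mrho W0 oW0; rewrite setTI in mW; have [oR rR] := mW.
have rR0 := rR _ rF0.
have F0E y c' : W0 (rho y) -> has_value (phi (y * y0^-1)%g 1) (orb X y) c' -> c' = F0 (rho y).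
  by move=> Wy hy; apply: (has_value_uniq hy (HF0 _ Wy)).
have oVo := morphism_opn (@orb_morph k n X) oV.
pose W := (rho @^-1` W0 `&` [set x | F0 (rho x) != 0]) `&` (orb X @^-1` V).
have oW' : opn (s := sl2_space k) (rho @^-1` W0 `&` [set x | F0 (rho x) != 0]).
  exact: (reg_opn GF (reg_inv GF rR0)).
have oW : opn (s := sl2_space k) W by apply: (opn_setI GF).
exists W, (fun x => F0 (rho x)); split => //.
- apply: sl2_meet => //.
    exists z; split; rewrite /preimage /= rhoz //.
    by have := HF0 (g0, orb X z) Wz => /= h; rewrite -(has_value_uniq hc h).
  have [|x [Vx [C _ EC]]] := meet_neq0 oV (open_orbit_opn X) V0.
    by exists (orb X 1%g); apply: orb_open.
  have [g Eg] : exists g, embedding_map X C = orb X g by apply/open_orbitP; exists C.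
  by exists g; rewrite /preimage /= -Eg EC.
- by move=> x [[]].
- by apply: (reg_restrict GF oW _ rR0) => x [[]].
- move=> x P [_ Vx] Px; apply: coeff_outdom; apply/negP => PD; exact: (Vx P PD Px).
- move=> g x [[Wx Fx] _] [[Wgx Fgx] _].
  have h1 := HF0 _ Wgx; have h2 := HF0 _ Wx; rewrite /= in h1 h2.
  have E : phi g 1 = phi (g * x * y0^-1)%g 1 / translate g (phi (x * y0^-1)%g 1).
    rewrite -[(g * x * _)%g]mulgA (lin_M Hphi g) mulfK // translate_neq0 //.
    exact: (lin_neq0 Hphi).
  rewrite E; apply: has_valueM => //; apply: has_valueV => //.
  by rewrite orbM; apply: translate_value.
Qed.

Lemma frame_mul D E phiD phiE phiDE W F W' F' : frame D phiD W F -> frame E phiE W' F' ->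
  linearization (D + E) phiDE -> frame (D + E) phiDE (W `&` W') (fun x => F x * F' x).
Proof.
move=> fD fE HDE; have oW := opn_setI GF (frame_opn fD) (frame_opn fE); split => //.
- exact: (sl2_meet (frame_opn fD) (frame_opn fE) (frame_neq0 fD) (frame_neq0 fE)).
- by move=> x [Wx Wx']; rewrite mulf_neq0 ?(frame_nz fD) ?(frame_nz fE).
- by apply: (reg_mul GF); [apply: (reg_restrict GF oW _ (frame_reg fD)) => x []
    | apply: (reg_restrict GF oW _ (frame_reg fE)) => x []].
- by move=> x P [Wx Wx'] Px; rewrite coeffD (frame_supp fD Wx Px) (frame_supp fE Wx' Px) addr0.
- move=> g x [Wx Wx'] [Wgx Wgx'].
  rewrite -[X in phiDE g X]mulr1 (lin_mul nX (frame_lin fD) (frame_lin fE) HDE) -mulf_div.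
  by apply: has_valueM; [apply: (frame_val fD) | apply: (frame_val fE)].
Qed.

(** [f] is the pullback of the section [a] to [G] in the frame [F]. Translating by any [g] with
    [g * x] in [W] defines [f] on all of [G], although [F] only lives on [W]. *)
Definition is_sfun (phi : G -> K -> K) W F a f :=
  forall g x, W (g * x)%g -> has_value (phi g a) (orb X (g * x)%g) (f x * F (g * x)%g).

Lemma frame_move D phi W F x : frame D phi W F -> exists g, W (g * x)%g.
Proof. by move=> fr; have [w Ww] := frame_neq0 fr; exists (w * x^-1)%g; rewrite -mulgA mulVg mulg1. Qed.

Lemma sfun_all D phi W F a f : frame D phi W F ->
  (forall x, exists g, W (g * x)%g /\ has_value (phi g a) (orb X (g * x)%g) (f x * F (g * x)%g)) ->
  is_sfun phi W F a f.
Proof.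
move=> fr H g' x Wg'; have [g [Wg hg]] := H x; pose h := (g' * g^-1)%g.
have E : (g' * x)%g = (h * (g * x))%g by rewrite /h -mulgA mulKg.
have -> : phi g' a = translate h (phi g a) * phi h 1.
  by rewrite -(lin_E (frame_lin fr)) -(linM (frame_lin fr)) /h -mulgA mulVg mulg1.
have Fg := frame_nz fr Wg.
have -> : f x * F (g' * x)%g = (f x * F (g * x)%g) * (F (h * (g * x))%g / F (g * x)%g).
    by rewrite -E; field.
apply: has_valueM; first by rewrite E orbM; apply: translate_value.
by rewrite E; apply: (frame_val fr) => //; rewrite -E.
Qed.

(** By [frame_supp], [D] has coefficient 0 on all prime divisors through a point of the orbit coming
    from [W]. There [phi g a] has no poles, and [hartogs] gives it a value. *)
Lemma sfun_ex D phi W F a : frame D phi W F -> global_sections D a ->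
  exists f, polyfun f /\ is_sfun phi W F a f.
Proof.
move=> fr ga; have Hphi := frame_lin fr.
have Hx x : exists gv : G * k, W (gv.1 * x)%g /\ has_value (phi gv.1 a) (orb X (gv.1 * x)%g) gv.2.
  have [g Wg] := frame_move x fr.
  suff [v hv] : exists v, has_value (phi g a) (orb X (g * x)%g) v by exists (g, v).
  have [E0|n0] := eqVneq (phi g a) 0; first by exists 0; rewrite E0; apply: has_value0.
  apply/reg_atP; apply: (hartogs nX n0) => P Px.
  case: (lin_global Hphi g ga) => [/eqP|/(_ P)]; first by rewrite (negPf n0).
  rewrite (frame_supp fr Wg Px) addr0; apply; exists (orb X (g * x)%g); split => //.
have [gv Hgv] := choice Hx.
pose f x := (gv x).2 / F ((gv x).1 * x)%g.
have sf : is_sfun phi W F a f.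
  apply: (sfun_all fr) => x; have [Wg hv] := Hgv x; exists (gv x).1; split => //.
  by rewrite /f divfK // (frame_nz fr Wg).
exists f; split => //; apply: reg_polyfun; apply: (reg_local GF); first exact: (opn_setT GF).
move=> x _; have [g Wg] := frame_move x fr.
have rF' := morphism_reg GF (mull_morph g) (frame_reg fr).
have oWg := reg_opn GF rF'.
exists ((fun y => (g * y)%g) @^-1` W); split => //.
have ru : reg (s := sl2_space k) W (fun y => f (g^-1 * y)%g * F y).
  apply: (orb_pull_reg (frame_opn fr) (a := phi g a)) => y Wy.
  have := sf g (g^-1 * y)%g; rewrite mulVKg; exact.
have ru' := morphism_reg GF (mull_morph g) ru.
have rV : reg (s := sl2_space k) ((fun y => (g * y)%g) @^-1` W) (fun y => (F (g * y)%g)^-1).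
  apply: (reg_restrict GF oWg _ (reg_inv GF rF')) => y Wy; split => //.
  exact: (frame_nz fr Wy).
apply: (reg_ext GF) (reg_mul GF ru' rV) => y Wy.
by rewrite /= mulKg mulfK // (frame_nz fr Wy).
Qed.

Lemma sfun_uniq D phi W F a f f' : frame D phi W F ->
  is_sfun phi W F a f -> is_sfun phi W F a f' -> f =1 f'.
Proof.
move=> fr s s' x; have [g Wg] := frame_move x fr; apply: (mulIf (frame_nz fr Wg)).
exact: (has_value_uniq (s g x Wg) (s' g x Wg)).
Qed.

Lemma sfunD D phi W F a b f f' : frame D phi W F ->
  is_sfun phi W F a f -> is_sfun phi W F b f' -> is_sfun phi W F (a + b) (fun x => f x + f' x).
Proof.
move=> fr s s' g x Wg; rewrite (lin_add (frame_lin fr)) mulrDl.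
by apply: has_valueD; [apply: s | apply: s'].
Qed.

Lemma sfunZ D phi W F a c f : frame D phi W F ->
  is_sfun phi W F a f -> is_sfun phi W F (ratC X c * a) (fun x => c * f x).
Proof.
move=> fr s g x Wg; rewrite (lin_semi (frame_lin fr)) translateC -mulrA.
by apply: has_valueM; [apply: has_valueC | apply: s].
Qed.

Lemma sfun0 D phi W F : frame D phi W F -> is_sfun phi W F 0 (fun=> 0).
Proof.
by move=> fr g x Wg; rewrite (lin_0 (frame_lin fr)) mul0r; apply: has_value0.
Qed.

Lemma sfun_sum D phi W F (I : Type) (r : seq I) (a : I -> K) (f : I -> G -> k) : frame D phi W F ->
  (forall i, is_sfun phi W F (a i) (f i)) ->
  is_sfun phi W F (\sum_(i <- r) a i) (fun x => \sum_(i <- r) f i x).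
Proof.
move=> fr s; elim: r => [|i r IH].
  by move=> g x Wg; rewrite !big_nil; apply: (sfun0 fr).
by move=> g x Wg; rewrite !big_cons; apply: (sfunD fr (s i) IH).
Qed.

Lemma sfun_act D phi W F a h f : frame D phi W F ->
  is_sfun phi W F a f -> is_sfun phi W F (phi h a) (fun x => f (h^-1 * x)%g).
Proof.
move=> fr s g x Wg; rewrite -(linM (frame_lin fr)).
by have := s (g * h)%g (h^-1 * x)%g; rewrite -mulgA mulVKg; apply.
Qed.

Lemma sfun_eq0 D phi W F a f : frame D phi W F -> is_sfun phi W F a f ->
  (forall x, f x = 0) -> a = 0.
Proof.
move=> fr s f0; apply/eqP/negPn/negP => a0.
have [g [c [Wg hc c0]]] := sl2_rat_neq0 (frame_opn fr) (frame_neq0 fr) a0.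
have := s 1%g g; rewrite mul1g (lin1 (frame_lin fr)) f0 mul0r => /(_ Wg) h.
by move: c0; rewrite (has_value_uniq hc h) eqxx.
Qed.

(** On functions, [phi g] is left translation by [g], so [separable_points] bounds the span of the
    orbit. Injectivity of the passage to functions ([sfun_eq0]) returns to sections. *)
Lemma sfun_rational D phi a : linearization D phi -> global_sections D a ->
  exists t (gs : 'I_t -> G) (m : 'I_t -> G -> k), (forall j, polyfun (m j)) /\
    forall g, phi g a = \sum_j ratC X (m j g) * phi (gs j) a.
Proof.
move=> Hphi ga; have [W [F fr]] := frame_ex Hphi.
have [f [pf sf]] := sfun_ex fr ga.
have [t [gs [m [pm E]]]] := separable_points (separable_translate pf).
exists t, gs, m; split => // g; apply/eqP; rewrite -subr_eq0; apply/eqP.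
rewrite (_ : phi g a - _ = phi g a + ratC X (-1) * \sum_j ratC X (m j g) * phi (gs j) a); last first.
  by rewrite rmorphN rmorph1 mulN1r.
apply: (sfun_eq0 fr (f := fun x => f (g^-1 * x)%g + -1 * \sum_j m j g * f ((gs j)^-1 * x)%g)).
  apply: (sfunD fr); first exact: (sfun_act _ fr sf).
  apply: (sfunZ _ fr); apply: (sfun_sum _ fr) => j; apply: (sfunZ _ fr); exact: (sfun_act _ fr sf).
by move=> x; rewrite E mulN1r subrr.
Qed.

Lemma sfun_frame D phi W F W' F' : frame D phi W F -> frame D phi W' F' ->
  exists2 c, c != 0 & forall a f, is_sfun phi W F a f -> is_sfun phi W' F' a (fun x => c * f x).
Proof.
move=> fr fr'; have [w [Ww Ww']] := sl2_meet (frame_opn fr) (frame_opn fr') (frame_neq0 fr) (frame_neq0 fr').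
have Fw := frame_nz fr Ww; have Fw' := frame_nz fr' Ww'.
exists (F w / F' w); first by rewrite mulf_neq0 ?invr_eq0.
move=> a f s; apply: (sfun_all fr') => x; pose g := (w * x^-1)%g.
have E : (g * x)%g = w by rewrite /g -mulgA mulVg mulg1.
exists g; rewrite E; split => //; have := s g x; rewrite E => /(_ Ww).
by rewrite mulrAC divfK // mulrC.
Qed.

Lemma sfun_mul D E phiD phiE phiDE W F W' F' a b f f' : frame D phiD W F -> frame E phiE W' F' ->
  linearization (D + E) phiDE -> is_sfun phiD W F a f -> is_sfun phiE W' F' b f' ->
  is_sfun phiDE (W `&` W') (fun x => F x * F' x) (a * b) (fun x => f x * f' x).
Proof.
move=> fD fE HDE s s' g x [Wg Wg']; rewrite (lin_mul nX (frame_lin fD) (frame_lin fE) HDE) mulrACA.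
by apply: has_valueM; [apply: s | apply: s'].
Qed.

(** * Divisors meeting the open orbit *)

(* Both [G] is irreducible and the complement of the open orbit contains only finitely many
   prime divisors, so [G] permutes them trivially. *)
Lemma stable_or_meets (P : prime_divisor X) : G_stable P \/ exists g, pd_set P (orb X g).
Proof.
case: (pselect (exists g, pd_set P (orb X g))) => [|nP]; [by right | left].
have oO := open_orbit_opn X.
have [||L HL] := @finite_divisors _ X (~` @open_orbit k n X).
- by rewrite /closed_set setCK.
- move=> E; have H : (~` @open_orbit k n X) (orb X 1%g) by rewrite E.
  by apply: H; apply: orb_open.
have PO (Q : prime_divisor X) h : (forall g, ~ pd_set Q (orb X g)) -> pd_act h Q \in L.
  move=> nQ; apply: HL => y [x Qx <-] /open_orbitP [g E].
  by apply: (nQ (h^-1 * g)%g); rewrite orbM -E actK.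
have nP' g : ~ pd_set P (orb X g) by move=> H; apply: nP; exists g.
have [V [oV [x0 [Px0 Vx0]] HV]] := divisor_open P L.
(* If [g] moved some [y] of [P] in [V] off [P], consider for [Q] in [L] the closed sets of [h] with
   [act h y] in [Q]. They cover [G], since [act h y] lies in [pd_act h P], so one of them is all of
   [G]. It cannot belong to [P] because of [g], nor to another [Q] because [V] avoids it. *)
have sub g : act g @` pd_set P `<=` pd_set P.
  rewrite -{1}(cl_irreducible_meet (pd_closed P) (pd_irreducible P) oV); last by exists x0.
  move=> _ [x cx <-]; apply: contrapT => nP1.
  have oN : opn (act g @^-1` (~` pd_set P)) := morphism_opn (act_morph g) (pd_closed P).
  have [y [[Py Vy] nPy]] := cx _ oN nP1.
  have [|h|Q [QL HQ]] := @sl2_cover k _ L (fun Q h => pd_set Q (act h y)).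
  - by move=> Q; exact: (morphism_opn (orbit_morph y) (pd_closed Q)).
  - by exists (pd_act h P); split; [apply: PO | apply/pd_actE].
  have [E|QP] := eqVneq Q P; first by apply: nPy; rewrite -E; apply: HQ.
  by apply: (HV Q QL QP y Vy); have := HQ 1%g; rewrite act1.
move=> g; apply/seteqP; split; first exact: sub.
by move=> x Px; exists (act g^-1%g x); rewrite ?actVK //; apply: (sub g^-1%g); exists x.
Qed.

End Frames.


(** * Homogeneous elements of the Cox ring and their divisors of zeros *)

Section CoxRing.
Variables (k : closedFieldType) (n : nat) (X : embedding k n).
Hypothesis nX : normal_variety X.
Local Notation XF := (variety_functions X).
Local Notation GF := (sl2_space_functions k).
Local Notation K := (ratfun X).
Local Notation G := (sl2 k).
Implicit Types (g h : G) (a b : K) (D E : weil_divisor X) (W : set G) (F f : G -> k).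

(** Proportional functions on [G] make [phiD g a / phiE g b] independent of [g], so the difference
    of the two divisors of zeros is [G]-invariant. A prime divisor meeting the orbit can be
    translated to pass through a point where [a / b] has a nonzero value and neither [D] nor [E] is
    supported, so the difference vanishes along it. *)
Lemma sfun_ratio D E phiD phiE W F W' F' a b f f' c : frame D phiD W F -> frame E phiE W' F' ->
  is_sfun phiD W F a f -> is_sfun phiE W' F' b f' -> polyfun f' -> a != 0 -> b != 0 -> c != 0 ->
  (forall x, f x = c * f' x) ->
  (forall P : prime_divisor X, G_stable P -> ord P a + coeff P D = ord P b + coeff P E) ->
  forall P : prime_divisor X, ord P a + coeff P D = ord P b + coeff P E.
Proof.
move=> fD fE sa sb pf' a0 b0 c0 ff' Hst.
have f'ne : [set x | f' x != 0] !=set0.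
  apply: contrapT => H; move/eqP: b0; apply; apply: (sfun_eq0 fE sb) => x.
  by apply/eqP/negPn/negP => fx; apply: H; exists x.
have of' := polyfun_opn pf'.
have HD := frame_lin fD; have HE := frame_lin fE.
have key g : phiD g a / phiE g b = a / b.
  have of'g := morphism_opn (mull_morph g^-1%g) of'.
  have [x0 fx0] := f'ne.
  have f'gne : [set x | f' (g^-1 * x)%g != 0] !=set0 by exists (g * x0)%g; rewrite /= mulKg.
  have oWW := opn_setI GF (frame_opn fD) (frame_opn fE).
  have WWne := sl2_meet (frame_opn fD) (frame_opn fE) (frame_neq0 fD) (frame_neq0 fE).
  have offne := sl2_meet of' of'g f'ne f'gne.
  have off := opn_setI GF of' of'g.
  apply: (sl2_rat_eqI (opn_setI GF oWW off) (sl2_meet oWW off WWne offne)).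
  move=> x d [[Wx Wx'] [/= fx fgx]] hd.
  have F'x := frame_nz fE Wx'.
  have h1 := sa g (g^-1 * x)%g; rewrite mulVKg in h1; have {}h1 := h1 Wx.
  have h2 := sb g (g^-1 * x)%g; rewrite mulVKg in h2; have {}h2 := h2 Wx'.
  have h3 := sa 1%g x; rewrite mul1g (lin1 HD) in h3; have {}h3 := h3 Wx.
  have h4 := sb 1%g x; rewrite mul1g (lin1 HE) in h4; have {}h4 := h4 Wx'.
  rewrite (has_value_uniq hd (has_valueM h1 (has_valueV h2 (mulf_neq0 fgx F'x)))).
  have := has_valueM h3 (has_valueV h4 (mulf_neq0 fx F'x)); rewrite !ff'.
  congr has_value; by field; rewrite fgx F'x fx.
pose gam := a / b; have gam0 : gam != 0 by rewrite mulf_neq0 ?invr_eq0.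
have dP g (P : prime_divisor X) : ord (pd_act g P) gam + coeff (pd_act g P) D - coeff (pd_act g P) E =
    ord P gam + coeff P D - coeff P E.
  rewrite /gam -{1}(key g) (lin_E HD) (lin_E HE) invfM mulrACA -translateV -translateM.
  rewrite !ordM ?mulf_neq0 ?invr_eq0 ?translate_neq0 ?(lin_neq0 HD) ?(lin_neq0 HE) ?mulf_neq0 ?invr_eq0 //.
  rewrite ord_act ?mulf_neq0 ?invr_eq0 // !ordM ?invr_eq0 // !ordV ?(lin_neq0 HE) //.
  rewrite (lin_ord nX HD) (lin_ord nX HE); lia.
have ogam P : ord P gam = ord P a - ord P b by rewrite ordM ?invr_eq0 // ordV.
move=> P; have [sP|[y Py]] := stable_or_meets P; first exact: Hst.
have [oV V0] := opn_avoid (freeg.dom D ++ freeg.dom E); set V := [set y | _] in oV V0.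
have [z [d [Vz hd d0]]] : exists z d, [/\ (orb X @^-1` V) z, has_value gam (orb X z) d & d != 0].
  apply: sl2_rat_neq0 => //; first exact: (morphism_opn (@orb_morph k n X)).
  have [|x [Vx [C _ EC]]] := meet_neq0 oV (open_orbit_opn X) V0.
    by exists (orb X 1%g); apply: orb_open.
  have [g Eg] : exists g, embedding_map X C = orb X g by apply/open_orbitP; exists C.
  by exists g; rewrite /preimage /= -Eg EC.
have Pz : pd_set (pd_act (z * y^-1)%g P) (orb X z) by exists (orb X y) => //; rewrite -orb_transitive.
have out D' : {subset freeg.dom D' <= freeg.dom D ++ freeg.dom E} -> coeff (pd_act (z * y^-1)%g P) D' = 0.
  by move=> H; apply: coeff_outdom; apply/negP => /H; move/(Vz _); apply.
have := dP (z * y^-1)%g P; rewrite (ord_value nX Pz hd d0) !out ?ogam; first lia.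
- by move=> Q QE; rewrite mem_cat QE orbT.
- by move=> Q QD; rewrite mem_cat QD.
Qed.

Variable R : cox_ring X.
Local Notation sec := (cox_sec R).

Lemma global_mul D E a b : global_sections D a -> global_sections E b -> global_sections (D + E) (a * b).
Proof.
move=> [->|Ha]; first by left; rewrite mul0r.
move=> [->|Hb]; first by left; rewrite mulr0.
have [->|a0] := eqVneq a 0; first by left; rewrite mul0r.
have [->|b0] := eqVneq b 0; first by left; rewrite mulr0.
right=> P Pne; rewrite ordM // coeffD addrACA.
by apply: addr_ge0; [apply: Ha | apply: Hb].
Qed.

Lemma globalP D a : a != 0 -> (forall P, 0 <= ord P a + coeff P D) -> global_sections D a.
Proof. by move=> _ H; right=> P _; apply: H. Qed.

Lemma global_ge0 D a (P : prime_divisor X) : a != 0 -> global_sections D a -> 0 <= ord P a + coeff P D.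
Proof.
move=> a0 [E|H]; first by rewrite E eqxx in a0.
by apply: H; have [x Px] := (pd_irreducible P).1; exists x.
Qed.

Lemma global_zero D : global_sections D (0 : K). Proof. by left. Qed.

Lemma global_cst c : global_sections 0 (ratC X c).
Proof.
have [->|c0] := eqVneq c 0; first by left; rewrite rmorph0.
by right=> P _; rewrite ordC // coeff0.
Qed.

Lemma globalD D a b : global_sections D a -> global_sections D b -> global_sections D (a + b).
Proof.
have [->|a0] := eqVneq a 0; first by rewrite add0r.
have [->|b0] := eqVneq b 0; first by rewrite addr0.
move=> ha hb; have [->|ab0] := eqVneq (a + b) 0; first by left.
right=> P _.
have := @ordD _ _ nX P a b (- coeff P D) ab0.
have := global_ge0 P a0 ha; have := global_ge0 P b0 hb.
move=> h1 h2 H; suff : - coeff P D <= ord P (a + b) by lia.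
by apply: H; right; lia.
Qed.

Lemma globalZ D c a : global_sections D a -> global_sections D (ratC X c * a).
Proof. by move=> ha; rewrite -[D]add0r; apply: global_mul => //; apply: global_cst. Qed.

Lemma secD D a b : global_sections D a -> global_sections D b -> sec D (a + b) = sec D a + sec D b.
Proof.
move=> ha hb; have := cox_sec_linear R 1 ha hb.
by rewrite rmorph1 mul1r scale1r.
Qed.

Lemma sec0 D : sec D 0 = 0.
Proof.
have := secD (global_zero D) (global_zero D); rewrite addr0 => /eqP.
by rewrite -subr_eq0 opprD addrA subrr sub0r oppr_eq0 => /eqP.
Qed.

Lemma secZ D c a : global_sections D a -> sec D (ratC X c * a) = c *: sec D a.
Proof.
move=> ha; have := cox_sec_linear R c ha (global_zero D).
by rewrite addr0 sec0 addr0.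
Qed.

Lemma global_sum D (I : Type) (r : seq I) (a : I -> K) : (forall i, global_sections D (a i)) ->
  global_sections D (\sum_(i <- r) a i).
Proof. by move=> H; apply: big_ind => //; [left | move=> *; apply: globalD]. Qed.

Lemma sec_sum D (I : Type) (r : seq I) (a : I -> K) : (forall i, global_sections D (a i)) ->
  sec D (\sum_(i <- r) a i) = \sum_(i <- r) sec D (a i).
Proof.
move=> H; elim: r => [|i r IH]; first by rewrite !big_nil sec0.
by rewrite !big_cons secD ?IH //; apply: global_sum.
Qed.

Lemma sec_inj D a b : global_sections D a -> global_sections D b -> sec D a = sec D b -> a = b.
Proof.
move=> ha hb E; apply/eqP; rewrite -subr_eq0; apply/eqP; apply: (cox_sec_inj (D := D) (c0 := R)).
  have -> : a - b = a + ratC X (-1) * b by rewrite rmorphN rmorph1 mulN1r.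
  by apply: globalD => //; apply: globalZ.
have -> : a - b = a + ratC X (-1) * b by rewrite rmorphN rmorph1 mulN1r.
by rewrite secD ?secZ ?E ?scaleN1r ?subrr //; apply: globalZ.
Qed.

(** Transfer [a] and [a^-1] to degree 0 by [cox_sec_equiv]. Their images are regular on [X] and
    mutually inverse, hence constant. *)
Lemma cox_principal D a : a != 0 -> (forall P, ord P a + coeff P D = 0) ->
  exists2 c, c != 0 & sec D a = c%:A.
Proof.
move=> a0 H.
have pr E b : b != 0 -> (forall P, ord P b + coeff P E = 0) ->
    exists2 z, global_sections 0 z & sec 0 z = sec E b.
  move=> b0 Hb; apply: cox_sec_equiv; last by apply: globalP => // P; rewrite Hb.
  exists b^-1; first by rewrite invr_eq0.
  by move=> P; rewrite ordV // coeff0 subr0; have := Hb P; lia.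
have [z gz Ez] := pr D a a0 H.
have aV0 : a^-1 != 0 by rewrite invr_eq0.
have HV P : ord P a^-1 + coeff P (- D) = 0 by rewrite ordV // coeffN; have := H P; lia.
have [z' gz' Ez'] := pr (- D) a^-1 aV0 HV.
have zz : z * z' = 1.
  have g1 : global_sections 0 (1 : K) by have := global_cst 1; rewrite rmorph1.
  have gzz := global_mul gz gz'; rewrite addr0 in gzz.
  apply: (sec_inj gzz g1).
  have gD : global_sections D a by apply: globalP => // P; rewrite H.
  have gN : global_sections (- D) a^-1 by apply: globalP => // P; rewrite HV.
  rewrite -{1}[0 : weil_divisor X]addr0 -cox_secM // Ez Ez' cox_secM // subrr divff //.
have z0 : z != 0 by apply/eqP => E; move: zz; rewrite E mul0r => /eqP; rewrite eq_sym oner_eq0.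
have z'0 : z' != 0 by apply/eqP => E; move: zz; rewrite E mulr0 => /eqP; rewrite eq_sym oner_eq0.
have [P|c c0 zc] := unit_const nX z0.
  have := global_ge0 P z0 gz; have := global_ge0 P z'0 gz'; rewrite coeff0 !addr0.
  by have := ordM nX P z0 z'0; rewrite zz ord1 //; lia.
exists c => //; rewrite -Ez zc -[ratC X c]mulr1 secZ ?cox_sec1 //.
by have := global_cst 1; rewrite rmorph1.
Qed.

(** The quotient [a / b] is a section of O_X(D - E) without zeros, to which [cox_principal] applies.
    Equality of divisors of zeros thus becomes proportionality in the Cox ring. *)
Lemma cox_unit_ratio D E a b : global_sections D a -> global_sections E b -> a != 0 -> b != 0 ->
  (forall P : prime_divisor X, ord P a + coeff P D = ord P b + coeff P E) ->
  exists2 c, c != 0 & sec D a = c *: sec E b.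
Proof.
move=> ga gb a0 b0 H; have ab0 : a / b != 0 by rewrite mulf_neq0 ?invr_eq0.
have Hab P : ord P (a / b) + coeff P (D - E) = 0.
  rewrite ordM ?invr_eq0 // ordV // coeffB; have := H P; lia.
have [c c0 Ec] := cox_principal ab0 Hab; exists c => //.
have -> : sec D a = sec E b * sec (D - E) (a / b).
  rewrite cox_secM //; first by rewrite addrC subrK mulrC divfK.
  by apply: globalP => // P; rewrite Hab.
by rewrite Ec -scalerAr mulr1.
Qed.

Lemma lin_equiv_sym D E : lin_equiv D E -> lin_equiv E D.
Proof.
move=> [a a0 H]; exists a^-1; first by rewrite invr_eq0.
by move=> P; rewrite ordV // H opprB.
Qed.

Lemma lin_equiv_trans D E D' : lin_equiv D E -> lin_equiv E D' -> lin_equiv D D'.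
Proof.
move=> [a a0 H] [b b0 H']; exists (a * b); first by rewrite mulf_neq0.
by move=> P; rewrite ordM // H H' addrA subrK.
Qed.

Lemma lin_equiv_refl D : lin_equiv D D.
Proof. by exists 1; [exact: oner_neq0 | move=> P; rewrite ord1 // subrr]. Qed.

(* The homogeneous components of a vanishing sum vanish. *)
Lemma cox_component (T : finType) (D : T -> weil_divisor X) (a : T -> K) D0 :
  (forall t, global_sections (D t) (a t)) -> \sum_t sec (D t) (a t) = 0 ->
  \sum_(t | `[< lin_equiv (D t) D0 >]) sec (D t) (a t) = 0.
Proof.
move=> ga S0; pose rep E := xget E [set E' | lin_equiv E' E].
have repP E : lin_equiv (rep E) E.
  by rewrite /rep; case: xgetP => // H; case: (H E); apply: lin_equiv_refl.
have rep_eq E E' : lin_equiv E E' -> rep E = rep E'.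
  move=> H; rewrite /rep; have -> : [set E1 | lin_equiv E1 E] = [set E1 | lin_equiv E1 E'].
    apply/seteqP; split => E1 /= H1; first exact: (lin_equiv_trans H1 H).
    exact: (lin_equiv_trans H1 (lin_equiv_sym H)).
  rewrite /xget; case: pselect => // H'.
  by case: H'; exists E'; apply/asboolP; apply: lin_equiv_refl.
have Hb t : exists b, global_sections (rep (D t)) b /\ sec (rep (D t)) b = sec (D t) (a t).
  by have [b gb E] := cox_sec_equiv R (lin_equiv_sym (repP (D t))) (ga t); exists b.
have [b Hb'] := choice Hb.
pose s := undup [seq rep (D t) | t <- enum T].
pose A (i : 'I_(size s)) := \sum_(t | rep (D t) == s`_i) b t.
have gA (i : 'I_(size s)) : global_sections s`_i (A i).
  rewrite /A; apply: big_ind; [by left | by move=> *; apply: globalD|].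
  by move=> t /eqP <-; have [] := Hb' t.
have EA (i : 'I_(size s)) : sec s`_i (A i) = \sum_(t | rep (D t) == s`_i) sec (D t) (a t).
  rewrite /A (eq_bigl (mem [pred t | rep (D t) == s`_i])) // -big_filter.
  rewrite [RHS](eq_bigl (mem [pred t | rep (D t) == s`_i])) // -[RHS]big_filter.
  have : all (fun t => rep (D t) == s`_i) [seq t <- index_enum T | mem [pred t | rep (D t) == s`_i] t].
    by apply/allP => t; rewrite mem_filter => /andP [].
  elim: [seq _ <- _ | _] => [|t r IH]; first by rewrite !big_nil sec0.
  move=> /= /andP [/eqP Et Hr]; rewrite !big_cons secD ?IH //.
  - by congr (_ + _); rewrite -Et; have [] := Hb' t.
  - by rewrite -Et; have [] := Hb' t.
  - elim: r Hr {IH} => [|t' r IH]; first by rewrite big_nil; left.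
    move=> /= /andP [/eqP Et' Hr]; rewrite big_cons; apply: globalD; last exact: IH.
    by rewrite -Et'; have [] := Hb' t'.
have SA : \sum_(i < size s) sec s`_i (A i) = 0.
  rewrite -[RHS]S0 (eq_bigr _ (fun i _ => EA i)) (exchange_big_dep xpredT) //=.
  apply: eq_bigr => t _; have ts : rep (D t) \in s.
    by rewrite mem_undup; apply/mapP; exists t; rewrite ?mem_enum.
  have il : (index (rep (D t)) s < size s)%N by rewrite index_mem.
  rewrite (big_pred1 (Ordinal il)) // => i /=; apply/eqP/eqP => [E|->]; last by rewrite nth_index.
  by apply: val_inj => /=; rewrite E index_uniq ?undup_uniq.
have H := cox_sec_direct gA _ SA.
have [D0s|D0s] := boolP (rep D0 \in s); last first.
  rewrite big1 // => t /asboolP Ht; case/negP: D0s.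
  by rewrite mem_undup; apply/mapP; exists t; rewrite ?mem_enum //; apply/esym/rep_eq.
have il : (index (rep D0) s < size s)%N by rewrite index_mem.
rewrite -[RHS](H _ (Ordinal il)); last first.
  move=> i j ij /rep_eq; have idem E : rep (rep E) = rep E by apply: rep_eq; apply: repP.
  have memr (i0 : 'I_(size s)) : exists E, s`_i0 = rep E.
    have : s`_i0 \in s by rewrite mem_nth.
    by rewrite mem_undup => /mapP [t _ ->]; exists (D t).
  have [E1 e1] := memr i; have [E2 e2] := memr j; rewrite e1 e2 !idem -e1 -e2 => E.
  by move/negP: ij; apply; rewrite -val_eqE /= -(nth_uniq (0 : weil_divisor X) (ltn_ord i) (ltn_ord j) (undup_uniq _)); apply/eqP.
rewrite EA; apply: eq_bigl => t /=; rewrite nth_index //.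
apply/asboolP/eqP => [/rep_eq //|E].
by apply: lin_equiv_trans (lin_equiv_sym (repP _)) _; rewrite E; apply: repP.
Qed.

End CoxRing.


(** * Odd functions on the cover [G -> G/mu_n] and the divisors they define *)

Section Odd.
Variables (k : closedFieldType) (n : nat) (X : embedding k n).
Hypotheses (nb : (0 < n <= 2)%N) (nX : normal_variety X).
Local Notation XF := (variety_functions X).
Local Notation GF := (sl2_space_functions k).
Local Notation K := (ratfun X).
Local Notation G := (sl2 k).
Implicit Types (g m : G) (f h : G -> k) (a b : K) (D E : weil_divisor X) (W : set G) (P : prime_divisor X).

(** The bound [n <= 2] forces the square of [m 0 0] to be 1, so elements of [mu n] are scalar
    matrices with entry 1 or -1. *)
Lemma muP m : mu n m -> [/\ m 1 0 = 0, m 0 1 = 0, m 1 1 = m 0 0 & m 0 0 != 0].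
Proof.
move=> [m10 m01 mn]; have := sl2_ad m; rewrite m10 mulr0 subr0 => E.
have m0 : m 0 0 != 0.
  by apply: contraTneq isT => E0; move: E; rewrite E0 mul0r => /eqP; rewrite eq_sym oner_eq0.
split => //; apply: (mulfI m0); rewrite E.
move: nb mn; case: (n) => [|[|[|]]] // _; rewrite ?expr1 ?expr2; by move=> ->; rewrite mulr1.
Qed.

Lemma mu1 : mu n (1%g : G).
Proof. by have [a b c d] := sl2_1E k; split => //; rewrite a expr1n. Qed.

Lemma orb_eq x y : orb X x = orb X y -> exists2 m, mu n m & y = (x * m)%g.
Proof.
have [inj _ _ _] := embedding_open X.
move=> /inj /(congr1 sval) /= E; have : double_coset [set 1%g] (@mu k n) y y.
  by exists 1%g, 1%g; split; [by [] | exact: mu1 | rewrite mul1g mulg1].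
by rewrite -E => -[l [m [-> Hm ->]]]; exists m; rewrite ?mul1g.
Qed.

(** The embedding is an open immersion of the quotient structure, so [mu n]-invariant regular
    functions on [G] descend to [X]. *)
Lemma push_rat W (f : G -> k) : opn (s := sl2_space k) W -> W !=set0 ->
  (forall x m, mu n m -> W x -> W (x * m)%g /\ f (x * m)%g = f x) ->
  reg (s := sl2_space k) W f -> exists a, forall x, W x -> has_value a (orb X x) (f x).
Proof.
move=> oW [w Ww] Hm rf; have [inj _ oi ri] := embedding_open X.
pose V : set (homogeneous_space k n) := [set C | exists2 x, W x & C = coset_map [set 1%g] (@mu k n) x].
have pV : coset_map [set 1%g] (@mu k n) @^-1` V = W.
  apply/seteqP; split => [y [x Wx E]|x Wx]; last by exists x.
  have [m mm ->] : exists2 m, mu n m & y = (x * m)%g by apply: orb_eq; rewrite /orb E.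
  exact: (Hm x m mm Wx).1.
have [F HF] : exists F : X -> k, forall x, W x -> F (orb X x) = f x.
  have H (z : X) : exists c, forall x, W x -> orb X x = z -> c = f x.
    case: (pselect (exists x, W x /\ orb X x = z)) => [[x [Wx E]]|nx]; last first.
      by exists 0 => x Wx E; case: nx; exists x.
    exists (f x) => y Wy Ey; have [m mm ->] : exists2 m, mu n m & y = (x * m)%g.
      by apply: orb_eq; rewrite E Ey.
    by rewrite (Hm x m mm Wx).2.
  by have [F HF] := choice H; exists F => x Wx; apply: HF.
have rV : reg V (F \o embedding_map X).
  have : reg (s := sl2_space k) (coset_map [set 1%g] (@mu k n) @^-1` V)
      ((F \o embedding_map X) \o coset_map [set 1%g] (@mu k n)).
    by rewrite pV; apply: (reg_ext GF) rf => x Wx /=; rewrite -HF.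
  exact.
have rF := (ri V F).1 rV.
have [|a ga] := reg_germ rF.
  by exists (orb X w), (coset_map [set 1%g] (@mu k n) w) => //; exists w.
exists a => x Wx; exists (embedding_map X @` V), F; split => //; last exact: HF.
by exists (coset_map [set 1%g] (@mu k n) x) => //; exists x.
Qed.

(** The functions that transform under [mu n] like the matrix entries. They need not descend to the
    orbit, but their quotients ([ratq]) and squares ([sqf]) do. *)
Definition odd_fun (f : G -> k) := polyfun f /\ forall x m, mu n m -> f (x * m)%g = m 0 0 * f x.
Definition nonzero (f : G -> k) := exists x, f x != 0.

Lemma odd_entry i j : odd_fun (fun x => x i j).
Proof.
split; first exact: polyfun_entry.
move=> x m /muP [m10 m01 m11 _]; rewrite sl2M.
by case: (ord2P j) => ->; rewrite ?m10 ?m01 ?m11 mulr0 ?addr0 ?add0r mulrC.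
Qed.

Lemma odd_comb c1 c2 f1 f2 : odd_fun f1 -> odd_fun f2 -> odd_fun (fun x => c1 * f1 x + c2 * f2 x).
Proof.
move=> [p1 H1] [p2 H2]; split.
  by apply: polyfunD; apply: polyfunM => //; apply: polyfun_cst.
by move=> x m mm; rewrite H1 // H2 // mulrDr !(mulrCA (m 0 0)).
Qed.

Lemma odd_act g f : odd_fun f -> odd_fun (fun x => f (g^-1 * x)%g).
Proof.
move=> [pf H]; split; first by apply: (polyfun_comp (phi := fun x => (g^-1 * x)%g)) => // i j; apply: polyfun_mull.
by move=> x m mm; rewrite mulgA H.
Qed.

Lemma nonzero_act g f : nonzero f -> nonzero (fun x => f (g^-1 * x)%g).
Proof. by move=> [x fx]; exists (g * x)%g; rewrite mulKg. Qed.

Definition ratq (f h : G -> k) : K := xget 0 [set a : K | forall x, h x != 0 -> has_value a (orb X x) (f x / h x)].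
Definition sqf (f : G -> k) : K := xget 0 [set a : K | forall x, has_value a (orb X x) (f x ^+ 2)].

Lemma ratqE f h x : odd_fun f -> odd_fun h -> h x != 0 -> has_value (ratq f h) (orb X x) (f x / h x).
Proof.
move=> [pf Hf] [ph Hh] hx; rewrite /ratq; case: xgetP => [a _ H|H]; first exact: H.
have [||||a Ha] := @push_rat [set x | h x != 0] (fun x => f x / h x); last by case: (H a).
- exact: polyfun_opn.
- by exists x.
- move=> y m mm /= hy; have [_ _ _ m0] := muP mm; rewrite Hf // Hh //.
  by rewrite mulf_neq0 //; split => //; rewrite -mulf_div divff // mul1r.
- have rh := reg_inv GF (polyfun_reg ph); rewrite setTI in rh.
  apply: (reg_mul GF) rh; apply: (reg_restrict GF (polyfun_opn ph) _ (polyfun_reg pf)) => //.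
Qed.

Lemma sqfE f x : odd_fun f -> has_value (sqf f) (orb X x) (f x ^+ 2).
Proof.
move=> [pf Hf]; rewrite /sqf; case: xgetP => [a _ H|H]; first exact: H.
have [||||a Ha] := @push_rat setT (fun x => f x ^+ 2); last by case: (H a) => y; apply: Ha.
- exact: (opn_setT GF).
- by exists 1%g.
- move=> y m mm _; split => //; rewrite Hf // exprMn.
  have [m10 m01 m11 m0] := muP mm; have := sl2_ad m; rewrite m10 mulr0 subr0 m11.
  by rewrite -expr2 => ->; rewrite mul1r.
- by apply: polyfun_reg; apply: polyfunM.
Qed.

Lemma nz_opn f : odd_fun f -> opn (s := sl2_space k) [set x | f x != 0].
Proof. by move=> [pf _]; apply: polyfun_opn. Qed.

Lemma sqf_neq0 f : odd_fun f -> nonzero f -> sqf f != 0.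
Proof. by move=> of_ [x fx]; apply: has_value_neq0 (sqfE x of_) _; rewrite expf_neq0. Qed.

Lemma nonzero2 f h : odd_fun f -> odd_fun h -> nonzero f -> nonzero h -> exists x, f x != 0 /\ h x != 0.
Proof. by move=> [pf _] [ph _] [x fx] [y hy]; apply: (polyfun_neq0 pf ph fx hy). Qed.

Lemma ratq_neq0 f h : odd_fun f -> odd_fun h -> nonzero f -> nonzero h -> ratq f h != 0.
Proof.
move=> of_ oh nf nh; have [x [fx hx]] := nonzero2 of_ oh nf nh.
by apply: has_value_neq0 (ratqE of_ oh hx) _; rewrite mulf_neq0 ?invr_eq0.
Qed.

Lemma ratq_sqf f h : odd_fun f -> odd_fun h -> nonzero h -> ratq f h ^+ 2 * sqf h = sqf f.
Proof.
move=> of_ oh nh; apply: (sl2_rat_eqI (nz_opn oh)) => [|x c /= hx hc]; first exact: nh.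
rewrite (has_value_uniq hc (has_valueM (has_valueX 2 (ratqE of_ oh hx)) (sqfE x oh))).
by rewrite expr_div_n divfK ?expf_neq0 //; apply: sqfE.
Qed.

Lemma ratqD c1 c2 f1 f2 h : odd_fun f1 -> odd_fun f2 -> odd_fun h -> nonzero h ->
  ratq (fun x => c1 * f1 x + c2 * f2 x) h = ratC X c1 * ratq f1 h + ratC X c2 * ratq f2 h.
Proof.
move=> o1 o2 oh nh; apply: (sl2_rat_eqI (nz_opn oh)) => [|x c /= hx hc]; first exact: nh.
rewrite (has_value_uniq hc (ratqE (odd_comb c1 c2 o1 o2) oh hx)) mulrDl -!mulrA.
by apply: has_valueD; apply: has_valueM; [exact: has_valueC | exact: ratqE | exact: has_valueC | exact: ratqE].
Qed.

Lemma ratq_id h : odd_fun h -> nonzero h -> ratq h h = 1.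
Proof.
move=> oh nh; apply: (sl2_rat_eqI (nz_opn oh)) => [|x c /= hx hc]; first exact: nh.
by rewrite (has_value_uniq hc (ratqE oh oh hx)) divff //; apply: has_value1.
Qed.

Lemma translate_ratq g f h : odd_fun f -> odd_fun h -> nonzero h ->
  translate g (ratq f h) = ratq (fun x => f (g^-1 * x)%g) (fun x => h (g^-1 * x)%g).
Proof.
move=> of_ oh nh; have [x0 hx0] := nonzero_act g nh.
apply: (sl2_rat_eqI (nz_opn (odd_act g oh))) => [|x c /= hx hc]; first by exists x0.
have := translate_value g (ratqE of_ oh hx); rewrite -orbM mulVKg => h1.
by rewrite (has_value_uniq hc h1); apply: ratqE => //; apply: odd_act.
Qed.

Lemma translate_sqf g f : odd_fun f -> translate g (sqf f) = sqf (fun x => f (g^-1 * x)%g).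
Proof.
move=> of_; apply: (sl2_rat_eqI (opn_setT GF)) => [|x c _ hc]; first by exists 1%g.
have := translate_value g (sqfE (g^-1 * x)%g of_); rewrite -orbM mulVKg => h1.
by rewrite (has_value_uniq hc h1); apply: (sqfE x (odd_act g of_)).
Qed.

(* Twice the order of vanishing along [P] of the function [f] on the cover [G] of the orbit. *)
Definition ord2 P f : int := ord P (sqf f).

Lemma ord2_ratq P f h : odd_fun f -> odd_fun h -> nonzero f -> nonzero h ->
  ord P (ratq f h) *+ 2 = ord2 P f - ord2 P h.
Proof.
move=> of_ oh nf nh; rewrite -ordX ?ratq_neq0 // /ord2 -(ratq_sqf of_ oh nh).
by rewrite ordM ?addrK ?sqf_neq0 // expf_neq0 // ratq_neq0.
Qed.

Lemma ord2_act g P f : odd_fun f -> nonzero f -> ord2 (pd_act g P) (fun x => f (g^-1 * x)%g) = ord2 P f.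
Proof. by move=> of_ nf; rewrite /ord2 -translate_sqf // ord_act // sqf_neq0. Qed.

Lemma ord2_value P f x : odd_fun f -> pd_set P (orb X x) -> f x != 0 -> ord2 P f = 0.
Proof. by move=> of_ Px fx; apply: (ord_value nX Px (sqfE x of_)); rewrite expf_neq0. Qed.

Lemma ord2_ge0 P f x : odd_fun f -> nonzero f -> pd_set P (orb X x) -> 0 <= ord2 P f.
Proof.
move=> of_ nf Px; apply/(ord_ge0 nX P (sqf_neq0 of_ nf)); apply/local_ringP.
by exists (orb X x), (f x ^+ 2); split => //; apply: sqfE.
Qed.

Lemma entry_neq0 (x : G) : exists i j, x i j != 0.
Proof.
apply: contrapT => H; have H' i j : x i j = 0.
  by apply/eqP/negPn/negP => n0; apply: H; exists i, j.
by have := sl2_ad x; rewrite !H' mul0r subrr => /eqP; rewrite eq_sym oner_eq0.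
Qed.

Lemma stable_not_meets P x : G_stable P -> ~ pd_set P (orb X x).
Proof.
move=> sP Px; apply: (pd_proper (p := P)); apply/seteqP; split => // y _.
apply: contrapT => nPy.
have [||z [nPz]] := meet_neq0 (pd_closed P) (open_orbit_opn X).
- by exists y.
- by exists (orb X x); apply: orb_open.
- move=> /open_orbitP [g Eg]; apply: nPz.
  by rewrite Eg (orb_transitive X g x) -(sP (g * x^-1)%g); exists (orb X x).
Qed.

Lemma divisor_of (e : prime_divisor X -> int) (L : seq (prime_divisor X)) :
  (forall P, e P != 0 -> P \in L) -> exists D : weil_divisor X, forall P, coeff P D = e P.
Proof.
move=> H; exists (\sum_(Q <- undup L) << e Q *g Q >>) => P.
rewrite raddf_sum /= (eq_bigr (fun Q => e Q * (Q == P)%:R)); last by move=> Q _; rewrite coeffU.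
have [PL|PL] := boolP (P \in L).
  rewrite (bigD1_seq P) ?undup_uniq ?mem_undup //= eqxx mulr1 big1 ?addr0 // => Q QP.
  by rewrite (negPf QP) mulr0.
rewrite big_seq big1; first by apply/esym/eqP; apply: contraNT PL => /H.
move=> Q; rewrite mem_undup => QL; case: eqP => [E|_]; last by rewrite mulr0.
by rewrite -E QL in PL.
Qed.

(** [D] is the closure in [X] of the divisor of zeros of [f] on the orbit; [ord2] counts orders
    twice because only the square of [f] descends. *)
Definition is_div f D := forall P,
  (G_stable P -> coeff P D = 0) /\ (forall x, pd_set P (orb X x) -> coeff P D *+ 2 = ord2 P f).

Lemma nonzero_entry i j : nonzero (fun x : G => x i j).
Proof.
pose T := (upper 1 * lower 1)%g : G.
have [a1 a2 a3 a4] := upperE (1 : k); have [b1 b2 b3 b4] := lowerE (1 : k).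
have [o1 o2 o3 o4] := sl2_1E k.
case: (ord2P i) => ->; case: (ord2P j) => ->.
- by exists 1%g; rewrite o1 oner_neq0.
- by exists (upper 1); rewrite a2 oner_neq0.
- by exists (lower 1); rewrite b3 oner_neq0.
- by exists 1%g; rewrite o4 oner_neq0.
Qed.

(** At any point of the orbit some matrix entry is nonzero, and the quotient of [f] by it is a local
    equation; this makes [ord2] even there. The support is finite because only four quotients
    occur. *)
Lemma div_ex f : odd_fun f -> nonzero f -> exists D, is_div f D.
Proof.
move=> of_ nf.
have Hz P : exists z : int, (G_stable P -> z = 0) /\
    (forall x, pd_set P (orb X x) -> z *+ 2 = ord2 P f /\
       exists i j, z = ord P (ratq f (fun x => x i j))).
  have [sP|[x Px]] := stable_or_meets P.
    by exists 0; split => // x /(stable_not_meets sP).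
  have [i [j xij]] := entry_neq0 x; exists (ord P (ratq f (fun x => x i j))); split.
    by move=> sP; case: (stable_not_meets sP Px).
  move=> y Py; split; last by exists i, j.
  rewrite ord2_ratq //; [|exact: odd_entry|exact: nonzero_entry].
  by rewrite (ord2_value (odd_entry i j) Px) // subr0.
have [e He] := choice Hz.
have HL (ij : 'I_2 * 'I_2) := ord_finite nX (ratq_neq0 of_ (odd_entry ij.1 ij.2) nf (nonzero_entry ij.1 ij.2)).
have [L HL'] := choice HL.
have [P eP|D HD] := @divisor_of e (flatten [seq L ij | ij <- enum {: 'I_2 * 'I_2}]); last first.
  exists D => P; rewrite HD; have [h1 h2] := He P; split => // x Px; exact: (h2 x Px).1.
have [sP|[x Px]] := stable_or_meets P; first by rewrite (He P).1 // eqxx in eP.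
have [_ [i [j E]]] := (He P).2 x Px; apply/flattenP; exists (L (i, j)).
  by apply: map_f; rewrite mem_enum.
by apply: HL'; rewrite /= -E.
Qed.

Section Div.
Variables (f : G -> k) (D : weil_divisor X).
Hypotheses (of_ : odd_fun f) (nf : nonzero f) (HD : is_div f D).

Lemma is_div_ge0 P : 0 <= coeff P D.
Proof.
have [sP|[x Px]] := stable_or_meets P; first by rewrite (HD P).1.
have := (HD P).2 x Px; have := ord2_ge0 of_ nf Px; lia.
Qed.

Lemma is_div_global : global_sections D (1 : K).
Proof. by right=> P _; rewrite ord1 // add0r is_div_ge0. Qed.

(** The right side is a cocycle with the orders required by [lin_ord], so [lin_uniq] applies. *)
Lemma is_div_lin phi : linearization D phi -> forall g, phi g 1 = ratq (fun x => f (g^-1 * x)%g) f.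
Proof.
move=> Hphi; apply: (lin_uniq nX Hphi) => [g h|g|g P].
- rewrite translate_ratq //; last exact: odd_act.
  have o1 := odd_act g of_.
  have nv := nonzero_act g nf.
  have [x0 [f0 f1]] := nonzero2 of_ o1 nf nv.
  apply: (sl2_rat_eqI (opn_setI GF (nz_opn of_) (nz_opn o1))); first by exists x0.
  move=> x c [/= fx fgx] hc.
  have h1 := ratqE (odd_act (g * h)%g of_) of_ fx.
  have h2 := ratqE o1 of_ fx; have h3 := ratqE (odd_act g (odd_act h of_)) o1 fgx.
  rewrite (has_value_uniq hc h1); have := has_valueM h2 h3.
  by congr has_value; rewrite invgM -mulgA; field; rewrite fx fgx.
- by apply: ratq_neq0 => //; [apply: odd_act | apply: nonzero_act].
- have := ord2_ratq (pd_act g P) (odd_act g of_) of_ (nonzero_act g nf) nf.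
  rewrite ord2_act //; have [sP|[x Px]] := stable_or_meets P.
    by rewrite !pd_act_stable // subrr; rewrite (HD P).1 //; lia.
  have Pgx : pd_set (pd_act g P) (orb X (g * x)%g) by rewrite orbM; apply/pd_actE.
  by rewrite -((HD P).2 x Px) -((HD (pd_act g P)).2 _ Pgx); lia.
Qed.

Lemma is_div_frame phi : linearization D phi -> frame D phi [set x | f x != 0] (fun x => (f x)^-1).
Proof.
move=> Hphi; split => //.
- exact: nz_opn.
- by move=> x fx; rewrite invr_eq0.
- by have := reg_inv GF (polyfun_reg of_.1); rewrite setTI.
- move=> x P /= fx Px; have := (HD P).2 x Px; rewrite (ord2_value of_ Px fx); lia.
- move=> g x fx fgx; rewrite (is_div_lin Hphi) invrK mulrC.
  by have := ratqE (odd_act g of_) of_ fgx; rewrite mulKg.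
Qed.

Lemma is_div_sfun phi : linearization D phi ->
  is_sfun phi [set x | f x != 0] (fun x => (f x)^-1) 1 f.
Proof.
move=> Hphi g x fgx; rewrite (is_div_lin Hphi).
by have := ratqE (odd_act g of_) of_ fgx; rewrite mulKg.
Qed.
End Div.

(** * The stable divisors *)
Lemma stable_divisors : exists L : seq (prime_divisor X), uniq L /\ forall P, (P \in L) <-> G_stable P.
Proof.
have [||L HL] := @finite_divisors _ X (~` @open_orbit k n X).
- by rewrite /closed_set setCK; apply: open_orbit_opn.
- move=> E; have H : (~` @open_orbit k n X) (orb X 1%g) by rewrite E.
  by apply: H; apply: orb_open.
exists (undup (filter (fun P : prime_divisor X => `[< G_stable P >]) L)); split; first exact: undup_uniq.
move=> P; rewrite mem_undup mem_filter; split => [/andP [/asboolP] //|sP].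
apply/andP; split; first exact/asboolP.
apply: HL => x Px /open_orbitP [g Eg]; apply: (stable_not_meets (x := g) sP).
by rewrite -Eg.
Qed.

Lemma stable_lin D phi : linearization D phi -> (forall P, ~ G_stable P -> coeff P D = 0) ->
  forall g, phi g 1 = 1.
Proof.
move=> Hphi H; apply: (lin_invariant nX Hphi) => g P.
case: (pselect (G_stable P)) => sP; first by rewrite pd_act_stable.
rewrite !H //; move=> sgP; apply: sP => h; rewrite -(pd_actK g P).
by have E := pd_act_stable sgP; rewrite E; have := E h; move/(congr1 (@pd_set k X)).
Qed.

Lemma stable_frame D phi : linearization D phi -> (forall P, ~ G_stable P -> coeff P D = 0) ->
  frame D phi setT (fun=> 1).
Proof.
move=> Hphi H; split => //.
- exact: (opn_setT GF).
- by exists 1%g.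
- by move=> x _; apply: oner_neq0.
- by apply: (reg_cst GF); apply: (opn_setT GF).
- by move=> x P _ Px; apply: H => sP; apply: (stable_not_meets sP Px).
- by move=> g x _ _; rewrite (stable_lin Hphi) // divr1; apply: has_value1.
Qed.

End Odd.


(** * Rational actions of [SL_2] and the associated derivations *)

Section RationalAction.
Variables (k : closedFieldType) (R : comAlgType k).
Hypothesis char0 : [pchar k] =i pred0.
Local Notation G := (sl2 k).

Record subspace (N : set R) : Prop := Subspace {
  subspace0 : N 0;
  subspaceD : forall x y, N x -> N y -> N (x + y);
  subspaceZ : forall c x, N x -> N (c *: x) }.

Lemma subspace_sum N (T : Type) (s : seq T) (P : pred T) (F : T -> R) :
  subspace N -> (forall i, P i -> N (F i)) -> N (\sum_(i <- s | P i) F i).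
Proof. by move=> sN H; apply: big_ind => //; [apply: subspace0 | apply: subspaceD]. Qed.

Lemma subspaceB N x y : subspace N -> N x -> N y -> N (x - y).
Proof. by move=> sN Nx Ny; rewrite -scaleN1r; apply: subspaceD => //; apply: subspaceZ. Qed.

Lemma ideal_subspace (N : set R) : is_ideal N -> subspace N.
Proof.
move=> iN; split; [exact: ideal0 | by move=> x y; apply: idealD | move=> c x Nx].
by rewrite -mulr_algl; apply: idealMl.
Qed.

Lemma subspace_zero : subspace [set 0].
Proof. by split => // [x y -> ->|c x ->]; rewrite ?addr0 ?scaler0. Qed.

(** Split off a factor ['X - c] and induct on the size; the infinite field [k] always supplies
    another [c]. This passes from statements about group elements [u t] to their Taylor coefficients
    in [t], modulo any subspace. *)
Lemma vandermonde N (Q : {poly R}) (bad : seq k) : subspace N ->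
  (forall t, t \notin bad -> N Q.[t%:A]) -> forall i, N Q`_i.
Proof.
move=> sN; move: {2}(size Q) (leqnn (size Q)) => n; elim: n Q bad => [|n IH] Q bad.
  by rewrite leqn0 size_poly_eq0 => /eqP -> _ i; rewrite coef0; apply: subspace0.
move=> sQ H; have [c cb] : exists c, c \notin bad.
  have : \prod_(b <- bad) ('X - b%:P) != 0 :> {poly k}.
    by apply: monic_neq0; apply: monic_prod_XsubC.
  move=> /exists_nonroot [c]; rewrite -rootE root_prod_XsubC => ?; by exists c.
have Nc := H c cb.
have : root (Q - Q.[c%:A]%:P) c%:A by rewrite rootE hornerD hornerN hornerC subrr.
move=> /factor_theorem [Q1 E].
have EQ : Q = Q1 * ('X - c%:A%:P) + Q.[c%:A]%:P by rewrite -E subrK.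
have HQ1 i : N Q1`_i.
  apply: (IH Q1 (c :: bad)) => [|t].
    have [->|Q10] := eqVneq Q1 0; first by rewrite size_poly0.
    have := size_Mmonic Q10 (monicXsubC c%:A); rewrite -E size_XsubC addn2 /= => S.
    rewrite -ltnS -S; apply: leq_trans (_ : maxn (size Q) (size Q.[c%:A]%:P) <= _)%N.
      by apply: leq_trans (size_polyD _ _) _; rewrite size_polyN.
    by rewrite geq_max sQ (leq_trans (size_polyC_leq1 _)).
  rewrite inE negb_or => /andP[tc tb]; have := H t tb; rewrite {1}EQ hornerD hornerM hornerXsubC hornerC.
  rewrite -scalerBl mulr_algr => Nt; have : N ((t - c)^-1 *: ((t - c) *: Q1.[t%:A])).
    by apply: subspaceZ => //; rewrite -[X in N X](addrK Q.[c%:A]); apply: subspaceB.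
  by rewrite scalerA mulVf ?scale1r // subr_eq0.
move=> i; rewrite EQ coefD mulrBr coefB coefMX coefMC coefC mulr_algr.
apply: subspaceD => //; last by case: ifP => // _; apply: subspace0.
by apply: subspaceB => //; [case: ifP => // _; apply: subspace0 | apply: subspaceZ].
Qed.

Lemma vandermonde_uniq (P Q : {poly R}) (bad : seq k) :
  (forall t, t \notin bad -> P.[t%:A] = Q.[t%:A]) -> P = Q.
Proof.
move=> H; apply/polyP => i; apply/eqP; rewrite -subr_eq0 -coefB; apply/eqP.
apply: (vandermonde (bad := bad) subspace_zero) => t tb /=.
by rewrite hornerD hornerN H // subrr.
Qed.

Lemma natr_scale_eq0 n (r : R) : n != 0%N -> r *+ n = 0 -> r = 0.
Proof.
move=> n0 H; rewrite -[r]scale1r -(@mulVf k n%:R) ?((pcharf0P k).1 char0) //.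
by rewrite -scalerA scaler_nat H scaler0.
Qed.

Record rational_action (alpha : G -> R -> R) : Prop := RationalAction {
  actionD : forall g r s, alpha g (r + s) = alpha g r + alpha g s;
  actionZ : forall g c r, alpha g (c *: r) = c *: alpha g r;
  actionM : forall g r s, alpha g (r * s) = alpha g r * alpha g s;
  action_id : forall r, alpha 1%g r = r;
  action_comp : forall g h r, alpha (g * h)%g r = alpha g (alpha h r);
  action_rational : forall r, exists t (m : 'I_t -> G -> k) (s : 'I_t -> R),
    (forall j, polyfun (m j)) /\ forall g, alpha g r = \sum_j m j g *: s j }.

Variable alpha : G -> R -> R.
Hypothesis ra : rational_action alpha.

Lemma action0 g : alpha g 0 = 0.
Proof. by rewrite -[0 in LHS](scale0r 0) actionZ // scale0r. Qed.
Lemma actionK g r : alpha g (alpha g^-1%g r) = r.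
Proof. by rewrite -action_comp // mulgV action_id. Qed.
Lemma action1 g : alpha g 1 = 1.
Proof. by rewrite -[LHS]mulr1 -{2}(actionK g 1) -actionM // mul1r actionK. Qed.
Lemma actionA g c : alpha g c%:A = c%:A.
Proof. by rewrite actionZ // action1. Qed.
Lemma action_sum g (T : Type) (s : seq T) (P : pred T) (F : T -> R) :
  alpha g (\sum_(i <- s | P i) F i) = \sum_(i <- s | P i) alpha g (F i).
Proof. by apply: big_morph; [apply: actionD | apply: action0]. Qed.

Lemma action_horner g (Q : {poly R}) c :
  alpha g Q.[c%:A] = (map_poly (alpha g) Q).[c%:A].
Proof.
rewrite (horner_coef_wide _ (size_poly _ _)) horner_coef action_sum.
apply: eq_bigr => i _; rewrite coef_map_id0 ?action0 // actionM // ; congr (_ * _).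
by elim: (i : nat) => [|j IH]; rewrite ?expr0 ?action1 // !exprS actionM // IH actionA.
Qed.

Lemma curve_poly gam r : polycurve gam ->
  exists Q : {poly R}, forall t, alpha (gam t) r = Q.[t%:A].
Proof.
move=> Hg; have [n [m [s [Hm Hs]]]] := action_rational ra r.
have /choice [P HP] j : exists P : {poly k}, forall z, m j (gam z) = P.[z].
  exact: polyfun_curve.
exists (\sum_j s j *: map_poly (in_alg R) (P j)) => t.
rewrite Hs horner_sum; apply: eq_bigr => j _.
by rewrite hornerZ -[t%:A]/(in_alg R t) horner_map /= -HP mulr_algr.
Qed.

Definition one_parameter (u : k -> G) : Prop :=
  polycurve u /\ forall s t, (u s * u t)%g = u (s + t).

Lemma one_parameter_upper : one_parameter (@upper k).
Proof.
split=> [i j|s t]; last exact: upperM.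
by have [P HP] := polycurve_upper (1 : k) i j; exists P => z; rewrite -HP mulr1.
Qed.

Lemma one_parameter_lower : one_parameter (@lower k).
Proof.
split=> [i j|s t]; last exact: lowerM.
by have [P HP] := polycurve_lower (1 : k) i j; exists P => z; rewrite -HP mulr1.
Qed.

(** The orbit of [r] under the one-parameter group, as a polynomial in the parameter. Its linear
    coefficient [der] is the Lie algebra action, and its higher coefficients are divided powers of
    it ([iter_der]). *)
Definition flow u r : {poly R} := xget 0 [set Q | forall t, alpha (u t) r = Q.[t%:A]].
Definition der u r := (flow u r)`_1.

Section OneParameter.
Variable u : k -> G.
Hypothesis Hu : one_parameter u.

Lemma one_parameter0 : u 0 = 1%g.
Proof. by have := Hu.2 0 0; rewrite addr0 => /(canRL (mulKg _)); rewrite mulVg. Qed.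

Lemma flowE r t : alpha (u t) r = (flow u r).[t%:A].
Proof.
rewrite /flow; case: xgetP => [Q _ ->//|] H.
by have [Q HQ] := curve_poly r Hu.1; have := H Q.
Qed.

Lemma flow_uniq r (Q : {poly R}) : (forall t, alpha (u t) r = Q.[t%:A]) -> flow u r = Q.
Proof. by move=> H; apply: (@vandermonde_uniq _ _ [::]) => t _; rewrite -flowE. Qed.

Lemma der_uniq r (Q : {poly R}) : (forall t, alpha (u t) r = Q.[t%:A]) -> der u r = Q`_1.
Proof. by move=> H; rewrite /der (flow_uniq H). Qed.

Lemma flow0 r : (flow u r)`_0 = r.
Proof. by rewrite -horner_coef0 -(scale0r 1) -flowE one_parameter0 action_id. Qed.

Lemma derD r s : der u (r + s) = der u r + der u s.
Proof. by rewrite -coefD; apply: der_uniq => t; rewrite hornerD -!flowE actionD. Qed.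
Lemma derZ c r : der u (c *: r) = c *: der u r.
Proof.
rewrite -[RHS]mulr_algl -coefZ; apply: der_uniq => t.
by rewrite hornerZ -flowE actionZ // mulr_algl.
Qed.
Lemma derM r s : der u (r * s) = der u r * s + r * der u s.
Proof.
rewrite (@der_uniq _ (flow u r * flow u s)) => [|t]; last by rewrite hornerM -!flowE actionM.
by rewrite coefM big_ord_recr big_ord1 /= !flow0 addrC.
Qed.

Lemma flow_der r : flow u (der u r) = (flow u r)^`().
Proof.
apply: flow_uniq => t.
have E : map_poly (alpha (u t)) (flow u r) = flow u r \Po ('X + (t%:A)%:P).
  apply: (@vandermonde_uniq _ _ [::]) => s _; rewrite -action_horner // -flowE -action_comp //.
  by rewrite horner_comp hornerD hornerX hornerC -scalerDl -flowE Hu.2 addrC.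
have := congr1 (fun Q : {poly R} => Q`_1) E; rewrite coef_map_id0 ?action0 // => ->.
have /= := coef_deriv (flow u r \Po ('X + (t%:A)%:P)) 0; rewrite mulr1n => <-.
rewrite deriv_comp derivD derivX derivC addr0 mulr1 -horner_coef0 horner_comp.
by rewrite hornerD hornerX hornerC add0r.
Qed.

Lemma iter_der r n : iter n (der u) r = (flow u r)`_n *+ n`!.
Proof.
have F : flow u (iter n (der u) r) = (flow u r)^`(n).
  by elim: n => [|n IH] //; rewrite iterS flow_der IH derivnS.
by have := flow0 (iter n (der u) r); rewrite F coef_derivn addn0 ffactnn => ->.
Qed.

Lemma iter_der_eq0 r m : (size (flow u r) <= m)%N -> iter m (der u) r = 0.
Proof. by move=> H; rewrite iter_der nth_default // mul0rn. Qed.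

(** The flow then has zero derivative, so in characteristic zero it is constant. *)
Lemma der_eq0 r t : der u r = 0 -> alpha (u t) r = r.
Proof.
move=> E; rewrite flowE (_ : flow u r = r%:P) ?hornerC //.
have D0 : (flow u r)^`() = 0.
  by rewrite -flow_der E; apply: flow_uniq => s; rewrite action0 // horner0.
apply/polyP => -[|i]; rewrite coefC ?flow0 //=; apply: (@natr_scale_eq0 i.+1) => //.
by rewrite -coef_deriv D0 coef0.
Qed.

Lemma der_sub N r : subspace N -> (forall t, N (alpha (u t) r)) -> N (der u r).
Proof. by move=> sN H; apply: (vandermonde (bad := [::])) => // t _; rewrite -flowE. Qed.

Lemma der_invariant_mod N r : subspace N -> (forall t, N (alpha (u t) r - r)) -> N (der u r).
Proof.
move=> sN H; rewrite (_ : der u r = (flow u r - r%:P)`_1); last first.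
  by rewrite coefB coefC subr0.
apply: (vandermonde (bad := [::])) => // t _.
by rewrite hornerD hornerN hornerC -flowE.
Qed.

End OneParameter.

End RationalAction.


(** * The [sl_2] commutation relation and weight components *)

Section Weights.
Variables (k : closedFieldType) (R : comAlgType k).
Local Notation G := (sl2 k).

Definition mono (e : nat * nat * nat * nat) (g : G) : k :=
  g 0 0 ^+ e.1.1.1 * g 0 1 ^+ e.1.1.2 * g 1 0 ^+ e.1.2 * g 1 1 ^+ e.2.

Lemma polyfun_mono f : polyfun f -> exists s : seq (k * (nat * nat * nat * nat)),
  forall g, f g = \sum_(x <- s) x.1 * mono x.2 g.
Proof.
move: f; apply: polyfun_ind => [f1 f2 E [s Hs]|c|i j|f1 f2 [s1 H1] [s2 H2]|f1 f2 [s1 H1] [s2 H2]].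
- by exists s => g; rewrite -E.
- by exists [:: (c, (0, 0, 0, 0)%N)] => g; rewrite big_seq1 /mono /= !expr0 !mulr1.
- exists [:: (1, (((i == 0) && (j == 0))%:R, ((i == 0) && (j == 1))%:R,
                  ((i == 1) && (j == 0))%:R, ((i == 1) && (j == 1))%:R))] => g.
  rewrite big_seq1 /mono /=.
  by case: (ord2P i) => ->; case: (ord2P j) => -> /=; rewrite ?expr0 ?expr1 ?mulr1 ?mul1r.
- by exists (s1 ++ s2) => g; rewrite big_cat H1 H2.
- exists [seq (x.1 * y.1, (x.2.1.1.1 + y.2.1.1.1, x.2.1.1.2 + y.2.1.1.2, x.2.1.2 + y.2.1.2, x.2.2 + y.2.2)%N)
    | x <- s1, y <- s2] => g.
  rewrite big_allpairs_dep H1 H2 mulr_suml; apply: eq_bigr => x _; rewrite mulr_sumr.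
  by apply: eq_bigr => y _; rewrite /mono /= !exprD; ring.
Qed.

Definition comb (s : seq (R * (nat * nat * nat * nat))) (p : (nat * nat * nat * nat) -> {poly k}) :=
  \sum_(x <- s) x.1 *: map_poly (in_alg R) (p x.2).

Lemma horner_comb s p t : (comb s p).[t%:A] = \sum_(x <- s) (p x.2).[t] *: x.1.
Proof.
rewrite horner_sum; apply: eq_bigr => x _.
by rewrite hornerZ -[t%:A]/(in_alg R t) horner_map /= mulr_algr.
Qed.

Lemma coef_comb s p i : (comb s p)`_i = \sum_(x <- s) (p x.2)`_i *: x.1.
Proof. by rewrite coef_sum; apply: eq_bigr => x _; rewrite coefZ coef_map /= mulr_algr. Qed.

Variable alpha : G -> R -> R.
Hypothesis ra : rational_action alpha.

Lemma action_mono r : exists s : seq (R * (nat * nat * nat * nat)),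
  forall g, alpha g r = \sum_(x <- s) mono x.2 g *: x.1.
Proof.
have [n [m [s [Hm Hs]]]] := action_rational ra r.
have /choice [f Hf] j := polyfun_mono (Hm j).
exists (flatten [seq [seq (x.1 *: s j, x.2) | x <- f j] | j <- enum 'I_n]) => g.
rewrite Hs big_flatten big_map big_enum /=; apply: eq_bigr => j _.
rewrite Hf scaler_suml big_map; apply: eq_bigr => x _ /=.
by rewrite scalerA mulrC.
Qed.

Definition has_weight (w : int) r :=
  forall t (t0 : t != 0), alpha (tdiag t0) r = t ^ w *: r.

Local Notation E := (der alpha (@upper k)).
Local Notation F := (der alpha (@lower k)).
Let uE := one_parameter_upper k.
Let uF := one_parameter_lower k.

Lemma horner_binomial (x y : k) : (1 + x *: 'X).[y] = 1 + x * y.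
Proof. by rewrite hornerD hornerZ hornerX -polyC1 hornerC. Qed.

Lemma coef1_binomial (t : k) a c :
  ((1 + t *: 'X) ^+ a * 'X^c)`_1 = (c == 0)%:R * a%:R * t + (c == 1)%:R.
Proof.
rewrite coefMXn; case: c => [|[|c]] //=; last by rewrite !mul0r addr0.
  have := coef_deriv ((1 + t *: 'X) ^+ a) 0; rewrite mulr1n => <-.
  rewrite deriv_exp derivD -[1]/(1%:P) derivC add0r derivZ derivX alg_polyC -horner_coef0.
  rewrite hornerMn hornerM hornerC horner_exp hornerD hornerZ hornerX hornerC mulr0 addr0.
  by rewrite expr1n mulr1 addr0 mul1r mulr_natl.
by rewrite -horner_coef0 horner_exp hornerD hornerZ hornerX -[1]/(1%:P) hornerC mulr0 addr0 expr1n !mul0r add0r.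
Qed.

(** Differentiates the action of [gam z * u t] at [t = 0] when it is written as a combination of
    monomials in the matrix entries. *)
Lemma der_comb u r s p q gam : one_parameter u -> polycurve gam ->
  (forall t z, alpha (gam z * u t)%g r = \sum_(x <- s) (p x.2 z).[t] *: x.1) ->
  (forall e z, (p e z)`_1 = (q e).[z]) ->
  forall z, alpha (gam z) (der alpha u r) = (comb s q).[z%:A].
Proof.
move=> Hu Hg H Hq z.
have EQ : map_poly (alpha (gam z)) (flow alpha u r) = comb s (p ^~ z).
  apply: (@vandermonde_uniq _ _ _ _ [::]) => t _.
  by rewrite horner_comb -action_horner // -flowE // -action_comp // H.
rewrite /der -coef_map_id0 ?action0 // EQ coef_comb horner_comb.
by apply: eq_bigr => x _; rewrite Hq.
Qed.

Lemma coef1_shift (x y : k) b : ('X^b * (x *: 'X + y%:P))`_1 = (b == 0)%:R * x + (b == 1)%:R * y.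
Proof.
rewrite coefXnM; case: b => [|[|b]] //=; last by rewrite !mul0r addr0.
  by rewrite coefD coefZ coefX coefC /= mulr1 addr0 mul1r mul0r addr0.
by rewrite coefD coefZ coefX coefC /= mulr0 add0r mul1r mul0r add0r.
Qed.

(** Expand the action in monomials in the four entries and take the bilinear terms of
    [upper z * lower t] and [lower z * upper t]. They differ only on monomials without off-diagonal
    entries, by the difference of the two diagonal exponents. That is the derivative of the torus
    action at 1. *)
Lemma commutator r w : has_weight w r -> E (F r) = F (E r) + w%:~R *: r.
Proof.
move=> Hw; have [s Hs] := action_mono r.
pose q (x y : nat * nat * nat * nat -> nat) (z : nat * nat * nat * nat -> nat) e : {poly k} :=
  'X^(x e) * (((y e == 0)%:R * (z e)%:R) *: 'X + (y e == 1)%:R%:P).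
pose A (e : nat * nat * nat * nat) := e.1.1.1.
pose B (e : nat * nat * nat * nat) := e.1.1.2.
pose C (e : nat * nat * nat * nat) := e.1.2.
pose D (e : nat * nat * nat * nat) := e.2.
have EF : E (F r) = (comb s (q B C A))`_1.
  apply: (der_uniq ra uE) => z; apply: (der_comb
    (p := fun e z => (z ^+ B e) *: ((1 + z *: 'X) ^+ A e * 'X^(C e)))) => // [|t y|e y].
  - exact: (one_parameter_upper k).1.
  - rewrite Hs; apply: eq_bigr => x _; congr (_ *: _); rewrite /mono !sl2M.
    have [-> -> -> ->] := upperE y; have [-> -> -> ->] := lowerE t.
    rewrite hornerZ hornerM !hornerXn horner_exp horner_binomial.
    rewrite !mulr0 !mul0r !mul1r !mulr1 !add0r expr1n mulr1 /A /B /C; ring.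
  - rewrite coefZ coef1_binomial /q hornerM hornerXn hornerD hornerZ hornerX hornerC; ring.
have FE : F (E r) = (comb s (q C B D))`_1.
  apply: (der_uniq ra uF) => z; apply: (der_comb
    (p := fun e z => (z ^+ C e) *: ((1 + z *: 'X) ^+ D e * 'X^(B e)))) => // [|t y|e y].
  - exact: (one_parameter_lower k).1.
  - rewrite Hs; apply: eq_bigr => x _; congr (_ *: _); rewrite /mono !sl2M.
    have [-> -> -> ->] := upperE t; have [-> -> -> ->] := lowerE y.
    rewrite hornerZ hornerM !hornerXn horner_exp horner_binomial.
    rewrite !mulr0 !mul1r !mulr1 !addr0 expr1n mul1r /D /B /C (addrC (y * t)); ring.
  - rewrite coefZ coef1_binomial /q hornerM hornerXn hornerD hornerZ hornerX hornerC; ring.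
pose d := (\max_(x <- s) D x.2 + `|w|)%N.
pose b (e : nat * nat * nat * nat) : k := (B e == 0)%:R * (C e == 0)%:R.
(* [Q] takes at [t] the value of [t ^+ d] times the torus action on [r]. The shift [d] clears
   negative powers and makes [d + w] nonnegative. The torus derivative is then the derivative of [Q]
   at 1 minus [d] times its value there. *)
pose Q := comb s (fun e => b e *: 'X^(d + A e - D e)).
have Dd x : x \in s -> (D x.2 <= d)%N.
  by move=> xs; rewrite (leq_trans _ (leq_addr _ _)) // (leq_bigmax_seq (F := fun x => D x.2)).
pose n := absz (d%:Z + w).
have dw : d%:Z + w = n.
  by rewrite /n gez0_abs // /d PoszD; move: (\max_(x <- s) _); lia.
have QE : Q = r%:P * 'X^n.
  apply: (@vandermonde_uniq _ _ _ _ [:: 0]) => t; rewrite inE => t0.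
  rewrite horner_comb hornerM hornerXn hornerC.
  rewrite -[t%:A]/(in_alg R t) -rmorphXn /= mulr_algr -[t ^+ n]/(t ^ n%:Z).
  rewrite -dw expfzDr // -scalerA -(Hw _ t0) Hs scaler_sumr.
  apply: eq_big_seq => x /Dd xd; rewrite scalerA; congr (_ *: _).
  have [m1 m2 m3 m4] := tdiagE t0; rewrite /mono m1 m2 m3 m4 hornerZ hornerXn /b !expr0n.
  rewrite exprVn; apply: (mulIf (expf_neq0 (D x.2) t0)).
  rewrite -[LHS]mulrA -exprD subnK ?(leq_trans xd) ?leq_addr // exprD -exprnP.
  rewrite -[RHS]mulrA divfK ?expf_neq0 // /A /B /C; ring.
have dQ : w%:~R *: r = \sum_(x <- s) (b x.2 * ((A x.2)%:R - (D x.2)%:R)) *: x.1.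
  have -> : w%:~R *: r = Q^`().[1%:A] - d%:R *: Q.[1%:A].
    rewrite QE mul_polyC derivZ derivXn !hornerZ hornerMn !hornerXn scale1r !expr1n mulr1 mulr_natr.
    have -> : w%:~R = n%:R - d%:R :> k.
      by rewrite -[n%:R]/((n : int)%:~R) -dw intrD -[d%:R]/((d : int)%:~R) addrAC subrr add0r.
    by rewrite scalerBl; congr (_ - _); apply: scaler_nat.
  rewrite /Q horner_comb /comb raddf_sum horner_sum scaler_sumr -sumrB.
  apply: eq_big_seq => x /Dd xd; rewrite /= derivZ deriv_map hornerZ -[1%:A]/(in_alg R 1) horner_map /=.
  rewrite derivZ derivXn !hornerZ hornerMn !hornerXn !expr1n mulr1 mulr_algr scalerA -scalerBl.
  congr (_ *: _); rewrite natrB ?(leq_trans xd) ?leq_addr // natrD; ring.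
rewrite EF FE dQ !coef_comb -big_split; apply: eq_bigr => x _ /=; rewrite -scalerDl.
congr (_ *: _); rewrite /q !coef1_shift /b; ring.
Qed.

Lemma der_torus (u : k -> G) (e : int) r : one_parameter u ->
  (forall t (t0 : t != 0) z, (tdiag t0 * u z)%g = (u (t ^ e * z)%R * tdiag t0)%g) ->
  forall t (t0 : t != 0), alpha (tdiag t0) (der alpha u r) = t ^ e *: der alpha u (alpha (tdiag t0) r).
Proof.
move=> Hu He t t0.
have H : map_poly (alpha (tdiag t0)) (flow alpha u r) =
    flow alpha u (alpha (tdiag t0) r) \Po ((t ^ e)%:A *: 'X).
  apply: (@vandermonde_uniq _ _ _ _ [::]) => z _.
  rewrite -action_horner // -flowE // -action_comp // He action_comp //.
  by rewrite horner_comp hornerZ hornerX !mulr_algl scalerA flowE.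
have C1 (Q : {poly R}) : Q`_1 = Q^`().[0] by rewrite horner_coef0 coef_deriv mulr1n.
rewrite /der -coef_map_id0 ?action0 // H !C1 deriv_comp derivZ derivX.
by rewrite hornerM horner_comp !hornerZ hornerX mulr0 -polyC1 hornerC mulr1 mulr_algr.
Qed.

Lemma upper_torus r t (t0 : t != 0) :
  alpha (tdiag t0) (E r) = t ^ 2 *: E (alpha (tdiag t0) r).
Proof. by apply: der_torus => // l l0 z; rewrite tdiag_upper. Qed.

Lemma lower_torus r t (t0 : t != 0) :
  alpha (tdiag t0) (F r) = t ^ (- 2%:Z) *: F (alpha (tdiag t0) r).
Proof.
apply: der_torus => // l l0 z; rewrite lower_tdiag; congr (_ * lower _)%g.
by rewrite mulrA -[l ^+ 2]/(l ^ 2) -expfzDr // mul1r.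
Qed.

Lemma upper_weight w r : has_weight w r -> has_weight (w + 2) (E r).
Proof. by move=> Hw t t0; rewrite upper_torus Hw derZ // scalerA mulrC -expfzDr. Qed.

Lemma lower_weight w r : has_weight w r -> has_weight (w - 2) (F r).
Proof. by move=> Hw t t0; rewrite lower_torus Hw derZ // scalerA mulrC -expfzDr. Qed.

Lemma weightD w r s : has_weight w r -> has_weight w s -> has_weight w (r + s).
Proof. by move=> Hr Hs t t0; rewrite actionD // Hr Hs scalerDr. Qed.
Lemma weightZ w c r : has_weight w r -> has_weight w (c *: r).
Proof. by move=> Hr t t0; rewrite actionZ // Hr !scalerA mulrC. Qed.
Lemma weightM v w r s : has_weight v r -> has_weight w s -> has_weight (v + w) (r * s).
Proof. by move=> Hr Hs t t0; rewrite actionM // Hr Hs -scalerAl -scalerAr scalerA expfzDr. Qed.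
Lemma weight0 w : has_weight w 0. Proof. by move=> t t0; rewrite action0 // scaler0. Qed.

(** Multiplying by a large power of [t] clears the inverse powers coming from the lower right entry
    of [tdiag]. The coefficients of [Q] are then the weight components of [r], with weights shifted
    by [d]. *)
Lemma torus_flow r : exists d0, forall d, (d0 <= d)%N -> exists Q : {poly R},
  forall t (t0 : t != 0), Q.[t%:A] = t ^+ d *: alpha (tdiag t0) r.
Proof.
have [s Hs] := action_mono r; exists (\max_(x <- s) x.2.2)%N => d d0.
exists (comb s (fun e => ((e.1.1.2 == 0)%N%:R * (e.1.2 == 0)%N%:R) *: 'X^(d + e.1.1.1 - e.2))) => t t0.
rewrite horner_comb Hs scaler_sumr; apply: eq_big_seq => x xs.
have xd : (x.2.2 <= d)%N by apply: leq_trans d0; apply: (leq_bigmax_seq (F := fun x => x.2.2)).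
have [m1 m2 m3 m4] := tdiagE t0; rewrite /mono m1 m2 m3 m4 hornerZ hornerXn !expr0n scalerA.
congr (_ *: _); rewrite exprVn; apply: (mulIf (expf_neq0 x.2.2 t0)).
rewrite -[LHS]mulrA -exprD subnK ?(leq_trans xd) ?leq_addr // exprD.
rewrite -[RHS]mulrA divfK ?expf_neq0 //; ring.
Qed.

Section TorusFlow.
Variables (r : R) (d : nat) (Q : {poly R}).
Hypothesis QE : forall t (t0 : t != 0), Q.[t%:A] = t ^+ d *: alpha (tdiag t0) r.

Lemma torus_flow_weight (i : nat) : has_weight (i%:Z - d%:Z) Q`_i.
Proof.
move=> t t0.
have H : map_poly (alpha (tdiag t0)) Q = (t ^- d)%:A *: \poly_(j < size Q) (t ^+ j *: Q`_j).
  apply: (@vandermonde_uniq _ _ _ _ [:: 0]) => z; rewrite inE => z0.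
  have tz0 : z * t != 0 by rewrite mulf_neq0.
  rewrite -action_horner // QE hornerZ mulr_algl.
  have -> : (\poly_(j < size Q) (t ^+ j *: Q`_j)).[z%:A] = Q.[(z * t)%:A].
    rewrite horner_poly horner_coef; apply: eq_bigr => j _.
    rewrite -![_%:A]/(in_alg R _) -!rmorphXn /= !mulr_algr scalerA exprMn; congr (_ *: _).
  rewrite (QE tz0) scalerA actionZ // -action_comp //.
  congr (_ *: alpha _ r); first by rewrite exprMn mulrC mulfK ?expf_neq0.
  have [a1 a2 a3 a4] := tdiagE t0; have [b1 b2 b3 b4] := tdiagE z0.
  have [c1 c2 c3 c4] := tdiagE tz0.
  by apply: sl2_eq; rewrite sl2M ?a1 ?a2 ?a3 ?a4 ?b1 ?b2 ?b3 ?b4 ?c1 ?c2 ?c3 ?c4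
    ?mulr0 ?mul0r ?addr0 ?add0r // ?invfM // mulrC.
rewrite -coef_map_id0 ?action0 // H coefZ coef_poly mulr_algl.
case: ltnP => [_|l]; last by rewrite nth_default // !scaler0.
by rewrite scalerA expfzDr // -exprnN mulrC.
Qed.

Lemma torus_flow_sub M i : subspace M -> (forall t (t0 : t != 0), M (alpha (tdiag t0) r)) -> M Q`_i.
Proof.
move=> sM Mr; apply: (vandermonde (bad := [:: 0])) => // t; rewrite inE => t0.
by rewrite QE; apply: subspaceZ.
Qed.

Lemma torus_flow1 : r = \sum_(i < size Q) Q`_i.
Proof.
have t1 : tdiag (oner_neq0 k) = 1%g.
  have [a1 a2 a3 a4] := tdiagE (oner_neq0 k); have [b1 b2 b3 b4] := sl2_1E k.
  by apply: sl2_eq; rewrite ?a1 ?a2 ?a3 ?a4 ?b1 ?b2 ?b3 ?b4 ?invr1.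
have := QE (oner_neq0 k); rewrite expr1n !scale1r t1 action_id // => <-.
by rewrite horner_coef; apply: eq_bigr => i _; rewrite expr1n mulr1.
Qed.

End TorusFlow.

End Weights.


(** * Complete reducibility through the extremal projector *)

Section Lifting.
Variables (k : closedFieldType) (R : comAlgType k).
Hypothesis char0 : [pchar k] =i pred0.
Local Notation G := (sl2 k).
Variable alpha : G -> R -> R.
Hypothesis ra : rational_action alpha.

Local Notation E := (der alpha (@upper k)).
Local Notation F := (der alpha (@lower k)).
Local Notation weight := (has_weight alpha).
Let uE := one_parameter_upper k.
Let uF := one_parameter_lower k.

Let natk n : (n.+1%:R : k) != 0. Proof. by rewrite ((pcharf0P k).1 char0). Qed.

Lemma derN u (Hu : one_parameter u) r : der alpha u (- r) = - der alpha u r.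
Proof. by rewrite -!scaleN1r derZ. Qed.
Lemma der0 u (Hu : one_parameter u) : der alpha u 0 = 0.
Proof. by rewrite -[0 in LHS](scale0r 0) derZ // scale0r. Qed.
Lemma der_sum u (Hu : one_parameter u) (T : Type) (s : seq T) (P : pred T) (f : T -> R) :
  der alpha u (\sum_(i <- s | P i) f i) = \sum_(i <- s | P i) der alpha u (f i).
Proof. by apply: big_morph; [apply: derD | apply: der0]. Qed.
Lemma iter_der0 u (Hu : one_parameter u) n : iter n (der alpha u) 0 = 0.
Proof. by elim: n => //= n ->; apply: der0. Qed.
Lemma iter_derD u (Hu : one_parameter u) n r s :
  iter n (der alpha u) (r + s) = iter n (der alpha u) r + iter n (der alpha u) s.
Proof. by elim: n => //= n ->; apply: derD. Qed.
Lemma iter_derZ u (Hu : one_parameter u) n c r :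
  iter n (der alpha u) (c *: r) = c *: iter n (der alpha u) r.
Proof. by elim: n => //= n ->; apply: derZ. Qed.

Lemma iter_upper_weight w n r : weight w r -> weight (w + (n * 2)%N) (iter n E r).
Proof.
move=> Hw; elim: n => [|n IH] /=; first by rewrite addr0.
have := upper_weight ra IH; congr weight; rewrite -addrA; congr (_ + _); lia.
Qed.

Lemma iter_lower_weight w n r : weight w r -> weight (w - (n * 2)%N%:Z) (iter n F r).
Proof.
move=> Hw; elim: n => [|n IH] /=; first by rewrite subr0.
have := lower_weight ra IH; congr weight; rewrite -addrA; congr (_ + _); lia.
Qed.

Lemma upper_iter_lower w j r : weight w r ->
  E (iter j.+1 F r) = iter j.+1 F (E r) + (j.+1%:R * (w%:~R - j%:R)) *: iter j F r.
Proof.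
move=> Hw; elim: j => [|j IH]; first by rewrite /= subr0 mul1r; apply: commutator.
rewrite iterS (commutator ra (iter_lower_weight j.+1 Hw)) IH derD // derZ // -!iterS -addrA -scalerDl.
congr (_ + _ *: _); rewrite intrB -[((j.+1 * 2)%N%:Z)%:~R]/((j.+1 * 2)%:R) natrM.
by rewrite -!natr1; ring.
Qed.

(** In closed form, [(-1)^j / (j! (d+2) ... (d+j+1))]: the coefficients of the extremal projector on
    vectors of weight [d]. *)
Fixpoint extremal_coef (d j : nat) : k :=
  if j is i.+1 then - extremal_coef d i / (i.+1%:R * (d + i.+2)%:R) else 1.

(* The truncation of the extremal projector of [sl_2] onto the highest weight vectors. *)
Definition extremal d n r := \sum_(j < n) extremal_coef d j *: iter j F (iter j E r).

(** By [upper_iter_lower] the sum telescopes under [E], leaving one term that contains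
    [iter n E r]. *)
Lemma upper_extremal d n r : weight d%:Z r -> iter n E r = 0 -> E (extremal d n r) = 0.
Proof.
move=> Hd; case: n => [|n] Hn; first by rewrite /extremal big_ord0 der0.
suff -> : E (extremal d n.+1 r) = extremal_coef d n *: iter n F (iter n.+1 E r).
  by rewrite Hn iter_der0 // scaler0.
elim: {Hn} n => [|n IH]; first by rewrite /extremal big_ord1 derZ.
rewrite /extremal big_ord_recr derD // IH derZ //=.
have /= -> := upper_iter_lower n (iter_upper_weight n.+1 Hd).
have -> : (d%:Z + (n.+1 * 2)%N)%:~R - n%:R = (d + n.+2)%:R :> k.
  rewrite intrD -[d%:~R]/(d%:R) -[((n.+1 * 2)%N%:Z)%:~R]/((n.+1 * 2)%:R).
  by rewrite -natrD -natrB; [congr (_%:R); lia | lia].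
rewrite scalerDr addrCA scalerA -scalerDl divfK ?mulf_neq0 ?addnS //.
by rewrite addrN scale0r addr0.
Qed.

Lemma extremal_weight d n r : weight d%:Z r -> weight d%:Z (extremal d n r).
Proof.
move=> Hd; apply: big_ind => [|x y|j _]; [exact: weight0 | exact: weightD | apply: weightZ => //].
by have := iter_lower_weight j (iter_upper_weight j Hd); rewrite addrK.
Qed.

Lemma extremalM d n r s : E s = 0 -> F s = 0 -> extremal d n (r * s) = extremal d n r * s.
Proof.
have H u : one_parameter u -> der alpha u s = 0 -> forall j x,
    iter j (der alpha u) (x * s) = iter j (der alpha u) x * s.
  by move=> Hu s0; elim=> // j IH x; rewrite !iterS IH derM // s0 mulr0 addr0.
move=> Es Fs; rewrite mulr_suml; apply: eq_bigr => j _.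
by rewrite H // H // scalerAl.
Qed.

Lemma extremal_sum d n (T : Type) (t : seq T) (P : pred T) (f : T -> R) :
  extremal d n (\sum_(i <- t | P i) f i) = \sum_(i <- t | P i) extremal d n (f i).
Proof.
apply: (big_morph (extremal d n)) => [x y|].
  by rewrite -big_split; apply: eq_bigr => j _; rewrite !iter_derD // scalerDr.
by apply: big1 => j _; rewrite !iter_der0 // scaler0.
Qed.

Lemma extremal_fixed d n r : E r = 0 -> extremal d n.+1 r = r.
Proof.
move=> E0; rewrite /extremal big_ord_recl big1 => [|j _]; first by rewrite addr0 /= scale1r.
by rewrite lift0 [iter _ E r]iterSr E0 !iter_der0 // scaler0.
Qed.

Definition stable_subspace N := subspace N /\ forall g x, N x -> N (alpha g x).

Lemma der_stable N u x : stable_subspace N -> one_parameter u -> N x -> N (der alpha u x).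
Proof. by move=> [sN Ng] Hu Nx; apply: der_sub => // t; apply: Ng. Qed.

Lemma iter_der_stable N u x n : stable_subspace N -> one_parameter u -> N x ->
  N (iter n (der alpha u) x).
Proof. by move=> sN Hu Nx; elim: n => //= n; apply: der_stable. Qed.

Lemma extremal_mod N d n r : stable_subspace N -> N (E r) -> N (r - extremal d n.+1 r).
Proof.
move=> sN NE; rewrite /extremal big_ord_recl [X in r - (X + _)](_ : _ = r); last exact: scale1r.
rewrite opprD addNKr.
rewrite -scaleN1r; apply: subspaceZ; first exact: sN.1.
apply: subspace_sum => [|j _]; first exact: sN.1.
apply: subspaceZ; first exact: sN.1.
by rewrite lift0 [iter _ E r]iterSr; do 2!apply: iter_der_stable => //.
Qed.

(** Some power of [F] kills [r]. Modulo [N], applying [E] goes back down one power of [F] at a time,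
    with the factor [(j+1)(w-j)], which is nonzero for negative [w]. *)
Lemma negative_weight N w r : stable_subspace N -> weight w r -> w < 0 -> N (E r) -> N r.
Proof.
move=> sN Hw w0 NE; have sub := sN.1.
have H j : N (iter j.+1 F r) -> N (iter j F r).
  move=> Nj; have c0 : (j.+1%:R * (w%:~R - j%:R) : k) != 0.
    rewrite mulf_neq0 // -oppr_eq0 opprB -[j%:R]/((j : int)%:~R) -intrB.
    have -> : j%:Z - w = (absz (j%:Z - w)).-1.+1 by lia.
    exact: natk.
  rewrite -(scale1r (iter j F r)) -(mulVf c0) -scalerA; apply: subspaceZ => //.
  rewrite (_ : _ *: _ = E (iter j.+1 F r) - iter j.+1 F (E r)).
    by apply: subspaceB => //; [apply: der_stable | apply: iter_der_stable].
  by rewrite (upper_iter_lower j Hw) addrAC subrr add0r.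
have : N (iter (size (flow alpha (@lower k) r)) F r).
  by rewrite (iter_der_eq0 ra uF (leqnn _)); apply: subspace0.
by elim: (size _) => // j IH /H.
Qed.

(* Complete reducibility, in the form: a highest weight vector modulo a stable subspace lifts. *)
Lemma highest_weight_lift N r : stable_subspace N -> N (E r) ->
  exists n (d : 'I_n -> nat) (x : 'I_n -> R),
    [/\ forall i, E (x i) = 0, forall i, weight (d i) (x i) & N (r - \sum_i x i)].
Proof.
move=> sN NE; have sub := sN.1.
have [d /(_ d (leqnn d)) [Q QE]] := torus_flow ra r.
have NQ i : N (E Q`_i).
  apply: (torus_flow_sub (M := [set x | N (E x)]) QE) => [|t t0].
    split=> /= [|x y Nx Ny|c x Nx]; rewrite ?der0 ?derD ?derZ //.
    - exact: subspace0.
    - exact: subspaceD.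
    - exact: subspaceZ.
  have : N (t ^- 2 *: alpha (tdiag t0) (E r)) by apply: subspaceZ => //; apply: sN.2.
  by rewrite upper_torus // scalerA mulVf ?scale1r // expf_neq0.
have Qw i := torus_flow_weight ra QE i.
(* Components of nonnegative weight are replaced by their extremal projection; those of negative
   weight already lie in [N]. *)
have /choice [x Hx] (i : 'I_(size Q)) : exists x,
    [/\ E x = 0, weight (i - d)%N%:Z x & N (Q`_i - x)].
  have [di|id] := leqP d i.
    have iw : weight (i - d)%N%:Z Q`_i by have := Qw i; rewrite subzn.
    set n := size (flow alpha (@upper k) Q`_i).
    exists (extremal (i - d) n.+1 Q`_i); split.
    - by apply: upper_extremal => //; apply: (iter_der_eq0 ra uE).
    - exact: extremal_weight.
    - exact: extremal_mod.
  exists 0; split; [exact: der0 | exact: weight0 | rewrite subr0].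
  by apply: (negative_weight sN (Qw i)) => //; rewrite subr_lt0 ltz_nat.
exists (size Q), (fun i : 'I_(size Q) => (i - d)%N), x; split=> [i|i|]; try by have [] := Hx i.
rewrite {1}(torus_flow1 ra QE) -sumrB; apply: subspace_sum => // i _.
by have [] := Hx i.
Qed.

(** The last coefficient outside [J] of the flow of [x] under [upper] is annihilated by [E] modulo
    [J]. Flows multiply, so the product of two such coefficients is, modulo [J], a coefficient of
    the flow of [x * y]. *)
Lemma prime_highest_weight J : is_ideal J -> stable_subspace J ->
  (forall x y, J (E x) -> J (E y) -> J (x * y) -> J x \/ J y) ->
  forall x y, J (x * y) -> J x \/ J y.
Proof.
move=> iJ sJ H x y Jxy; have sub := sJ.1.
have top z : ~ J z -> exists n, [/\ ~ J (flow alpha (@upper k) z)`_n,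
    J (E (flow alpha (@upper k) z)`_n) & forall m, (n < m)%N -> J (flow alpha (@upper k) z)`_m].
  move=> Jz; set Q := flow _ _ z.
  have : exists n, `[< forall m, (n <= m)%N -> J Q`_m >].
    by exists (size Q); apply/asboolP => m Hm; rewrite nth_default //; apply: ideal0.
  case/ex_minnP => -[|n] /asboolP Hn Hmin.
    by case: Jz; rewrite -(flow0 ra uE z); apply: Hn.
  have Jn : ~ J Q`_n.
    move=> Jn; have : (n.+1 <= n)%N; last by rewrite ltnn.
    by apply: Hmin; apply/asboolP => m; rewrite leq_eqVlt => /predU1P[<-//|]; apply: Hn.
  exists n; split => //.
  rewrite -[E _]scale1r -(@mulVf k n`!%:R) -?scalerA; last by rewrite -(prednK (fact_gt0 n)).
  apply: subspaceZ => //; rewrite -derZ // scaler_nat -iter_der // -iterS iter_der //.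
  by rewrite -scaler_nat; apply: subspaceZ => //; apply: Hn.
have [Jx|/top [n [nx Ex tx]]] := pselect (J x); first by left.
have [Jy|/top [m [my Ey ty]]] := pselect (J y); first by right.
exfalso; have := H _ _ Ex Ey; suff Jnm : J ((flow alpha (@upper k) x)`_n * (flow alpha (@upper k) y)`_m).
  by case.
have : J (flow alpha (@upper k) (x * y))`_(n + m).
  apply: (vandermonde (bad := [::])) => // t _; rewrite -flowE //; exact: sJ.2.
have -> : flow alpha (@upper k) (x * y) = flow alpha (@upper k) x * flow alpha (@upper k) y.
  by apply: flow_uniq => // t; rewrite hornerM -!flowE // actionM.
have nm : (n < (n + m).+1)%N by lia.
rewrite coefM (bigD1 (Ordinal nm)) //= addKn => H'.
rewrite -[X in J X](addrK (\sum_(i < (n + m).+1 | i != Ordinal nm)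
  (flow alpha (@upper k) x)`_i * (flow alpha (@upper k) y)`_(n + m - i))).
apply: subspaceB => //; apply: ideal_sum => // i; rewrite -val_eqE /= => ni.
have [l|l] := ltnP n i; first by apply: idealMr => //; apply: tx.
by apply: idealMl => //; apply: ty; lia.
Qed.

End Lifting.


(** * The quotient by [J] described through its highest weight vectors *)

Section MpolyEvaluation.
Variables (k : closedFieldType) (R : comAlgType k) (n : nat).

Lemma subspace_mmap (N : set R) (s : 'I_n -> R) p : subspace N -> N 1 ->
  (forall x y, N x -> N y -> N (x * y)) -> (forall i, N (s i)) -> N (mmap (in_alg R) s p).
Proof.
move=> sN N1 NM Ns; rewrite /mmap; apply: subspace_sum => // m _.
rewrite mulr_algl; apply: subspaceZ => //; apply: big_ind => // i _.
by elim: (m i) => [|j IH]; rewrite ?expr0 // exprS; apply: NM.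
Qed.

Lemma mmap_homog (s : 'I_n -> R) c d (p : {mpoly k[n]}) : p \is d.-homog ->
  mmap (in_alg R) (fun i => c *: s i) p = c ^+ d *: mmap (in_alg R) s p.
Proof.
move=> /dhomogP Hp; rewrite /mmap scaler_sumr; apply: eq_big_seq => m /Hp <-.
rewrite !mulr_algl scalerA mulrC -scalerA; congr (_ *: _).
rewrite /mmap1 /= mdegE -prodrXr -scaler_prod; apply: eq_bigr => i _.
by rewrite exprZn.
Qed.

Lemma ideal_generated_ideal (S : set R) : is_ideal (ideal_generated S).
Proof.
split.
- by exists 0%N, (fun=> 0), (fun=> 0); split=> [[]|] //; rewrite big_ord0.
- move=> a b [m1 [r1 [s1 [S1 ->]]]] [m2 [r2 [s2 [S2 ->]]]]; exists (m1 + m2)%N.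
  exists (fun i => match fintype.split i with inl j => r1 j | inr j => r2 j end).
  exists (fun i => match fintype.split i with inl j => s1 j | inr j => s2 j end).
  split=> [i|]; first by case: fintype.split.
  by rewrite big_split_ord; congr (_ + _); apply: eq_bigr => i _;
    rewrite -1?[lshift _ _]/(unsplit (inl _)) -1?[rshift _ _]/(unsplit (inr _)) unsplitK.
- move=> c a [m [r [s [Ss ->]]]]; exists m, (fun i => c * r i), s; split=> //.
  by rewrite mulr_sumr; apply: eq_bigr => i _; rewrite mulrA.
Qed.

End MpolyEvaluation.

Section HighestWeights.
Variables (k : closedFieldType) (R : comAlgType k).
Hypothesis char0 : [pchar k] =i pred0.
Local Notation G := (sl2 k).
Variable alpha : G -> R -> R.
Hypothesis ra : rational_action alpha.

Local Notation E := (der alpha (@upper k)).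
Local Notation F := (der alpha (@lower k)).
Local Notation weight := (has_weight alpha).
Let uE := one_parameter_upper k.
Let uF := one_parameter_lower k.

Variables (S : set R) (m : nat) (s s' : 'I_m -> R).
Local Notation J := (ideal_generated S).
Local Notation ev := (mmap (in_alg R)).
Hypothesis S_invariant : forall g r, S r -> alpha g r = r.
Hypothesis s_act : forall g i, alpha g (s i) = g 0 0 *: s i + g 1 0 *: s' i.
(** [generation] and [independence] concern genuine [U]-invariants of [R], which can be computed on
    [X]. Below they are turned into statements about [U]-invariants of the quotient by [J]. *)
Hypothesis generation : forall x (d : nat), (forall t, alpha (upper t) x = x) ->
  weight d x -> exists2 p : {mpoly k[m]}, p \is d.-homog & J (x - ev s p).
Hypothesis independence : forall d (p : {mpoly k[m]}), p \is d.-homog ->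
  forall n (r b : 'I_n -> R), (forall i, S (r i)) ->
  (forall i t, alpha (upper t) (b i) = b i) -> (forall i, weight d (b i)) ->
  ev s p = \sum_i b i * r i -> p = 0.

Let iJ : is_ideal J := ideal_generated_ideal S.

Lemma s'_act g i : alpha g (s' i) = g 0 1 *: s i + g 1 1 *: s' i.
Proof.
have [l1 l2 l3 l4] := lowerE (1 : k).
have := s_act (g * lower 1)%g i; rewrite action_comp // s_act !sl2M l1 l3 !mulr1 !scale1r.
by rewrite actionD // s_act !scalerDl addrACA => /addrI.
Qed.

Lemma stable_J : stable_subspace alpha J.
Proof.
split=> [|g x [n [r [t [St ->]]]]]; first exact: ideal_subspace.
rewrite action_sum //; apply: ideal_sum => // i _; rewrite actionM // (S_invariant g (St i)).
exists 1%N, (fun=> alpha g (r i)), (fun=> t i); split=> //.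
by rewrite big_ord1.
Qed.

Lemma action_mmap g n (t : 'I_n -> R) p : alpha g (ev t p) = ev (fun i => alpha g (t i)) p.
Proof.
rewrite /mmap action_sum //; apply: eq_bigr => e _; rewrite !mulr_algl actionZ //.
congr (_ *: _); rewrite /mmap1 (big_morph (alpha g) (actionM ra g) (action1 ra g)).
apply: eq_bigr => i _; elim: (e i) => [|j IH]; first by rewrite !expr0 action1.
by rewrite !exprS actionM // IH.
Qed.

Lemma upper_s t i : alpha (upper t) (s i) = s i.
Proof. by rewrite s_act; have [-> _ -> _] := upperE t; rewrite scale1r scale0r addr0. Qed.

Lemma upper_ev t p : alpha (upper t) (ev s p) = ev s p.
Proof. by rewrite action_mmap; apply: eq_mmap => // i; apply: upper_s. Qed.

Lemma der_invariant u r : one_parameter u -> (forall t, alpha (u t) r = r) -> der alpha u r = 0.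
Proof.
move=> Hu H; rewrite (@der_uniq _ _ _ ra u Hu _ r%:P) ?coefC // => t.
by rewrite hornerC.
Qed.

Lemma ev_weight d p : p \is d.-homog -> weight d (ev s p).
Proof.
move=> Hp t t0; rewrite action_mmap -exprnP -mmap_homog //; apply: eq_mmap => // i.
by rewrite s_act; have [-> _ -> _] := tdiagE t0; rewrite scale0r addr0.
Qed.

Lemma highest_weight_mod x : J (E x) -> exists p : {mpoly k[m]}, J (x - ev s p).
Proof.
move=> JE; have [n [d [y [Ey wy Jy]]]] := highest_weight_lift char0 ra stable_J JE.
have /choice [p Hp] i : exists p : {mpoly k[m]}, J (y i - ev s p).
  have [t|p _ Hp] := generation _ (wy i); first exact: der_eq0.
  by exists p.
exists (\sum_i p i); rewrite rmorph_sum /=.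
rewrite (_ : _ - _ = x - \sum_i y i + \sum_i (y i - ev s (p i))); last first.
  by rewrite sumrB addrA subrK.
by apply: idealD => //; apply: ideal_sum.
Qed.

(** In a relation with values in [J], replace the coefficients of the generators by their components
    of weight [d], and then by their extremal projections. Both operations commute with
    multiplication by the invariant generators and fix [ev s p], so [independence] applies. *)
Lemma ev_independent_homog d p : p \is d.-homog -> J (ev s p) -> p = 0.
Proof.
move=> Hp [n [a [r [Sr Ear]]]].
have inv g i : alpha g (r i) = r i by apply: S_invariant.
have /choice [d0 Hd0] i := torus_flow ra (a i).
pose D := (\max_i d0 i)%N.
have /choice [Q HQ] i : exists Q : {poly R}, forall t (t0 : t != 0), Q.[t%:A] = t ^+ D *: alpha (tdiag t0) (a i).
  by apply: Hd0; apply: leq_bigmax.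
have EQ : \sum_i Q i * (r i)%:P = (ev s p)%:P * 'X^(D + d).
  apply: (@vandermonde_uniq _ _ _ _ [:: 0]) => t; rewrite inE => t0.
  rewrite horner_sum hornerM hornerXn hornerC -[t%:A]/(in_alg R t) -rmorphXn /= mulr_algr.
  rewrite exprD -scalerA [t ^+ d]exprnP -(ev_weight Hp t0) Ear action_sum // scaler_sumr.
  by apply: eq_bigr => i _; rewrite hornerM hornerC HQ actionM // inv scalerAl.
pose b i := (Q i)`_(D + d).
have bw i : weight d (b i).
  by have := torus_flow_weight ra (HQ i) (D + d); congr weight; rewrite PoszD addrC addKr.
have Eb : ev s p = \sum_i b i * r i.
  have := congr1 (fun Q : {poly R} => Q`_(D + d)) EQ.
  rewrite coefCM coefXn eqxx mulr1 coef_sum => <-.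
  by apply: eq_bigr => i _; rewrite coefMC.
pose K := (\max_i size (flow alpha (@upper k) (b i)))%N.
apply: (independence Hp (r := r) (b := fun i => extremal alpha d K.+1 (b i))) => // [i t|i|].
- apply: der_eq0 => //; apply: upper_extremal => //.
  apply: iter_der_eq0 => //; apply: leqW; exact: leq_bigmax.
- exact: extremal_weight.
- rewrite -(@extremal_fixed _ _ _ ra d K (ev s p)); last first.
    by apply: der_invariant => // t; apply: upper_ev.
  rewrite Eb extremal_sum //; apply: eq_bigr => i _; apply: extremalM => //.
  - by apply: der_invariant.
  - by apply: der_invariant.
Qed.

Lemma ev_independent p : J (ev s p) -> p = 0.
Proof.
move=> Jp.
have Ep := pihomog_partitionE (leqnn (@mmeasure _ _ mdeg p)).
pose Q : {poly R} := \poly_(d < @mmeasure _ _ mdeg p) ev s (pihomog mdeg d p).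
have JQ d : J Q`_d.
  apply: (vandermonde (bad := [:: 0])) => [|t]; first exact: stable_J.1.
  rewrite inE => t0; suff -> : Q.[t%:A] = alpha (tdiag t0) (ev s p) by apply: stable_J.2.
  rewrite [p in RHS]Ep rmorph_sum action_sum // horner_poly; apply: eq_bigr => i _ /=.
  have := ev_weight (pihomogP mdeg i p) t0 => ->.
  by rewrite -[t%:A]/(in_alg R t) -rmorphXn /= mulr_algr.
rewrite Ep big1 // => i _; apply: (ev_independent_homog (pihomogP mdeg i p)).
by have := JQ i; rewrite coef_poly ltn_ord.
Qed.

Lemma special_proper : ~ J 1.
Proof.
move=> J1; have /eqP : (1 : {mpoly k[m]}) = 0 by apply: ev_independent; rewrite rmorph1.
by rewrite oner_eq0.
Qed.

Lemma special_prime : forall x y, J (x * y) -> J x \/ J y.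
Proof.
apply: (prime_highest_weight char0 ra iJ stable_J) => x y /highest_weight_mod[p Hp] /highest_weight_mod[q Hq] Jxy.
have : J (ev s (p * q)).
  rewrite rmorphM /= (_ : _ * _ = x * y - (x - ev s p) * y - ev s p * (y - ev s q)); last by ring.
  by apply: idealB => //; [apply: idealB => //; apply: idealMr | apply: idealMl].
move=> /ev_independent /eqP; rewrite mulf_eq0 => /orP[] /eqP H.
- by left; move: Hp; rewrite H rmorph0 subr0.
- by right; move: Hq; rewrite H rmorph0 subr0.
Qed.

Definition pairs : 'I_(m + m) -> R := fun i =>
  match fintype.split i with inl j => s j | inr j => s' j end.

Lemma pairs_l i : pairs (lshift m i) = s i.
Proof. by rewrite /pairs -[lshift _ _]/(unsplit (inl _)) unsplitK. Qed.
Lemma pairs_r i : pairs (rshift m i) = s' i.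
Proof. by rewrite /pairs -[rshift _ _]/(unsplit (inr _)) unsplitK. Qed.

(** The subalgebra [B] generated modulo [J] by the [s i] and [s' i] is stable and contains all
    highest weight vectors. Lifting modulo [B] shows that [E y] in [B] implies [y] in [B], and [E]
    acts nilpotently on each element. *)
Lemma special_generated x : exists p : {mpoly k[m + m]}, J (x - ev pairs p).
Proof.
pose B : set R := [set x | exists p : {mpoly k[m + m]}, J (x - ev pairs p)].
have Bp i : B (pairs i).
  by exists 'X_i; rewrite mmapX mmap1U subrr; apply: ideal0.
have B1 : B 1 by exists 1; rewrite rmorph1 subrr; apply: ideal0.
have sB : subspace B.
  split.
  - by exists 0; rewrite rmorph0 subr0; apply: ideal0.
  - move=> y z [p Hp] [q Hq]; exists (p + q); rewrite rmorphD opprD addrACA.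
    exact: idealD.
  - move=> c y [p Hp]; exists (c *: p); rewrite /= mmapZ mulr_algl -scalerBr.
    by apply: subspaceZ => //; apply: stable_J.1.
have MB y z : B y -> B z -> B (y * z).
  move=> [p Hp] [q Hq]; exists (p * q); rewrite rmorphM.
  rewrite (_ : _ - _ = (y - ev pairs p) * z + ev pairs p * (z - ev pairs q)); last by ring.
  by apply: idealD => //; [apply: idealMr | apply: idealMl].
have JB y z : J (y - z) -> B z -> B y.
  move=> Jyz [p Hp]; exists p; rewrite -(subrK z y) -addrA.
  exact: idealD.
have stB : stable_subspace alpha B.
  split=> // g y [p Hp]; apply: (JB _ (alpha g (ev pairs p))).
    by rewrite -scaleN1r -actionZ // -actionD // scaleN1r; apply: stable_J.2.
  rewrite action_mmap; apply: subspace_mmap => // i.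
  rewrite /pairs; case: (splitP i) => j _; rewrite ?s_act ?s'_act; apply: subspaceD => //;
    by apply: subspaceZ => //; rewrite -1?pairs_l -1?pairs_r.
have step y : B (E y) -> B y.
  move=> BE; have [n [d [z [Ez wz Bz]]]] := highest_weight_lift char0 ra stB BE.
  rewrite -(subrK (\sum_i z i) y); apply: subspaceD => //; apply: subspace_sum => // i _.
  have [p Hp] : exists p, J (z i - ev s p).
    by apply: highest_weight_mod; rewrite Ez; apply: ideal0.
  by apply: (JB _ _ Hp); apply: subspace_mmap => // j; rewrite -pairs_l.
have : B (iter (size (flow alpha (@upper k) x)) E x).
  by rewrite (iter_der_eq0 ra uE (leqnn _)); apply: subspace0.
by elim: (size _) => // j IH /step.
Qed.

Theorem special_invariants : affine_space_mod J (invariants_mod alpha J (@unipotent k)).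
Proof.
exists m, s; split=> [i u [u10 u00 u11]|b Hb|].
- by rewrite s_act u10 u00 scale1r scale0r addr0 subrr; apply: ideal0.
- apply: highest_weight_mod; apply: der_invariant_mod => // [|t]; first exact: ideal_subspace.
  by apply: Hb; have [? ? ? ?] := upperE t.
- exact: ev_independent.
Qed.

(** The determinant is [G]-invariant, so it has weight 0, and [generation] in degree 0 only offers
    constants. *)
Lemma special_pairing i j : exists c, J (s i * s' j - s j * s' i - c%:A).
Proof.
set x := s i * s' j - s j * s' i.
have inv g : alpha g x = x.
  rewrite actionD // -scaleN1r actionZ // scaleN1r !actionM // !s_act !s'_act.
  have D1 : (g 0 0)%:A * (g 1 1)%:A - (g 0 1)%:A * (g 1 0)%:A = 1 :> R.
    by rewrite -!(rmorphM (in_alg R)) -rmorphB sl2_ad rmorph1.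
  rewrite -[RHS]mul1r -D1 /x -!(mulr_algl _ (s _)) -!(mulr_algl _ (s' _)).
  move: (_%:A) (_%:A) (_%:A) (_%:A) (s i) (s j) (s' i) (s' j) => *; ring.
have [|t t0|p /dhomogP Hp Jp] := @generation x 0%N; first by move=> t; rewrite inv.
  by rewrite inv expr0z scale1r.
exists p@_0%MM; rewrite (_ : _%:A = ev s p) //; have -> : p = (p@_0%MM)%:MP.
  apply/mpolyP => e; rewrite mcoeffC; have [->|e0] := eqVneq e 0%MM; first by rewrite mulr1.
  rewrite mulr0; apply/eqP/negPn/negP; rewrite -mcoeff_msupp => /Hp /eqP.
  by rewrite mdeg_eq0 (negPf e0).
by rewrite mmapC mcoeffC eqxx mulr1.
Qed.

Lemma coef_linear_pow (a b : R) l n : (l <= n)%N ->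
  ((a%:P + b *: 'X) ^+ l)`_n = (l == n)%:R * b ^+ n.
Proof.
elim: l n => [|l IH] [|n] //; first by rewrite expr0 coefC mulr1.
  by rewrite expr0 coefC mul0r.
rewrite ltnS => ln; rewrite exprS mulrDl coefD coefCM -scalerAl coefZ coefXM /= !IH // ?leqW //.
by rewrite eqSS (ltn_eqF (_ : l < n.+1)%N) ?ltnS // mul0r mulr0 add0r mulrCA exprS.
Qed.

(** Since [upper t] sends [s' i] to [s' i + t s i], the coefficient of the top power of [t] in the
    translated relation is the leading coefficient of [q] times a power of [s i]. This is a
    polynomial in the [s] alone, hence zero by [ev_independent]. *)
Lemma special_injective i (q : {poly {mpoly k[m]}}) :
  J (map_poly (ev s) q).[s' i] -> q = 0.
Proof.
move=> Jq; apply/eqP/negPn/negP => q0.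
pose n := (size q).-1; have sq : size q = n.+1 by rewrite prednK ?size_poly_gt0.
pose Q : {poly R} := \sum_(l < n.+1) (ev s q`_l)%:P * ((s' i)%:P + s i *: 'X) ^+ l.
have JQ : forall n, J Q`_n.
  apply: (vandermonde (bad := [::])) => [|t _]; first exact: stable_J.1.
  suff -> : Q.[t%:A] = alpha (upper t) (map_poly (ev s) q).[s' i] by apply: stable_J.2.
  have sn : (size (map_poly (ev s) q) <= n.+1)%N by rewrite -sq; apply: size_poly.
  rewrite (horner_coef_wide _ sn) action_sum // horner_sum; apply: eq_bigr => l _.
  rewrite coef_map /= actionM // upper_ev hornerM hornerC horner_exp hornerD hornerC hornerZ hornerX.
  congr (_ * _); rewrite mulr_algr.
  have [_ u01 _ u11] := upperE t.
  elim: (l : nat) => [|j IH]; first by rewrite !expr0 action1.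
  by rewrite !exprS actionM // -IH s'_act u01 u11 scale1r addrC.
have := JQ n; rewrite coef_sum big_ord_recr /= big1 => [|l _]; last first.
  by rewrite coefCM coef_linear_pow ?ltn_eqF ?mul0r ?mulr0 // ltnW.
rewrite add0r coefCM coef_linear_pow // eqxx mul1r => JN.
have : J (ev s (q`_n * 'X_i ^+ n)).
  by rewrite rmorphM rmorphXn /= [X in _ * X ^+ _]mmapX mmap1U.
move=> /ev_independent /eqP; rewrite mulf_eq0 -[q`_n]lead_coefE lead_coef_eq0 (negPf q0) /=.
rewrite expf_eq0 => /andP[_ /eqP /(congr1 (mcoeff U_(i)%MM))].
by rewrite mcoeffX eqxx mcoeff0 => /eqP; rewrite oner_eq0.
Qed.

End HighestWeights.


(** * Normality of the special fiber *)

Section Congruence.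
Variables (A : comNzRingType) (I : set A).
Hypothesis iI : is_ideal I.

Definition cong x y := I (x - y).

Lemma cong_refl x : cong x x. Proof. by rewrite /cong subrr; apply: ideal0. Qed.
Lemma cong_sym x y : cong x y -> cong y x.
Proof. by move=> H; rewrite /cong -opprB; apply: idealN. Qed.
Lemma cong_trans x y z : cong x y -> cong y z -> cong x z.
Proof. by move=> H H'; rewrite /cong -(subrK y x) -addrA; apply: idealD. Qed.
Lemma congD x y z t : cong x y -> cong z t -> cong (x + z) (y + t).
Proof. by move=> H H'; rewrite /cong opprD addrACA; apply: idealD. Qed.
Lemma congM x y z t : cong x y -> cong z t -> cong (x * z) (y * t).
Proof.
move=> H H'; rewrite /cong (_ : _ - _ = (x - y) * z + y * (z - t)); last by ring.
by apply: idealD => //; [apply: idealMr | apply: idealMl].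
Qed.
Lemma congX x y n : cong x y -> cong (x ^+ n) (y ^+ n).
Proof.
move=> H; elim: n => [|n IH]; rewrite ?expr0 ?exprS; [exact: cong_refl | exact: congM].
Qed.
Lemma cong_sum (T : Type) (s : seq T) (P : pred T) (f g : T -> A) :
  (forall i, P i -> cong (f i) (g i)) -> cong (\sum_(i <- s | P i) f i) (\sum_(i <- s | P i) g i).
Proof.
move=> H; apply: (big_ind2 cong) => //; [exact: cong_refl | by move=> *; apply: congD].
Qed.
Lemma cong_ideal x y : cong x y -> I y -> I x.
Proof. by move=> H Iy; rewrite -(subrK y x); apply: idealD. Qed.

Lemma ideal_sum_power x y n l : I (x ^+ n) -> I (y ^+ l) -> forall a b, I ((a * x + b * y) ^+ (n + l)).
Proof.
move=> Ix Iy a b; rewrite exprDn; apply: ideal_sum => // i _; rewrite -mulr_natl; apply: idealMl => //.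
rewrite !exprMn; have [le|lt] := leqP l i.
  by apply: idealMl => //; apply: idealMl => //; rewrite -(subnK le) exprD; apply: idealMl.
apply: idealMr => //; apply: idealMl => //.
by rewrite (_ : (n + l - i = n + (l - i))%N); [rewrite exprD; apply: idealMr | lia].
Qed.

End Congruence.

Section Normality.
Variables (k : closedFieldType) (m : nat) (c : 'I_m -> 'I_m -> k).
Local Notation ev A := (mmap (in_alg A)).

Definition eval1 (A : comAlgType k) (t : 'I_m -> A) (y : A) (q : {poly {mpoly k[m]}}) : A :=
  (map_poly (ev A t) q).[y].

Section Eval1.
Variables (A : comAlgType k) (t : 'I_m -> A) (y : A).
Lemma eval1D p q : eval1 t y (p + q) = eval1 t y p + eval1 t y q.
Proof. by rewrite /eval1 rmorphD hornerD. Qed.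
Lemma eval1B p q : eval1 t y (p - q) = eval1 t y p - eval1 t y q.
Proof. by rewrite /eval1 rmorphB hornerD hornerN. Qed.
Lemma eval1M p q : eval1 t y (p * q) = eval1 t y p * eval1 t y q.
Proof. by rewrite /eval1 rmorphM hornerM. Qed.
Lemma eval1X p n : eval1 t y (p ^+ n) = eval1 t y p ^+ n.
Proof. by rewrite /eval1 rmorphXn horner_exp. Qed.
Lemma eval1_sum (T : Type) (s : seq T) (P : pred T) f :
  eval1 t y (\sum_(i <- s | P i) f i) = \sum_(i <- s | P i) eval1 t y (f i).
Proof. by rewrite /eval1 rmorph_sum horner_sum. Qed.
Lemma eval1C p : eval1 t y p%:P = ev A t p.
Proof. by rewrite /eval1 map_polyC hornerC. Qed.
Lemma eval1T : eval1 t y 'X = y.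
Proof. by rewrite /eval1 map_polyX hornerX. Qed.
Lemma eval1V i : eval1 t y ('X_i)%:P = t i.
Proof. by rewrite eval1C mmapX mmap1U. Qed.
End Eval1.

Lemma mpolyX_neq0 n (i : 'I_n) : 'X_i != 0 :> {mpoly k[n]}.
Proof.
apply/eqP => /(congr1 (mcoeff U_(i)%MM)).
by rewrite mcoeffX eqxx mcoeff0 => /eqP; rewrite oner_eq0.
Qed.

Lemma mcoeffM_neq0 n (f g : {mpoly k[n]}) e : (f * g)@_e != 0 ->
  exists e1 e2, [/\ e = (e1 + e2)%MM, f@_e1 != 0 & g@_e2 != 0].
Proof.
rewrite mcoeffM => H.
have [u /andP[/eqP E]] : exists u : 'X_{1..n < (mdeg e).+1, (mdeg e).+1},
    (e == (u.1 + u.2)%MM) && (f@_u.1 * g@_u.2 != 0).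
  apply/existsP; apply: contraR H => /existsPn Hu; apply/eqP/big1 => u eu.
  by have := Hu u; rewrite eu /= negbK => /eqP.
by rewrite mulf_eq0 => /norP[H1 H2]; exists u.1, u.2.
Qed.

(** Where [t i] is invertible, the pairing gives [t' j = (t j * t' i + c i j) / t i], so everything
    is a polynomial in the [t] and [t' i]. [N] and [q] depend on [p] and [c] only, so the same pair
    serves in [R] and in a model ring. *)
Lemma clear_denominators i (p : {mpoly k[m + m]}) : exists N (q : {poly {mpoly k[m]}}),
  forall (A : comAlgType k) (I : set A) (t t' : 'I_m -> A), is_ideal I ->
    (forall j, I (t i * t' j - t j * t' i - (c i j)%:A)) ->
    cong I (t i ^+ N * ev A (pairs t t') p) (eval1 t (t' i) q).
Proof.
pose B : set {mpoly k[m + m]} := [set p | exists N (q : {poly {mpoly k[m]}}),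
  forall (A : comAlgType k) (I : set A) (t t' : 'I_m -> A), is_ideal I ->
    (forall j, I (t i * t' j - t j * t' i - (c i j)%:A)) ->
    cong I (t i ^+ N * ev A (pairs t t') p) (eval1 t (t' i) q)].
suff : B (mmap (in_alg {mpoly k[m + m]}) (fun j => 'X_j) p).
  have -> : mmap (in_alg {mpoly k[m + m]}) (fun j => 'X_j) p = p; last by [].
  rewrite -[RHS]mmap_id; apply: eq_mmap => // x.
  by rewrite /= -mul_mpolyC mulr1.
apply: subspace_mmap.
- split.
  + exists 0%N, 0 => A I t t' iI _; rewrite rmorph0 mulr0 /eval1 rmorph0 horner0.
    exact: cong_refl.
  + move=> p1 p2 [N1 [q1 H1]] [N2 [q2 H2]].
    exists (N1 + N2)%N, (('X_i)%:P ^+ N2 * q1 + ('X_i)%:P ^+ N1 * q2) => A I t t' iI Ht.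
    rewrite eval1D !eval1M !eval1X eval1V rmorphD mulrDr exprD; apply: congD => //.
      by rewrite mulrAC mulrC; apply: congM => //; [apply: cong_refl | apply: H1].
    by rewrite -mulrA; apply: congM => //; [apply: cong_refl | apply: H2].
  + move=> x p1 [N1 [q1 H1]]; exists N1, (x%:MP%:P * q1) => A I t t' iI Ht.
    rewrite eval1M eval1C mmapC /= mmapZ mulrCA.
    by apply: congM => //; [apply: cong_refl | apply: H1].
- exists 0%N, 1 => A I t t' iI _; rewrite rmorph1 mulr1 /eval1 rmorph1 -polyC1 hornerC.
  exact: cong_refl.
- move=> p1 p2 [N1 [q1 H1]] [N2 [q2 H2]]; exists (N1 + N2)%N, (q1 * q2) => A I t t' iI Ht.
  rewrite eval1M rmorphM exprD mulrACA; apply: congM => //; [exact: H1 | exact: H2].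
- move=> j; case: (split_ordP j) => l ->.
  + exists 0%N, ('X_l)%:P => A I t t' iI Ht.
    by rewrite expr0 mul1r eval1V mmapX mmap1U pairs_l; apply: cong_refl.
  + exists 1%N, (('X_l)%:P * 'X + (c i l)%:MP%:P) => A I t t' iI Ht.
    rewrite expr1 eval1D eval1M eval1V eval1T eval1C mmapC mmapX mmap1U pairs_r.
    by rewrite /cong opprD addrA; apply: Ht.
Qed.

Variables (R : comAlgType k) (J : set R) (s s' : 'I_m -> R).
Hypothesis pJ : is_prime J.
Hypothesis generated : forall x, exists p : {mpoly k[m + m]}, J (x - ev R (pairs s s') p).
Hypothesis injective1 : forall i q, J (eval1 s (s' i) q) -> q = 0.
Hypothesis pairing : forall i j, J (s i * s' j - s j * s' i - (c i j)%:A).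
Let iJ : is_ideal J := prime_ideal pJ.

Lemma s_notin i : ~ J (s i).
Proof.
rewrite -(eval1V s (s' i) i) => /injective1 /eqP.
by rewrite polyC_eq0 (negPf (mpolyX_neq0 i)).
Qed.

Lemma prime_pow x n : J (x ^+ n) -> J x.
Proof.
elim: n => [|n IH]; first by rewrite expr0 => /(prime1 pJ).
by rewrite exprS => /(primeM pJ) [].
Qed.

Section Untwisted.
Variable i0 : 'I_m.
Hypothesis c0 : forall j, c i0 j = 0.

Local Notation C := {mpoly k[2 + m]}.
Let xC (a : 'I_2) : C := 'X_(lshift m a).
Let zC (j : 'I_m) : C := 'X_(rshift 2 j).
(** The parametrization of matrices with two rows and rank at most one: [s j] goes to [x_0 z_j] and
    [s' j] to [x_1 z_j]. *)
Let theta : {rmorphism {mpoly k[m + m]} -> C} := ev C (pairs (fun j => xC 0 * zC j) (fun j => xC 1 * zC j)).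

(** [psi] dehomogenizes by [x_0 = 1] and [x_1 = 'X], after which the coefficients of [q] can be read
    off up to powers of the variable [z_i0]. *)
Lemma eval1_theta_injective q :
  eval1 (fun j => xC 0 * zC j) (xC 1 * zC i0) q = 0 -> q = 0.
Proof.
pose psi : {rmorphism C -> {poly {mpoly k[m]}}} := mmap (polyC \o @mpolyC m k) (fun i : 'I_(2 + m) =>
  match fintype.split i with inl u => if u == 0 then 1 else 'X | inr j => ('X_j)%:P end).
have psix u : psi (xC u) = if u == 0 then 1 else 'X.
  by rewrite /psi /= mmapX mmap1U -[lshift _ _]/(unsplit (inl _)) unsplitK.
have psiz j : psi (zC j) = ('X_j)%:P.
  by rewrite /psi /= mmapX mmap1U -[rshift _ _]/(unsplit (inr _)) unsplitK.
move=> H; have : psi (eval1 (fun j => xC 0 * zC j) (xC 1 * zC i0) q) = 0 by rewrite H rmorph0.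
have psie p : psi (ev C (fun j => xC 0 * zC j) p) = p%:P.
  rewrite rmorph_mmap -{2}[p]mmap_id rmorph_mmap; apply: eq_mmap => j /=.
    by rewrite -mul_mpolyC mulr1 /psi mmapC.
  by rewrite rmorphM psix psiz mul1r.
have -> : psi (eval1 (fun j => xC 0 * zC j) (xC 1 * zC i0) q) =
    \poly_(l < size q) (q`_l * 'X_i0 ^+ l).
  rewrite /eval1 (horner_coef_wide _ (size_poly _ _)) rmorph_sum [RHS]poly_def; apply: eq_bigr => l _ /=.
  rewrite coef_map rmorphM psie rmorphXn rmorphM psix psiz /= exprMn -rmorphXn mulrCA mulrC.
  by rewrite -rmorphM mul_polyC.
move=> /polyP H0; apply/polyP => l; have := H0 l; rewrite coef_poly coef0.
case: ltnP => [_ /eqP|/(nth_default 0) -> //]; rewrite mulf_eq0 => /orP[/eqP //|].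
by rewrite expf_eq0 (negPf (mpolyX_neq0 i0)) andbF.
Qed.

(** Both conditions say that the polynomial [q] of [clear_denominators] is zero, because the power
    of [s i0], or of [x_0 z_i0], can be cancelled. *)
Lemma theta_eq0 p : theta p = 0 <-> J (ev R (pairs s s') p).
Proof.
have [N [q Hq]] := clear_denominators i0 p.
have i_zero : is_ideal [set (0 : C)].
  by split=> [|x y -> ->|x y ->] //=; rewrite ?addr0 ?mulr0.
have : cong [set (0 : C)] ((xC 0 * zC i0) ^+ N * theta p) (eval1 (fun j => xC 0 * zC j) (xC 1 * zC i0) q).
  apply: Hq => // j; rewrite c0 scale0r subr0 /=; ring.
rewrite /cong => /= /eqP; rewrite subr_eq0 => /eqP E.
have := Hq _ J s s' iJ (pairing i0) => EJ; split=> [T|Jp].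
- have q0 : q = 0 by apply: eval1_theta_injective; rewrite -E T mulr0.
  move: EJ; rewrite q0 /cong /eval1 rmorph0 horner0 subr0 => /(primeM pJ)[/prime_pow|//].
  by move=> /s_notin.
- have q0 : q = 0.
    apply: (injective1 (i := i0)); apply: (cong_ideal iJ (y := s i0 ^+ N * ev R (pairs s s') p)).
      exact: cong_sym.
    exact: idealMl.
  apply/eqP; move: E; rewrite q0 /eval1 rmorph0 horner0 => /eqP; rewrite mulf_eq0 => /orP[|//].
  by rewrite expf_eq0 mulf_eq0 !(negPf (mpolyX_neq0 _)) andbF.
Qed.

(** Monomials of equal degree in the [x] and the [z], that is, invariants of the torus with weight 1
    on the [x] and -1 on the [z]. They span the image of [theta] ([theta_balanced],
    [theta_monomial]). *)
Let balanced (e : 'X_{1.. 2 + m}) : bool :=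
  (\sum_u e (lshift m u) == \sum_j e (rshift 2 j))%N.

Lemma balancedD e1 e2 : balanced e2 -> balanced (e1 + e2)%MM = balanced e1.
Proof.
move=> /eqP H; rewrite /balanced.
under eq_bigr => u _ do rewrite mnmDE.
under [X in _ == X]eq_bigr => u _ do rewrite mnmDE.
by rewrite !big_split /= H eqn_add2r.
Qed.

Lemma sum_pair u j : (\sum_v (U_(lshift m u) + U_(rshift 2 j))%MM (lshift m v) = 1)%N.
Proof.
under eq_bigr => v _ do rewrite mnmDE !mnmE eq_rlshift addn0.
by rewrite (bigD1 u) //= eqxx big1 // => v vu; rewrite (inj_eq (@lshift_inj _ _)) eq_sym (negPf vu).
Qed.

Lemma balanced_pair u j : balanced (U_(lshift m u) + U_(rshift 2 j))%MM.
Proof.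
rewrite /balanced sum_pair; under eq_bigr => v _ do rewrite mnmDE !mnmE eq_lrshift add0n.
by rewrite (bigD1 j) //= eqxx big1 // => v vj; rewrite (inj_eq (@rshift_inj _ _)) eq_sym (negPf vj).
Qed.

Lemma theta_balanced p e : (theta p)@_e != 0 -> balanced e.
Proof.
suff : forall e, (theta p)@_e != 0 -> balanced e by apply.
apply: (subspace_mmap (N := [set f : C | forall e, f@_e != 0 -> balanced e])) => /= [||f g Hf Hg e'|i].
- split=> /= [e'|f g Hf Hg e'|x f Hf e']; first by rewrite mcoeff0 eqxx.
    rewrite mcoeffD; have [->|/Hf //] := eqVneq f@_e' 0.
    by rewrite add0r => /Hg.
  rewrite mcoeffZ mulf_eq0 => /norP[_]; exact: Hf.
- move=> e'; rewrite mcoeff1; case: (e' =P 0%MM) => [->|]; last by rewrite eqxx.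
  by move=> _; rewrite /balanced !big1 // => u _; rewrite mnm0E.
- by move=> /mcoeffM_neq0[e1 [e2 [-> /Hf H1 /Hg H2]]]; rewrite balancedD.
- move=> e'; have X u j : xC u * zC j = 'X_[U_(lshift m u) + U_(rshift 2 j)] by rewrite mpolyXD.
  rewrite /pairs; case: (fintype.split i) => j; rewrite X mcoeffX; case: ((_ : 'X_{1..(2 + m)}) =P e') => [<- _|_]; rewrite ?balanced_pair ?eqxx //.
Qed.

Lemma theta_monomial e : balanced e -> exists p, theta p = 'X_[e].
Proof.
move: {2}(\sum_u e (lshift m u))%N (erefl (\sum_u e (lshift m u))%N) => n.
elim: n e => [|n IH] e En be.
  exists 1; rewrite rmorph1 (_ : e = 0%MM) ?mpolyX0 //.
  apply/mnmP => v; rewrite mnm0E; case: (split_ordP v) => u ->.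
    by move/eqP: En; rewrite sum_nat_eq0 => /forallP /(_ u) /eqP.
  by move/eqP: be; rewrite En => /esym/eqP; rewrite sum_nat_eq0 => /forallP /(_ u) /eqP.
have pos l (v : 'I_l -> 'I_(2 + m)) : (\sum_u e (v u) = n.+1)%N -> exists u, (0 < e (v u))%N.
  move=> H; apply/existsP; apply: contraPT H => /existsPn H.
  by rewrite big1 // => u _; have := H u; rewrite lt0n negbK => /eqP.
have [u eu] := pos _ _ En; have [|j ej] := pos _ (@rshift 2 m); first by rewrite -(eqP be).
have le : (U_(lshift m u) + U_(rshift 2 j) <= e)%MM.
  apply/mnm_lepP => v; rewrite mnmDE !mnmE; case: (split_ordP v) => w ->.
    rewrite eq_rlshift addn0; case: eqP => [<-|] //.
  rewrite eq_lrshift; case: eqP => [<-|] //.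
have bU : balanced (U_(lshift m u) + U_(rshift 2 j))%MM by apply: balanced_pair.
have [||p Hp] := IH (e - (U_(lshift m u) + U_(rshift 2 j)))%MM.
- have : (\sum_v (e - (U_(lshift m u) + U_(rshift 2 j)))%MM (lshift m v) +
      \sum_v (U_(lshift m u) + U_(rshift 2 j))%MM (lshift m v) = n.+1)%N.
    by rewrite -En -big_split; apply: eq_bigr => v _; rewrite -[e in RHS](submK le) [RHS]mnmDE.
  by rewrite sum_pair addn1 => -[->].
- by rewrite -(balancedD _ bU) submK.
exists (p * (if u == 0 then 'X_(lshift m j) else 'X_(rshift m j))).
rewrite rmorphM Hp -[e in RHS](submK le) mpolyXD; congr (_ * _).
rewrite mpolyXD /theta /=; case: (ord2P u) => ->; rewrite /= mmapX mmap1U ?pairs_l ?pairs_r //.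
Qed.

(** The integral fraction exists in the polynomial ring by [cic_mpoly]. Its balanced part still
    satisfies the equation, because numerator and denominator are balanced, and it lies in the image
    of [theta]. *)
Lemma untwisted_normal (a b : R) (d : nat) (e : 'I_d -> R) : ~ J b ->
  J (a ^+ d + \sum_(l < d) e l * a ^+ l * b ^+ (d - l)) -> exists h, J (a - h * b).
Proof.
move=> nb H.
have [pa Hpa] := generated a; have [pb Hpb] := generated b.
have /choice [pe Hpe] l := generated (e l).
have [||h Hh] := @cic_integral _ (theta pa) (theta pb) d (theta \o pe) (@cic_mpoly k _).
- apply/eqP => /theta_eq0 Jb; apply: nb; exact: cong_ideal Hpb Jb.
- under eq_bigr => l _ do rewrite /= -!rmorphXn -!rmorphM.
  rewrite -rmorphXn -rmorph_sum -rmorphD; apply/theta_eq0; apply: cong_ideal H => //.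
  rewrite rmorphD rmorphXn rmorph_sum /=; apply: cong_sym => //; apply: congD => //; first exact: congX.
  apply: cong_sum => // l _; rewrite !rmorphM !rmorphXn /=.
  by do !apply: congM => //; apply: congX.
(* The Reynolds operator of the torus, applied to [h]. *)
pose h0 := \sum_(e <- msupp h | balanced e) h@_e *: 'X_[e].
have h0E e' : h0@_e' = if balanced e' then h@_e' else 0.
  rewrite /h0 raddf_sum big_mkcond /=.
  under eq_bigr => e1 _ do rewrite mcoeffZ mcoeffX.
  have [e'h|e'h] := boolP (e' \in msupp h).
    rewrite (bigD1_seq e') //= eqxx mulr1 big1 ?addr0 // => e1 /negPf ->.
    by rewrite mulr0 if_same.
  rewrite big1_seq ?memN_msupp_eq0 ?if_same // => e1 /= e1h; case: eqP => [E|_].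
    by move: e'h; rewrite -E e1h.
  by rewrite mulr0 if_same.
have E : theta pa = h0 * theta pb.
  apply/eqP; rewrite Hh -subr_eq0 -mulrBl; apply/eqP/mpolyP => e'; rewrite mcoeff0; apply/eqP/negPn/negP.
  move=> H0; have nb' : balanced e'.
    have : (theta pa)@_e' - (h0 * theta pb)@_e' != 0 by rewrite Hh -mcoeffB -mulrBl.
    have [/theta_balanced //|] := boolP ((theta pa)@_e' != 0); rewrite negbK => /eqP ->.
    rewrite sub0r oppr_eq0 => /mcoeffM_neq0[e1 [e2 [-> H1 /theta_balanced H2]]].
    rewrite balancedD //; move: H1; rewrite h0E; case: ifP => //; by rewrite eqxx.
  have [e1 [e2 [E H1 /theta_balanced H2]]] := mcoeffM_neq0 H0.
  by move: nb' H1; rewrite E balancedD // mcoeffB h0E => ->; rewrite subrr eqxx.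
have [ph Hph] : exists p, theta p = h0.
  have /choice [f Hf] (e' : 'X_{1..(2 + m)}) : exists p, balanced e' -> theta p = 'X_[e'].
    by case: (boolP (balanced e')) => [/theta_monomial [p Hp]|_]; [exists p | exists 0].
  exists (\sum_(e <- msupp h | balanced e) h@_e *: f e); rewrite rmorph_sum; apply: eq_bigr => e' /Hf He.
  by rewrite -He /theta /= mmapZ mulr_algl.
exists (ev R (pairs s s') ph); have : theta (pa - ph * pb) = 0 by rewrite rmorphB rmorphM Hph -E subrr.
move=> /theta_eq0; rewrite rmorphB rmorphM /= => Hab.
apply: (cong_trans iJ Hpa); apply: (cong_trans iJ Hab); apply: congM => //; first exact: cong_refl.
exact: cong_sym.
Qed.

End Untwisted.

Variables (a b : R) (d : nat) (e : 'I_d -> R).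
Hypothesis b_notin : ~ J b.
Hypothesis integral : J (a ^+ d + \sum_(l < d) e l * a ^+ l * b ^+ (d - l)).


(** After inverting [s i], the quotient is a localization of the polynomial ring in the [s] and
    [s' i], which is completely integrally closed by [cic_poly]. *)
Lemma localized_normal i : exists L h, J (s i ^+ L * a - h * b).
Proof.
have lift x : exists N0, forall N, (N0 <= N)%N -> exists q, cong J (s i ^+ N * x) (eval1 s (s' i) q).
  have [p Hp] := generated x; have [N0 [q Hq]] := clear_denominators i p.
  exists N0 => N NN; exists (('X_i)%:P ^+ (N - N0) * q).
  rewrite eval1M eval1X eval1V -{1}(subnK NN) exprD -mulrA.
  apply: congM => //; first exact: cong_refl.
  apply: (cong_trans iJ (y := s i ^+ N0 * ev R (pairs s s') p)); last exact: Hq.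
  by apply: congM => //; apply: cong_refl.
have [Na Ha] := lift a; have [Nb Hb] := lift b; have /choice [Ne He] l := lift (e l).
pose N := (Na + Nb + \max_l Ne l)%N.
have [qa Hqa] := Ha N ltac:(rewrite /N; lia).
have [qb Hqb] := Hb N ltac:(rewrite /N; lia).
have /choice [qe Hqe] l : exists q, cong J (s i ^+ N * e l) (eval1 s (s' i) q).
  by apply: He; rewrite (leq_trans (leq_bigmax l)) // leq_addl.
pose X : {poly {mpoly k[m]}} := ('X_i)%:P.
(* [qa], [qb] and [qe l] represent [a], [b] and [e l] multiplied by [s i ^+ N]. Multiplying the
   given equation by [s i ^+ (N * d).*2] makes it monic in [X ^+ N * qa] with these coefficients. *)
have [||h Hh] := @cic_integral _ (X ^+ N * qa) qb d (fun l => qe l * X ^+ (N * (d - l).-1)) (cic_poly (@cic_mpoly k m)).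
- apply/eqP => qb0; move: Hqb; rewrite qb0 /cong /eval1 rmorph0 horner0 subr0.
  by move=> /(primeM pJ) [/prime_pow|//]; apply: s_notin.
- apply: (injective1 (i := i)).
  have Hd : cong J (eval1 s (s' i) ((X ^+ N * qa) ^+ d + \sum_(l < d) qe l * X ^+ (N * (d - l).-1) * (X ^+ N * qa) ^+ l * qb ^+ (d - l)))
    (s i ^+ (N * d).*2 * (a ^+ d + \sum_(l < d) e l * a ^+ l * b ^+ (d - l))).
    have Hxa : cong J (eval1 s (s' i) (X ^+ N * qa)) (s i ^+ N * (s i ^+ N * a)).
      rewrite eval1M eval1X eval1V; apply: congM => //; [exact: cong_refl | exact: cong_sym].
    rewrite eval1D eval1_sum mulrDr mulr_sumr; apply: congD => //.
      rewrite eval1X (_ : s i ^+ _ * _ = (s i ^+ N * (s i ^+ N * a)) ^+ d); first exact: congX.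
      by rewrite mulrA -exprD exprMn -exprM addnn -doubleMl.
    apply: cong_sum => // l _.
    rewrite (_ : s i ^+ _ * _ = (s i ^+ N * e l) * s i ^+ (N * (d - l).-1) *
      (s i ^+ N * (s i ^+ N * a)) ^+ l * (s i ^+ N * b) ^+ (d - l)); last first.
      rewrite !exprMn -!exprM (_ : (N * d).*2 = N + N * (d - l).-1 + N * l + N * l + N * (d - l))%N.
        rewrite !exprD; ring.
      have dl := ltn_ord l; rewrite (_ : d - l = (d - l).-1.+1)%N /=; last by lia.
      rewrite (_ : (N * d).*2 = (N * (l + (d - l).-1.+1)).*2)%N; last by congr (N * _).*2; lia.
      by move: (d - l).-1 => y; lia.
    rewrite !eval1M !eval1X eval1V; do !apply: congM => //; rewrite ?eval1M ?eval1X ?eval1V.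
    + exact: cong_sym.
    + exact: cong_refl.
    + by apply: congX => //; move: Hxa; rewrite eval1M eval1X eval1V.
    + by apply: congX => //; apply: cong_sym.
  by apply: cong_ideal Hd _ => //; apply: idealMl.
exists (N + N)%N, (eval1 s (s' i) h * s i ^+ N).
have : cong J (s i ^+ N * (s i ^+ N * a)) (eval1 s (s' i) (X ^+ N * qa)).
  by rewrite eval1M eval1X eval1V; apply: congM => //; apply: cong_refl.
rewrite Hh eval1M => H; rewrite exprD -mulrA -mulrA; apply: cong_trans H _ => //.
by apply: congM => //; [apply: cong_refl | apply: cong_sym].
Qed.

(** The [x] for which [x * a] is a multiple of [b] modulo [J] form an ideal. It contains powers of
    [s i] and [s j], hence a power of their determinant, which is congruent to a nonzero scalar. *)
Lemma twisted_normal i j : c i j != 0 -> exists h, J (a - h * b).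
Proof.
move=> c0; pose K : set R := [set x | exists h, J (x * a - h * b)].
have iK : is_ideal K.
  split.
  - by exists 0; rewrite !mul0r subr0; apply: ideal0.
  - move=> x y [h Hh] [h' Hh']; exists (h + h'); rewrite !mulrDl opprD addrACA.
    exact: idealD.
  - move=> x y [h Hh]; exists (x * h); rewrite -!mulrA -mulrBr.
    exact: idealMl.
have JK x y : cong J x y -> K y -> K x.
  move=> Hxy [h Hh]; exists h; apply: cong_trans Hh => //.
  by apply: congM => //; apply: cong_refl.
have [Li Hi] := localized_normal i; have [Lj Hj] := localized_normal j.
have Kp := ideal_sum_power iK Hi Hj (s' j) (- s' i).
have [h] : K ((c i j)%:A ^+ (Li + Lj)).
  apply: JK Kp; apply: congX => //; rewrite mulNr (mulrC (s' j)) (mulrC (s' i)).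
  by apply: (cong_sym iJ); apply: pairing.
rewrite -(rmorphXn (in_alg R)) /= => Hh; exists ((c i j ^- (Li + Lj)) *: h).
rewrite -scalerAl (_ : a = (c i j ^- (Li + Lj)) *: ((c i j ^+ (Li + Lj))%:A * a)); last first.
  by rewrite mulr_algl scalerA mulVf ?scale1r // expf_neq0.
by rewrite -scalerBr; apply: (subspaceZ (ideal_subspace iJ)).
Qed.

End Normality.

Section SpecialNormal.
Variables (k : closedFieldType) (R : comAlgType k).
Hypothesis char0 : [pchar k] =i pred0.
Variable alpha : sl2 k -> R -> R.
Hypothesis ra : rational_action alpha.
Variables (S : set R) (m : nat) (s s' : 'I_m -> R).
Local Notation J := (ideal_generated S).
Local Notation ev := (mmap (in_alg R)).
Hypothesis m_gt0 : (0 < m)%N.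
Hypothesis S_invariant : forall g r, S r -> alpha g r = r.
Hypothesis s_act : forall g i, alpha g (s i) = g 0 0 *: s i + g 1 0 *: s' i.
Hypothesis generation : forall x (d : nat), (forall t, alpha (upper t) x = x) ->
  has_weight alpha d x -> exists2 p : {mpoly k[m]}, p \is d.-homog & J (x - ev s p).
Hypothesis independence : forall d (p : {mpoly k[m]}), p \is d.-homog ->
  forall n (r b : 'I_n -> R), (forall i, S (r i)) ->
  (forall i t, alpha (upper t) (b i) = b i) -> (forall i, has_weight alpha d (b i)) ->
  ev s p = \sum_i b i * r i -> p = 0.

(** Normality splits according to whether the pairing constants all vanish. For the rank-one case,
    the first row of [c] suffices. *)
Theorem special_normal : normal_affine_variety J /\
  affine_space_mod J (invariants_mod alpha J (@unipotent k)).
Proof.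
have iJ := ideal_generated_ideal S.
have J1 := special_proper char0 ra S_invariant s_act independence.
have JM := special_prime char0 ra S_invariant s_act generation independence.
have pJ := IsPrime iJ J1 JM.
have gen := special_generated char0 ra S_invariant s_act generation.
have inj := special_injective char0 ra S_invariant s_act independence.
have /choice [c Hc] i : exists c, forall j, J (s i * s' j - s j * s' i - (c j)%:A).
  have [f Hf] := choice (special_pairing ra s_act generation i); by exists f.
split; last by apply: (special_invariants char0 ra (s' := s')).
split=> // [|a b nb [d [e H]]]; first by exists (m + m)%N, (pairs s s').
have [|] := pselect (exists i j, c i j != 0).
  by move=> [i [j cij]]; apply: (twisted_normal pJ gen inj Hc nb H cij).
move=> c0; have c0' j : c (Ordinal m_gt0) j = 0.
  by apply/eqP/negPn/negP => cj; apply: c0; exists (Ordinal m_gt0), j.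
exact: (untwisted_normal pJ gen inj Hc c0' nb H).
Qed.

End SpecialNormal.


(** * The action on the Cox ring is rational *)

Section CoxAction.
Variables (k : closedFieldType) (n : nat) (X : embedding k n).
Hypothesis nX : normal_variety X.
Local Notation K := (ratfun X).
Local Notation G := (sl2 k).
Variables (R : cox_ring X) (alpha : G -> R -> R) (phi : weil_divisor X -> G -> K -> K).
Local Notation sec := (cox_sec R).
Hypothesis alphaD : forall g, {morph alpha g : r s / r + s}.
Hypothesis Hphi : forall D, linearization D (phi D).
Hypothesis alphaE : forall D g a, global_sections D a -> alpha g (sec D a) = sec D (phi D g a).

Lemma alpha0 g : alpha g 0 = 0.
Proof. by apply: (addrI (alpha g 0)); rewrite -alphaD !addr0. Qed.

Lemma alpha_sum g m (D : 'I_m -> weil_divisor X) (a : 'I_m -> K) : (forall i, global_sections (D i) (a i)) ->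
  alpha g (\sum_i sec (D i) (a i)) = \sum_i sec (D i) (phi (D i) g (a i)).
Proof.
move=> ga.
by rewrite (big_morph (alpha g) (alphaD g) (alpha0 g)); apply: eq_bigr => i _; apply: alphaE.
Qed.

Lemma lin_Z D g c a : phi D g (ratC X c * a) = ratC X c * phi D g a.
Proof. by rewrite (lin_semi (Hphi D)) translateC. Qed.

(** Additivity reduces everything to homogeneous sections. Multiplicativity there is [lin_mul], and
    algebraic dependence on [g] is [sfun_rational]. *)
Lemma cox_action_rational : rational_action alpha.
Proof.
have gl D g a : global_sections D a -> global_sections D (phi D g a) by apply: lin_global.
have Z g c r : alpha g (c *: r) = c *: alpha g r.
  have [m [D [a [ga ->]]]] := cox_sec_span r.
  rewrite alpha_sum // !scaler_sumr.
  rewrite (eq_bigr (fun i => sec (D i) (ratC X c * a i))) => [|i _]; last by rewrite secZ.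
  rewrite alpha_sum => [|i]; last exact: globalZ.
  by apply: eq_bigr => i _; rewrite lin_Z secZ //; apply: gl.
have M D E a b g : global_sections D a -> global_sections E b ->
    alpha g (sec D a * sec E b) = alpha g (sec D a) * alpha g (sec E b).
  move=> ga gb; rewrite cox_secM // !alphaE ?cox_secM //; [|exact: gl|exact: gl|exact: global_mul].
  by rewrite (lin_mul nX (Hphi D) (Hphi E) (Hphi (D + E))).
have S g T (s : seq T) (f : T -> R) : alpha g (\sum_(i <- s) f i) = \sum_(i <- s) alpha g (f i).
  exact: (big_morph (alpha g) (alphaD g) (alpha0 g)).
split=> //.
- move=> g r s; have [m [D [a [ga ->]]]] := cox_sec_span r; have [m' [E [b [gb ->]]]] := cox_sec_span s.
  rewrite mulr_suml !S mulr_suml; apply: eq_bigr => i _.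
  by rewrite mulr_sumr S mulr_sumr; apply: eq_bigr => j _; apply: M.
- move=> r; have [m [D [a [ga ->]]]] := cox_sec_span r.
  by rewrite alpha_sum //; apply: eq_bigr => i _; rewrite (lin1 (Hphi _)).
- move=> g h r; have [m [D [a [ga ->]]]] := cox_sec_span r.
  rewrite !alpha_sum // => [|i]; last exact: gl.
  by apply: eq_bigr => i _; rewrite (linM (Hphi _)).
- pose Q r := exists t (c : 'I_t -> G -> k) (s : 'I_t -> R),
    (forall j, polyfun (c j)) /\ forall g, alpha g r = \sum_j c j g *: s j.
  move=> r; have [m [D [a [ga ->]]]] := cox_sec_span r.
  apply: (big_ind Q) => [|x y [t [c [u [Hc Ec]]]] [t' [c' [u' [Hc' Ec']]]]|i _].
  + exists 0%N, (fun _ _ => 0), (fun=> 0); split=> [[]|g] //.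
    by rewrite big_ord0 alpha0.
  + pose sp T (v : 'I_t -> T) (w : 'I_t' -> T) (i : 'I_(t + t')) :=
      match fintype.split i with inl j => v j | inr j => w j end.
    exists (t + t')%N, (sp _ c c'), (sp _ u u'); split=> [i|g]; first by rewrite /sp; case: fintype.split.
    rewrite alphaD Ec Ec' big_split_ord; congr (_ + _); apply: eq_bigr => i _;
      by rewrite /sp -1?[lshift _ _]/(unsplit (inl _)) -1?[rshift _ _]/(unsplit (inr _)) unsplitK.
  + have [t [gs [c [Hc Ec]]]] := sfun_rational nX (Hphi (D i)) (ga i).
    exists t, c, (fun j => sec (D i) (phi (D i) (gs j) (a i))); split=> // g.
    rewrite (alphaE g (ga i)) Ec (sec_sum nX) => [|j]; last by apply: globalZ => //; apply: gl.
    by apply: eq_bigr => j _ /=; rewrite secZ //; apply: gl.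
Qed.

(* A simultaneous eigenvector is a sum of homogeneous ones. *)
Lemma eigen_components (Gam : G -> k -> Prop) r : (forall g c, Gam g c -> alpha g r = c *: r) ->
  exists m (D : 'I_m -> weil_divisor X) (a : 'I_m -> K),
    [/\ forall i, global_sections (D i) (a i),
        forall i g c, Gam g c -> alpha g (sec (D i) (a i)) = c *: sec (D i) (a i) &
        r = \sum_i sec (D i) (a i)].
Proof.
move=> Hr; have ra := cox_action_rational.
have [m [D [a [ga Er]]]] := cox_sec_span r.
pose eqv (i j : 'I_m) := `[< lin_equiv (D i) (D j) >].
have eqvP i j l : eqv i j -> eqv l i = eqv l j.
  move=> /asboolP ij; apply/idP/idP => /asboolP H; apply/asboolP; apply: (lin_equiv_trans nX H) => //.
  exact: lin_equiv_sym.
(* One index per linear equivalence class. All terms of a class are moved to its representative, and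
   [cox_component] separates the classes. *)
pose rep i := odflt i [pick j | eqv j i].
have repP i : eqv (rep i) i.
  rewrite /rep; case: pickP => [j //|/(_ i)]; rewrite /eqv => /asboolP [].
  exact: lin_equiv_refl.
have repE i j : (rep i == rep j) = eqv i j.
  apply/eqP/idP => [E|ij].
    by rewrite -(eqvP _ _ _ (repP j)) -E /eqv; apply/asboolP/(lin_equiv_sym nX)/asboolP/repP.
  rewrite /rep (eq_pick (eqvP _ _ ^~ ij)); case: pickP => // /(_ i); by rewrite ij.
have rep_id i : rep (rep i) = rep i by apply/eqP; rewrite repE.
have /choice [b Hb] (ij : 'I_m * 'I_m) : exists b, global_sections (D ij.2) b /\
    sec (D ij.2) b = if eqv ij.1 ij.2 then sec (D ij.1) (a ij.1) else 0.
  case: ifP => [/asboolP e|_]; last by exists 0; rewrite sec0; split => //; left.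
  by have [b gb Eb] := cox_sec_equiv R e (ga ij.1); exists b.
pose a' i := if rep i == i then \sum_j b (j, i) else 0.
have gsum i : global_sections (D i) (\sum_j b (j, i)).
  by apply: global_sum => // j; apply: (Hb (j, i)).1.
have ssum i : sec (D i) (\sum_j b (j, i)) = \sum_(j | eqv j i) sec (D j) (a j).
  rewrite (sec_sum nX) => [|j]; last exact: (Hb (j, i)).1.
  by rewrite [RHS]big_mkcond; apply: eq_bigr => j _; rewrite (Hb (j, i)).2.
exists m, D, a'; split=> [i|i g c Hc|].
- by rewrite /a'; case: ifP => _ //; left.
- rewrite /a'; case: ifP => _; last by rewrite sec0 action0 // scaler0.
  rewrite ssum; apply/eqP; rewrite -subr_eq0; apply/eqP.
  have gi j : global_sections (D j) (phi (D j) g (a j) - ratC X c * a j).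
    rewrite -mulN1r -(rmorph1 (ratC X)) -rmorphN; apply: globalD => //; first exact: lin_global.
    by rewrite mulrA -rmorphM; apply: globalZ.
  have si j : sec (D j) (phi (D j) g (a j) - ratC X c * a j) = alpha g (sec (D j) (a j)) - c *: sec (D j) (a j).
    rewrite -mulN1r -(rmorph1 (ratC X)) -rmorphN mulrA -rmorphM secD //; last exact: globalZ.
      by rewrite secZ // mulN1r scaleNr alphaE.
    exact: lin_global.
  have T0 : \sum_j sec (D j) (phi (D j) g (a j) - ratC X c * a j) = 0.
    rewrite (eq_bigr _ (fun j _ => si j)) sumrB -scaler_sumr -Er -(Hr g c Hc) Er alpha_sum //.
    by rewrite (eq_bigr _ (fun j _ => alphaE g (ga j))) subrr.
  have := cox_component nX (D i) gi T0; rewrite (eq_bigr _ (fun j _ => si j)) sumrB -scaler_sumr => H0.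
  by rewrite (big_morph (alpha g) (alphaD g) (alpha0 g)); apply: H0.
- rewrite Er (partition_big rep (fun i => rep i == i)) => [|i _]; last by rewrite rep_id.
  rewrite big_mkcond; apply: eq_bigr => i _; rewrite /a'; case: eqP => [ii|_]; last by rewrite sec0.
  by rewrite ssum; apply: eq_bigl => j; rewrite -{1}ii repE.
Qed.

End CoxAction.


(** * Sections whose function on [G] is a product of linear forms *)

Section Forms.
Variables (k : closedFieldType) (n : nat) (X : embedding k n).
Hypotheses (nb : (0 < n <= 2)%N) (nX : normal_variety X).
Local Notation GF := (sl2_space_functions k).
Local Notation K := (ratfun X).
Local Notation G := (sl2 k).
Variables (R : cox_ring X) (phi : weil_divisor X -> G -> K -> K).
Local Notation sec := (cox_sec R).
Hypothesis Hphi : forall D, linearization D (phi D).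
Variable L : seq (prime_divisor X).
Hypotheses (uL : uniq L) (HL : forall P, (P \in L) <-> G_stable P).
Implicit Types (l : k * k) (ls : seq (k * k)) (N : prime_divisor X -> nat) (P : prime_divisor X) (D : weil_divisor X).

(** Linear forms in the second row: [U] acts on the left without changing that row, and its class up
    to scalars is the image in [B\G]. *)
Definition form l (x : G) : k := l.1 * x 1 0 + l.2 * x 1 1.

Lemma form_odd l : odd_fun n (form l).
Proof. by apply: odd_comb; apply: odd_entry. Qed.

Lemma form_nonzero l : l != (0, 0) -> nonzero (form l).
Proof.
case: l => a b; rewrite xpair_eqE negb_and /form /=; have [o1 o2 o3 o4] := sl2_1E k.
have [b0|b0 /orP[a0|//]] := eqVneq b 0; last by exists 1%g; rewrite o3 o4 mulr0 mulr1 add0r.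
  rewrite orbF => a0; exists (lower 1); have [_ _ l3 l4] := lowerE (1 : k).
  by rewrite l3 b0 mul0r addr0 mulr1.
by exists 1%g; rewrite o3 o4 mulr0 mulr1 add0r.
Qed.

Definition form_div l : weil_divisor X := xget 0 [set D | is_div (form l) D].

Lemma form_divP l : l != (0, 0) -> is_div (form l) (form_div l).
Proof.
move=> l0; rewrite /form_div; case: xgetP => [D _ //|H].
by have [D HD] := div_ex nb nX (form_odd l) (form_nonzero l0); case: (H D).
Qed.

Definition forms_div ls N : weil_divisor X :=
  \sum_(l <- ls) form_div l + \sum_(P <- L) << (N P)%:Z *g P >>.

Lemma forms_div_cons l ls N : forms_div (l :: ls) N = form_div l + forms_div ls N.
Proof. by rewrite /forms_div big_cons addrA. Qed.

Lemma forms_div_nil N P : coeff P (forms_div [::] N) = (N P)%:Z * (P \in L)%:R.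
Proof.
rewrite /forms_div big_nil add0r raddf_sum /= (eq_bigr (fun Q => (N Q)%:Z * (Q == P)%:R)) => [|Q _]; last by rewrite coeffU.
have [PL|PL] := boolP (P \in L).
  by rewrite (bigD1_seq P) //= eqxx !mulr1 big1 ?addr0 // => Q /negPf ->; rewrite mulr0.
rewrite mulr0 big_seq big1 // => Q QL; case: eqP => [E|_]; last by rewrite mulr0.
by rewrite E in QL; rewrite QL in PL.
Qed.

Lemma forms_div_stable ls N P : all (fun l => l != (0, 0)) ls -> G_stable P ->
  coeff P (forms_div ls N) = (N P)%:Z.
Proof.
move=> l0 sP; elim: ls l0 => [_|l ls IH /= /andP[l0 ls0]].
  by rewrite forms_div_nil (HL P).2 // mulr1.
by rewrite forms_div_cons coeffD IH // (form_divP l0 P).1 // add0r.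
Qed.

Lemma forms_div_orbit ls N P x : all (fun l => l != (0, 0)) ls -> pd_set P (orb X x) ->
  coeff P (forms_div ls N) *+ 2 = \sum_(l <- ls) ord2 P (form l).
Proof.
move=> l0 Px; elim: ls l0 => [_|l ls IH /= /andP[l0 ls0]].
  rewrite forms_div_nil big_nil (_ : (P \in L) = false) ?mulr0 ?mul0rn //.
  by apply/negP => /HL sP; apply: (stable_not_meets sP Px).
by rewrite forms_div_cons coeffD mulrnDl IH // big_cons ((form_divP l0 P).2 x Px).
Qed.

Lemma forms_div_ge0 ls N P : all (fun l => l != (0, 0)) ls -> 0 <= coeff P (forms_div ls N).
Proof.
elim: ls => [_|l ls IH /= /andP[l0 ls0]]; first by rewrite forms_div_nil mulr_ge0.
rewrite forms_div_cons coeffD addr_ge0 ?IH //.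
by have := is_div_ge0 nb nX (form_odd l) (form_nonzero l0) (form_divP l0) P.
Qed.

Lemma forms_div_global ls N : all (fun l => l != (0, 0)) ls -> global_sections (forms_div ls N) (1 : K).
Proof. by move=> l0; right=> P _; rewrite ord1 // add0r forms_div_ge0. Qed.

Lemma sec_forms ls N : all (fun l => l != (0, 0)) ls -> sec (forms_div ls N) 1 =
  \prod_(l <- ls) sec (form_div l) 1 * \prod_(P <- L) canonical_section R P ^+ N P.
Proof.
elim: ls => [_|l ls IH /= /andP[l0 ls0]]; last first.
  rewrite forms_div_cons big_cons -mulrA -IH // cox_secM ?mulr1 //.
    exact: (is_div_global nb nX (form_odd l) (form_nonzero l0) (form_divP l0)).
  exact: forms_div_global.
rewrite /forms_div !big_nil add0r mul1r.
have H s : global_sections (\sum_(P <- s) << (N P)%:Z *g P >>) (1 : K) /\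
    sec (\sum_(P <- s) << (N P)%:Z *g P >>) 1 = \prod_(P <- s) canonical_section R P ^+ N P.
  elim: s => [|P s [g IHs]].
    rewrite !big_nil cox_sec1; split=> //.
    by right=> P _; rewrite ord1 // coeff0.
  have gP i : global_sections << i%:Z *g P >> (1 : K) /\ sec << i%:Z *g P >> 1 = canonical_section R P ^+ i.
    elim: i => [|i [gi IHi]].
      rewrite freegU0 cox_sec1; split=> //; by right=> Q _; rewrite ord1 // coeff0.
    have g1 : global_sections << P >> (1 : K) by right=> Q _; rewrite ord1 // coeffU add0r mul1r.
    have -> : << i.+1%:Z *g P >> = << P >> + << i%:Z *g P >> :> weil_divisor X.
      by rewrite freegUD; congr << _ *g _ >>; rewrite -natr1 addrC.
    have := cox_secM R g1 gi; rewrite mulr1 IHi exprS => <-; split=> //.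
    by have := global_mul nX g1 gi; rewrite mulr1.
  rewrite !big_cons -IHs -(gP _).2 cox_secM ?mulr1 //; last exact: (gP _).1.
  by split=> //; have := global_mul nX (gP (N P)).1 g; rewrite mulr1.
exact: (H L).2.
Qed.

Lemma forms_frame ls N : all (fun l => l != (0, 0)) ls -> exists W F,
  frame (forms_div ls N) (phi (forms_div ls N)) W F /\
  is_sfun (phi (forms_div ls N)) W F 1 (fun x => \prod_(l <- ls) form l x).
Proof.
elim: ls => [_|l ls IH /= /andP[l0 ls0]].
  have st P : ~ G_stable P -> coeff P (forms_div [::] N) = 0.
    by move=> sP; rewrite forms_div_nil (_ : (P \in L) = false) ?mulr0 //; apply/negP => /HL.
  exists setT, (fun=> 1); split; first exact: stable_frame.
  by move=> g x _; rewrite (stable_lin nX (Hphi _) st) big_nil mulr1; apply: has_value1.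
have [W [F [fr sf]]] := IH ls0.
have ofo := form_odd l; have nfo := form_nonzero l0; have dl := form_divP l0.
have fr1 := is_div_frame nb nX ofo nfo dl (Hphi (form_div l)).
have sf1 := is_div_sfun nb nX ofo nfo dl (Hphi (form_div l)).
exists ([set x | form l x != 0] `&` W), (fun x => (form l x)^-1 * F x); rewrite forms_div_cons; split.
  exact: (frame_mul nX fr1 fr (Hphi _)).
have := sfun_mul nX fr1 fr (Hphi _) sf1 sf; rewrite mulr1.
by move=> H g x Wx; rewrite big_cons; apply: H.
Qed.

(* The sections whose function on [G] is a product of linear forms in the second row. *)
Lemma sec_of_forms D a c ls W F : all (fun l => l != (0, 0)) ls -> frame D (phi D) W F ->
  global_sections D a -> a != 0 -> c != 0 ->
  is_sfun (phi D) W F a (fun x => c * \prod_(l <- ls) form l x) ->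
  exists N c', [/\ c' != 0, sec D a = c' *: sec (forms_div ls N) 1 &
    forall P, G_stable P -> (N P)%:Z = ord P a + coeff P D].
Proof.
move=> l0 fr ga a0 c0 sf; pose N P := absz (ord P a + coeff P D).
have NE P : (N P)%:Z = ord P a + coeff P D by rewrite gez0_abs //; apply: global_ge0.
have [W' [F' [fr' sf']]] := forms_frame N l0.
have pf : polyfun (fun x => \prod_(l <- ls) form l x).
  elim: (ls) => [|l s IH]; first by apply: polyfun_ext (polyfun_cst 1) => x; rewrite big_nil.
  by apply: polyfun_ext (polyfunM (form_odd l).1 IH) => x; rewrite big_cons.
have H := sfun_ratio nX fr fr' sf sf' pf a0 (oner_neq0 _) c0 (fun x => erefl).
have [|c' c'0 E] := cox_unit_ratio nX R ga (forms_div_global N l0) a0 (oner_neq0 _).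
  by apply: H => P sP; rewrite ord1 // add0r forms_div_stable.
by exists N, c'.
Qed.

Definition forms_ratio ls ls0 : K := \prod_(p <- zip ls ls0) ratq X (form p.1) (form p.2).

Lemma forms_ratio_neq0 ls ls0 : size ls = size ls0 ->
  all (fun l => l != (0, 0)) ls -> all (fun l => l != (0, 0)) ls0 -> forms_ratio ls ls0 != 0.
Proof.
rewrite /forms_ratio; elim: ls ls0 => [|l ls IH] [|l0 ls0] //=.
  by move=> _ _ _; rewrite !big_nil oner_neq0.
move=> [/IH {}IH] /andP[ln /IH {}IH] /andP[l0n /IH n0].
rewrite big_cons mulf_neq0 //; exact: (ratq_neq0 X nb (form_odd l) (form_odd l0) (form_nonzero ln) (form_nonzero l0n)).
Qed.

Lemma forms_ratio_ord ls ls0 P : size ls = size ls0 ->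
  all (fun l => l != (0, 0)) ls -> all (fun l => l != (0, 0)) ls0 ->
  ord P (forms_ratio ls ls0) *+ 2 = \sum_(l <- ls) ord2 P (form l) - \sum_(l <- ls0) ord2 P (form l).
Proof.
elim: ls ls0 => [|l ls IH] [|l0 ls0] //=.
  by move=> _ _ _; rewrite /forms_ratio !big_nil ord1.
move=> [sz] /andP[ln lsn] /andP[l0n ls0n]; have {}IH := IH _ sz lsn ls0n.
have n0 := forms_ratio_neq0 sz lsn ls0n.
have rn := ratq_neq0 X nb (form_odd l) (form_odd l0) (form_nonzero ln) (form_nonzero l0n).
have rE := ord2_ratq nb nX P (form_odd l) (form_odd l0) (form_nonzero ln) (form_nonzero l0n).
have -> : forms_ratio (l :: ls) (l0 :: ls0) = ratq X (form l) (form l0) * forms_ratio ls ls0.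
  by rewrite /forms_ratio big_cons.
by rewrite ordM // mulrnDl rE IH !big_cons; ring.
Qed.

Lemma forms_ratio_value ls ls0 x : size ls = size ls0 -> \prod_(l <- ls0) form l x != 0 ->
  has_value (forms_ratio ls ls0) (orb X x) (\prod_(l <- ls) form l x / \prod_(l <- ls0) form l x).
Proof.
rewrite /forms_ratio; elim: ls ls0 => [|l ls IH] [|l0 ls0] //=.
  by rewrite !big_nil divr1 => _ _; apply: has_value1.
rewrite !big_cons => -[/IH {}IH]; rewrite mulf_eq0 negb_or => /andP[lx /IH {}IH].
by rewrite -mulf_div; apply: has_valueM => //; apply: ratqE => //; apply: form_odd.
Qed.

Section Comparison.
Variables (ls ls0 : seq (k * k)) (N N0 : prime_divisor X -> nat).
Hypotheses (sz : size ls = size ls0) (lsn : all (fun l => l != (0, 0)) ls)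
  (ls0n : all (fun l => l != (0, 0)) ls0) (eqv : lin_equiv (forms_div ls N) (forms_div ls0 N0)).

(** On the orbit, [forms_ratio ls ls0] has the same divisor as any rational function giving the
    linear equivalence. By [orbit_unit_const] the two are proportional, so their orders agree along
    the stable divisors too. *)
Lemma forms_ratio_div P :
  ord P (forms_ratio ls ls0) = coeff P (forms_div ls N) - coeff P (forms_div ls0 N0).
Proof.
have [g g0 Hg] := eqv; have h0 := forms_ratio_neq0 sz lsn ls0n.
have [||c c0 Ec] := @orbit_unit_const _ _ _ nX (g / forms_ratio ls ls0).
- by rewrite mulf_neq0 ?invr_eq0.
- move=> x Q Qx; have HQ := forms_ratio_ord Q sz lsn ls0n.
  have e1 := forms_div_orbit N lsn Qx; have e2 := forms_div_orbit N0 ls0n Qx.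
  by rewrite ordM ?invr_eq0 // ordV // Hg; lia.
by rewrite -Hg -[g](divfK h0) Ec ordM ?ordC ?add0r // -(rmorph0 (ratC X)) fmorph_eq.
Qed.

Lemma forms_ratio_stable P : G_stable P ->
  ((N P)%:Z - (N0 P)%:Z) *+ 2 = \sum_(l <- ls) ord2 P (form l) - \sum_(l <- ls0) ord2 P (form l).
Proof.
move=> sP; rewrite -(forms_ratio_ord P sz lsn ls0n).
by rewrite forms_ratio_div !forms_div_stable.
Qed.

Lemma forms_ratio_sec : global_sections (forms_div ls0 N0) (forms_ratio ls ls0) /\
  exists2 c, c != 0 & sec (forms_div ls N) 1 = c *: sec (forms_div ls0 N0) (forms_ratio ls ls0).
Proof.
have gr : global_sections (forms_div ls0 N0) (forms_ratio ls ls0).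
  by right=> P _; rewrite forms_ratio_div subrK forms_div_ge0.
split=> //; apply: (cox_unit_ratio nX R _ gr (oner_neq0 _) (forms_ratio_neq0 sz lsn ls0n)) => [|P].
  exact: forms_div_global.
by rewrite forms_ratio_div subrK ord1 // add0r.
Qed.

End Comparison.

(* A linear relation between homogeneous sections, restricted to one class, is an identity
   between products of linear forms. *)
Lemma forms_relation (T : finType) (c : T -> k) (ls : T -> seq (k * k)) (N : T -> prime_divisor X -> nat) t0 :
  (forall t, size (ls t) = size (ls t0)) -> (forall t, all (fun l => l != (0, 0)) (ls t)) ->
  \sum_t c t *: sec (forms_div (ls t) (N t)) 1 = 0 ->
  exists2 kap : T -> k, (forall t, kap t != 0) & forall x, \prod_(l <- ls t0) form l x != 0 ->
    \sum_(t | `[< lin_equiv (forms_div (ls t) (N t)) (forms_div (ls t0) (N t0)) >])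
      c t * kap t * \prod_(l <- ls t) form l x = 0.
Proof.
move=> sz lsn H0; pose D t := forms_div (ls t) (N t).
have gD t : global_sections (D t) (1 : K) by apply: forms_div_global.
have E1 t : c t *: sec (D t) 1 = sec (D t) (ratC X (c t)) by rewrite -secZ // mulr1.
have gC t : global_sections (D t) (ratC X (c t)) by rewrite -[ratC X _]mulr1; apply: globalZ.
rewrite (eq_bigr _ (fun t _ => E1 t)) in H0.
have := cox_component nX (D t0) gC H0.
have /choice [kap Hkap] t : exists kap, kap != 0 /\ (lin_equiv (D t) (D t0) ->
    sec (D t) 1 = kap *: sec (D t0) (forms_ratio (ls t) (ls t0))).
  have [e|ne] := pselect (lin_equiv (D t) (D t0)); last by exists 1; rewrite oner_neq0.
  by have [_ [y y0 E]] := forms_ratio_sec (sz t) (lsn t) (lsn t0) e; exists y.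
pose y t := if `[< lin_equiv (D t) (D t0) >] then c t * kap t else 0.
have gr t : global_sections (D t0) (ratC X (y t) * forms_ratio (ls t) (ls t0)).
  rewrite /y; case: asboolP => e; last by rewrite rmorph0 mul0r; left.
  by apply: globalZ => //; have [] := forms_ratio_sec (sz t) (lsn t) (lsn t0) e.
rewrite big_mkcond (eq_bigr (fun t => sec (D t0) (ratC X (y t) * forms_ratio (ls t) (ls t0)))); last first.
  move=> t _; have := gr t; rewrite /y; case: asboolP => e g; last by rewrite rmorph0 mul0r sec0.
  have [gt _] := forms_ratio_sec (sz t) (lsn t) (lsn t0) e.
  by rewrite -E1 ((Hkap t).2 e) scalerA secZ.
rewrite -sec_sum // => /(cox_sec_inj (global_sum nX _ gr)) S0.
exists kap => [t|x x0]; first exact: (Hkap t).1.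
have hv : has_value (\sum_t ratC X (y t) * forms_ratio (ls t) (ls t0)) (orb X x)
    (\sum_t y t * (\prod_(l <- ls t) form l x / \prod_(l <- ls t0) form l x)).
  apply: (big_ind2 (fun a v => has_value a (orb X x) v)) => [|a v b w|t _]; first exact: has_value0.
    exact: has_valueD.
  by apply: has_valueM; [exact: has_valueC | exact: forms_ratio_value].
have := has_value_uniq hv; rewrite S0 => /(_ _ (has_value0 _)).
rewrite (eq_bigr (fun t => y t * \prod_(l <- ls t) form l x / \prod_(l <- ls t0) form l x)); last first.
  by move=> t _; rewrite mulrA.
rewrite -mulr_suml => /eqP; rewrite mulf_eq0 invr_eq0 (negPf x0) orbF => /eqP E.
rewrite -[RHS]E [LHS]big_mkcond; apply: eq_bigr => t _.
by rewrite /y; case: asboolP => // _; rewrite mul0r.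
Qed.

End Forms.


(** * [U]-invariant functions of weight [d] on [G] are binary forms *)

Section BinaryForms.
Variable k : closedFieldType.
Local Notation G := (sl2 k).
Variables (f : G -> k) (d : nat).
Hypotheses (pf : polyfun f) (f_upper : forall t x, f (upper t * x)%g = f x)
  (f_torus : forall t (t0 : t != 0) x, f ((tdiag t0)^-1 * x)%g = t ^+ d * f x).

Lemma f_row (x y : G) : x 1 0 = y 1 0 -> x 1 1 = y 1 1 -> f x = f y.
Proof.
move=> e0 e1; pose t := sl2_mx (x * y^-1)%g 0 1.
rewrite (_ : x = (upper t * y)%g) ?f_upper //.
apply: (mulIg y^-1%g); rewrite mulgK; have [u1 u2 u3 u4] := upperE t.
have [v1 v2 v3 v4] := sl2_VE y; have D := sl2_ad y; have Dx := sl2_ad (x * y^-1)%g.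
have z10 : sl2_mx (x * y^-1)%g 1 0 = 0 by rewrite sl2M v1 v3 e0 e1; ring.
have z11 : sl2_mx (x * y^-1)%g 1 1 = 1 by rewrite sl2M v2 v4 e0 e1 -D; ring.
apply: sl2_eq; rewrite ?u1 ?u2 ?u3 ?u4 //.
by move: Dx; rewrite z10 z11 mulr1 mulr0 subr0.
Qed.

Lemma f_scale (x y : G) t : t != 0 -> x 1 0 = t * y 1 0 -> x 1 1 = t * y 1 1 -> f x = t ^+ d * f y.
Proof.
move=> t0 e0 e1; rewrite -(f_torus t0); have [t1 t2 t3 t4] := tdiagE t0.
have [v1 v2 v3 v4] := sl2_VE (tdiag t0).
by apply: f_row; rewrite sl2M v3 v4 t1 t3 oppr0 mul0r add0r.
Qed.

Lemma poly_eq_off0 (P Q : {poly k}) : (forall z, z != 0 -> P.[z] = Q.[z]) -> P = Q.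
Proof.
move=> H; apply/eqP; rewrite -subr_eq0; apply/negPn/negP => PQ0.
have /exists_nonroot [z] : 'X * (P - Q) != 0 by rewrite mulf_neq0 ?polyX_eq0.
rewrite hornerM hornerX mulf_eq0 negb_or hornerD hornerN => /andP[z0].
by rewrite H // subrr eqxx.
Qed.

(** Restricting [f] to rows [(1, z)] gives a polynomial [h], and homogeneity recovers [f] from it.
    [h] has degree at most [d] because [f] is also regular at the row [(0, 1)]. The roots of [h]
    give the linear forms, and the missing factors are copies of the first coordinate. *)
Lemma binary_form_factor : exists c ls, [/\ size ls = d, all (fun l => l != (0, 0)) ls &
  forall x, f x = c * \prod_(l <- ls) form l x].
Proof.
pose gam z := (lower 1 * upper (-1) * upper (z * 1) : G)%g.
have gamE z : gam z 1 0 = 1 /\ gam z 1 1 = z.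
  have [l1 l2 l3 l4] := lowerE (1 : k); have [u1 u2 u3 u4] := upperE (-1 : k).
  have [w1 w2 w3 w4] := upperE (z * 1).
  by rewrite /gam !sl2M l3 l4 u1 u2 u3 u4 w1 w2 w3 w4; split; ring.
have [|h Hh] := @polyfun_curve _ gam f _ pf.
  by do ?apply: polycurveM; [apply: polycurve_cst | apply: polycurve_cst | apply: polycurve_upper].
have [|h' Hh'] := @polyfun_curve _ (fun z => lower (z * 1)) f _ pf; first exact: polycurve_lower.
have fh (x : G) : x 1 0 != 0 -> f x = x 1 0 ^+ d * h.[x 1 1 / x 1 0].
  move=> x0; rewrite -Hh; have [g0 g1] := gamE (x 1 1 / x 1 0).
  by apply: f_scale => //; rewrite ?g0 ?g1 ?mulr1 // mulrC divfK.
have sh : (size h <= d.+1)%N.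
  rewrite leqNgt; apply/negP => dh; have h0 : h != 0 by rewrite -size_poly_gt0; lia.
  pose r := (size h).-1; have sr : size h = r.+1 by rewrite prednK ?size_poly_gt0.
  have rd : (d < r)%N by rewrite sr in dh.
  (* [h'] is [f] on rows [(y, 1)], that is, [y ^+ d] times [h] at [1 / y]. If [r > d], evaluating
     this identity at 0 kills the leading coefficient of [h]. *)
  have E : 'X^(r - d) * h' = \poly_(i < r.+1) h`_(r - i).
    apply: poly_eq_off0 => y y0; have [l1 l2 l3 l4] := lowerE (y * 1).
    rewrite hornerM hornerXn -Hh' fh ?l3 ?l4 ?mulr1 // mulrA -exprD subnK ?(ltnW rd) //.
    rewrite horner_coef sr horner_poly mulr_sumr (reindex_inj rev_ord_inj); apply: eq_bigr => i _ /=.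
    rewrite mulrCA subSS div1r exprVn; congr (_ * _); rewrite -exprB ?leq_subr ?unitfE //.
    by rewrite subKn // -ltnS.
  have := congr1 (fun p : {poly k} => p.[0]) E; rewrite hornerM hornerXn horner_coef0 coef_poly /= subn0.
  rewrite expr0n subn_eq0 leqNgt rd mul0r -lead_coefE => /esym/eqP.
  by rewrite lead_coef_eq0 (negPf h0).
have [rs Ers] := closed_field_poly_normal h.
have ext c ls : (forall x : G, x 1 0 != 0 -> f x = c * \prod_(l <- ls) form l x) ->
    forall x, f x = c * \prod_(l <- ls) form l x.
  move=> H x; apply/eqP; rewrite -subr_eq0; apply/negPn/negP => n0.
  have pF (l : k * k) : polyfun (form l) by apply: polyfunD; apply: polyfunM; [exact: polyfun_cst | exact: polyfun_entry | exact: polyfun_cst | exact: polyfun_entry].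
  have pP : polyfun (fun x => \prod_(l <- ls) form l x).
    elim: (ls) => [|l s IH]; first by apply: polyfun_ext (polyfun_cst 1) => y; rewrite big_nil.
    by apply: polyfun_ext (polyfunM (pF l) IH) => y; rewrite big_cons.
  have pD : polyfun (fun x => f x - c * \prod_(l <- ls) form l x).
    apply: polyfun_ext (polyfunD pf (polyfunM (polyfun_cst (- c)) pP)) => y; by rewrite mulNr.
  have [_ _ l3 _] := lowerE (1 : k).
  have [|y [yn /H Hy]] := polyfun_neq0 pD (polyfun_entry k 1 0) n0 (h := lower 1).
    by rewrite l3 oner_neq0.
  by rewrite Hy subrr eqxx in yn.
have [h0|h0] := eqVneq h 0.
  exists 0, (nseq d (1, 0)); split; first by rewrite size_nseq.
    by apply/allP => l /nseqP [-> _]; rewrite xpair_eqE oner_eq0.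
  by apply: ext => x x0; rewrite fh // h0 horner0 mulr0 mul0r.
have srs : (size rs <= d)%N.
  move: sh; rewrite Ers size_scale ?lead_coef_eq0 // size_prod_XsubC; lia.
exists (lead_coef h), (nseq (d - size rs) (1, 0) ++ [seq (- z, 1) | z <- rs]); split.
- by rewrite size_cat size_nseq size_map subnK.
- rewrite all_cat; apply/andP; split; apply/allP => l.
    by move=> /nseqP [-> _]; rewrite xpair_eqE oner_eq0.
  by move=> /mapP [z _ ->]; rewrite xpair_eqE oner_eq0 andbF.
- apply: ext => x x0; rewrite fh // {1}Ers hornerZ mulrCA; congr (_ * _).
  rewrite big_cat big_map /= big_nseq iter_mulr mulr1 /form /= mul1r mul0r addr0.
  rewrite -{1}(subnK srs) exprD -mulrA; congr (_ * _); first by rewrite mul1r.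
  rewrite horner_prod; elim: (rs) => [|z s IH]; first by rewrite !big_nil mulr1.
  rewrite !big_cons -IH /= exprS hornerXsubC mulrACA; congr (_ * _).
  by rewrite mulrBr mulrC divfK // addrC mulNr (mulrC z).
Qed.

End BinaryForms.


(** * Highest weight vectors of the Cox ring modulo the stable sections *)

Section Lines.
Variable k : closedFieldType.
Implicit Types l : k * k.

(** A normal form for the proportionality class of a nonzero linear form, so that points of the
    projective line can be compared by equality. *)
Definition line l : k * k := if l.1 != 0 then (1, l.2 / l.1) else (0, 1).

Lemma line_neq0 l : line l != (0, 0).
Proof.
by rewrite /line; case: ifP => _; rewrite xpair_eqE negb_and oner_eq0 ?orbT.
Qed.

Lemma line_scale l : l != (0, 0) -> exists2 c, c != 0 & forall x, form l x = c * form (line l) x.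
Proof.
case: l => a b; rewrite xpair_eqE negb_and /line /form /=.
have [->|a0] := eqVneq a 0 => /= [b0|_].
  by exists b => // x; rewrite !mul0r !add0r mul1r.
by exists a => // x; rewrite mul1r mulrDr mulrA (mulrC a (b / a)) divfK.
Qed.

Lemma line_basis l1 l2 : line l1 != line l2 -> exists u v : k * k,
  [/\ u.1 * (line l1).1 + u.2 * (line l1).2 = 1, u.1 * (line l2).1 + u.2 * (line l2).2 = 0,
      v.1 * (line l1).1 + v.2 * (line l1).2 = 0 & v.1 * (line l2).1 + v.2 * (line l2).2 = 1] /\
  forall l x, form l x = (l.1 * u.1 + l.2 * u.2) * form (line l1) x + (l.1 * v.1 + l.2 * v.2) * form (line l2) x.
Proof.
rewrite /line /form; case: (l1.1 != 0); case: (l2.1 != 0) => /= H; rewrite ?eqxx // in H *.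
- move: H; rewrite xpair_eqE eqxx /= => H.
  set a := l1.2 / l1.1 in H *; set b := l2.2 / l2.1 in H *.
  have d0 : a - b != 0 by rewrite subr_eq0.
  exists (- b / (a - b), (a - b)^-1), (a / (a - b), - (a - b)^-1) => /=.
  by split=> [|l x]; [split; field; exact: d0 | field; exact: d0].
- by exists (1, 0), (- (l1.2 / l1.1), 1) => /=; split=> [|l x]; [split; ring | ring].
- by exists (- (l2.2 / l2.1), 1), (1, 0) => /=; split=> [|l x]; [split; ring | ring].
Qed.

Lemma row_ex (y0 y1 : k) : (y0, y1) != (0, 0) -> exists x : sl2 k, x 1 0 = y0 /\ x 1 1 = y1.
Proof.
rewrite xpair_eqE negb_and; have [->|y00] := eqVneq y0 0 => /= H.
  exists (tdiag H)^-1%g; have [a b c d] := tdiagE H; have [_ _ e f] := sl2_VE (tdiag H).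
  by rewrite e f a c oppr0.
have D : 0 * y1 - (- y0^-1) * y0 = 1 by rewrite mul0r sub0r mulNr opprK mulVf.
by exists (sl2_mk D); have [_ _ ? ?] := sl2_mkE D.
Qed.

End Lines.

Section Special.
Variables (k : closedFieldType) (n : nat) (X : embedding k n).
Hypotheses (nb : (0 < n <= 2)%N) (nX : normal_variety X).
Local Notation K := (ratfun X).
Local Notation G := (sl2 k).
Variables (R : cox_ring X) (alpha : G -> R -> R) (phi : weil_divisor X -> G -> K -> K).
Local Notation sec := (cox_sec R).
Hypothesis alphaD : forall g, {morph alpha g : r s / r + s}.
Hypothesis Hphi : forall D, linearization D (phi D).
Hypothesis alphaE : forall D g a, global_sections D a -> alpha g (sec D a) = sec D (phi D g a).
Variable L : seq (prime_divisor X).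
Hypotheses (uL : uniq L) (HL : forall P, (P \in L) <-> G_stable P).
Implicit Types (l : k * k) (ls : seq (k * k)) (N : prime_divisor X -> nat) (P : prime_divisor X) (D : weil_divisor X).

Local Notation nz := (all (fun l => l != (0, 0))).
Local Notation fdiv := (forms_div L).
Let S : set R := [set r | exists2 P : prime_divisor X, G_stable P & r = canonical_section R P].
Local Notation J := (ideal_generated S).
Let iJ : is_ideal J := ideal_generated_ideal S.

Lemma stable_section_invariant g r : S r -> alpha g r = r.
Proof.
move=> [P sP ->]; rewrite /canonical_section.
have gP : global_sections << P >> (1 : K).
  by right=> Q _; rewrite ord1 // coeffU add0r mul1r.
rewrite alphaE // (stable_lin nX (Hphi _)) // => Q nQ; rewrite coeffU mul1r.
by case: eqP => // E; case: nQ; rewrite -E.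
Qed.

Lemma ord2_scale P c l l' : c != 0 -> l' != (0, 0) -> (forall x, form l x = c * form l' x) ->
  ord2 P (form l) = ord2 P (form l').
Proof.
move=> c0 l'0 E; rewrite /ord2; have ofo := form_odd nb l; have of' := form_odd nb l'.
have -> : sqf X (form l) = ratC X (c ^+ 2) * sqf X (form l').
  apply: (sl2_rat_eqI (opn_setT (sl2_space_functions k))) => [|x v _ hv]; first by exists 1%g.
  rewrite (has_value_uniq hv (sqfE X nb x ofo)) E exprMn.
  by apply: has_valueM; [exact: has_valueC | exact: sqfE].
rewrite ordM ?ordC ?add0r ?expf_neq0 //; last by apply: sqf_neq0 => //; apply: form_nonzero.
by rewrite fmorph_eq0 expf_neq0.
Qed.

Lemma ratqM f1 f2 f3 : odd_fun n f1 -> odd_fun n f2 -> odd_fun n f3 -> nonzero f2 -> nonzero f3 ->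
  ratq X f1 f2 * ratq X f2 f3 = ratq X f1 f3.
Proof.
move=> o1 o2 o3 n2 n3; have [x0 [x2 x3]] := nonzero2 o2 o3 n2 n3.
apply: (sl2_rat_eqI (opn_setI (sl2_space_functions k) (nz_opn o2) (nz_opn o3))); first by exists x0.
move=> x c [/= f2x f3x] hc.
rewrite (has_value_uniq hc (has_valueM (ratqE X nb o1 o2 f2x) (ratqE X nb o2 o3 f3x))).
by rewrite mulrA divfK //; apply: ratqE.
Qed.

Lemma form_section_line l : l != (0, 0) -> exists c, sec (form_div X l) 1 = c *: sec (form_div X (line l)) 1.
Proof.
move=> l0; have [c c0 E] := line_scale l0; have m0 := line_neq0 l.
have dl := form_divP nb nX l0; have dm := form_divP nb nX m0.
have [||||P|c' _ E'] := @cox_unit_ratio _ _ _ nX R (form_div X l) (form_div X (line l)) 1 1.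
- exact: (is_div_global nb nX (form_odd nb l) (form_nonzero l0) dl).
- exact: (is_div_global nb nX (form_odd nb _) (form_nonzero m0) dm).
- exact: oner_neq0.
- exact: oner_neq0.
- congr (_ + _); have [sP|[x Px]] := stable_or_meets P; first by rewrite (dl P).1 // (dm P).1.
  have := (dl P).2 x Px; have := (dm P).2 x Px; rewrite (ord2_scale P c0 m0 E); lia.
- by exists c'.
Qed.

(** Left translation mixes [form l] with the same form [h] in the first row. The partner of the
    section 1 is minus the section given by the quotient of [h] by [form l]. *)
Lemma form_section_act l : l != (0, 0) -> exists s', forall g,
  alpha g (sec (form_div X l) 1) = g 0 0 *: sec (form_div X l) 1 + g 1 0 *: s'.
Proof.
move=> l0; have ofo := form_odd nb l; have nfo := form_nonzero l0; have dl := form_divP nb nX l0.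
have g1 := is_div_global nb nX ofo nfo dl.
pose h (x : G) := l.1 * x 0 0 + l.2 * x 0 1.
have oh : odd_fun n h by apply: odd_comb => //; apply: odd_entry.
pose a := ratq X h (form l).
have Ea g : phi (form_div X l) g 1 = ratC X (g 0 0) + ratC X (- g 1 0) * a.
  rewrite (is_div_lin nb nX ofo nfo dl (Hphi _)).
  have -> : (fun x : G => form l (g^-1 * x)%g) = (fun x => g 0 0 * form l x + (- g 1 0) * h x).
    apply/funext => x; have [_ _ v3 v4] := sl2_VE g; rewrite /form /h !sl2M v3 v4; ring.
  by rewrite ratqD // ratq_id // mulr1.
have ga : global_sections (form_div X l) a.
  have [_ _ l3 _] := lowerE (-1 : k); have [l1 _ _ _] := lowerE (-1 : k).
  (* The translate of 1 by [lower (-1)] is [1 + a], which shows that [a] is a global section. *)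
  have := lin_global (Hphi _) (lower (-1)) g1; rewrite Ea l1 l3 opprK rmorph1 mul1r => H.
  have -> : a = (1 + a) + ratC X (-1) * 1 by rewrite rmorphN rmorph1 mulr1 addrC addKr.
  by apply: globalD => //; apply: globalZ.
exists (- sec (form_div X l) a) => g; rewrite alphaE // Ea.
rewrite -[ratC X (g 0 0)]mulr1 secD //; [|exact: globalZ|exact: globalZ].
by rewrite !secZ // scalerN scaleNr.
Qed.

Lemma canonical_in_J P : G_stable P -> J (canonical_section R P).
Proof.
by move=> sP; exists 1%N, (fun=> 1), (fun=> canonical_section R P); split=> [_|]; [exists P | rewrite big_ord1 mul1r].
Qed.

Lemma sec_forms_mod ls N : nz ls -> exists c,
  J (sec (fdiv ls N) 1 - c *: \prod_(l <- ls) sec (form_div X l) 1).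
Proof.
move=> lsn; rewrite (sec_forms nb nX R uL) //.
have [/hasP [P PL NP]|NL] := boolP (has (fun P => N P != 0%N) L).
  exists 0; rewrite scale0r subr0; apply: idealMl => //; rewrite (bigD1_seq P) //=.
  apply: idealMr => //; case: (N P) NP => // i _; rewrite exprS; apply: idealMr => //.
  by apply: canonical_in_J; apply/HL.
exists 1; rewrite scale1r [X in _ * X](_ : _ = 1) ?mulr1 ?subrr; first exact: ideal0.
apply: big1_seq => P /= PL; move/hasPn: NL => /(_ P PL).
by rewrite negbK => /eqP ->.
Qed.

(** [ex P] is the exceptional line of a stable divisor [P]. [lam] lists at least two lines, all the
    exceptional ones among them. *)
Variables (ex : prime_divisor X -> k * k) (lo hi : prime_divisor X -> int).
Hypothesis lo_hi : forall P, G_stable P -> lo P < hi P.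
Hypothesis ord2_form : forall P l, G_stable P -> l != (0, 0) ->
  ord2 P (form l) = if line l == ex P then hi P else lo P.
Variables (m : nat) (lam : 'I_m.+2 -> k * k).
Hypotheses (lam_inj : injective lam) (lam_line : forall i, line (lam i) = lam i)
  (lam_ex : forall P, G_stable P -> exists i, ex P = lam i).
Let lam0 i : lam i != (0, 0). Proof. by rewrite -lam_line line_neq0. Qed.
Let s i := sec (form_div X (lam i)) 1.
Local Notation ev := (mmap (in_alg R)).

(** Along every stable divisor a non-exceptional [l] has the least possible order, so the quotient
    of [form (lam i)] by [form l] has no pole there. As a section of O_X(form_div l) its function on
    [G] is [form (lam i)], so it is [s i] times stable sections. *)
Lemma form_section_generic l i : l != (0, 0) -> line l != lam i ->
  (forall P : prime_divisor X, G_stable P -> ex P <> line l) ->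
  global_sections (form_div X l) (ratq X (form (lam i)) (form l)) /\
  exists c, J (sec (form_div X l) (ratq X (form (lam i)) (form l)) - c *: s i).
Proof.
move=> l0 li lex; set a := ratq _ _ _; have dl := form_divP nb nX l0.
have ofo := form_odd nb l; have nfo := form_nonzero l0.
have oi := form_odd nb (lam i); have ni := form_nonzero (lam0 i).
have a0 : a != 0 by apply: ratq_neq0.
have oE P := ord2_ratq nb nX P oi ofo ni nfo.
have ga : global_sections (form_div X l) a.
  apply: globalP => // P; have := oE P; rewrite -/a; have [sP|[x Px]] := stable_or_meets P.
    rewrite (dl P).1 // !ord2_form // (_ : line l == ex P = false); last by apply/eqP => /esym/(lex P sP).
    have := lo_hi sP; case: ifP => _; lia.
  have := (dl P).2 x Px; have := ord2_ge0 nb nX oi ni Px; lia.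
split=> //; have fr := is_div_frame nb nX ofo nfo dl (Hphi (form_div X l)).
have lsn : nz [:: lam i] by rewrite /= lam0.
have [|N [c [c0 Ea _]]] := sec_of_forms nb nX R Hphi uL HL lsn fr ga a0 (oner_neq0 k).
  move=> g x fgx; rewrite mul1r big_seq1 (lin_E (Hphi _)) translate_ratq //.
  rewrite (is_div_lin nb nX ofo nfo dl (Hphi _)) ratqM //; try exact: odd_act; try exact: nonzero_act.
  by have := ratqE X nb (odd_act g oi) ofo fgx; rewrite mulKg.
have [c' Hc'] := sec_forms_mod N lsn; exists (c * c'); rewrite Ea -scalerA -scalerBr.
by rewrite big_seq1 in Hc'; apply: (subspaceZ (ideal_subspace iJ)).
Qed.

(** A listed [l] gives a multiple of some [s i]. For any other, write [form l] through
    [form (lam 0)] and [form (lam 1)], divide by [form l], and apply [form_section_generic] to both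
    quotients. *)
Lemma form_section_mod l : l != (0, 0) ->
  exists2 q : {mpoly k[m.+2]}, q \is 1.-homog & J (sec (form_div X l) 1 - ev s q).
Proof.
move=> l0; have sJ := ideal_subspace iJ.
have hX i : ('X_i : {mpoly k[m.+2]}) \is 1.-homog by rewrite dhomogX /= mdeg1.
have eX i : ev s 'X_i = s i by rewrite mmapX mmap1U.
have [[i li]|nl] := pselect (exists i, line l = lam i).
  have [c Ec] := form_section_line l0; exists (c *: 'X_i); first exact: dhomogZ.
  by rewrite Ec li mmapZ eX mulr_algl subrr; apply: ideal0.
have lex P : G_stable P -> ex P <> line l.
  by move=> /lam_ex [i ->] E; apply: nl; exists i.
have nli i : line l != lam i by apply/eqP => E; apply: nl; exists i.
have [g0 [c0 H0]] := form_section_generic l0 (nli 0) lex.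
have [g1 [c1 H1]] := form_section_generic l0 (nli 1) lex.
have [|u [v [_ Huv]]] := @line_basis _ (lam 0) (lam 1); first by rewrite !lam_line (inj_eq lam_inj).
pose x := l.1 * u.1 + l.2 * u.2; pose y := l.1 * v.1 + l.2 * v.2.
have El : form l = (fun g => x * form (lam 0) g + y * form (lam 1) g).
  by apply/funext => g; rewrite Huv !lam_line.
have E1 : (1 : K) = ratC X x * ratq X (form (lam 0)) (form l) + ratC X y * ratq X (form (lam 1)) (form l).
  have ofo := form_odd nb l; have nfo := form_nonzero l0.
  by rewrite -ratqD ?ratq_id // -?El ?ratq_id //; apply: form_odd.
exists ((x * c0) *: 'X_0 + (y * c1) *: 'X_1); first by apply: dhomogD; apply: dhomogZ.
rewrite {1}E1 secD ?secZ //; try exact: globalZ.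
rewrite rmorphD /= !mmapZ !eX !mulr_algl opprD addrACA -!scalerA -!scalerBr.
by apply: idealD => //; apply: (subspaceZ sJ).
Qed.

Lemma forms_product_mod ls : nz ls -> exists2 q : {mpoly k[m.+2]}, q \is (size ls).-homog &
  J (\prod_(l <- ls) sec (form_div X l) 1 - ev s q).
Proof.
elim: ls => [_|l ls IH /= /andP[l0 /IH [q hq Hq]]].
  exists 1; first exact: dhomog1.
  by rewrite big_nil rmorph1 subrr; apply: ideal0.
have [p hp Hp] := form_section_mod l0; exists (p * q); first exact: (dhomogM hp hq).
by rewrite big_cons rmorphM; apply: (congM iJ).
Qed.

Local Notation term := (k * seq (k * k) * (prime_divisor X -> nat))%type.
Let val (t : term) := t.1.1 *: sec (fdiv t.1.2 t.2) 1.

(** The homogeneous components of [x] satisfy the same eigenvector equations ([eigen_components]).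
    Their functions on [G] are binary forms of degree [d], which factor, and [sec_of_forms] returns
    to the Cox ring. *)
Lemma highest_weight_sections x (d : nat) : (forall t, alpha (upper t) x = x) -> has_weight alpha d x ->
  exists ts : seq term, all (fun t => (size t.1.2 == d) && nz t.1.2) ts /\ x = \sum_(t <- ts) val t.
Proof.
move=> xu xt.
pose Gam (g : G) (c : k) := (exists t, g = upper t /\ c = 1) \/ (exists t (t0 : t != 0), g = tdiag t0 /\ c = t ^+ d).
have [|r [D [a [ga ea ->]]]] := @eigen_components _ _ _ nX R alpha phi alphaD Hphi alphaE Gam x.
  by move=> g c [[t [-> ->]]|[t [t0 [-> ->]]]]; rewrite ?xu ?scale1r ?xt.
have H i : exists t : term, (size t.1.2 == d) && nz t.1.2 /\ sec (D i) (a i) = val t.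
  have nz1 : nz (nseq d ((1, 0) : k * k)).
    by apply/allP => l /nseqP [-> _]; rewrite xpair_eqE oner_eq0.
  have [a0|a0] := eqVneq (a i) 0.
    exists (0, nseq d (1, 0), fun=> 0%N); rewrite /val /= size_nseq eqxx nz1; split=> //.
    by rewrite a0 sec0 // scale0r.
  have [W [F fr]] := frame_ex (Hphi (D i)); have [f [pf sf]] := sfun_ex nX fr (ga i).
  have Ef g c : Gam g c -> forall y, f (g^-1 * y)%g = c * f y.
    move=> gc; have E1 := sfun_act g fr sf; have E2 := sfunZ c fr sf.
    have E : phi (D i) g (a i) = ratC X c * a i.
      have := ea i g c gc; rewrite alphaE // -secZ // => /(sec_inj nX); apply.
        exact: lin_global.
      exact: globalZ.
    by rewrite E in E1; apply: (sfun_uniq fr E1 E2).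
  have [t y|t t0 y|c [ls [sz lsn fE]]] := @binary_form_factor _ f d pf.
  - have g1 : Gam (upper t) 1 by left; exists t.
    by have := Ef _ _ g1 (upper t * y)%g; rewrite mulKg mul1r.
  - by apply: Ef; right; exists t, t0.
  - have c0 : c != 0.
      apply: contraNneq a0 => c0; apply/eqP; apply: (sfun_eq0 fr sf) => y.
      by rewrite fE c0 mul0r.
    have sf' : is_sfun (phi (D i)) W F (a i) (fun x => c * \prod_(l <- ls) form l x).
      by move=> g y Wy; rewrite -fE; apply: sf.
    have [N [c' [_ E _]]] := sec_of_forms nb nX R Hphi uL HL lsn fr (ga i) a0 c0 sf'.
    by exists (c', ls, N); rewrite /val /= sz eqxx lsn.
have /choice [t Ht] := H.
exists [seq t i | i <- enum 'I_r]; split.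
  by apply/allP => _ /mapP [i _ ->]; have [] := Ht i.
by rewrite big_map big_enum; apply: eq_bigr => i _; have [] := Ht i.
Qed.

Lemma special_generation x (d : nat) : (forall t, alpha (upper t) x = x) -> has_weight alpha d x ->
  exists2 p : {mpoly k[m.+2]}, p \is d.-homog & J (x - ev s p).
Proof.
move=> xu xt; have [ts [/allP Hts ->]] := highest_weight_sections xu xt.
elim: ts Hts => [|t ts IH] Hts.
  by exists 0; [exact: dhomog0 | rewrite big_nil rmorph0 subr0; apply: ideal0].
have [|p hp Hp] := IH; first by move=> t' H'; apply: Hts; rewrite inE H' orbT.
have /andP[/eqP sz lsn] := Hts t (mem_head _ _).
have [c Hc] := sec_forms_mod t.2 lsn; have [q hq Hq] := forms_product_mod lsn.
exists ((t.1.1 * c) *: q + p); first by apply: dhomogD => //; apply: dhomogZ; rewrite -sz.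
rewrite big_cons rmorphD /=; apply: (congD iJ) => //; rewrite /val mmapZ mulr_algl -scalerA.
rewrite /cong -scalerBr; apply: (subspaceZ (ideal_subspace iJ)).
apply: (cong_trans iJ Hc); rewrite /cong -scalerBr; exact: (subspaceZ (ideal_subspace iJ)).
Qed.

Let cnt P ls := count (fun l => line l == ex P) ls.

Lemma sum_ord2 P ls : G_stable P -> nz ls ->
  \sum_(l <- ls) ord2 P (form l) = lo P *+ size ls + (hi P - lo P) *+ cnt P ls.
Proof.
move=> sP; elim: ls => [_|l ls IH /= /andP[l0 /IH {}IH]]; first by rewrite big_nil.
rewrite big_cons IH ord2_form // mulrS /cnt /=; case: ifP => _; rewrite ?add1n ?add0n ?mulrS; ring.
Qed.

(** Comparing orders along [P] in one class gives [(hi P - lo P) (cnt P ls - cnt P ls0) = 2 N P]. A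
    stable factor must be paid for by extra linear factors on the exceptional line. *)
Lemma class_count ls N ls0 P : size ls = size ls0 -> nz ls -> nz ls0 ->
  lin_equiv (fdiv ls N) (fdiv ls0 (fun=> 0%N)) -> G_stable P ->
  (cnt P ls0 + (N P != 0%N) <= cnt P ls)%N.
Proof.
move=> sz lsn ls0n eqv sP; have := forms_ratio_stable nb nX uL HL sz lsn ls0n eqv sP.
rewrite !sum_ord2 // sz opprD addrACA subrr add0r subr0 => H.
have h0 : 0 < hi P - lo P by rewrite subr_gt0; apply: lo_hi.
have : (hi P - lo P) * ((cnt P ls)%:Z - (cnt P ls0)%:Z) = (N P)%:Z *+ 2.
  by rewrite H mulrBr -!natz !mulr_natr.
move: (hi P - lo P) h0 (cnt P ls) (cnt P ls0) => x x0 a b E.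
rewrite leqNgt; apply/negP; case: (N P) E => [|i] /= E lt.
  have : x * (a%:Z - b%:Z) < 0 by rewrite pmulr_rlt0 // subr_lt0 ltz_nat; lia.
  by rewrite E ltxx.
have : x * (a%:Z - b%:Z) <= 0 by rewrite pmulr_rle0 // subr_le0 lez_nat; lia.
rewrite E; lia.
Qed.

Let mono (e : 'X_{1..m.+2}) := flatten [seq nseq (e i) (lam i) | i <- enum 'I_m.+2].

Lemma size_mono e : size (mono e) = mdeg e.
Proof.
rewrite /mono size_flatten /shape -map_comp mdegE sumnE big_map big_enum.
by apply: eq_bigr => i _; rewrite /= size_nseq.
Qed.

Lemma mono_nz e : nz (mono e).
Proof. by apply/allP => l /flattenP [_ /mapP [i _ ->] /nseqP [-> _]]. Qed.

Lemma count_mono e P i : ex P = lam i -> cnt P (mono e) = e i.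
Proof.
move=> E; rewrite /cnt /mono count_flatten -map_comp sumnE big_map big_enum (bigD1 i) //=.
rewrite count_nseq /= lam_line E eqxx mul1n big1 ?addn0 // => j ji.
by rewrite /= count_nseq /= lam_line (inj_eq lam_inj) (negPf ji).
Qed.

Lemma prod_mono (A : comNzRingType) (f : k * k -> A) e :
  \prod_(l <- mono e) f l = \prod_i f (lam i) ^+ e i.
Proof.
rewrite /mono big_flatten big_map big_enum; apply: eq_bigr => i _.
by rewrite big_nseq iter_mulr mulr1.
Qed.

Lemma forms_nonvanishing ls : nz ls -> exists x, \prod_(l <- ls) form l x != 0.
Proof.
move=> lsn; suff [] : polyfun (fun x : G => \prod_(l <- ls) form l x) /\
    exists x, \prod_(l <- ls) form l x != 0 by [].
elim: ls lsn => [_|l ls IH /= /andP[/form_nonzero [x lx] /IH [pls [y lsy]]]].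
  split; first by apply: polyfun_ext (polyfun_cst 1) => x; rewrite big_nil.
  by exists 1%g; rewrite big_nil oner_neq0.
have pl : polyfun (form l) := (form_odd nb l).1.
split; first by apply: polyfun_ext (polyfunM pl pls) => z; rewrite big_cons.
by have [z [lz lsz]] := polyfun_neq0 pl pls lx lsy; exists z; rewrite big_cons mulf_neq0.
Qed.

(** The second alternative covers at most one exceptional line, where [lam] was completed to two
    lines. *)
Hypothesis lam_alt : (forall i, exists2 P : prime_divisor X, G_stable P & ex P = lam i) \/
  (m = 0%N /\ forall P : prime_divisor X, G_stable P -> ex P = lam 0).

Lemma count_le_size ls : (\sum_i count (fun l => line l == lam i) ls <= size ls)%N.
Proof.
elim: ls => [|l ls IH] /=; first by rewrite big1.
rewrite big_split /= -[(size ls).+1]add1n leq_add //.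
have [[i li]|nl] := pselect (exists i, line l = lam i).
  rewrite (bigD1 i) //= li eqxx big1 // => j ji.
  by rewrite (inj_eq lam_inj) eq_sym (negPf ji).
by rewrite big1 // => i _; case: eqP => // E; case: nl; exists i.
Qed.

(** Restrict the relation to the class of one monomial of [p]. By [class_count], the terms
    containing a stable section carry too many factors on some exceptional line. If all listed lines
    are exceptional, the total degree leaves room for the chosen monomial only. If there are just
    two lines, the forms are coordinates, and those terms vanish to higher order along [lam 0] than
    the monomial does. *)
Lemma special_independence d (p : {mpoly k[m.+2]}) : p \is d.-homog ->
  forall r (c b : 'I_r -> R), (forall i, S (c i)) ->
  (forall i t, alpha (upper t) (b i) = b i) -> (forall i, has_weight alpha d (b i)) ->
  ev s p = \sum_i b i * c i -> p = 0.
Proof.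
move=> /dhomogP hp r c b Sc bu bt Ep; apply/eqP/negPn/negP => p0.
have /choice [Pi HPi] i : exists P : prime_divisor X, G_stable P /\ c i = canonical_section R P.
  by have [P sP E] := Sc i; exists P.
have /choice [ts Hts] i := highest_weight_sections (bu i) (bt i).
(* Moves a term of [b i * c i] to the other side of the relation, absorbing the stable section [c i]
   into the exponents. *)
pose lift i (t : term) : term := (- t.1.1, t.1.2, fun Q => (t.2 Q + (Q == Pi i))%N).
pose others := flatten [seq [seq lift i t | t <- ts i] | i <- enum 'I_r].
have oP t : t \in others -> [/\ size t.1.2 = d, nz t.1.2 & exists2 P : prime_divisor X, G_stable P & t.2 P != 0%N].
  move=> /flattenP [_ /mapP [i _ ->] /mapP [t' t'i ->]] /=.
  have /allP /(_ t' t'i) /andP[/eqP sz lsn] := (Hts i).1; split=> //.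
  by exists (Pi i); [exact: (HPi i).1 | rewrite eqxx addn1].
have lval i t : t \in ts i -> val (lift i t) = - (val t * c i).
  move=> ti; have /allP /(_ t ti) /andP[_ lsn] := (Hts i).1.
  rewrite /val /= scaleNr -scalerAl; congr (- (_ *: _)).
  rewrite !(sec_forms nb nX R uL) // -mulrA; congr (_ * _).
  under eq_bigr => Q _ do rewrite exprD.
  rewrite big_split /=; congr (_ * _); have PL : Pi i \in L by apply/HL; exact: (HPi i).1.
  rewrite (bigD1_seq (Pi i)) //= eqxx expr1 big1 ?mulr1 ?(HPi i).2 // => Q /negPf ->.
  by rewrite expr0.
pose M := msupp p; pose e0 := nth 0%MM M.
pose tt (j : 'I_(size M) + 'I_(size others)) : term := match j with
  | inl j => (p@_(e0 j), mono (e0 j), fun=> 0%N) | inr j => nth (0, [::], fun=> 0%N) others j end.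
have Me (j : 'I_(size M)) : e0 j \in M by apply: mem_nth.
have M0 : (0 < size M)%N by rewrite lt0n size_eq0 msupp_eq0.
pose j0 : 'I_(size M) := Ordinal M0.
have szt t : size (tt t).1.2 = d.
  by case: t => j /=; [rewrite size_mono (hp _ (Me j)) | have [] := oP _ (mem_nth (0, [::], fun=> 0%N) (ltn_ord j))].
have nzt t : nz (tt t).1.2.
  by case: t => j /=; [exact: mono_nz | have [] := oP _ (mem_nth (0, [::], fun=> 0%N) (ltn_ord j))].
have S0 : \sum_t val (tt t) = 0.
  rewrite big_sumType /=.
  have -> : \sum_(j < size M) val (p@_(e0 j), mono (e0 j), fun=> 0%N) = ev s p.
    rewrite /mmap (big_nth 0%MM) big_mkord; apply: eq_bigr => j _.
    have L1 : \prod_(P <- L) canonical_section R P ^+ 0 = 1 by apply: big1.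
    by rewrite [RHS]mulr_algl /val /= (sec_forms nb nX R uL) ?mono_nz // prod_mono L1 mulr1.
  have -> : \sum_(j < size others) val (nth (0, [::], fun=> 0%N) others j) = - \sum_i b i * c i.
    have := big_nth (0, [::], fun=> 0%N) (op := +%R) (idx := 0) (r := others) predT val.
    rewrite big_mkord => <-; rewrite /others big_flatten big_map big_enum -sumrN; apply: eq_bigr => i _.
    rewrite big_map (Hts i).2 mulr_suml -sumrN; apply: eq_big_seq => t; exact: lval.
  by rewrite Ep subrr.
have [|//|kap kap0 Hkap] := @forms_relation _ _ _ nb nX R L uL HL _ (fun t => (tt t).1.1)
    (fun t => (tt t).1.2) (fun t => (tt t).2) (inl j0) _ _ S0; first by move=> t; rewrite !szt.
have pj0 : p@_(e0 j0) != 0 by rewrite -mcoeff_msupp.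
have e0_inj (i j : 'I_(size M)) : e0 i = e0 j -> i = j.
  by move=> /eqP; rewrite nth_uniq ?msupp_uniq // => /eqP /val_inj.
pose cl t := `[< lin_equiv (fdiv (tt t).1.2 (tt t).2) (fdiv (tt (inl j0)).1.2 (tt (inl j0)).2) >].
have clj0 : cl (inl j0) by apply/asboolP; apply: lin_equiv_refl.
have clP t P i : cl t -> G_stable P -> ex P = lam i ->
    (e0 j0 i + ((tt t).2 P != 0%N) <= cnt P (tt t).1.2)%N.
  move=> /asboolP eqv sP E; have := class_count (etrans (szt t) (esym (szt (inl j0)))) (nzt t) (nzt (inl j0)) eqv sP.
  by rewrite (count_mono _ E).
case: lam_alt => [Hex|[m0 Hex]].
(* Each count is at least the corresponding exponent while their sum is at most [d], so all are
   equal and no stable section can occur. *)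
- have cl_eq t i : cl t -> count (fun l => line l == lam i) (tt t).1.2 = e0 j0 i /\
      forall P, G_stable P -> ex P = lam i -> (tt t).2 P = 0%N.
    move=> ct; have H i' : (e0 j0 i' <= count (fun l => line l == lam i') (tt t).1.2)%N.
      have [P sP E] := Hex i'; apply: leq_trans (leq_addr _ _) _.
      by rewrite -E; apply: clP.
    have le : (\sum_i count (fun l => line l == lam i) (tt t).1.2 <= \sum_i e0 j0 i)%N.
      by rewrite -mdegE (hp _ (Me j0)) -(szt t); apply: count_le_size.
    have Ei : count (fun l => line l == lam i) (tt t).1.2 = e0 j0 i.
      apply/eqP; rewrite eqn_leq H andbT leqNgt; apply/negP => lt.
      move: le; rewrite leqNgt => /negP; apply.
      rewrite (bigD1 i) // [X in (_ < X)%N](bigD1 i) //= -addSn; apply: leq_add => //.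
      by apply: leq_sum => i' _; apply: H.
    split=> // P sP E; have := clP t P i ct sP E; rewrite /cnt E Ei.
    by case: ((tt t).2 P) => // q; rewrite /= addn1 ltnn.
  have cl1 t : cl t = (t == inl j0).
    apply/idP/eqP => [ct|-> //]; case: t ct => j ct.
      congr inl; apply: e0_inj; apply/mnmP => i; have [P sP E] := Hex i.
      by have [<- _] := cl_eq _ i ct; rewrite -E -/(cnt P _) /= (count_mono _ E).
    have [_ _ [P sP NP]] := oP _ (mem_nth (0, [::], fun=> 0%N) (ltn_ord j)).
    have [i E] := lam_ex sP; have [_ /(_ P sP E) N0] := cl_eq _ i ct.
    by rewrite /= in N0; rewrite N0 in NP.
  have [x x0] := forms_nonvanishing (nzt (inl j0)).
  have := Hkap x x0; rewrite (eq_bigl _ _ cl1) big_pred1_eq => /eqP.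
  by rewrite !mulf_eq0 (negPf x0) (negPf pj0) (negPf (kap0 _)).
have i01 (i : 'I_m.+2) : i = 0 \/ i = 1.
  case: i => [[|[|i]] Hi]; [left | right | exfalso]; try exact: val_inj.
  by move: Hi; rewrite m0.
have prod2 (A : comNzRingType) (f : 'I_m.+2 -> A) : \prod_i f i = f 0 * f 1.
  by rewrite (bigD1 0) // (bigD1 1) //= big1 ?mulr1 // => i /andP[]; case: (i01 i) => ->.
have deg2 (e : 'X_{1..m.+2}) : mdeg e = (e 0%R + e 1%R)%N.
  by rewrite mdegE (bigD1 0) // (bigD1 1) //= big1 ?addn0 // => i /andP[]; case: (i01 i) => ->.
have [|u [v [[u0 u1 v0 v1] _]]] := @line_basis _ (lam 0) (lam 1); first by rewrite !lam_line (inj_eq lam_inj).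
rewrite !lam_line in u0 u1 v0 v1.
(* On these rows [form (lam 0)] equals [z] and [form (lam 1)] equals 1, so products of forms become
   polynomials in [z]. *)
have /choice [x Hx] (z : k) : exists x : G, x 1 0 = z * u.1 + v.1 /\ x 1 1 = z * u.2 + v.2.
  apply: row_ex; rewrite xpair_eqE; apply/negP => /andP[/eqP e1 /eqP e2].
  have : (z * u.1 + v.1) * (lam 1).1 + (z * u.2 + v.2) * (lam 1).2 = 1.
    by rewrite !mulrDl addrACA -!mulrA -mulrDr u1 v1 mulr0 add0r.
  by rewrite e1 e2 !mul0r addr0 => /eqP; rewrite eq_sym oner_eq0.
pose pl l : {poly k} := (l.1 * u.1 + l.2 * u.2) *: 'X + (l.1 * v.1 + l.2 * v.2)%:P.
have plE l z : (pl l).[z] = form l (x z).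
  have [e1 e2] := Hx z; rewrite /pl /form e1 e2 hornerD hornerZ hornerX hornerC; ring.
have pl0 : pl (lam 0) = 'X.
  rewrite /pl mulrC (mulrC (lam 0).2) u0 mulrC (mulrC (lam 0).2) v0; by rewrite scale1r addr0.
have pl1 : pl (lam 1) = 1.
  rewrite /pl mulrC (mulrC (lam 1).2) u1 mulrC (mulrC (lam 1).2) v1; by rewrite scale0r add0r.
have pl_line l : l != (0, 0) -> line l = lam 0 -> exists c, pl l = c *: 'X.
  move=> /line_scale [c' _ E] El; exists c'; apply: poly_eq_off0 => z _.
  by rewrite plE E El hornerZ -pl0 plE.
have pl_count ls : nz ls -> exists q, \prod_(l <- ls) pl l = 'X^(count (fun l => line l == lam 0) ls) * q.
  elim: ls => [_|l ls IH /= /andP[l0 /IH [q Hq]]]; first by exists 1; rewrite big_nil mulr1.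
  rewrite big_cons Hq; case: eqP => [/(pl_line _ l0) [c' ->]|_]; last by exists (pl l * q); rewrite mulrCA.
  by exists (c' *: q); rewrite add1n exprS -!scalerAl -!scalerAr mulrA.
have piE t z : (\prod_(l <- (tt t).1.2) pl l).[z] = \prod_(l <- (tt t).1.2) form l (x z).
  by rewrite horner_prod; apply: eq_bigr => l _; apply: plE.
have pim e : \prod_(l <- mono e) pl l = 'X^(e 0).
  by rewrite prod_mono prod2 pl0 pl1 expr1n mulr1.
have Z : \sum_(t | cl t) ((tt t).1.1 * kap t) *: \prod_(l <- (tt t).1.2) pl l = 0.
  apply: poly_eq_off0 => z z0; rewrite horner0 horner_sum -[RHS](Hkap (x z)).
    by apply: eq_bigr => t _; rewrite hornerZ piE.
  rewrite -(piE (inl j0)) /= pim hornerXn expf_neq0 //.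
(* Since the degree is fixed, only the chosen monomial has this exponent of [lam 0]; the terms with
   a stable section are divisible by a higher power of ['X]. *)
have := congr1 (fun P : {poly k} => P`_(e0 j0 0)) Z; rewrite coef0 coef_sum (bigD1 (inl j0)) //=.
rewrite pim coefZ coefXn eqxx mulr1 big1 ?addr0 => [/eqP|t /andP[ct tj]].
  by rewrite mulf_eq0 (negPf pj0) (negPf (kap0 _)).
rewrite coefZ; case: t ct tj => j ct tj /=.
  rewrite pim coefXn; case: eqP => [E|_]; last by rewrite mulr0.
  case/eqP: tj; congr inl; apply: e0_inj; apply/mnmP => i.
  have D1 := hp _ (Me j); have D2 := hp _ (Me j0); rewrite /= !deg2 in D1 D2.
  by rewrite E in D2; case: (i01 i) => ->; [rewrite E | apply: (@addnI (e0 j 0%R)); rewrite D1 D2].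
have [sz lsn [P sP NP]] := oP _ (mem_nth (0, [::], fun=> 0%N) (ltn_ord j)).
have [q ->] := pl_count _ lsn; have := clP _ _ _ ct sP (Hex P sP).
rewrite /cnt (Hex P sP) /= NP addn1 => lt.
by rewrite coefXnM lt mulr0.
Qed.

End Special.


(** * A stable divisor with constant orders dominates the projective line *)

Section Dominating.
Variables (k : closedFieldType) (n : nat) (X : embedding k n).
Hypotheses (nb : (0 < n <= 2)%N) (nX : normal_variety X).
Local Notation XF := (variety_functions X).
Local Notation K := (ratfun X).
Local Notation G := (sl2 k).

Lemma reg_horner (U : set X) F (P : {poly k}) : reg U F -> reg U (fun y => P.[F y]).
Proof.
move=> rF; elim/poly_ind: P => [|P c IH].
  by apply: (reg_ext XF) (reg_cst XF 0 (reg_opn XF rF)) => y _; rewrite horner0.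
apply: (reg_ext XF) (reg_add XF (reg_mul XF IH rF) (reg_cst XF c (reg_opn XF rF))) => y _.
by rewrite hornerMXaddC.
Qed.

(** Composing a regular function with a polynomial curve gives a morphism from an open set to [G];
    it is used with [gam = lower] to extend the rational quotient by [B]. *)
Lemma curve_pullback (U : set X) F gam (W : set G) : reg U F -> polycurve gam ->
  opn (s := sl2_space k) W -> opn (U `&` [set y | W (gam (F y))]) /\
  forall f, reg (s := sl2_space k) W f -> reg (U `&` [set y | W (gam (F y))]) (fun y => f (gam (F y))).
Proof.
move=> rF pg oW.
have Hp p : exists P : {poly k}, forall z, meval (sl2_coord (gam z)) p = P.[z].
  by apply: (polyfun_curve (f := fun g => meval (sl2_coord g) p) pg); exists p.
have nbh p (P : {poly k}) : (forall z, meval (sl2_coord (gam z)) p = P.[z]) ->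
    reg (U `&` [set y | P.[F y] != 0]) (fun y => (P.[F y])^-1).
  by move=> _; apply: (reg_inv XF); apply: reg_horner.
have op : opn (U `&` [set y | W (gam (F y))]).
  rewrite (_ : _ `&` _ = \bigcup_(V in [set V | opn V /\ V `<=` U `&` [set y | W (gam (F y))]]) V).
    by apply: (opn_bigcup XF) => V [].
  apply/seteqP; split=> [y [Uy Wy]|y [V [_ VW] Vy]]; last exact: VW.
  have [p [py Hpy]] := oW _ Wy; have [P HP] := Hp p.
  exists (U `&` [set y | P.[F y] != 0]); last by split=> //=; rewrite -HP.
  split; first exact: (reg_opn XF (nbh p P HP)).
  by move=> z [Uz Pz]; split=> //; apply: Hpy; rewrite HP.
split=> // f rf; apply: (reg_local XF op) => y [Uy Wy].
have [p [q [qy Hq]]] := rf _ Wy; have [P HP] := Hp p; have [Q HQ] := Hp q.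
have rQ := nbh q Q HQ; exists (U `&` [set y | Q.[F y] != 0]); split.
- by split=> //=; rewrite -HQ.
- by move=> z [Uz Qz]; split=> //; apply: (Hq _ _).1; rewrite HQ.
- apply: (reg_ext XF) (reg_mul XF (reg_restrict XF (reg_opn XF rQ) _ (reg_horner P rF)) rQ) => [z [Uz Qz]|z []//].
  by rewrite (Hq (gam (F z)) _).2 ?HQ // HP.
Qed.

Lemma coset_map_borel (b h : G) : borel b ->
  coset_map (@borel k) (mu n) (b * h)%g = coset_map (@borel k) (mu n) h.
Proof.
move=> Bb; apply: eq_exist; apply/seteqP; split=> _ [l [m [Bl Mm ->]]].
  exists (l * b)%g, m; split=> //; last by rewrite !mulgA.
  by rewrite /borel /= sl2M Bb Bl mul0r mulr0 addr0.
exists (l * b^-1)%g, m; split=> //; last by rewrite -!mulgA mulKg.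
have [_ _ v3 v4] := sl2_VE b.
by rewrite /borel /= sl2M v3 Bb Bl mul0r oppr0 mulr0 addr0.
Qed.

Lemma borel_lower (g : G) : g 1 1 != 0 -> exists2 b, borel b & g = (b * lower (g 1 0 / g 1 1)%R)%g.
Proof.
move=> g0; exists (g * lower (- (g 1 0 / g 1 1))%R)%g.
  have [_ _ l3 _] := lowerE (- (g 1 0 / g 1 1)); have [l1 _ _ _] := lowerE (- (g 1 0 / g 1 1)).
  by rewrite /borel /= sl2M l1 l3 mulr1 mulrN mulrC divfK // subrr.
by rewrite -mulgA lowerM addNr lower0 mulg1.
Qed.

Lemma ratq_form_sub (c : k) : let h := fun x : G => x 1 1 in
  ratq X (fun x => x 1 0) h - ratC X c = ratq X (form (1, - c)) h.
Proof.
move=> h; have oh : odd_fun n h by apply: odd_entry. have nh : nonzero h by apply: nonzero_entry.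
have -> : form (1, - c) = (fun x => 1 * x 1 0 + (- c) * h x) by [].
by rewrite ratqD ?ratq_id //; [rewrite rmorph1 mul1r mulr1 rmorphN | apply: odd_entry].
Qed.

(** Let [r] be the quotient of the entries [x 1 0] and [x 1 1]. Every [r - c] has order 0 along [P],
    so [r] is regular at the generic point of [P], and [y |-> B lower (r y)] extends the rational
    quotient there. A product of factors [r - c] still has order 0, so [r] avoids any finite set of
    values somewhere on [P]. *)
Lemma dominates_of_const (P : prime_divisor X) :
  (forall l l' : k * k, l != (0, 0) -> l' != (0, 0) -> ord2 P (form l) = ord2 P (form l')) ->
  dominates P.
Proof.
move=> H; pose h := fun x : G => x 1 1; pose r := ratq X (fun x => x 1 0) h.
have oh : odd_fun n h by apply: odd_entry. have nh : nonzero h by apply: nonzero_entry.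
have f01 : form (0, 1) = h by apply/funext => x; rewrite /form /= mul0r add0r mul1r.
have f10 : form (1, 0) = (fun x : G => x 1 0) by apply/funext => x; rewrite /form /= mul0r addr0 mul1r.
have n0 (c : k) : (1, c) != (0, 0) :> k * k by rewrite xpair_eqE oner_eq0.
have n1 : (0, 1) != (0, 0) :> k * k by rewrite xpair_eqE oner_eq0 andbF.
have rc0 c : r - ratC X c != 0.
  by rewrite ratq_form_sub; apply: ratq_neq0 => //; [apply: form_odd | apply: form_nonzero].
have rcP c : ord P (r - ratC X c) = 0.
  have := ord2_ratq nb nX P (form_odd nb (1, - c)) oh (form_nonzero (n0 _)) nh.
  by rewrite -ratq_form_sub -/r -f01 (H _ (0, 1)) // subrr; lia.
have r0 : r != 0 by have := rc0 0; rewrite rmorph0 subr0.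
have : local_ring P r by apply/(ord_ge0 nX P r0); have := rcP 0; rewrite rmorph0 subr0 => ->.
move=> [U [F [gF PU]]]; have rF := germ_reg gF.
have Fv y : U y -> has_value r y (F y) by move=> Uy; exists U, F.
exists U, (fun y => coset_map (@borel k) (mu n) (lower (F y))); split.
- by split=> //; apply: (reg_opn XF rF).
- move=> W oW; have pl : polycurve (@lower k) := (one_parameter_lower k).1.
  have [oV rV] := curve_pullback (W := coset_map (@borel k) (mu n) @^-1` W) rF pl oW; split=> //.
  by move=> f rf; apply: (rV (f \o coset_map (@borel k) (mu n)) rf).
- move=> g x Ux; have Ug : U (orb X g) by [].
  (* At a point with [g 1 1 = 0] the inverse of [r] vanishes, so [r] could have no value there. *)
  have g0 : g 1 1 != 0.
    apply/eqP => g0; have g10 : g 1 0 != 0.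
      by apply/eqP => g10; have := sl2_ad g; rewrite g0 g10 !mulr0 subrr => /eqP; rewrite eq_sym oner_eq0.
    have oc : odd_fun n (fun x : G => x 1 0) by apply: odd_entry.
    have := has_valueM (Fv _ Ug) (ratqE X nb oh oc g10); rewrite /h g0 mul0r mulr0.
    have nc : nonzero (fun x : G => x 1 0) by apply: nonzero_entry.
    rewrite ratqM //.
    by rewrite ratq_id // => /(has_value_uniq (has_value1 _)) /eqP; rewrite oner_eq0.
  have [b Bb E] := borel_lower g0.
  rewrite (has_value_uniq (Fv _ Ug) (ratqE X nb (odd_entry k nb 1 0) oh g0)) -/(orb X g).
  by rewrite -[LHS](coset_map_borel _ Bb) -E.
- move=> W oW [[C [g0 EC]] WC].
  pose W' : set G := coset_map (@borel k) (mu n) @^-1` W.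
  have W'g0 : W' g0.
    by rewrite /W' /preimage /= (_ : coset_map _ _ g0 = exist _ C (ex_intro _ g0 EC)) //; apply: eq_exist.
  have [g [W'g hg]] : exists g, W' g /\ h g != 0.
    have [x0 x00] := nh.
    by have [||g [? ?]] := sl2_meet (U := W') (V := [set x | h x != 0]) oW (polyfun_opn oh.1); [exists g0 | exists x0 | exists g].
  have Wl : W' (lower (g 1 0 / g 1 1)).
    have [b Bb E] := borel_lower hg; rewrite /W' /preimage /= -(coset_map_borel _ Bb) -E.
    exact: W'g.
  have [p [pp pz Hp]] := sl2_opnP (V := W') oW Wl.
  have [P0 HP0] := polyfun_curve (one_parameter_lower k).1 pp.
  have P00 : P0 != 0 by apply: contraNneq pz => E; rewrite HP0 E horner0.
  have [rs Ers] := closed_field_poly_normal P0.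
  (* The open set [W] contains the image of [lower z] whenever [z] is not a root of [P0]; [q]
     detects these roots on [P]. *)
  pose q := \prod_(c <- rs) (r - ratC X c).
  have [q0 oq] : q != 0 /\ ord P q = 0.
    rewrite /q; elim: (rs) => [|c s [IH1 IH2]]; first by rewrite big_nil oner_neq0 ord1.
    by rewrite big_cons mulf_neq0 // ordM // rcP IH2 addr0.
  have lq : local_ring P q by apply/(ord_ge0 nX P q0); rewrite oq.
  have nq : ~ local_max P q by move/(ord_gt0 nX P q0); rewrite oq ltxx.
  have [x [v [Px hv v0]]] := local_maxPn (pd_irreducible P) lq nq.
  have [V [oV Vx HV]] := has_value_nz hv v0.
  have [|y [[Py Uy] Vy]] := (pd_irreducible P).2 U V (reg_opn XF rF) oV PU; first by exists x.
  exists y; split=> //; apply: Hp; have [w w0 hw] := HV y Vy.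
  rewrite HP0 Ers hornerZ mulf_neq0 ?lead_coef_eq0 // horner_prod.
  apply: contraNneq w0 => E0; apply/eqP; rewrite -E0; apply: (has_value_uniq hw).
  rewrite /q; elim: (rs) => [|c s IH]; first by rewrite !big_nil; apply: has_value1.
  rewrite !big_cons hornerXsubC; apply: has_valueM => //.
  by apply: has_valueB; [exact: Fv | exact: has_valueC].
Qed.

End Dominating.

(** * The exceptional lines of the stable divisors *)

Section Exceptional.
Variables (k : closedFieldType) (n : nat) (X : embedding k n).
Hypotheses (nb : (0 < n <= 2)%N) (nX : normal_variety X).
Local Notation K := (ratfun X).
Local Notation G := (sl2 k).
Implicit Types (l : k * k) (P : prime_divisor X).

Lemma line_id l : line (line l) = line l.
Proof.
rewrite [in line l]/line; case: ifP => _; last by rewrite /line /= eqxx.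
by rewrite /line /= oner_eq0 divr1.
Qed.

Lemma line_prop l l' c : l != (0, 0) -> (forall x, form l x = c * form l' x) -> line l = line l'.
Proof.
move=> l0 H.
have row y : y != (0, 0) -> l.1 * y.1 + l.2 * y.2 = c * (l'.1 * y.1 + l'.2 * y.2).
  by case: y => y0 y1 /row_ex [x [<- <-]]; apply: H.
have e1 : l.1 = c * l'.1.
  by have := row (1, 0); rewrite xpair_eqE oner_eq0 /= !mulr1 !mulr0 !addr0; apply.
have e2 : l.2 = c * l'.2.
  by have := row (0, 1); rewrite xpair_eqE oner_eq0 andbF /= !mulr1 !mulr0 !add0r; apply.
have c0 : c != 0.
  by apply: contraNneq l0 => c0; case: l e1 e2 {H row} => a b /= -> ->; rewrite c0 !mul0r.
rewrite /line e1 e2 mulf_eq0 (negPf c0) /=; case: ifP => // _.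
by rewrite -mulf_div divff // mul1r.
Qed.

Lemma int_half (x a b : int) : x *+ 2 = a - b -> (b < a -> 1 <= x) /\ (x = 0 -> a = b).
Proof. by lia. Qed.

(** Take two lines with different orders and let [r] be the quotient of the form of higher order by
    the other, so that [r] has positive order. For any other [l], its quotient by the lower form is
    [A r + B] with [B] nonzero, which has order 0 by the ultrametric inequality. *)
Lemma exceptional_form P : ~ dominates P -> exists e lo hi,
  [/\ lo < hi, line e = e & forall l, l != (0, 0) ->
      ord2 P (form l) = if line l == e then hi else lo].
Proof.
move=> nd.
have same l l' : l != (0, 0) -> l' != (0, 0) -> line l = line l' -> ord2 P (form l) = ord2 P (form l').
  move=> l0 l'0 E; have [c c0 H] := line_scale l0; have [c' c'0 H'] := line_scale l'0.
  by rewrite (ord2_scale nb nX P c0 (line_neq0 l) H) (ord2_scale nb nX P c'0 (line_neq0 l') H') E.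
have [l1 [l2 [l10 l20 lt]]] : exists l1 l2, [/\ l1 != (0, 0), l2 != (0, 0) & ord2 P (form l2) < ord2 P (form l1)].
  apply: contrapT => H; apply: nd; apply: (dominates_of_const nb nX) => l l' l0 l'0.
  apply/eqP; rewrite eq_le !leNgt; apply/andP; split; apply/negP => lt; apply: H; [exists l, l' | exists l', l]; by split.
have n12 : line l1 != line l2.
  by apply/eqP => E; move: lt; rewrite (same _ _ l10 l20 E) ltxx.
pose m1 := line l1; pose m2 := line l2.
have m10 : m1 != (0, 0) := line_neq0 l1. have m20 : m2 != (0, 0) := line_neq0 l2.
have E1 : ord2 P (form l1) = ord2 P (form m1) by apply: same => //; rewrite line_id.
have E2 : ord2 P (form l2) = ord2 P (form m2) by apply: same => //; rewrite line_id.
exists m1, (ord2 P (form m2)), (ord2 P (form m1)); split; [by rewrite -E1 -E2 | exact: line_id |] => l l0.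
case: eqP => [E|/eqP lm]; first by apply: same => //; rewrite E line_id.
have [u [v [_ Huv]]] := line_basis n12; have {Huv} := Huv l.
set A := _ + _; set B := _ * v.1 + _ => Hl.
have B0 : B != 0.
  apply: contra lm => /eqP B0; apply/eqP; transitivity (line m1); last exact: line_id.
  apply: (line_prop (c := A)) => // x.
  by rewrite Hl B0 mul0r addr0.
have o1 := form_odd nb m1; have o2 := form_odd nb m2; have ol := form_odd nb l.
have f1 := form_nonzero m10; have f2 := form_nonzero m20; have fl := form_nonzero l0.
pose r := ratq X (form m1) (form m2); pose a := ratq X (form l) (form m2).
have r0 : r != 0 by apply: ratq_neq0. have a0 : a != 0 by apply: ratq_neq0.
have r1 : 1 <= ord P r.
  by apply: (int_half (ord2_ratq nb nX P o1 o2 f1 f2)).1; rewrite -E1 -E2.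
have aE : a = ratC X A * r + ratC X B.
  have fE : form l = (fun x => A * form m1 x + B * form m2 x) by apply/funext.
  by rewrite /a fE ratqD // ratq_id // mulr1.
have Cn (c : k) : c != 0 -> ratC X c != 0 by rewrite fmorph_eq0.
have ordt (c : k) : ratC X c * r = 0 \/ 1 <= ord P (ratC X c * r).
  have [->|c0] := eqVneq c 0; first by left; rewrite rmorph0 mul0r.
  by right; rewrite ordM ?Cn // ordC // add0r.
have oa0 : 0 <= ord P a.
  rewrite aE; apply: ordD; rewrite -?aE //; last by right; rewrite ordC.
  by case: (ordt A) => [|H]; [left | right; apply: le_trans H].
have oa1 : ~ 1 <= ord P a.
  move=> H; have : 1 <= ord P (ratC X B); last by rewrite ordC.
  have BE : ratC X B = a + ratC X (- A) * r by rewrite aE rmorphN mulNr addrAC subrr add0r.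
  by rewrite BE; apply: ordD; rewrite -?BE ?Cn //; right.
apply: (int_half (ord2_ratq nb nX P ol o2 fl f2)).2; apply/eqP.
by rewrite eq_le oa0 andbT leNgt gtz0_ge1; apply/negP.
Qed.

Lemma form_list (L : seq (prime_divisor X)) : (forall P, (P \in L) <-> G_stable P) ->
  (forall P : prime_divisor X, G_stable P -> ~ dominates P) ->
  exists (ex : prime_divisor X -> k * k) (lo hi : prime_divisor X -> int) m (lam : 'I_m.+2 -> k * k),
    [/\ forall P : prime_divisor X, G_stable P -> lo P < hi P,
        forall P l, G_stable P -> l != (0, 0) ->
          ord2 P (form l) = if line l == ex P then hi P else lo P,
        injective lam /\ (forall i, line (lam i) = lam i),
        forall P : prime_divisor X, G_stable P -> exists i, ex P = lam i &
        (forall i, exists2 P : prime_divisor X, G_stable P & ex P = lam i) \/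
        (m = 0%N /\ forall P : prime_divisor X, G_stable P -> ex P = lam 0)].
Proof.
move=> HL nd.
have /choice [d Hd] (P : prime_divisor X) : exists d : (k * k) * (int * int), G_stable P ->
    [/\ d.2.1 < d.2.2, line d.1 = d.1 & forall l, l != (0, 0) ->
      ord2 P (form l) = if line l == d.1 then d.2.2 else d.2.1].
  have [sP|nsP] := pselect (G_stable P); last by exists ((0, 0), (0, 0)).
  by have [e [lo [hi H]]] := exceptional_form (nd P sP); exists (e, (lo, hi)).
exists (fun P => (d P).1), (fun P => (d P).2.1), (fun P => (d P).2.2).
pose exs := undup [seq (d P).1 | P <- L].
have exsP P : G_stable P -> (d P).1 \in exs.
  by move=> /HL PL; rewrite mem_undup; apply: map_f.
have exsE e : e \in exs -> exists2 P : prime_divisor X, G_stable P & (d P).1 = e.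
  by rewrite mem_undup => /mapP [P /HL sP ->]; exists P.
have lin e : e \in exs -> line e = e by move=> /exsE [P /Hd [_ H _] <-].
have h1 P : G_stable P -> (d P).2.1 < (d P).2.2 by move=> /Hd [].
have h2 P l : G_stable P -> l != (0, 0) -> ord2 P (form l) = if line l == (d P).1 then (d P).2.2 else (d P).2.1.
  by move=> /Hd [_ _]; apply.
have [s2|s1] := leqP 2 (size exs).
  pose m := (size exs - 2)%N; have sm : size exs = m.+2 by rewrite /m; lia.
  have lm (i : 'I_m.+2) : nth (0, 0) exs i \in exs by rewrite mem_nth // sm.
  exists m, (fun i : 'I_m.+2 => nth (0, 0) exs i); split=> //.
  - split=> [i j /eqP|i]; last exact: lin.
    by rewrite nth_uniq ?sm ?undup_uniq // => /eqP /val_inj.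
  - move=> P sP; have := exsP P sP; rewrite -index_mem sm => lt.
    by exists (Ordinal lt); rewrite nth_index // exsP.
  - by left=> i; have [P sP E] := exsE _ (lm i); exists P.
pose e0 : k * k := head (1, 0) exs; pose e1 : k * k := if e0 == (1, 0) then (0, 1) else (1, 0).
have ne : e1 != e0.
  rewrite /e1; case: (e0 =P (1, 0)) => [->|/eqP]; last by rewrite eq_sym.
  by rewrite xpair_eqE oner_eq0 andbF.
have l10 : line (1, 0) = (1, 0) :> k * k by rewrite /line /= oner_eq0 mul0r.
have l01 : line (0, 1) = (0, 1) :> k * k by rewrite /line /= eqxx.
have le0 : line e0 = e0.
  by rewrite /e0; case E : exs => [|e s] //=; apply: lin; rewrite E mem_head.
have le1 : line e1 = e1 by rewrite /e1; case: ifP.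
have ex0 P : G_stable P -> (d P).1 = e0.
  move=> /exsP; rewrite /e0; case: (exs) s1 => [|e [|e' s]] //= _.
  by rewrite inE => /eqP.
exists 0%N, (fun i => if i == 0 then e0 else e1); split=> //.
- split=> [i j|i]; last by case: ifP.
  by case: (ord2P i) => ->; case: (ord2P j) => -> //= E; move: ne; rewrite E eqxx.
- by move=> P sP; exists 0; rewrite ex0.
- by right; split=> // P sP; rewrite ex0.
Qed.

End Exceptional.

Theorem proposition4p2p1 (k : closedFieldType) (char0 : [pchar k] =i pred0)
    (n : nat) (n_bounds : (0 < n <= 2)%N)
    (X : embedding k n) (X_normal : normal_variety X)
    (no_dominating : forall P : prime_divisor X, G_stable P -> ~ dominates P)
    (R : cox_ring X) (alpha : sl2 k -> R -> R) (Halpha : cox_action alpha) :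
  normal_affine_variety (special_ideal R) /\
  affine_space_mod (special_ideal R)
    (invariants_mod alpha (special_ideal R) (@unipotent k)).
Proof.
have [alphaD [phi [Hphi alphaE]]] := Halpha.
have [L [uL HL]] := stable_divisors X.
have [ex [lo [hi [m [lam [lo_hi ord2_form [lam_inj lam_line] lam_ex lam_alt]]]]]] :=
  form_list n_bounds X_normal HL no_dominating.
have lam0 i : lam i != (0, 0) by rewrite -lam_line line_neq0.
have /choice [s' Hs'] i := form_section_act n_bounds X_normal Hphi alphaE (lam0 i).
apply: (special_normal char0 (cox_action_rational X_normal alphaD Hphi alphaE)
  (s := fun i => cox_sec R (form_div X (lam i)) 1) (s' := s')) => //.
- exact: (stable_section_invariant X_normal Hphi alphaE).
- exact: (special_generation n_bounds X_normal alphaD Hphi alphaE uL HL lo_hi ord2_form lam_inj lam_line).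
- exact: (special_independence n_bounds X_normal alphaD Hphi alphaE uL HL lo_hi ord2_form lam_inj lam_line lam_ex lam_alt).
Qed.
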